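(* Let $n\ge 1$, let $V$ be a complex vector space of dimension $n+1$, and let $\mathcal{E}$ be the image of the morphism of vector bundles $\psi: S^2V\otimes\mathcal{O}_{\mathbb{P}(V)}\to S_{21}V\otimes\mathcal{O}_{\mathbb{P}(V)}(1)$ on $\mathbb{P}(V)=\mathbb{P}^n$. Then $\mathcal{E}$ is rigid, i.e. for every small deformation $(\mathcal{E}_t)$ of $\mathcal{E}_0=\mathcal{E}$ one has $\mathcal{E}_t\simeq\mathcal{E}$ for $t$ sufficiently close to $0$.
   Context: $S_\pi V$ denotes the irreducible $GL(V)$-module (Schur module) of highest weight the partition $\pi$. $\mathbb{P}(V)$ is the projective space of lines in $V$. There is a unique (up to scale) nonzero $GL(V)$-equivariant morphism $V\to\mathrm{Hom}(S^2V,S_{21}V)$, $v\mapsto\psi_v$; realizing $S_{21}V\subset\wedge^2V\otimes V$, it is $\psi_v(w^2)=(v\wedge w)\otimes w$. It has constant rank on $V\setminus\{0\}$, with $\mathrm{Ker}(\psi_v)=\mathbb{C}v^2$, and it induces the bundle morphism $\psi$, so that $\mathcal{E}$ is a vector bundle fitting into $0\to\mathcal{O}(-2)\to S^2V\otimes\mathcal{O}\to\mathcal{E}\to 0$. *)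

(* Defs.v *)
From HB Require Import structures.
From mathcomp Require Import all_boot all_order all_algebra.
From mathcomp Require Import complex ring.
From mathcomp Require Import boolp classical_sets functions reals topology.
From mathcomp Require Import normedtype derive.

Set Implicit Arguments.
Unset Strict Implicit.
Unset Printing Implicit Defensive.

Import numFieldNormedType.Exports.
Import passmx.
Import Order.TTheory GRing.Theory Num.Theory.

Local Open Scope classical_set_scope.
Local Open Scope ring_scope.
Local Open Scope complex_scope.

(* MathComp-Analysis equips R[i]^o, but not R[i], with a topology. *)
HB.instance Definition _ (R : rcfType) := NormedModule.copy R[i] R[i]^o.

Section HolomorphicBundles.
Variable R : realType.
Local Notation C := R[i].

(* A space with functions: its points, its open sets, and the C-valued functions
   that are holomorphic on each open set (the values of such a function outside
   the open set are irrelevant). *)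
Record space := Space {
  pts :> Type;
  isopen : set pts -> Prop;
  holo : set pts -> (pts -> C) -> Prop }.

(* The space with underlying set X presented by lifts in a normed space M:
   "over z x" reads "z is a lift of x". Open sets are those of the quotient
   topology on X, and a function is holomorphic when, near every lift, its
   pullback to the set of lifts extends to a function that is holomorphic, i.e.
   complex differentiable, on an open subset of M. *)
Definition lifted_space (M : normedModType C) (X : Type)
    (over : M -> X -> Prop) : space :=
  @Space X
    (fun U => forall z x, over z x -> U x ->
       \forall z' \near z, forall x', over z' x' -> U x')
    (fun U f => forall z x, over z x -> U x ->
       exists F : M -> C, \forall z' \near z,
         differentiable F z' /\
         (forall x', over z' x' -> U x' -> F z' = f x')).

Record space_mor (X Y : space) := SpaceMor {
  space_fun :> X -> Y;
  space_fun_open : forall U, isopen U -> isopen (space_fun @^-1` U);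
  space_fun_holo : forall U f, holo U f ->
    holo (space_fun @^-1` U) (f \o space_fun) }.

(* Holomorphic vector bundles, as families of vector spaces with holomorphically
   related local trivializations. The maps triv a x and the matrix g x are only
   meaningful for x in the relevant chart domains. *)
Record vbundle (X : space) := VBundle {
  rk : nat;
  fib : X -> lmodType C;
  chart : Type;
  dom : chart -> set X;
  triv : forall (a : chart) (x : X), {linear fib x -> 'rV[C]_rk};
  dom_open : forall a, isopen (dom a);
  dom_cover : forall x, exists a, dom a x;
  triv_bij : forall a x, dom a x -> bijective (triv a x);
  triv_holo : forall a b, exists g : X -> 'M[C]_rk,
    (forall i j, holo (dom a `&` dom b) (fun x => g x i j)) /\
    (forall x, dom a x -> dom b x ->
       forall u, triv b x u = triv a x u *m g x) }.

Record bundle_hom (X : space) (E F : vbundle X) := BundleHom {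
  hmap :> forall x : X, {linear fib E x -> fib F x};
  hmap_holo : forall (a : chart E) (b : chart F),
    exists g : X -> 'M[C]_(rk E, rk F),
    (forall i j, holo (dom a `&` dom b) (fun x => g x i j)) /\
    (forall x, dom a x -> dom b x ->
       forall u, triv b x (hmap x u) = triv a x u *m g x) }.

Definition bundle_iso (X : space) (E F : vbundle X) : Prop :=
  exists (f : bundle_hom E F) (g : bundle_hom F E),
    forall x, cancel (f x) (g x) /\ cancel (g x) (f x).

(* E is the image of f: it factors f as a bundle morphism that is surjective on
   every fibre followed by one that is injective on every fibre. *)
Definition is_image (X : space) (A B : vbundle X) (f : bundle_hom A B)
    (E : vbundle X) : Prop :=
  exists (q : bundle_hom A E) (j : bundle_hom E B),
    [/\ forall x u, f x u = j x (q x u),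
        forall x (e : fib E x), exists u, q x u = e
      & forall x, injective (j x)].

Section Pullback.
Variables (X Y : space) (p : space_mor X Y) (E : vbundle Y).

Lemma pullback_open (a : chart E) : isopen (p @^-1` dom a).
Proof. by apply: (space_fun_open p); exact: dom_open. Qed.

Lemma pullback_triv_holo (a b : chart E) : exists g : X -> 'M[C]_(rk E),
  (forall i j, holo (p @^-1` dom a `&` p @^-1` dom b) (fun x => g x i j)) /\
  (forall x, dom a (p x) -> dom b (p x) ->
     forall u, triv b (p x) u = triv a (p x) u *m g x).
Proof.
have [g [gh gE]] := triv_holo a b.
exists (g \o p); split=> [i j|x]; last exact: gE.
exact: (space_fun_holo p (gh i j)).
Qed.

Definition pullback : vbundle X :=
  {| fib := fun x => fib E (p x);
     dom := fun a => p @^-1` dom a;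
     triv := fun a x => triv a (p x);
     dom_open := pullback_open;
     dom_cover := fun x => dom_cover E (p x);
     triv_bij := fun a x => @triv_bij Y E a (p x);
     triv_holo := pullback_triv_holo |}.

End Pullback.

Section ProjectiveSpace.
Variable n : nat.
Local Notation V := ('rV[C]_n.+1).

(* V is C^(n+1), and a point of P(V) is a one-dimensional subspace of V. *)
Definition line := {l : {vspace V} | \dim l == 1%N}.

Definition spans (v : V) (l : line) : Prop := (v != 0) && (v \in val l).

Definition PV : space := @lifted_space V line spans.

Section Family.
Variables (m : nat) (T : set 'rV[C]_m).

(* The product P(V) x T, for T with the reduced structure induced by C^m. *)
Definition PVxT : space :=
  @lifted_space (V * 'rV[C]_m)%type (line * set_type T)%type
    (fun z x => spans z.1 x.1 /\ z.2 = set_val x.2).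

Lemma differentiable_slice (t : 'rV[C]_m) (v : V) :
  differentiable (fun v' : V => (v', t)) v.
Proof. by apply: differentiable_pair. Qed.

Lemma nbhs_slice (t : 'rV[C]_m) (v : V) (P : set (V * 'rV[C]_m)) :
  (\forall z \near (v, t), P z) -> \forall v' \near v, P (v', t).
Proof. exact: (differentiable_continuous (differentiable_slice t v)). Qed.

Lemma slice_open (t : set_type T) (U : set PVxT) :
  isopen U -> @isopen PV ((fun l => (l, t)) @^-1` U).
Proof.
move=> Uo v l vl Ul.
have := nbhs_slice (Uo (v, set_val t) (l, t) (conj vl erefl) Ul).
by apply: filterS => v' H l' vl'; exact: H.
Qed.

Lemma slice_holo (t : set_type T) (U : set PVxT) (f : PVxT -> C) :
  holo U f -> @holo PV ((fun l => (l, t)) @^-1` U) (f \o (fun l => (l, t))).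
Proof.
move=> fh v l vl Ul.
have [F FP] := fh (v, set_val t) (l, t) (conj vl erefl) Ul.
exists (fun v' => F (v', set_val t)).
have := nbhs_slice FP; apply: filterS => v' [dF FE]; split.
  exact: (differentiable_comp (differentiable_slice (set_val t) v') dF).
by move=> l' vl' Ul'; rewrite (FE (l', t)).
Qed.

Definition slice (t : set_type T) : space_mor PV PVxT :=
  @SpaceMor PV PVxT (fun l => (l, t)) (@slice_open t) (@slice_holo t).

(* T is a closed analytic subset of an open subset of C^m. *)
Definition analytic_set : Prop :=
  exists (D : set 'rV[C]_m) (k : nat) (f : 'I_k -> 'rV[C]_m -> C),
    [/\ open D,
        forall i t, D t -> differentiable (f i) t
      & T = D `&` [set t | forall i, f i t = 0]].

(* The member F_t of a family F of vector bundles on P(V) parametrized by T. *)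
Definition member (F : vbundle PVxT) (t : set_type T) : vbundle PV :=
  pullback (slice t) F.

End Family.

(* A deformation is a holomorphic vector bundle on P(V) x T together with a base
   point o of T. Every reduced complex space is locally such a T, and only the
   restrictions to the points of T matter, so that restricting to reduced bases
   loses no generality. *)
Definition rigid (E : vbundle PV) : Prop :=
  forall (m : nat) (T : set 'rV[C]_m), analytic_set T ->
  forall (F : vbundle (PVxT T)) (o : set_type T),
    bundle_iso (member F o) E ->
    \forall z \near (set_val o : 'rV[C]_m),
      forall t : set_type T, set_val t = z -> bundle_iso (member F t) E.


Section TrivialBundle.
Variable W : vectType C.
Local Notation coords := (rVof (vbasis {:W})).

Lemma trivial_open : @isopen PV setT.
Proof. by move=> v l _ _; exact: filterE. Qed.

Lemma coords_bij : bijective coords.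
Proof.
exists (vecof (vbasis {:W})).
  by apply: rVofK; exact: vbasisP.
by apply: vecofK; exact: vbasisP.
Qed.

Lemma holo_cst (U : set PV) (c : C) : holo U (fun=> c).
Proof.
by move=> v l _ _; exists (fun=> c); apply: filterE.
Qed.

Lemma trivial_triv_holo (a b : unit) :
  exists g : PV -> 'M[C]_(\dim {:W}),
  (forall i j, @holo PV (setT `&` setT) (fun x => g x i j)) /\
  (forall x : PV, setT x -> setT x ->
     forall u : W, coords u = coords u *m g x).
Proof.
exists (fun=> 1%:M); split=> [i j|x _ _ u]; first exact: holo_cst.
by rewrite mulmx1.
Qed.

Definition trivial_bundle : vbundle PV :=
  @VBundle PV (\dim {:W}) (fun=> W) unit (fun=> setT)
    (fun _ _ => coords : {linear W -> _})
    (fun=> trivial_open) (fun=> ex_intro _ tt I) (fun _ _ _ => coords_bij)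
    trivial_triv_holo.

End TrivialBundle.

Definition gen (l : line) : V := vpick (val l).

(* The vector of l with i-th coordinate 1, if there is one. *)
Definition unit_vec (i : 'I_n.+1) (l : line) : V :=
  (gen l 0 i)^-1 *: gen l.

Definition unit_elt (i : 'I_n.+1) (l : line) : subvs_of (val l) :=
  vsproj (val l) (unit_vec i l).

Definition std_dom (i : 'I_n.+1) : set line :=
  [set l | gen l 0 i != 0].

Lemma spansP (v : V) (l : line) : spans v l ->
  val l = <[v]>%VS /\ exists2 c, c != 0 & gen l = c *: v.
Proof.
case: l => l dl' /andP[/= v0 vl]; have dl := eqP dl'.
have lE : l = <[v]>%VS.
  apply/eqP; rewrite eq_sym eqEdim -memvE vl /=.
  by rewrite dim_vline v0 dl.
split=> //.
rewrite /gen /=; have /vlineP[c cE] : vpick l \in <[v]>%VS by rewrite -lE memv_pick.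
exists c => //; apply: contraTneq (v0) => c0.
have : vpick l == 0 by rewrite cE c0 scale0r.
by rewrite vpick0 -dimv_eq0 dl.
Qed.

Lemma spans_gen (l : line) : spans (gen l) l.
Proof.
apply/andP; split; last exact: memv_pick.
by rewrite /gen; case: l => l dl /=; rewrite vpick0 -dimv_eq0 (eqP dl).
Qed.

Lemma std_domP i v l : spans v l -> std_dom i l <-> v 0 i != 0.
Proof.
move=> /spansP[_ [c c0 cE]]; rewrite /std_dom /= cE mxE mulf_eq0 (negPf c0).
by [].
Qed.

Lemma unit_vecE i v l : spans v l -> unit_vec i l = (v 0 i)^-1 *: v.
Proof.
move=> /spansP[_ [c c0 cE]]; rewrite /unit_vec cE mxE scalerA.
by rewrite invfM mulrAC mulVf// mul1r.
Qed.

Lemma unit_eltE i l : vsval (unit_elt i l) = unit_vec i l.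
Proof. by rewrite vsprojK// memvZ// memv_pick. Qed.

Lemma unit_vec_change i j l : std_dom i l -> std_dom j l ->
  unit_vec j l = (unit_vec i l 0 j)^-1 *: unit_vec i l.
Proof.
rewrite /std_dom /unit_vec /= => i0 j0.
by rewrite mxE scalerA invfM invrK mulrAC mulfV// mul1r.
Qed.

Lemma near_coord_neq0 (i : 'I_n.+1) (v : V) : v 0 i != 0 ->
  \forall v' \near v, (v' : V) 0 i != 0.
Proof.
move=> vi.
have ci : {for v, continuous (fun v' : V => v' 0 i)}.
  exact: coord_continuous.
exact: (cvgr_neq0 _ ci vi).
Qed.

Lemma std_dom_open i : @isopen PV (std_dom i).
Proof.
move=> v l vl /(std_domP i vl) vi.
apply: filterS (near_coord_neq0 vi) => v' v'i l' v'l'.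
exact/(std_domP i v'l').
Qed.

Lemma std_dom_cover l : exists i, std_dom i l.
Proof.
have /andP[/rV0Pn[i vi] _] := spans_gen l.
by exists i.
Qed.

Lemma holo_linear_unit_vec (i : 'I_n.+1) (c : 'I_n.+1 -> C) (U : set PV) :
  (forall l, U l -> std_dom i l) ->
  holo U (fun l => \sum_k unit_vec i l 0 k * c k).
Proof.
move=> Ui v l vl /Ui /(std_domP i vl) vi.
exists (fun v' : V => (v' 0 i)^-1 * \sum_k v' 0 k * c k).
apply: filterS (near_coord_neq0 vi) => v' v'i; split; last first.
  move=> l' v'l' Ul'; rewrite (unit_vecE i v'l') mulr_sumr.
  by apply: eq_bigr => k _; rewrite mxE mulrA.
apply: differentiableM.
  by apply: differentiableV => //; exact: differentiable_coord.
rewrite (_ : (fun _ => _) = \sum_k (fun v' : V => v' 0 k * c k)); last first.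
  by apply/funext => w; rewrite fct_sumE.
apply: differentiable_sum => k; apply: differentiableM => //.
exact: differentiable_coord.
Qed.

Lemma holo_unit_vec (i j : 'I_n.+1) (U : set PV) :
  (forall l, U l -> std_dom i l) ->
  holo U (fun l => unit_vec i l 0 j).
Proof.
move=> Ui; have := holo_linear_unit_vec (fun k => (k == j)%:R) Ui.
congr (holo U _); apply/funext => l.
rewrite (bigD1 j) //= eqxx mulr1 big1 ?addr0// => k /negPf ->.
by rewrite mulr0.
Qed.

Lemma unit_eltP i l (u : subvs_of (val l)) : std_dom i l ->
  u = (vsval u 0 i) *: unit_elt i l.
Proof.
move=> li; apply: val_inj => /=; rewrite unit_eltE /unit_vec.
have [lE _] := spansP (spans_gen l).
have : vsval u \in <[gen l]>%VS by rewrite -lE subvsP.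
move=> /vlineP[c ->]; rewrite mxE scalerA -mulrA mulfV ?mulr1//.
Qed.

(* The bundle W (x) O(1): its fibre at the line l is W (x) l^* = Hom(l, W). *)
Section TwistedBundle.
Variable W : vectType C.

Definition twist_triv (i : 'I_n.+1) (l : line) (f : 'Hom(subvs_of (val l), W)) :
  'rV[C]_(\dim {:W}) := rVof (vbasis {:W}) (f (unit_elt i l)).

Lemma twist_triv_linear i l : linear (@twist_triv i l).
Proof.
move=> c f g; rewrite /twist_triv add_lfunE scale_lfunE.
by rewrite linearP.
Qed.

HB.instance Definition _ i l := GRing.isLinear.Build C
  'Hom(subvs_of (val l), W) 'rV[C]_(\dim {:W}) *:%R (@twist_triv i l)
  (@twist_triv_linear i l).

Lemma twist_triv_bij i l : std_dom i l -> bijective (@twist_triv i l).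
Proof.
move=> li.
pose h (w : W) (u : subvs_of (val l)) := vsval u 0 i *: w.
have hL w : linear (h w).
  by move=> c u u'; rewrite /h linearP !mxE scalerDl scalerA.
pose hl w := GRing.isLinear.Build _ _ _ _ (h w) (hL w).
pose H w : {linear subvs_of (val l) -> W} := HB.pack (h w) (hl w).
exists (fun r => linfun (H (vecof (vbasis {:W}) r))).
- move=> f; apply/lfunP => u; rewrite lfunE /= /h /twist_triv.
  rewrite rVofK; last exact: vbasisP.
  by rewrite -linearZ -unit_eltP.
- move=> r; rewrite /twist_triv lfunE /= /h unit_eltE /unit_vec mxE.
  by rewrite mulVf// scale1r vecofK//; exact: vbasisP.
Qed.

Lemma twist_triv_holo (i j : 'I_n.+1) :
  exists g : PV -> 'M[C]_(\dim {:W}),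
  (forall a b, @holo PV (std_dom i `&` std_dom j) (fun l => g l a b)) /\
  (forall l, std_dom i l -> std_dom j l ->
     forall f, @twist_triv j l f = twist_triv i f *m g l).
Proof.
exists (fun l => (unit_vec j l 0 i)%:M); split.
- move=> a b.
  have [ab|ab] := eqVneq a b; last first.
    rewrite (_ : (fun _ => _) = fun=> 0); first exact: holo_cst.
    by apply/funext => l; rewrite mxE (negPf ab).
  rewrite (_ : (fun _ => _) = fun l => unit_vec j l 0 i); last first.
    by apply/funext => l; rewrite ab mxE eqxx mulr1n.
  by apply: holo_unit_vec => l [].
- move=> l li lj f; rewrite /twist_triv mul_mx_scalar -linearZ -linearZ.
  by rewrite -unit_eltE -unit_eltP.
Qed.

Definition twisted_bundle : vbundle PV :=
  @VBundle PV (\dim {:W}) (fun l => 'Hom(subvs_of (val l), W)) 'I_n.+1 std_dom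
    (fun i l => @twist_triv i l : {linear _ -> _})
    std_dom_open std_dom_cover twist_triv_bij twist_triv_holo.

End TwistedBundle.

(* S^2 V, as the symmetric tensors in V (x) V = 'M_n.+1; here v (x) w is v^T *m w,
   so that the square w^2 is w^T *m w. *)
Definition Sym2 : {vspace 'M[C]_n.+1} := fixedSpace (linfun trmx).

(* V (x) V (x) V: the coefficient of T on e_i (x) e_j (x) e_k is T k i j. *)
Definition tensor3 : vectType C := {ffun 'I_n.+1 -> 'M[C]_n.+1}.

Lemma tensor3_linE c (T T' : tensor3) k i j :
  (c *: T + T' : tensor3) k i j = c * T k i j + T' k i j.
Proof. by rewrite ffunE mxE ffunE mxE. Qed.

Definition wedge (v w : V) : 'M[C]_n.+1 := v^T *m w - w^T *m v.

Definition tensor (A : 'M[C]_n.+1) (w : V) : tensor3 := [ffun k => w 0 k *: A].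

Definition skew_defect (T : tensor3) : tensor3 := [ffun k => T k + (T k)^T].

Definition cyclic_sum (T : tensor3) : tensor3 :=
  [ffun k => \matrix_(i, j) (T k i j + T i j k + T j k i)].

Lemma skew_defect_linear : linear skew_defect.
Proof.
move=> c T T'; apply/ffunP => k; rewrite !ffunE linearP /= scalerDr.
by rewrite addrACA.
Qed.
HB.instance Definition _ := GRing.isLinear.Build C tensor3 tensor3 *:%R
  skew_defect skew_defect_linear.

Lemma cyclic_sum_linear : linear cyclic_sum.
Proof.
move=> c T T'; apply/ffunP => k; apply/matrixP => i j; rewrite !(ffunE, mxE).
ring.
Qed.
HB.instance Definition _ := GRing.isLinear.Build C tensor3 tensor3 *:%R
  cyclic_sum cyclic_sum_linear.

(* S_21 V, as the kernel of wedge^2 V (x) V -> wedge^3 V. *)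
Definition S21 : {vspace tensor3} :=
  (lker (linfun skew_defect) :&: lker (linfun cyclic_sum))%VS.

Lemma mem_Sym2 (Q : 'M[C]_n.+1) : (Q \in Sym2) = (Q^T == Q).
Proof. by apply/fixedSpaceP/eqP; rewrite lfunE. Qed.

Lemma mem_S21 (T : tensor3) : T \in S21 <->
  (forall k, (T k)^T = - T k) /\
  (forall i j k, T k i j + T i j k + T j k i = 0).
Proof.
rewrite memv_cap !memv_ker !lfunE /=; split.
  move=> /andP[/eqP/ffunP h1 /eqP/ffunP h2]; split=> [k|i j k].
    by apply/eqP; rewrite -addr_eq0 addrC; have := h1 k; rewrite !ffunE => ->.
  by have := h2 k; rewrite !ffunE => /matrixP/(_ i j); rewrite !mxE.
move=> [h1 h2]; apply/andP; split; apply/eqP/ffunP => k; rewrite !ffunE.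
  by rewrite h1 subrr.
by apply/matrixP => i j; rewrite !mxE.
Qed.

(* The linear extension of w^2 |-> (v /\ w) (x) w to all of V (x) V. *)
Definition psi_tensor (v : V) (Q : 'M[C]_n.+1) : tensor3 :=
  [ffun k => wedge v (row k Q)].

Lemma psi_tensor_square (v w : V) :
  psi_tensor v (w^T *m w) = tensor (wedge v w) w.
Proof.
apply/ffunP => k; rewrite !ffunE /wedge row_mul.
have -> : row k w^T *m w = w 0 k *: w.
  by apply/rowP => j; rewrite !mxE big_ord1 !mxE.
by rewrite -scalemxAr linearZ /= -scalemxAl scalerBr.
Qed.

Lemma psi_tensorE v Q i j k :
  psi_tensor v Q k i j = v 0 i * Q k j - Q k i * v 0 j.
Proof. by rewrite ffunE !mxE !big_ord1 !mxE. Qed.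

Lemma psi_tensor_S21 v Q : Q \in Sym2 -> psi_tensor v Q \in S21.
Proof.
rewrite mem_Sym2 => /eqP QT; apply/mem_S21; split=> [k|i j k].
  by apply/matrixP => i j; rewrite !mxE !psi_tensorE; ring.
have QC a b : Q a b = Q b a by rewrite -[in LHS]QT mxE.
by rewrite !psi_tensorE (QC k j) (QC k i) (QC i j); ring.
Qed.

Definition psi_sub (v : V) (q : subvs_of Sym2) : subvs_of S21 :=
  vsproj S21 (psi_tensor v (vsval q)).

Lemma psi_subE v q : vsval (psi_sub v q) = psi_tensor v (vsval q).
Proof. by rewrite vsprojK// psi_tensor_S21// subvsP. Qed.

Lemma psi_sub_linear v : linear (psi_sub v).
Proof.
move=> c q q'; apply: subvs_inj; rewrite [RHS]linearP /= !psi_subE.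
apply/ffunP => k; apply/matrixP => i j.
rewrite [RHS]tensor3_linE !psi_tensorE.
by rewrite linearP !mxE; ring.
Qed.

HB.instance Definition _ v := GRing.isLinear.Build C
  (subvs_of Sym2) (subvs_of S21) *:%R (psi_sub v) (@psi_sub_linear v).

Definition psi_hom (v : V) : 'Hom(subvs_of Sym2, subvs_of S21) :=
  linfun (psi_sub v).

Lemma psi_hom_linear : linear psi_hom.
Proof.
move=> c v v'; apply/lfunP => q; rewrite add_lfunE scale_lfunE !lfunE /=.
apply: subvs_inj; rewrite [RHS]linearP /= !psi_subE.
apply/ffunP => k; apply/matrixP => i j.
rewrite [RHS]tensor3_linE !psi_tensorE.
by rewrite !mxE; ring.
Qed.

HB.instance Definition _ := GRing.isLinear.Build C
  V 'Hom(subvs_of Sym2, subvs_of S21) *:%R psi_hom psi_hom_linear.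

(* The value of psi on the fibre at l: the map q |-> (v |-> psi_v q) from S^2 V
   to Hom(l, S_21 V). *)
Section PsiFibre.
Variable l : line.

Definition psi_eval (q : subvs_of Sym2) (u : subvs_of (val l)) :
  subvs_of S21 := psi_hom (vsval u) q.

Lemma psi_eval_linear q : linear (psi_eval q).
Proof.
by move=> c u u'; rewrite /psi_eval !linearP /= add_lfunE scale_lfunE.
Qed.

HB.instance Definition _ q := GRing.isLinear.Build C
  (subvs_of (val l)) (subvs_of S21) *:%R (psi_eval q) (@psi_eval_linear q).

Definition psi_fib (q : subvs_of Sym2) : 'Hom(subvs_of (val l), subvs_of S21) :=
  linfun (psi_eval q).

Lemma psi_fib_linear : linear psi_fib.
Proof.
move=> c q q'; apply/lfunP => u; rewrite add_lfunE scale_lfunE !lfunE /=.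
by rewrite /psi_eval linearP.
Qed.

HB.instance Definition _ := GRing.isLinear.Build C
  (subvs_of Sym2) 'Hom(subvs_of (val l), subvs_of S21) *:%R
  psi_fib psi_fib_linear.

End PsiFibre.

Lemma psi_holo (a : unit) (i : 'I_n.+1) :
  exists g : PV -> 'M[C]_(\dim {:subvs_of Sym2}, \dim {:subvs_of S21}),
  (forall s t, @holo PV (setT `&` std_dom i) (fun l => g l s t)) /\
  (forall l, [set: line] l -> std_dom i l -> forall q,
     twist_triv i (psi_fib l q) = rVof (vbasis {:subvs_of Sym2}) q *m g l).
Proof.
pose mx v := mxof (vbasis {:subvs_of Sym2}) (vbasis {:subvs_of S21}) (psi_hom v).
exists (fun l => mx (unit_vec i l)); split.
- move=> s t.
  have -> : (fun l => mx (unit_vec i l) s t) =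
      fun l => \sum_k unit_vec i l 0 k * mx (delta_mx 0 k) s t.
    apply/funext => l.
    rewrite {1}/mx [in LHS](row_sum_delta (unit_vec i l)) !linear_sum summxE.
    by apply: eq_bigr => k _; rewrite !linearZ mxE.
  by apply: holo_linear_unit_vec => l [].
- move=> l _ li q; rewrite /twist_triv lfunE /= /psi_eval unit_eltE.
  by apply: rVof_app; exact: vbasisP.
Qed.

Definition psi : bundle_hom (trivial_bundle (subvs_of Sym2))
                            (twisted_bundle (subvs_of S21)) :=
  @BundleHom PV (trivial_bundle (subvs_of Sym2)) (twisted_bundle (subvs_of S21))
    (fun l => @psi_fib l : {linear _ -> _}) psi_holo.

End ProjectiveSpace.
End HolomorphicBundles.

(* Main.v *)
From HB Require Import structures.
Require Import Defs.
From mathcomp Require Import all_boot all_order all_algebra.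
From mathcomp Require Import complex ring lra interval_inference set_interval.
From mathcomp Require Import boolp classical_sets functions reals topology.
From mathcomp Require Import ereal constructive_ereal normedtype landau derive.
From mathcomp Require Import sequences measure lebesgue_measure lebesgue_integral.

Set Implicit Arguments.
Unset Strict Implicit.
Unset Printing Implicit Defensive.

Import Order.TTheory GRing.Theory Num.Theory.
Import numFieldNormedType.Exports.
Import Normc.
Local Notation Re := complex.Re.
Local Notation Im := complex.Im.

Local Open Scope classical_set_scope.
Local Open Scope ring_scope.
Local Open Scope complex_scope.

(** The fibre of [E] at the line of [z] is [S^2V / C z^2], so that [E] is the quotient of
    [S^2V (x) O] by [O(-2)]. Given a family whose member at [o] is isomorphic to [E], an isomorphism
    of the member at [t] with [E] is built directly for [t] near [o]. Three cohomological facts are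
    behind it: [H^1(E) = 0], [H^1(O) = 0] and [H^0(O(2)) = S^2V^*].

    Because [H^1(E) = 0], the sections of the central member that come from [S^2V] extend to nearby
    members. They form a map from [S^2V (x) O] to the nearby member that is close to the quotient
    map, hence onto, with a line bundle close to [O(-2)] as kernel. Because [H^1(O) = 0], that
    kernel is isomorphic to [O(-2)] by an isomorphism close to the identity. Its inclusion in
    [S^2V (x) O] is then a matrix of quadratic forms close to [z^2], that is [z -> B(z^2)] for a
    linear endomorphism [B] of [S^2V] close to the identity. After composition with the invertible
    map [B] the kernel is exactly [C z^2], as it is for [E], and two surjections from [S^2V] with
    the same kernel have isomorphic targets.

    Everything is done on Cech cochains for the cones [om i], with explicit bounds, so that small
    perturbations can be absorbed. The bounded vanishing theorem for [O(d)] is [cousin]; it splits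
    Laurent series in one coordinate and accepts cochains that are cocycles only approximately.
    [cousinE] is the same for [E], seen inside [S_21 V (x) O(1)]: the equations that cut out [E] are
    restored by a Koszul homotopy ([koszul2], [koszul1]) and a projection. [neumann] passes from a
    cocycle of transition matrices to a nearby one by iterating such an approximate solver. [deform]
    applies it twice, to extend the sections and to trivialize the kernel.

    To see a nearby member as a small perturbation, it needs frames over the whole of each cone that
    tend to given frames of the central member. They exist near each point; [framed_glue] joins them
    across a common face of two boxes by Cartan's factorization of matrices close to the identity
    ([cartan_limit]), and bisection gives [frames]. [near_iso] puts the pieces together.

    The function theory rests on integrals around rectangles: [goursat], [cauchy], the limit theorem
    [weierstrass], and holomorphy of integrals with parameters [hd_ci]. *)

Section Complex.

(** * Real-valued modulus of complex numbers *)

Variable R : realType.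
Local Notation C := R[i].
Implicit Types (x y z w : C) (e d : R).

Lemma pos_min (p q : R) : 0 < p -> 0 < q -> exists s, [/\ 0 < s, s <= p & s <= q].
Proof.
by move=> p0 q0; exists (Num.min p q); rewrite lt_min p0 !ge_min !lexx orbT.
Qed.

Lemma le_normcD z w : normc (z + w) <= normc z + normc w.
Proof. exact: (@complex.le_normcD R z w). Qed.

Lemma normcN z : normc (- z) = normc z.
Proof. exact: (@complex.normcN R z). Qed.

Lemma normc_ge0 z : 0 <= normc z.
Proof. by case: z => a b /=; exact: sqrtr_ge0. Qed.

Lemma normcB z w : normc (z - w) = normc (w - z).
Proof. by rewrite -normcN opprB. Qed.

Lemma normcD_le z w a b : normc z <= a -> normc w <= b -> normc (z + w) <= a + b.
Proof. by move=> za wb; apply: le_trans (le_normcD _ _) _; exact: lerD. Qed.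

Lemma normcB_le z w a b : normc z <= a -> normc w <= b -> normc (z - w) <= a + b.
Proof. by move=> za wb; apply: normcD_le => //; rewrite normcN. Qed.

Lemma normcM_le z w a b : normc z <= a -> normc w <= b -> normc (z * w) <= a * b.
Proof. by move=> za wb; rewrite normcM ler_pM ?normc_ge0. Qed.

Lemma normc_eq0 z : (normc z == 0) = (z == 0).
Proof.
apply/eqP/eqP => [|->]; last exact: normc0.
exact: eq0_normc.
Qed.

Lemma normc_gt0 z : (0 < normc z) = (z != 0).
Proof. by rewrite lt_def normc_ge0 andbT normc_eq0. Qed.

Lemma normc_real (a : R) : normc (a +i* 0) = `|a|.
Proof. by rewrite /= expr0n addr0 sqrtr_sqr. Qed.

Lemma normc_imag (a : R) : normc (0 +i* a) = `|a|.
Proof. by rewrite /= expr0n add0r sqrtr_sqr. Qed.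

Lemma normc_i : normc ('i : C) = 1.
Proof. by rewrite normc_imag normr1. Qed.

Lemma normc_le_parts z : normc z <= `|Re z| + `|Im z|.
Proof.
have {1}-> : z = (Re z +i* 0) + (0 +i* Im z) by case: z => a b; simpc.
by apply: (le_trans (le_normcD _ _)); rewrite normc_real normc_imag.
Qed.

Lemma normc_ge_Re_r z : `|Re z| <= normc z.
Proof.
case: z => a b /=; rewrite -sqrtr_sqr ler_sqrt ?addr_ge0 ?sqr_ge0//.
by rewrite lerDl sqr_ge0.
Qed.

Lemma normc_ge_Im_r z : `|Im z| <= normc z.
Proof.
case: z => a b /=; rewrite -sqrtr_sqr ler_sqrt ?addr_ge0 ?sqr_ge0//.
by rewrite lerDr sqr_ge0.
Qed.

(** The sign is kept as a factor [-1] so that linearity of the real integral applies to it. *)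
Lemma Re_i z : Re ('i * z) = -1 * Im z.
Proof. by rewrite mulN1r; case: z => a b; simpc. Qed.

Lemma Im_i z : Im ('i * z) = Re z.
Proof. by case: z => a b; simpc. Qed.

Lemma normc_sum (I : Type) (r : seq I) (P : pred I) (F : I -> C) :
  normc (\sum_(i <- r | P i) F i) <= \sum_(i <- r | P i) normc (F i).
Proof.
elim/big_rec2: _ => [|i u v _ H]; first by rewrite normc0.
by apply: normcD_le.
Qed.

End Complex.

Arguments Normc.normc : simpl never.

(** * Integrals of continuous complex functions over real intervals *)

Section Integral.
Variable R : realType.
Local Notation C := R[i].
Local Notation mu := (@lebesgue_measure R).
Implicit Types (f g : R -> C) (a b c : R).

Definition rcont (g : R -> C) (x : R) := forall e, 0 < e ->
  exists2 d, 0 < d & forall y, `|y - x| < d -> normc (g y - g x) < e.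

Definition contin g a b := forall x, a <= x <= b -> rcont g x.

Definition ci g a b : C :=
  (\int[mu]_(x in `[a, b]) Re (g x))%R +i* (\int[mu]_(x in `[a, b]) Im (g x))%R.

(** Any 1-Lipschitz [p] is allowed, so that real and imaginary parts are handled at once. *)
Let rcont_part (p : C -> R) g a b :
  (forall z w, `|p z - p w| <= normc (z - w)) -> contin g a b ->
  mu.-integrable `[a, b] (EFin \o (p \o g)).
Proof.
move=> pl gc; apply: continuous_compact_integrable.
  exact: segment_compact.
apply: continuous_in_subspaceT => x; rewrite inE /= in_itv /= => xab.
apply/cvgrPdist_lt => e e0; have [d d0 H] := gc x xab e e0.
apply/nbhs_ballP; exists d => //= y; rewrite /ball /= => xy.
rewrite (le_lt_trans (pl _ _))// normcB; apply: H.
by rewrite distrC.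
Qed.

Lemma Re_lip (z w : C) : `|Re z - Re w| <= normc (z - w).
Proof. by move: (normc_ge_Re_r (z - w)); rewrite raddfB. Qed.

Lemma Im_lip (z w : C) : `|Im z - Im w| <= normc (z - w).
Proof. by move: (normc_ge_Im_r (z - w)); rewrite raddfB. Qed.

Let ire g a b := @rcont_part (@Re R) g a b Re_lip.
Let iim g a b := @rcont_part (@Im R) g a b Im_lip.

Arguments ci : simpl never.

Lemma eq_ci f g a b : (forall x, a <= x <= b -> f x = g x) -> ci f a b = ci g a b.
Proof.
move=> fg; rewrite /ci; congr (_ +i* _); apply: eq_Rintegral => x;
  by rewrite inE /= in_itv /= => /fg ->.
Qed.

Lemma ciD f g a b : contin f a b -> contin g a b ->
  ci (fun x => f x + g x) a b = ci f a b + ci g a b.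
Proof.
move=> fc gc; rewrite /ci; simpc.
rewrite -!RintegralD//; try (by [exact: ire|exact: iim]).
by congr (_ +i* _); apply: eq_Rintegral => x _; rewrite raddfD.
Qed.

Let ciZr f a b (k : R) : contin f a b ->
  ci (fun x => k%:C * f x) a b = k%:C * ci f a b.
Proof.
move=> fc; rewrite /ci; simpc; rewrite -!RintegralZl//; try (by [exact: ire|exact: iim]).
by congr (_ +i* _); apply: eq_Rintegral => x _; case: (f x) => u v; simpc.
Qed.

Lemma rcontD f g x : rcont f x -> rcont g x -> rcont (fun x => f x + g x) x.
Proof.
move=> fc gc e e0; have e2 : 0 < e / 2 by lra.
have [d d0 H] := fc _ e2; have [d' d'0 H'] := gc _ e2.
exists (Num.min d d'); first by rewrite lt_min d0.
move=> y; rewrite lt_min => /andP[/H h /H' h'].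
rewrite opprD addrACA (le_lt_trans (le_normcD _ _))//.
by rewrite (splitr e) ltrD.
Qed.

Lemma rcontZ (k : C) f x : rcont f x -> rcont (fun x => k * f x) x.
Proof.
move=> fc e e0; have k1 : 0 < normc k + 1 by rewrite ltr_wpDl ?normc_ge0.
have [d d0 H] := fc _ (divr_gt0 e0 k1).
exists d => // y /H h; rewrite -mulrBr normcM.
have : normc k * normc (f y - f x) <= (normc k + 1) * normc (f y - f x).
  by rewrite ler_wpM2r ?normc_ge0// lerDl.
by move/le_lt_trans; apply; rewrite mulrC -ltr_pdivlMr.
Qed.

Lemma rcont_cst (k : C) x : rcont (fun=> k) x.
Proof. by move=> e e0; exists 1 => // y _; rewrite subrr normc0. Qed.

Lemma ciZ f a b (k : C) : contin f a b ->
  ci (fun x => k * f x) a b = k * ci f a b.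
Proof.
move=> fc; case: k => u v.
have H1 : contin (fun x => u%:C * f x) a b by move=> x /fc; exact: rcontZ.
have H2 : contin (fun x => 'i * f x) a b by move=> x /fc; exact: rcontZ.
have H3 : contin (fun x => v%:C * ('i * f x)) a b by move=> x /H2; exact: rcontZ.
have -> : ci (fun x => (u +i* v) * f x) a b =
    ci (fun x => u%:C * f x + v%:C * ('i * f x)) a b.
  by apply: eq_ci => x _; case: (f x) => p q; simpc.
rewrite ciD// !ciZr//.
have -> : ci (fun x => 'i * f x) a b = 'i * ci f a b.
  rewrite /ci; simpc; congr (_ +i* _).
    under eq_Rintegral => x _ do rewrite Re_i.
    by rewrite RintegralZl// ?mulN1r//; exact: iim.
  by apply: eq_Rintegral => x _; rewrite Im_i.
by case: (ci f a b) => p q; simpc.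
Qed.

Lemma ciB f g a b : contin f a b -> contin g a b ->
  ci (fun x => f x - g x) a b = ci f a b - ci g a b.
Proof.
move=> fc gc; have gc' : contin (fun x => -1 * g x) a b.
  by move=> x /gc; exact: rcontZ.
have -> : ci (fun x => f x - g x) a b = ci (fun x => f x + -1 * g x) a b.
  by apply: eq_ci => x _; rewrite mulN1r.
by rewrite ciD// ciZ// mulN1r.
Qed.

Lemma ci_cst (k : C) a b : a <= b -> ci (fun=> k) a b = (b - a)%:C * k.
Proof.
move=> ab; rewrite /ci !Rintegral_cst//.
have -> : fine (mu `[a, b]) = b - a.
  rewrite lebesgue_measure_itv /= lte_fin; case: ifPn => //; rewrite -leNgt => ba.
  have -> : a = b by apply/eqP; rewrite eq_le ab.
  by rewrite subrr.
by case: k => u v /=; simpc; rewrite ![(b - a) * _]mulrC.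
Qed.

(** Real and imaginary parts are estimated separately. This costs the factor 2, which is harmless,
    and avoids rotating the integral. *)
Lemma ci_bound f a b (M : R) : a <= b -> contin f a b ->
  (forall x, a <= x <= b -> normc (f x) <= M) ->
  normc (ci f a b) <= 2 * M * (b - a).
Proof.
move=> ab fc fM.
have mc : mu.-integrable `[a, b] (EFin \o (fun=> M : R)).
  apply: continuous_compact_integrable; first exact: segment_compact.
  by apply: continuous_subspaceT => x; exact: cvg_cst.
have bd (p : C -> R) : (forall z w, `|p z - p w| <= normc (z - w)) -> p 0 = 0 ->
    `|\int[mu]_(x in `[a, b]) p (f x)|%R <= M * (b - a).
  move=> pl p0; have pi := rcont_part pl fc.
  have pi' : mu.-integrable `[a, b] (EFin \o (fun x => `|p (f x)|)).
    exact: (integrable_norm pi).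
  apply: le_trans (le_normr_Rintegral _ pi) _ => //.
  have -> : M * (b - a) = \int[mu]_(x in `[a, b]) M.
    rewrite Rintegral_cst//= lebesgue_measure_itv /= lte_fin.
    case: ifPn => //; rewrite -leNgt => ba.
    have -> : a = b by apply/eqP; rewrite eq_le ab.
    by rewrite subrr.
  apply: le_Rintegral => // x /=; rewrite in_itv /= => /fM.
  by apply: le_trans; rewrite -[p _]subr0 -p0 -[f x in leRHS]subr0; exact: pl.
apply: le_trans (normc_le_parts _) _ => /=.
have h1 := bd _ Re_lip erefl; have h2 := bd _ Im_lip erefl.
rewrite -mulrA mulr_natl mulr2n; exact: lerD.
Qed.

Lemma ci_cat f a b c : a <= b -> b <= c -> contin f a c ->
  ci f a c = ci f a b + ci f b c.
Proof.
move=> ab bc fc; rewrite /ci; simpc.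
have main (p : C -> R) : (forall z w, `|p z - p w| <= normc (z - w)) ->
    \int[mu]_(x in `[a, c]) p (f x) =
    (\int[mu]_(x in `[a, b]) p (f x)) + \int[mu]_(x in `[b, c]) p (f x).
  move=> pl; have pi := rcont_part pl fc.
  have := @Rintegral_itvB _ (p \o f) (BLeft a) (BRight c) b pi.
  rewrite !bnd_simp => /(_ ab bc) /= H.
  rewrite -(@Rintegral_itv_obnd_cbnd R b (BRight c)).
    by apply/eqP; rewrite addrC -subr_eq H.
  apply: integrableS pi => //.
  by apply: subset_itv; rewrite bnd_simp.
by rewrite !main//; [exact: Im_lip|exact: Re_lip].
Qed.

End Integral.
Arguments ci : simpl never.

(** * Induction on boxes by bisection *)

Section Bisection.
Variables (R : realType) (D : finType).
Implicit Types (lo hi : D -> R).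

Definition upd lo (d : D) (m : R) : D -> R := fun e => if e == d then m else lo e.

Definition mid lo hi (d : D) : R := (lo d + hi d) / 2.

Section Halving.
Variable P : (D -> R) -> (D -> R) -> Prop.
Hypothesis P_cat : forall lo hi d, (forall e, lo e <= hi e) ->
  P lo (upd hi d (mid lo hi d)) -> P (upd lo d (mid lo hi d)) hi -> P lo hi.

(** The sides listed in [s] are halved one at a time; by [P_cat], one of the two halves still
    violates [P]. *)
Let halve_list (s : seq D) lo hi : uniq s -> (forall e, lo e <= hi e) -> ~ P lo hi ->
  exists lo' hi', [/\ ~ P lo' hi', forall d, lo d <= lo' d, forall d, hi' d <= hi d &
    forall d, hi' d - lo' d = (if d \in s then 2^-1 else 1) * (hi d - lo d)].
Proof.
elim: s lo hi => [|d s IH] lo hi /=.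
  by move=> _ _ nP; exists lo, hi; split=> // d; rewrite mul1r.
move=> /andP[ds us] lh nP.
have [lo1 [hi1 [nP1 lo1E hi1E E1]]] : exists lo' hi', [/\ ~ P lo' hi',
    forall d, lo d <= lo' d, forall d, hi' d <= hi d &
    forall e, hi' e - lo' e = (if e == d then 2^-1 else 1) * (hi e - lo e)].
  have [P1|nP1] := pselect (P lo (upd hi d (mid lo hi d))).
    exists (upd lo d (mid lo hi d)), hi; split=> //.
    - by move=> P2; apply: nP; exact: (P_cat (d := d)).
    - move=> e; rewrite /upd /mid; case: eqP => // ->.
      by have := lh d; lra.
    - move=> e; rewrite /upd /mid; case: eqP => [->|_]; last by rewrite mul1r.
      by field.
  exists lo, (upd hi d (mid lo hi d)); split=> //.
  - move=> e; rewrite /upd /mid; case: eqP => // ->.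
    by have := lh d; lra.
  - move=> e; rewrite /upd /mid; case: eqP => [->|_]; last by rewrite mul1r.
    by field.
have lh1 e : lo1 e <= hi1 e.
  rewrite -subr_ge0 E1; have := lh e; rewrite -subr_ge0.
  by case: ifP => _ ?; rewrite mulr_ge0 // invr_ge0.
have [lo2 [hi2 [nP2 lo2E hi2E E2]]] := IH lo1 hi1 us lh1 nP1.
exists lo2, hi2; split=> // [e|e|e].
- exact: le_trans (lo1E _) (lo2E _).
- exact: le_trans (hi2E _) (hi1E _).
rewrite E2 E1 inE; case: eqP => [->|_] /=.
  by rewrite (negPf ds) mul1r.
by rewrite mul1r.
Qed.

Let halve lo hi : (forall e, lo e <= hi e) -> ~ P lo hi ->
  exists lo' hi', [/\ ~ P lo' hi', forall d, lo d <= lo' d, forall d, hi' d <= hi d &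
    forall d, hi' d - lo' d = 2^-1 * (hi d - lo d)].
Proof.
move=> lh /(halve_list (enum_uniq D) lh)[lo' [hi' [? ? ? E]]].
by exists lo', hi'; split=> // d; rewrite E mem_enum.
Qed.

(** This is compactness of the box in the form used below, for Goursat's theorem and for uniform
    estimates. A box violating [P] contains one of half the size that violates it; the nested boxes
    shrink to a point, where the local hypothesis is contradicted. *)
Lemma box_induction lo0 hi0 : (forall d, lo0 d <= hi0 d) ->
  (forall x, (forall d, lo0 d <= x d <= hi0 d) ->
    exists2 e, 0 < e & forall s lo hi, 0 < s < e ->
      (forall d, lo d <= x d <= hi d) ->
      (forall d, hi d - lo d = s * (hi0 d - lo0 d)) ->
      (forall d, lo0 d <= lo d /\ hi d <= hi0 d) -> P lo hi) ->
  P lo0 hi0.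
Proof.
move=> lh0 loc; apply: contrapT => nP0.
(* Bad boxes are made a type so that halving can be iterated as a function. *)
pose bad := {b : (D -> R) * (D -> R) | (forall d, b.1 d <= b.2 d) /\ ~ P b.1 b.2}.
have step (b : bad) : {b' : bad | [/\ forall d, (sval b).1 d <= (sval b').1 d,
    forall d, (sval b').2 d <= (sval b).2 d &
    forall d, (sval b').2 d - (sval b').1 d = 2^-1 * ((sval b).2 d - (sval b).1 d)]}.
  apply: cid; case: b => -[lo hi] [/= lh nP].
  have [lo' [hi' [nP' h1 h2 h3]]] := halve lh nP.
  have lh' : forall d, lo' d <= hi' d.
    by move=> d; rewrite -subr_ge0 h3 mulr_ge0 ?invr_ge0 ?subr_ge0.
  by exists (exist _ (lo', hi') (conj lh' nP')).
pose b0 : bad := exist _ (lo0, hi0) (conj lh0 nP0).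
pose b := fix b k := if k is k'.+1 then sval (step (b k')) else b0.
pose lo k := (sval (b k)).1; pose hi k := (sval (b k)).2.
have loS k d : lo k d <= lo k.+1 d by rewrite /lo /=; case: (step (b k)) => ? [].
have hiS k d : hi k.+1 d <= hi k d by rewrite /hi /=; case: (step (b k)) => ? [].
have szS k d : hi k d - lo k d = 2^-1 ^+ k * (hi0 d - lo0 d).
  elim: k => [|k IH]; first by rewrite expr0 mul1r.
  rewrite exprS -mulrA -IH /hi /lo /=.
  by case: (step (b k)) => ? [].
have lh k d : lo k d <= hi k d by rewrite /lo /hi; case: (b k) => -[? ?] [].
have mlo d : {homo lo ^~ d : k l / (k <= l)%N >-> k <= l}.
  by apply: homo_leq => //; exact: le_trans.
have mhi d : {homo hi ^~ d : k l / (k <= l)%N >-> l <= k}.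
  apply: (@homo_leq _ (hi ^~ d) (fun x y => y <= x)) => // y x z xy yz.
  exact: le_trans yz xy.
have lohi k l d : lo k d <= hi l d.
  have [kl|/ltnW lk] := leqP k l.
    exact: le_trans (mlo d _ _ kl) (lh _ _).
  exact: le_trans (lh _ _) (mhi d _ _ lk).
(* The common point of the nested boxes, whose sizes are [2^-k] times the initial ones. *)
pose x d := sup (range (lo ^~ d)).
have hs d : has_sup (range (lo ^~ d)).
  split; first by exists (lo 0%N d), 0%N.
  by exists (hi 0%N d) => _ [k _ <-]; exact: lohi.
have xlo k d : lo k d <= x d.
  by apply: ub_le_sup; [by case: (hs d)|exists k].
have xhi k d : x d <= hi k d.
  by apply: ge_sup; [by case: (hs d)|move=> _ [l _ <-]; exact: lohi].
have [|e e0 H] := loc x; first by move=> d; rewrite (xlo 0%N) (xhi 0%N).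
have [k ke] : exists k, 2^-1 ^+ k < e.
  have := @cvg_expr R 2^-1; rewrite ger0_norm ?invr_ge0//.
  rewrite invf_lt1 ?ltr1n// => /(_ isT) cv.
  move/cvgrPdist_lt: cv => cv; have [k _ /(_ k)] := cv e e0.
  rewrite /= sub0r normrN => /(_ (leqnn _)) ke; exists k.
  by apply: le_lt_trans ke; exact: ler_norm.
have [_] := svalP (b k); apply.
apply: (H (2^-1 ^+ k)) => [|d|d|d].
- by rewrite ke exprn_gt0// invr_gt0.
- by rewrite (xlo k) (xhi k).
- exact: szS.
- by split; [exact: (mlo d 0%N k)|exact: (mhi d 0%N k)].
Qed.

End Halving.
End Bisection.

(** * Contour integrals around rectangles *)

Section Rectangles.
Variable R : realType.
Local Notation C := R[i].
Implicit Types (f g : C -> C) (a b c d : R) (z w : C).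

Definition ccont f w := forall e, 0 < e ->
  exists2 d, 0 < d & forall w', normc (w' - w) < d -> normc (f w' - f w) < e.

Definition cdiff f w := exists l : C, forall e, 0 < e ->
  exists2 d, 0 < d & forall h, normc h < d ->
    normc (f (w + h) - f w - l * h) <= e * normc h.

Lemma cdiff_cont f w : cdiff f w -> ccont f w.
Proof.
move=> [l H] e e0; have [d d0 {}H] := H 1 ltr01.
have k0 : 0 < 1 + normc l by rewrite ltr_wpDr ?normc_ge0.
exists (Num.min d (e / (1 + normc l))); first by rewrite lt_min d0 divr_gt0.
move=> w'; rewrite lt_min => /andP[/H]; rewrite [w + _]addrC subrK mul1r => h.
rewrite ltr_pdivlMr// => h'; apply: le_lt_trans h'.
rewrite [leRHS]mulrDr mulr1 -[f w' - f w](subrK (l * (w' - w))).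
by apply: normcD_le => //; rewrite normcM mulrC.
Qed.

Definition hseg f a b c := contin (fun x => f (x +i* c)) a b.
Definition vseg f a c d := contin (fun y => f (a +i* y)) c d.

(** The integral of [f(w) dw] counterclockwise around [[a, b] x [c, d]], with opposite sides paired
    under one integral sign. *)
Definition rint f a b c d : C :=
  ci (fun x => f (x +i* c) - f (x +i* d)) a b +
  'i * ci (fun y => f (b +i* y) - f (a +i* y)) c d.

Lemma ccont_h f x c : ccont f (x +i* c) -> rcont (fun x => f (x +i* c)) x.
Proof.
move=> fc e /fc[d d0 H]; exists d => // y yx; apply: H.
have -> : (y +i* c) - (x +i* c) = (y - x) +i* 0 by simpc.
by rewrite normc_real.
Qed.

Lemma ccont_v f a y : ccont f (a +i* y) -> rcont (fun y => f (a +i* y)) y.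
Proof.
move=> fc e /fc[d d0 H]; exists d => // y' yy; apply: H.
have -> : (a +i* y') - (a +i* y) = 0 +i* (y' - y) by simpc.
by rewrite normc_imag.
Qed.

Lemma rcontB (g h : R -> C) x : rcont g x -> rcont h x -> rcont (fun x => g x - h x) x.
Proof.
move=> gc hc; have -> : (fun x => g x - h x) = (fun x => g x + -1 * h x).
  by apply/funext => y; rewrite mulN1r.
by apply: rcontD => //; exact: rcontZ.
Qed.

Lemma continB (g h : R -> C) a b : contin g a b -> contin h a b ->
  contin (fun x => g x - h x) a b.
Proof. by move=> gc hc x xab; apply: rcontB; [exact: gc|exact: hc]. Qed.

Lemma rint_splitx f a m b c d : a <= m -> m <= b ->
  hseg f a b c -> hseg f a b d ->
  vseg f a c d -> vseg f m c d -> vseg f b c d ->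
  rint f a b c d = rint f a m c d + rint f m b c d.
Proof.
move=> am mb hc hd va vm vb; rewrite /rint (ci_cat am mb); last exact: continB.
rewrite addrACA -mulrDr -ciD; try exact: continB.
congr (_ + _ + 'i * _).
by apply: eq_ci => y _; rewrite [RHS]addrC addrA subrK.
Qed.

Lemma rint_splity f a b c m d : c <= m -> m <= d ->
  hseg f a b c -> hseg f a b m -> hseg f a b d ->
  vseg f a c d -> vseg f b c d ->
  rint f a b c d = rint f a b c m + rint f a b m d.
Proof.
move=> am mb hc hm hd va vb; rewrite /rint (ci_cat am mb); last exact: continB.
rewrite addrACA -mulrDr -ciD; try exact: continB.
congr (_ + _).
by apply: eq_ci => y _; rewrite addrA subrK.
Qed.

(** The constant 4 is the 2 of [ci_bound] times the 2 for a pair of opposite sides. *)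
Lemma rint_bound f a b c d (M : R) : a <= b -> c <= d ->
  hseg f a b c -> hseg f a b d -> vseg f a c d -> vseg f b c d ->
  (forall w, a <= Re w <= b -> c <= Im w <= d ->
     [\/ Re w = a, Re w = b, Im w = c | Im w = d] -> normc (f w) <= M) ->
  normc (rint f a b c d) <= 4 * M * ((b - a) + (d - c)).
Proof.
move=> ab cd hc hd va vb fM.
have -> : 4 * M * ((b - a) + (d - c)) = 2 * (M + M) * (b - a) + 2 * (M + M) * (d - c) by ring.
apply: normcD_le.
  apply: ci_bound => //; first exact: continB.
  move=> x xab; apply: normcB_le; apply: fM => //=.
  - by rewrite lexx cd.
  - by apply: Or43.
  - by rewrite lexx cd.
  - by apply: Or44.
rewrite normcM normc_i mul1r; apply: ci_bound => //; first exact: continB.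
move=> x xab; apply: normcB_le; apply: fM => //=.
- by rewrite lexx ab.
- by apply: Or42.
- by rewrite lexx ab.
- by apply: Or41.
Qed.

Lemma rintD f g a b c d :
  hseg f a b c -> hseg f a b d -> vseg f a c d -> vseg f b c d ->
  hseg g a b c -> hseg g a b d -> vseg g a c d -> vseg g b c d ->
  rint (fun w => f w + g w) a b c d = rint f a b c d + rint g a b c d.
Proof.
move=> *; rewrite /rint addrACA -mulrDr -!ciD; try exact: continB.
by congr (_ + 'i * _); apply: eq_ci => x _; ring.
Qed.

Lemma rintZ f a b c d (k : C) :
  hseg f a b c -> hseg f a b d -> vseg f a c d -> vseg f b c d ->
  rint (fun w => k * f w) a b c d = k * rint f a b c d.
Proof.
move=> hc hd va vb; rewrite /rint mulrDr mulrCA.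
rewrite -(ciZ k (continB hc hd)) -(ciZ k (continB vb va)).
by congr (_ + 'i * _); apply: eq_ci => x _; ring.
Qed.

Lemma eq_rint f g a b c d : a <= b -> c <= d ->
  (forall w, a <= Re w <= b -> c <= Im w <= d ->
     [\/ Re w = a, Re w = b, Im w = c | Im w = d] -> f w = g w) ->
  rint f a b c d = rint g a b c d.
Proof.
move=> ab cd fg; rewrite /rint; congr (_ + 'i * _); apply: eq_ci => x xab.
  by congr (_ - _); apply: fg => //=; rewrite ?lexx ?cd//; [apply: Or43|apply: Or44].
by congr (_ - _); apply: fg => //=; rewrite ?lexx ?ab//; [apply: Or42|apply: Or41].
Qed.

Lemma rint_affine a b c d (k l z : C) : a <= b -> c <= d ->
  rint (fun w => k + l * (w - z)) a b c d = 0.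
Proof.
move=> ab cd; rewrite /rint.
rewrite (@eq_ci _ _ (fun=> l * (0 +i* (c - d)))); last first.
  move=> x _; have -> : 0 +i* (c - d) = (x +i* c) - (x +i* d) by simpc.
  by ring.
rewrite (@eq_ci _ _ (fun=> l * ((b - a) +i* 0)) c d); last first.
  move=> x _; have -> : (b - a) +i* 0 = (b +i* x) - (a +i* x) by simpc.
  by ring.
rewrite !ci_cst//; case: l => u v; apply/eqP; rewrite eq_complex /=.
by apply/andP; split; apply/eqP; ring.
Qed.

End Rectangles.
Arguments rint : simpl never.

(** * Goursat's theorem *)

Section Goursat.
Variable R : realType.
Local Notation C := R[i].
Implicit Types (f g : C -> C) (a b c d : R) (z w : C).

Lemma ccont_hseg f a b c : (forall x, a <= x <= b -> ccont f (x +i* c)) -> hseg f a b c.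
Proof. by move=> H x /H; exact: ccont_h. Qed.

Lemma ccont_vseg f a c d : (forall y, c <= y <= d -> ccont f (a +i* y)) -> vseg f a c d.
Proof. by move=> H x /H; exact: ccont_v. Qed.

Lemma ccontD f g w : ccont f w -> ccont g w -> ccont (fun w => f w + g w) w.
Proof.
move=> fc gc e e0; have e2 : 0 < e / 2 by lra.
have [d d0 H] := fc _ e2; have [d' d'0 H'] := gc _ e2.
exists (Num.min d d'); first by rewrite lt_min d0.
move=> y; rewrite lt_min => /andP[/H h /H' h'].
rewrite opprD addrACA (le_lt_trans (le_normcD _ _))//.
by rewrite (splitr e) ltrD.
Qed.

Lemma ccont_affine (k l z w : C) : ccont (fun w => k + l * (w - z)) w.
Proof.
apply: cdiff_cont; exists l => e e0; exists 1 => // h _.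
have -> : k + l * (w + h - z) - (k + l * (w - z)) - l * h = 0 by ring.
by rewrite normc0 mulr_ge0 ?normc_ge0// ltW.
Qed.

(** An affine function has integral zero, so only the deviation of [f] from it counts. *)
Let local_bound f a b c d (k l z : C) (m : R) : a <= b -> c <= d ->
  (forall w, a <= Re w <= b -> c <= Im w <= d -> ccont f w) ->
  (forall w, a <= Re w <= b -> c <= Im w <= d ->
    normc (f w - k - l * (w - z)) <= m) ->
  normc (rint f a b c d) <= 4 * m * ((b - a) + (d - c)).
Proof.
move=> ab cd fc fm.
pose r w := f w + ((- k) + (- l) * (w - z)).
have rc w : a <= Re w <= b -> c <= Im w <= d -> ccont r w.
  by move=> h1 h2; apply: ccontD; [exact: fc|exact: ccont_affine].
have -> : rint f a b c d = rint r a b c d.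
  rewrite (@rintD _ f (fun w => (- k) + (- l) * (w - z))) ?rint_affine// ?addr0//;
    try (by apply: ccont_hseg => x xab; apply: ccont_affine);
    try (by apply: ccont_vseg => x xab; apply: ccont_affine);
    try (by apply: ccont_hseg => x xab; apply: fc => //=; rewrite lexx ?ab ?cd);
    by apply: ccont_vseg => x xab; apply: fc => //=; rewrite lexx ?ab ?cd.
apply: rint_bound => //;
    try (by apply: ccont_hseg => x xab; apply: rc => //=; rewrite lexx ?ab ?cd);
    try (by apply: ccont_vseg => x xab; apply: rc => //=; rewrite lexx ?ab ?cd).
move=> w h1 h2 _; have -> : r w = f w - k - l * (w - z) by rewrite /r; ring.
exact: fm.
Qed.

(** A bound of the integral by [e] times the area is additive under cutting. It holds for small
    rectangles around any point, where [f] is affine up to an error small compared with the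
    diameter. By bisection it holds for the whole rectangle, for every [e]. *)
Lemma goursat f a b c d : a <= b -> c <= d ->
  (forall w, a <= Re w <= b -> c <= Im w <= d -> cdiff f w) ->
  rint f a b c d = 0.
Proof.
rewrite le_eqVlt => /orP[/eqP<-|ab] cd fd.
  have hs y : c <= y <= d -> hseg f a a y.
    move=> h; apply: ccont_hseg => x xab; apply: cdiff_cont; apply: fd => //.
  have vs : vseg f a c d.
    by apply: ccont_vseg => y yab; apply: cdiff_cont; apply: fd => //=; rewrite lexx.
  have hc := hs c; have hd := hs d; rewrite !lexx cd in hc hd.
  (* A degenerate rectangle is the union of two copies of itself, so its integral equals its own
     double. *)
  have := @rint_splitx _ f a a a c d (lexx _) (lexx _) (hc isT) (hd isT) vs vs vs.
  by rewrite -[X in X = _]addr0 => /addrI.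
move: cd; rewrite le_eqVlt => /orP[/eqP cd|cd].
  rewrite -cd in fd *.
  have vs y : a <= y <= b -> vseg f y c c.
    move=> h; apply: ccont_vseg => x xab; apply: cdiff_cont; apply: fd => //.
  have hs : hseg f a b c.
    by apply: ccont_hseg => y yab; apply: cdiff_cont; apply: fd => //=; rewrite lexx.
  have hc := vs a; have hd := vs b; rewrite !lexx (ltW ab) in hc hd.
  have := @rint_splity _ f a b c c c (lexx _) (lexx _) hs hs hs (hc isT) (hd isT).
  by rewrite -[X in X = _]addr0 => /addrI.
apply/eqP; rewrite -normc_eq0 eq_le normc_ge0 andbT.
have A0 : 0 < (b - a) * (d - c) by rewrite mulr_gt0 ?subr_gt0.
apply/ler_addgt0Pl => e0 e0p; rewrite addr0.
pose e := e0 / ((b - a) * (d - c)).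
have ep : 0 < e by rewrite divr_gt0.
have -> : e0 = e * ((b - a) * (d - c)) by rewrite /e divfK// gt_eqF.
pose lo0 (t : bool) := if t then a else c; pose hi0 (t : bool) := if t then b else d.
(* The premise keeps the subrectangles inside the region where [f] is known to be differentiable. *)
pose P (lo hi : bool -> R) := (forall t, lo0 t <= lo t /\ hi t <= hi0 t) ->
  normc (rint f (lo true) (hi true) (lo false) (hi false)) <=
  e * ((hi true - lo true) * (hi false - lo false)).
suff : P lo0 hi0 by apply => t; rewrite !lexx.
have fc lo hi w : (forall t, lo0 t <= lo t /\ hi t <= hi0 t) ->
   lo true <= Re w <= hi true -> lo false <= Im w <= hi false -> cdiff f w.
  move=> lh /andP[h1 h2] /andP[h3 h4]; have [l1 l2] := lh true; have [l3 l4] := lh false.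
  apply: fd; first by rewrite (le_trans l1 h1) (le_trans h2 l2).
  by rewrite (le_trans l3 h3) (le_trans h4 l4).
apply: box_induction => [lo hi t lh|t|x xlh].
- have m1 : lo t <= mid lo hi t by rewrite /mid; have := lh t; lra.
  have m2 : mid lo hi t <= hi t by rewrite /mid; have := lh t; lra.
  move=> P1 P2 sub.
  have h1 : forall t', lo0 t' <= lo t' /\ upd hi t (mid lo hi t) t' <= hi0 t'.
    move=> t'; have [s1 s2] := sub t'; split => //; rewrite /upd; case: eqP => // tt.
    by rewrite tt; apply: le_trans m2 _; have [] := sub t.
  have h2 : forall t', lo0 t' <= upd lo t (mid lo hi t) t' /\ hi t' <= hi0 t'.
    move=> t'; have [s1 s2] := sub t'; split => //; rewrite /upd; case: eqP => // tt.
    by rewrite tt; apply: le_trans m1; have [] := sub t.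
  have := normcD_le (P1 h1) (P2 h2).
  have hs y : lo false <= y <= hi false -> hseg f (lo true) (hi true) y.
    by move=> yy; apply: ccont_hseg => u uu; apply: cdiff_cont; apply: (fc lo hi).
  have vs y : lo true <= y <= hi true -> vseg f y (lo false) (hi false).
    by move=> yy; apply: ccont_vseg => u uu; apply: cdiff_cont; apply: (fc lo hi).
  case: t m1 m2 {P1 P2 h1 h2} => m1 m2; rewrite /upd /=.
    rewrite -rint_splitx//; try (by apply: hs; rewrite lexx lh);
      try (by apply: vs; rewrite ?lexx ?lh ?m1 ?m2).
    by move=> h; apply: le_trans h _; rewrite le_eqVlt; apply/orP; left; apply/eqP; ring.
  rewrite -rint_splity//; try (by apply: vs; rewrite lexx lh);
    try (by apply: hs; rewrite ?lexx ?lh ?m1 ?m2).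
  by move=> h; apply: le_trans h _; rewrite le_eqVlt; apply/orP; left; apply/eqP; ring.
- by case: t; apply: ltW.
pose z := x true +i* x false.
have zd : cdiff f z by apply: fd; [exact: (xlh true)|exact: (xlh false)].
pose p := (b - a) + (d - c).
have p0 : 0 < p by rewrite addr_gt0// subr_gt0.
have [l H] := zd.
(* For a rectangle scaled by [s], [local_bound] yields [4 * (e' * (s * p)) * (s * p)]; with this
   [e'] it is [e * s^2] times the full area. *)
have e'0 : 0 < e * ((b - a) * (d - c)) / (4 * (p * p)).
  apply: divr_gt0; first exact: mulr_gt0.
  by apply: mulr_gt0 => //; exact: mulr_gt0.
have [del del0 {}H] := H _ e'0.
exists (del / p); first exact: divr_gt0.
move=> s lo hi /andP[s0 sdel] xin sz sub.
have [xt1 xt2] := andP (xin true); have [xf1 xf2] := andP (xin false).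
have szt := sz true; have szf := sz false; rewrite /= in szt szf.
have sp0 : 0 < s * p by rewrite mulr_gt0.
have wz w : lo true <= Re w <= hi true -> lo false <= Im w <= hi false ->
    normc (w - z) <= s * p.
  move=> /andP[w1 w2] /andP[w3 w4]; apply: le_trans (normc_le_parts _) _.
  have -> : s * p = s * (b - a) + s * (d - c) by rewrite /p mulrDr.
  rewrite -szt -szf; case: w w1 w2 w3 w4 => u v /= w1 w2 w3 w4.
  by apply: lerD; rewrite ler_norml; apply/andP; split; lra.
have := @local_bound f (lo true) (hi true) (lo false) (hi false) (f z) l z
  (e * ((b - a) * (d - c)) / (4 * (p * p)) * (s * p)).
have lt : lo true <= hi true by lra.
have lf : lo false <= hi false by lra.
move=> /(_ lt lf) LB _; apply: le_trans (LB _ _) _.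
- by move=> w h1 h2; apply: cdiff_cont; apply: (fc lo hi).
- move=> w h1 h2.
  have wd : normc (w - z) < del.
    by apply: le_lt_trans (wz _ h1 h2) _; rewrite -ltr_pdivlMr.
  have := H _ wd; rewrite [z + _]addrC subrK => h; apply: le_trans h _.
  by rewrite ler_pM2l//; exact: wz.
rewrite szt szf le_eqVlt; apply/orP; left; apply/eqP.
rewrite -[s * (b - a) + _]mulrDr -/p; field.
by rewrite gt_eqF.
Qed.

End Goursat.

(** * Algebra of complex differentiable functions *)

Section Cdiff.
Variable R : realType.
Local Notation C := R[i].
Implicit Types (f g : C -> C) (a b c d : R) (z w : C).

Lemma cdiff_cst (k : C) w : cdiff (fun=> k) w.
Proof.
exists 0 => e e0; exists 1 => // h _.
by rewrite subrr mul0r subr0 normc0 mulr_ge0 ?normc_ge0// ltW.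
Qed.

Lemma cdiffM f g w : cdiff f w -> cdiff g w -> cdiff (fun w => f w * g w) w.
Proof.
move=> fd gd; have gc := cdiff_cont gd; case: fd => l Hl; case: gd => m Hm.
exists (l * g w + f w * m) => e e0.
pose K := normc (g w) + 1 + normc (f w) + normc l + 1.
have K0 : 0 < K by rewrite /K; have := normc_ge0 (g w); have := normc_ge0 (f w);
  have := normc_ge0 l; lra.
pose e' := e / K; have e'0 : 0 < e' by rewrite divr_gt0.
have [d1 d10 H1] := Hl _ e'0; have [d2 d20 H2] := Hm _ e'0.
have m0 : 0 < Num.min 1 e' by rewrite lt_min ltr01.
have [d3 d30 H3] := gc _ m0.
exists (Num.min d1 (Num.min d2 d3)); first by rewrite !lt_min d10 d20.
move=> h; rewrite !lt_min => /and3P[/H1 h1 /H2 h2 hd3].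
have := H3 (w + h); rewrite [w + h]addrC addrK => /(_ hd3).
rewrite lt_min [h + w]addrC => /andP[g1 ge].
have gwh : normc (g (w + h)) <= normc (g w) + 1.
  rewrite -[g (w + h)](subrK (g w)) addrC; apply: normcD_le => //; exact: ltW.
have -> : f (w + h) * g (w + h) - f w * g w - (l * g w + f w * m) * h =
  (f (w + h) - f w - l * h) * g (w + h) + f w * (g (w + h) - g w - m * h) +
  l * h * (g (w + h) - g w) by ring.
have -> : e * normc h = e' * normc h * (normc (g w) + 1) + normc (f w) * (e' * normc h)
   + normc l * normc h * e' + e' * normc h.
  have -> : e = e' * K by rewrite /e' divfK ?gt_eqF.
  by rewrite /K; ring.
apply: ler_wpDr; first by rewrite mulr_ge0 ?normc_ge0// ltW.
apply: normcD_le; first apply: normcD_le.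
- exact: normcM_le.
- exact: normcM_le.
- by apply: normcM_le; [rewrite normcM|exact: ltW].
Qed.

Lemma cdiffD f g w : cdiff f w -> cdiff g w -> cdiff (fun w => f w + g w) w.
Proof.
move=> [l Hl] [m Hm]; exists (l + m) => e e0; have e2 : 0 < e / 2 by lra.
have [d1 d10 H1] := Hl _ e2; have [d2 d20 H2] := Hm _ e2.
exists (Num.min d1 d2); first by rewrite lt_min d10.
move=> h; rewrite lt_min => /andP[/H1 h1 /H2 h2].
have -> : f (w + h) + g (w + h) - (f w + g w) - (l + m) * h =
  (f (w + h) - f w - l * h) + (g (w + h) - g w - m * h) by ring.
by have := normcD_le h1 h2; rewrite -mulrDl -splitr.
Qed.

Lemma cdiff_affine (k l z w : C) : cdiff (fun w => k + l * (w - z)) w.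
Proof.
exists l => e e0; exists 1 => // h _.
have -> : k + l * (w + h - z) - (k + l * (w - z)) - l * h = 0 by ring.
by rewrite normc0 mulr_ge0 ?normc_ge0// ltW.
Qed.

Lemma cdiff_inv (z w : C) : w != z -> cdiff (fun w => (w - z)^-1) w.
Proof.
move=> wz; pose u := w - z; have u0 : u != 0 by rewrite subr_eq0.
have nu : 0 < normc u by rewrite normc_gt0.
exists (- (u ^- 2)) => e e0.
pose d := Num.min (normc u / 2) (e * (normc u ^+ 3 / 2)).
have d0 : 0 < d.
  by rewrite /d lt_min; apply/andP; split; rewrite ?mulr_gt0 ?exprn_gt0 ?invr_gt0.
exists d => // h; rewrite lt_min => /andP[h1 h2].
have nuh : normc u / 2 <= normc (u + h).
  have := le_normcD (u + h) (- h); rewrite addrK normcN; lra.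
have nuh0 : 0 < normc (u + h) by lra.
have uh0 : u + h != 0 by rewrite -normc_gt0.
have -> : (w + h - z)^-1 - (w - z)^-1 - - u ^- 2 * h = h * (h / (u ^+ 2 * (u + h))).
  have -> : w + h - z = u + h by rewrite /u; ring.
  rewrite -/u; field.
  by rewrite u0 uh0.
rewrite normcM mulrC ler_wpM2r ?normc_ge0//.
rewrite normcM normcV normcM ler_pdivrMr; last first.
  by rewrite mulr_gt0 ?normc_gt0 ?expf_neq0.
apply: le_trans (ltW h2) _; rewrite -mulrA ler_pM2l//.
have -> : normc (u ^+ 2) = normc u ^+ 2 by rewrite !expr2 normcM.
have -> : normc u * (normc u * normc u / 2) = normc u ^+ 2 * (normc u / 2) by ring.
by apply: ler_wpM2l nuh; exact: sqr_ge0.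
Qed.

Lemma cdiff_div f z w : cdiff f w -> w != z -> cdiff (fun w => f w / (w - z)) w.
Proof. by move=> fd wz; apply: cdiffM => //; exact: cdiff_inv. Qed.

End Cdiff.

(** * Deformation of contours and the constant [2 pi i] *)

Section Cauchy.
Variable R : realType.
Local Notation C := R[i].
Implicit Types (f g : C -> C) (a b c d : R) (z w : C).

(** The frame between the two rectangles is cut into four rectangles, on each of which [goursat]
    applies. *)
Lemma rint_nest f a b c d a' b' c' d' : a <= a' -> a' <= b' -> b' <= b ->
  c <= c' -> c' <= d' -> d' <= d ->
  (forall w, a <= Re w <= b -> c <= Im w <= d ->
     ~ (a' < Re w < b' /\ c' < Im w < d') -> cdiff f w) ->
  rint f a b c d = rint f a' b' c' d'.
Proof.
move=> aa ab bb cc cd dd fd.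
have fc w : a <= Re w <= b -> c <= Im w <= d ->
     ~ (a' < Re w < b' /\ c' < Im w < d') -> ccont f w.
  by move=> h1 h2 h3; apply: cdiff_cont; exact: fd.
have hs y p q : a <= p -> q <= b -> c <= y -> y <= d ->
    (y <= c') || (d' <= y) -> hseg f p q y.
  move=> pp qq cy yd ny; apply: ccont_hseg => x xx; apply: fc => /=.
  - by have := xx; lra.
  - by rewrite cy.
  - by case=> _; move: ny => /orP[] ?; lra.
have vs y p q : c <= p -> q <= d -> a <= y -> y <= b ->
    (y <= a') || (b' <= y) -> vseg f y p q.
  move=> pp qq cy yd ny; apply: ccont_vseg => x xx; apply: fc => /=.
  - by rewrite cy.
  - by have := xx; lra.
  - by case=> + _; move: ny => /orP[] ?; lra.
have [ab' cd' ab'' cd''] : [/\ a' <= b, c' <= d, a <= b' & c <= d'] by split; lra.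
have [ab''' cd'''] : a <= b /\ c <= d by split; lra.
have g p q r t : a <= p -> q <= b -> c <= r -> t <= d -> p <= q -> r <= t ->
   [|| q <= a', b' <= p, t <= c' | d' <= r] -> rint f p q r t = 0.
  move=> ? ? ? ? ? ? h; by apply: goursat => // w w1 w2; apply: fd; lra.
rewrite (@rint_splity _ f a b c c' d) //; last first.
- by apply: vs; rewrite ?lexx ?bb ?orbT.
- by apply: vs; rewrite ?lexx ?aa ?orbT.
- by apply: hs; rewrite ?lexx ?dd ?orbT.
- by apply: hs; rewrite ?lexx ?dd ?orbT.
- by apply: hs; rewrite ?lexx ?cc ?orbT.
rewrite g ?lexx ?orbT// add0r (@rint_splity _ f a b c' d' d) //; last first.
- by apply: vs; rewrite ?lexx ?bb ?orbT.
- by apply: vs; rewrite ?lexx ?aa ?orbT.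
- by apply: hs; rewrite ?lexx ?dd ?orbT.
- by apply: hs; rewrite ?lexx ?dd ?orbT.
- by apply: hs; rewrite ?lexx ?cc ?orbT.
rewrite (g a b d' d) ?lexx ?orbT// addr0 (@rint_splitx _ f a a' b c' d') //; last first.
- by apply: vs; rewrite ?lexx ?bb ?orbT.
- by apply: vs; rewrite ?lexx ?aa ?orbT.
- by apply: vs; rewrite ?lexx ?aa ?orbT.
- by apply: hs; rewrite ?lexx ?dd ?orbT.
- by apply: hs; rewrite ?lexx ?cc ?orbT.
rewrite (g a a' c' d') ?lexx ?orbT// add0r (@rint_splitx _ f a' b' b c' d') //; last first.
- by apply: vs; rewrite ?lexx ?bb ?orbT.
- by apply: vs; rewrite ?lexx ?bb ?orbT.
- by apply: vs; rewrite ?lexx ?aa ?orbT.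
- by apply: hs; rewrite ?lexx ?dd ?orbT.
- by apply: hs; rewrite ?lexx ?cc ?orbT.
by rewrite (g b' b c' d') ?lexx ?orbT// addr0.
Qed.

(* The value 2 pi i, which never needs to be known exactly. *)
Definition kappa : C := rint (fun w => (w - 0)^-1) (-1) 1 (-1) 1.

Definition bdry a b c d w := [/\ a <= Re w <= b, c <= Im w <= d &
  [\/ Re w = a, Re w = b, Im w = c | Im w = d]].

Lemma cdiff_segs f a b c d : a <= b -> c <= d ->
  (forall w, bdry a b c d w -> cdiff f w) ->
  [/\ hseg f a b c, hseg f a b d, vseg f a c d & vseg f b c d].
Proof.
move=> ab cd H; split.
- by apply: ccont_hseg => x xab; apply/cdiff_cont/H; split; rewrite /= ?lexx//; apply: Or43.
- by apply: ccont_hseg => x xab; apply/cdiff_cont/H; split; rewrite /= ?lexx ?cd//; apply: Or44.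
- by apply: ccont_vseg => x xab; apply/cdiff_cont/H; split; rewrite /= ?lexx//; apply: Or41.
- by apply: ccont_vseg => x xab; apply/cdiff_cont/H; split; rewrite /= ?lexx ?ab//; apply: Or42.
Qed.

Lemma cdiff_rint_bound f a b c d (M : R) : a <= b -> c <= d ->
  (forall w, bdry a b c d w -> cdiff f w /\ normc (f w) <= M) ->
  normc (rint f a b c d) <= 4 * M * ((b - a) + (d - c)).
Proof.
move=> ab cd H.
have [] := cdiff_segs ab cd (fun w h => (H w h).1).
by move=> *; apply: rint_bound => // w h1 h2 h3; have [] := H w (And3 h1 h2 h3).
Qed.

Lemma cdiff_rintD f g a b c d : a <= b -> c <= d ->
  (forall w, bdry a b c d w -> cdiff f w /\ cdiff g w) ->
  rint (fun w => f w + g w) a b c d = rint f a b c d + rint g a b c d.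
Proof.
move=> ab cd H.
have [? ? ? ?] := cdiff_segs ab cd (fun w h => (H w h).1).
have [? ? ? ?] := cdiff_segs ab cd (fun w h => (H w h).2).
exact: rintD.
Qed.

Lemma cdiff_rintZ f a b c d (k : C) : a <= b -> c <= d ->
  (forall w, bdry a b c d w -> cdiff f w) ->
  rint (fun w => k * f w) a b c d = k * rint f a b c d.
Proof. by move=> ab cd H; have [? ? ? ?] := cdiff_segs ab cd H; exact: rintZ. Qed.

Lemma square_far z w (s : R) :
  [\/ Re w = Re z - s, Re w = Re z + s, Im w = Im z - s | Im w = Im z + s] ->
  s <= normc (w - z).
Proof.
have := normc_ge_Re_r (w - z); have := normc_ge_Im_r (w - z).
rewrite !raddfB /= => h1 h2 [] e; move: h1 h2; rewrite e !ler_norml; lra.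
Qed.

(** Both contours are moved to a large square of half-side [T]. There
    [1/(w - z) - 1/w = z / ((w - z) w)] is of order [T^-2], so the two integrals differ by a
    quantity of order [1/T]. *)
Lemma kappaE z a b c d : a < Re z < b -> c < Im z < d ->
  rint (fun w => (w - z)^-1) a b c d = kappa.
Proof.
move=> zab zcd.
have key (S S' : R) z1 : 0 < S -> normc z1 < S -> S <= S' ->
   rint (fun w => (w - z1)^-1) (- S') S' (- S') S' =
   rint (fun w => (w - z1)^-1) (- S) S (- S) S.
  move=> S0 zS SS; apply: rint_nest; try lra.
  move=> w _ _ nw; apply: cdiff_inv; apply/eqP => wz; apply: nw.
  have := normc_ge_Re_r w; have := normc_ge_Im_r w; rewrite wz !ler_norml.
  by move=> /andP[? ?] /andP[? ?]; split; lra.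
pose S := 1 + 2 * normc z + `|a| + `|b| + `|c| + `|d|.
have n0 := normc_ge0 z.
have bigS : [/\ 1 <= S, 2 * normc z < S, - S <= a, b <= S & - S <= c /\ d <= S].
  rewrite /S; have := ler_norm a; have := ler_norm (-a); have := ler_norm b.
  have := ler_norm (-c); have := ler_norm d; rewrite !normrN.
  have := normr_ge0 b; have := normr_ge0 d; have := normr_ge0 a; have := normr_ge0 c.
  by split; [| | | |split]; lra.
have [S1 zS Sa Sb [Sc Sd]] := bigS; clearbody S.
have -> : rint (fun w => (w - z)^-1) a b c d = rint (fun w => (w - z)^-1) (- S) S (- S) S.
  symmetry; apply: rint_nest; try lra.
  move=> w _ _ nw; apply: cdiff_inv; apply/eqP => wz; apply: nw.
  by rewrite wz.
have -> : kappa = rint (fun w => (w - 0)^-1) (- S) S (- S) S.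
  rewrite [RHS](@key 1)//; rewrite ?normc0//; lra.
apply/eqP; rewrite -subr_eq0 -normc_eq0 eq_le normc_ge0 andbT.
apply/ler_addgt0Pl => e e0; rewrite addr0.
(* The difference will be at most [32 |z| / T], hence at most [e]. *)
pose T := S + 32 * normc z / e.
have TS : S <= T by rewrite /T lerDl; apply: divr_ge0; [exact: mulr_ge0|exact: ltW].
rewrite -(@key S T z)//; try lra.
rewrite -(@key S T 0)//; rewrite ?normc0; try lra.
have cd (w : C) : [\/ Re w = - T, Re w = T, Im w = - T | Im w = T] ->
    [/\ T <= normc w, T / 2 <= normc (w - z), w != z & w != 0].
  move=> hw; have Tw : T <= normc w.
    have := @square_far 0 w T; rewrite !subr0 sub0r !add0r; exact.
  have wz : T / 2 <= normc (w - z).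
    have := le_normcD (w - z) z; rewrite subrK; lra.
  split=> //; apply/eqP => h; move: wz Tw; rewrite h ?subrr ?normc0; lra.
have lT : - T <= T by lra.
have -> : rint (fun w => (w - z)^-1) (- T) T (- T) T -
  rint (fun w => (w - 0)^-1) (- T) T (- T) T =
  rint (fun w => z * ((w - z)^-1 * (w - 0)^-1)) (- T) T (- T) T.
  apply/eqP; rewrite subr_eq; apply/eqP.
  rewrite -cdiff_rintD//; last first.
    move=> w [_ _ /cd[_ _ wz w0]]; split; last exact: cdiff_inv.
    apply: cdiffM; first exact: cdiff_cst.
    by apply: cdiffM; apply: cdiff_inv.
  apply: eq_rint => // w _ _ /cd[_ _ wz w0].
  rewrite subr0; field.
  by rewrite w0 subr_eq0 wz.
have := @cdiff_rint_bound (fun w => z * ((w - z)^-1 * (w - 0)^-1)) (-T) T (-T) T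
  (normc z * ((T / 2)^-1 * T^-1)).
move=> /(_ lT lT) H; apply: le_trans (H _) _.
  move=> w [_ _ /cd[Tw wz wnz w0]]; split.
    apply: cdiffM; first exact: cdiff_cst.
    by apply: cdiffM; apply: cdiff_inv.
  apply: normcM_le => //; apply: normcM_le; rewrite normcV ?subr0.
    by rewrite lef_pV2 ?posrE//; lra.
  by rewrite lef_pV2 ?posrE//; lra.
have T0 : 0 < T by lra.
have -> : 4 * (normc z * ((T / 2)^-1 * T^-1)) * (T - - T + (T - - T)) = 32 * normc z / T.
  field.
  by rewrite gt_eqF.
rewrite ler_pdivrMr// /T mulrDr [_ * (_ / e)]mulrC divfK ?gt_eqF//.
by rewrite lerDr mulr_ge0 ?ltW//; lra.
Qed.

End Cauchy.

(** * Cauchy's formula for rectangles *)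

Section CauchyFormula.
Variable R : realType.
Local Notation C := R[i].
Local Notation kappa := (kappa R).
Implicit Types (f g : C -> C) (a b c d : R) (z w : C).

(** Pairing opposite sides gives [4 i] times the integral of [1/(x^2 + 1)] over [[-1, 1]]. The
    integrand is within [1/4] of [3/4], so by [ci_bound] the integral is within 1 of [3/2]. *)
Lemma kappa_neq0 : kappa != 0.
Proof.
pose g (x : R) : C := ((x +i* 1) * (x +i* (-1)))^-1.
have gE (x : R) : g x = ((x ^+ 2 + 1)^-1)%:C.
  rewrite fmorphV; congr (_^-1); apply/eqP; rewrite eq_complex /=.
  by apply/andP; split; apply/eqP; ring.
have gc : contin g (-1) 1.
  move=> x _; have : ccont (fun w => (w - (0 +i* (-1)))^-1 * (w - (0 +i* 1))^-1) (x +i* 0).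
    apply: cdiff_cont; apply: cdiffM; apply: cdiff_inv; apply/eqP => -[_ h]; lra.
  move=> /ccont_h; congr (rcont _ x); apply/funext => y.
  rewrite -invfM /g; congr (_^-1); apply/eqP; rewrite eq_complex /=.
  by apply/andP; split; apply/eqP; ring.
have -> : kappa = (4 * 'i) * ci g (-1) 1.
  rewrite /kappa /rint.
  rewrite (@eq_ci _ _ (fun x => (2 * 'i) * g x)); last first.
    move=> x _; rewrite !subr0 /g invfM.
    have h1 : x +i* 1 != 0 by apply/eqP => -[_ h]; lra.
    have h2 : x +i* -1 != 0 by apply/eqP => -[_ h]; lra.
    have -> : 2 * 'i = (x +i* 1) - (x +i* -1).
      by apply/eqP; rewrite eq_complex /=; apply/andP; split; apply/eqP; ring.
    by field; rewrite h1 h2.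
  rewrite (@eq_ci _ (fun y => _ - _) (fun x => 2 * g x)); last first.
    move=> y _; rewrite !subr0 /g.
    have h1 : 1 +i* y != 0 by apply/eqP => -[h _]; lra.
    have h2 : -1 +i* y != 0 by apply/eqP => -[h _]; lra.
    have -> : (y +i* 1) * (y +i* -1) = - ((1 +i* y) * (-1 +i* y)).
      by apply/eqP; rewrite eq_complex /=; apply/andP; split; apply/eqP; ring.
    have -> : 2 = (1 +i* y) - (-1 +i* y).
      by apply/eqP; rewrite eq_complex /=; apply/andP; split; apply/eqP; ring.
    by field; rewrite h1 h2.
  rewrite !ciZ//; ring.
have h : normc (ci g (-1) 1 - (3 / 2)%:C) <= 1.
  have -> : ci g (-1) 1 - (3 / 2)%:C = ci (fun x => g x - (3 / 4)%:C) (-1) 1.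
    rewrite ciB//; last by move=> x _; exact: rcont_cst.
    rewrite ci_cst; last lra.
    by rewrite -rmorphM /=; congr (_ - _%:C); field.
  apply: (@le_trans _ _ (2 * (1 / 4) * (1 - -1))); last lra.
  apply: ci_bound; first lra.
    by apply: continB => // x _; exact: rcont_cst.
  move=> x xx; rewrite gE -rmorphB normc_real ler_norml; apply/andP; split.
    rewrite lerBrDr; apply: (@le_trans _ _ 2^-1); first lra.
    rewrite lef_pV2 ?posrE; nra.
  rewrite lerBlDr; apply: (@le_trans _ _ 1); last lra.
  rewrite invf_le1; nra.
apply/eqP => k0; move: h; have : ci g (-1) 1 = 0.
  move/eqP: k0; rewrite !mulf_eq0 => /orP[/orP[]|/eqP//].
    by rewrite pnatr_eq0.
  by rewrite eq_complex /= oner_eq0 andbF.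
move=> ->; rewrite sub0r normcN normc_real ger0_norm; lra.
Qed.

(** On a small square around [z], split [f(w)] as [f(z) + (f(w) - f(z))]: the first term gives
    [kappa * f z] by [kappaE], the second tends to 0 with the square by continuity. *)
Lemma cauchy f a b c d z : a < Re z < b -> c < Im z < d ->
  (forall w, a <= Re w <= b -> c <= Im w <= d -> cdiff f w) ->
  rint (fun w => f w / (w - z)) a b c d = kappa * f z.
Proof.
move=> zab zcd fd.
apply/eqP; rewrite -subr_eq0 -normc_eq0 eq_le normc_ge0 andbT.
apply/ler_addgt0Pl => e e0; rewrite addr0.
(* On a square of half-side [s] the error is at most [4 * (e / 32 / s) * (4 * s) = e / 2]. *)
have e16 : 0 < e / 32 by lra.
have zd : cdiff f z by apply: fd; lra.
have [del del0 H] := cdiff_cont zd e16.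
have [s [s0 sd s1 s2 [s3 s4]]] : exists s, [/\ 0 < s, s <= del / 4, a <= Re z - s, Re z + s <= b &
   c <= Im z - s /\ Im z + s <= d].
  have d4 : 0 < del / 4 by lra.
  have za : 0 < Re z - a by lra. have zb : 0 < b - Re z by lra.
  have zc : 0 < Im z - c by lra. have ze : 0 < d - Im z by lra.
  have [p [p0 pa pb]] := pos_min za zb; have [q [q0 qa qb]] := pos_min zc ze.
  have [r [r0 rp rq]] := pos_min p0 q0; have [s [s0 sr sd]] := pos_min r0 d4.
  by exists s; split; [| | | |split]; lra.
have zns w : bdry (Re z - s) (Re z + s) (Im z - s) (Im z + s) w ->
   [/\ cdiff f w, w != z, s <= normc (w - z) & normc (f w - f z) <= e / 32].
  move=> [w1 w2 w3]; have wz := square_far w3; split=> //.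
  - by apply: fd; lra.
  - by apply/eqP => h; move: wz; rewrite h subrr normc0; lra.
  - apply/ltW/H; apply: le_lt_trans (normc_le_parts _) _.
    rewrite !raddfB /=; apply: (@le_lt_trans _ _ (s + s)); last lra.
    by apply: lerD; rewrite ler_norml; lra.
have l1 : Re z - s <= Re z + s by lra.
have l2 : Im z - s <= Im z + s by lra.
rewrite (@rint_nest _ (fun w => f w / (w - z)) a b c d (Re z - s) (Re z + s) (Im z - s) (Im z + s)) //; last first.
  move=> w w1 w2 nw; apply: cdiff_div; first exact: fd.
  by apply/eqP => h; apply: nw; rewrite h; split; lra.
have -> : rint (fun w => f w / (w - z)) (Re z - s) (Re z + s) (Im z - s) (Im z + s) =
   rint (fun w => f z * (w - z)^-1 + (f w - f z) / (w - z))
     (Re z - s) (Re z + s) (Im z - s) (Im z + s).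
  apply: eq_rint => // w _ _ _; ring.
have dq w : cdiff f w -> w != z -> cdiff (fun w => (f w - f z) / (w - z)) w.
  move=> fw wz; apply: cdiff_div => //; apply: cdiffD => //; exact: cdiff_cst.
rewrite cdiff_rintD//; last first.
  move=> w /zns[fw wz _ _]; split; last exact: dq.
  apply: cdiffM; [exact: cdiff_cst|exact: cdiff_inv].
rewrite cdiff_rintZ//; last by move=> w /zns[fw wz _ _]; exact: cdiff_inv.
rewrite kappaE; [|lra|lra].
rewrite [kappa * _]mulrC addrAC subrr add0r.
apply: le_trans (cdiff_rint_bound (M := e / 32 / s) l1 l2 _) _.
  move=> w /zns[fw wz sw fe]; split; first exact: dq.
  apply: normcM_le => //; rewrite normcV lef_pV2 ?posrE//.
  exact: lt_le_trans sw.
have -> : 4 * (e / 32 / s) * (Re z + s - (Re z - s) + (Im z + s - (Im z - s))) = e / 2.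
  by field; rewrite gt_eqF.
lra.
Qed.

End CauchyFormula.

(** * Holomorphic functions of several variables *)

Lemma differentiable_intro (K : numFieldType) (V W : normedModType K) (f : V -> W)
    (L : {linear V -> W}) (x : V) : continuous L ->
  (forall e : K, 0 < e -> \forall h \near (0 : V), `|f (x + h) - f x - L h| <= e * `|h|) ->
  differentiable f x.
Proof.
move=> Lc H; have E : f \o shift x = cst (f x) + L +o_ 0 id.
  apply/eqaddoP => e e0; have := H e e0; apply: filterS => h.
  by rewrite !fctE /= [h + x]addrC opprD addrA.
have dE : 'd f x = L :> (V -> W) by apply: diff_unique E.
by apply/diff_locallyP; rewrite dE.
Qed.

Section Hd.
Variables (R : realType) (n : nat).
Local Notation C := R[i].
Local Notation V := 'rV[C]_n.
Implicit Types (f g : V -> C) (z h : V).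

(** A real-valued [l^1] norm, used in place of the maximum norm of the library, whose values lie in
    [C]. *)
Definition vn h : R := \sum_k normc (h 0 k).

Definition lf (c : 'I_n -> C) h : C := \sum_k h 0 k * c k.

(** Differentiability with an explicit gradient. It agrees with the notion of the library by
    [differentiable_hd] and [hd_differentiable], and inherits its closure properties from there. *)
Definition hd f z := exists c : 'I_n -> C, forall e, 0 < e ->
  exists2 d, 0 < d & forall h, vn h < d ->
    normc (f (z + h) - f z - lf c h) <= e * vn h.

Lemma normCE (x : C) : `|x| = (normc x)%:C.
Proof. by []. Qed.

Lemma vn_ge0 h : 0 <= vn h.
Proof. by apply: sumr_ge0 => k _; exact: normc_ge0. Qed.

Lemma normc_le_vn h k : normc (h 0 k) <= vn h.
Proof.
rewrite /vn (bigD1 k) //= lerDl; apply: sumr_ge0 => i _; exact: normc_ge0.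
Qed.

Lemma pos_real (e : C) : 0 < e -> exists2 d : R, 0 < d & e = d%:C.
Proof.
by case: e => a b; rewrite ltcE /= => /andP[/eqP -> a0]; exists a.
Qed.

Lemma ltc_norm (x : C) (d : R) : (`|x| < d%:C) = (normc x < d).
Proof. by rewrite normCE ltcR. Qed.

Lemma nbhs_vn z (P : set V) :
  nbhs z P <-> exists2 d, 0 < d & forall z', vn (z' - z) < d -> P z'.
Proof.
split=> [/nbhs_ballP[e /= /pos_real[d d0 ->] H]|[d d0 H]].
  exists d => // z' zd; apply: H; split; first by rewrite ltcR.
  move=> i j; rewrite ord1 /ball /= distrC ltc_norm.
  by apply: le_lt_trans zd; have := normc_le_vn (z' - z) j; rewrite !mxE.
have dn : 0 < d / n.+1%:R by rewrite divr_gt0.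
apply/nbhs_ballP; exists (d / n.+1%:R)%:C; first by rewrite /= ltcR.
move=> z' [_ zd]; apply: H; rewrite /vn.
apply: (@le_lt_trans _ _ (\sum_(k < n) d / n.+1%:R)).
  apply: ler_sum => k _; have := zd 0 k; rewrite /ball /= distrC ltc_norm !mxE.
  exact: ltW.
rewrite sumr_const card_ord -[_ *+ n]mulr_natr -mulrA gtr_pMr// mulrC.
by rewrite ltr_pdivrMr ?mul1r ?ltr_nat.
Qed.

Lemma norm_le_vn h : `|h| <= (vn h)%:C.
Proof.
have [h0|h0] := eqVneq `|h| 0; first by rewrite h0 lecR vn_ge0.
have [[i j] /= E] := mx_norm_neq0 h0.
by rewrite /Num.norm /= E normCE lecR ord1 normc_le_vn.
Qed.

Lemma vn_le_norm h (a : R) : 0 <= a -> `|h| <= a%:C -> vn h <= n%:R * a.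
Proof.
move=> a0 ha; rewrite /vn mulr_natl -[n in leRHS]card_ord -sumr_const.
apply: ler_sum => k _; rewrite -lecR -normCE; apply: le_trans ha.
rewrite [leRHS]/Num.norm /= mx_normE.
by rewrite -[leLHS]nngE num_le; apply: (le_bigmax _ _ (0, k)).
Qed.

Lemma lf_linear (c : 'I_n -> C) : linear (lf c).
Proof.
move=> a h h'; rewrite /lf scaler_sumr -big_split /=; apply: eq_bigr => k _.
by rewrite !mxE mulrDl /GRing.scale /= mulrA.
Qed.
HB.instance Definition _ (c : 'I_n -> C) := GRing.isLinear.Build C V C *:%R (lf c)
  (lf_linear c).

Lemma lf_continuous (c : 'I_n -> C) : continuous (lf c).
Proof.
move=> z; apply: differentiable_continuous.
rewrite (_ : lf c = \sum_k (fun v : V => v 0 k * c k)); last first.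
  by apply/funext => w; rewrite fct_sumE.
apply: differentiable_sum => k; apply: differentiableM => //.
exact: differentiable_coord.
Qed.

Lemma differentiable_hd f z : differentiable f z -> hd f z.
Proof.
move=> fd; have /diff_locally := fd.
move=> /eqaddoP fo; exists (fun k => 'd f z (delta_mx 0 k)) => e e0.
have := fo e%:C; rewrite ltcR e0 => /(_ isT)/nbhs_vn[d d0 H].
exists d => // h hd; have := H h; rewrite subr0 => /(_ hd).
rewrite /= !fctE /=.
have -> : 'd f z h = lf (fun k => 'd f z (delta_mx 0 k)) h.
  rewrite {1}[h]row_sum_delta linear_sum /lf; apply: eq_bigr => k _.
  by rewrite linearZ.
rewrite [h + z]addrC opprD addrA => H1.
rewrite -lecR -normCE; apply: le_trans H1 _.
rewrite rmorphM; apply: ler_wpM2l (norm_le_vn h).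
by rewrite lecE /= eqxx ltW.
Qed.

Lemma hd_differentiable f z : hd f z -> differentiable f z.
Proof.
move=> [c H]; apply: (@differentiable_intro _ V C f (lf c)).
  exact: lf_continuous.
move=> _ /pos_real[e e0 ->]; have en : 0 < e / n.+1%:R by rewrite divr_gt0.
have [d d0 Hd] := H _ en; apply/nbhs_vn; exists d => // h; rewrite subr0 => /Hd H1.
rewrite normCE; have [a a0 ha] : exists2 a : R, 0 <= a & `|h| = a%:C.
  have := normr_ge0 h; case: (`|h|) => a b; rewrite lecE /= => /andP[/eqP -> a0].
  by exists a.
rewrite ha -rmorphM lecR; apply: le_trans H1 _.
rewrite mulrAC ler_pdivrMr// -mulrA ler_pM2l// mulrC.
apply: (@le_trans _ _ (n%:R * a)).
  by apply: vn_le_norm => //; rewrite le_eqVlt; apply/orP; left; apply/eqP; exact: ha.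
by rewrite ler_wpM2r// ler_nat.
Qed.

Lemma hdM f g z : hd f z -> hd g z -> hd (fun z => f z * g z) z.
Proof.
move=> /hd_differentiable fd /hd_differentiable gd.
by apply: differentiable_hd; exact: differentiableM.
Qed.

Lemma hdD f g z : hd f z -> hd g z -> hd (fun z => f z + g z) z.
Proof.
move=> /hd_differentiable fd /hd_differentiable gd.
by apply: differentiable_hd; exact: differentiableD.
Qed.

Lemma hdV f z : hd f z -> f z != 0 -> hd (fun z => (f z)^-1) z.
Proof.
move=> /hd_differentiable fd f0; apply: differentiable_hd; exact: differentiableV.
Qed.

Lemma hd_cst (k : C) z : hd (fun=> k) z.
Proof. by apply: differentiable_hd; exact: differentiable_cst. Qed.

Lemma hd_coord k z : hd (fun z => z 0 k) z.
Proof. by apply: differentiable_hd; exact: differentiable_coord. Qed.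

End Hd.

(** * Second-order Taylor estimate in one variable *)

Section Taylor1.
Variable R : realType.
Local Notation C := R[i].
Local Notation kappa := (kappa R).
Implicit Types (f g : C -> C) (a b c d S M : R) (z w : C).

Definition cderiv f w l := forall e, 0 < e ->
  exists2 d, 0 < d & forall h, normc h < d ->
    normc (f (w + h) - f w - l * h) <= e * normc h.

Definition sqint (S : R) f : C := rint f (- S) S (- S) S.

Lemma sq_bdry S w : 0 < S -> bdry (- S) S (- S) S w ->
  [/\ S <= normc w, w != 0 & forall t, normc t <= S / 2 -> S / 2 <= normc (w - t) /\ w != t].
Proof.
move=> S0 [_ _ hw]; have Sw : S <= normc w.
  have := @square_far _ 0 w S; rewrite !subr0 sub0r !add0r; exact.
split=> //; first by rewrite -normc_gt0; lra.
move=> t tS; have h : S / 2 <= normc (w - t).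
  have := le_normcD (w - t) t; rewrite subrK; lra.
by split=> //; apply/eqP => wt; move: h; rewrite wt subrr normc0; lra.
Qed.

Lemma sq_bound S f M : 0 < S ->
  (forall w, bdry (- S) S (- S) S w -> cdiff f w /\ normc (f w) <= M) ->
  normc (sqint S f) <= 16 * M * S.
Proof.
move=> S0 H; have SS : - S <= S by lra.
apply: le_trans (cdiff_rint_bound SS SS H) _; lra.
Qed.

Definition K0 : R := 32 / normc kappa.

Lemma nkappa_gt0 : 0 < normc kappa.
Proof. by rewrite normc_gt0 kappa_neq0. Qed.

Lemma K0_gt0 : 0 < K0.
Proof. by rewrite divr_gt0 ?nkappa_gt0. Qed.

(** Cauchy's integral for [f'(0)] over the square of half-side [S]. *)
Definition D1 S f : C := kappa^-1 * sqint S (fun w => f w * ((w - 0)^-1 * (w - 0)^-1)).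

(** From Cauchy's formula at [t] and at 0, by [1/(w - t) - 1/w - t/w^2 = t^2 / (w^2 (w - t))]. On
    the contour [|w| >= S] and [|w - t| >= S/2], which yields [K0]. *)
Lemma taylor2_D1 S M f : 0 < S ->
  (forall w, - S <= Re w <= S -> - S <= Im w <= S -> cdiff f w /\ normc (f w) <= M) ->
  forall t, normc t <= S / 2 ->
  normc (f t - f 0 - D1 S f * t) <= K0 * M * normc t ^+ 2 / S ^+ 2.
Proof.
move=> S0 H t tS.
have SS : - S <= S by lra.
have ht : [/\ - S < Re t < S & - S < Im t < S].
  have := normc_ge_Re_r t; have := normc_ge_Im_r t; rewrite !ler_norml.
  by move=> /andP[? ?] /andP[? ?]; split; apply/andP; split; lra.
have [ht1 ht2] := ht.
have fd w : - S <= Re w <= S -> - S <= Im w <= S -> cdiff f w by move=> h1 h2; case: (H w h1 h2).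
have fb w : bdry (- S) S (- S) S w -> cdiff f w /\ normc (f w) <= M.
  by move=> [h1 h2 _]; exact: H.
have h0 : - S < Re (0 : C) < S by rewrite /=; apply/andP; split; lra.
have h0' : - S < Im (0 : C) < S by [].
have E1 := cauchy ht1 ht2 fd; have E0 := cauchy h0 h0' fd.
have tS' : normc (0 : C) <= S / 2 by rewrite normc0; lra.
pose G w := t ^+ 2 * (f w * ((w - 0)^-1 * (w - 0)^-1 * (w - t)^-1)).
have inv w : bdry (- S) S (- S) S w -> cdiff (fun w => (w - 0)^-1) w /\ cdiff (fun w => (w - t)^-1) w.
  move=> bw; have [_ w0 wt] := sq_bdry S0 bw; split; apply: cdiff_inv => //.
  exact: (wt t tS).2.
have Gb w : bdry (- S) S (- S) S w -> cdiff G w /\ normc (G w) <= normc t ^+ 2 * (M * (S^-1 * S^-1 * (S / 2)^-1)).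
  move=> bw; have [fw fM] := fb w bw; have [i0 it] := inv w bw.
  have [Sw w0 wt] := sq_bdry S0 bw; have [wt1 wt2] := wt t tS; split.
    apply: cdiffM; first exact: cdiff_cst.
    by do 2! [apply: cdiffM => //]; apply: cdiffM.
  have n0 := normc_ge0 w.
  apply: normcM_le; first by rewrite !expr2 normcM.
  apply: normcM_le => //; apply: normcM_le; first apply: normcM_le.
  - by rewrite normcV subr0 lef_pV2 ?posrE//; lra.
  - by rewrite normcV subr0 lef_pV2 ?posrE//; lra.
  - by rewrite normcV lef_pV2 ?posrE//; lra.
have E : kappa * (f t - f 0 - D1 S f * t) = sqint S G.
  have -> : kappa * (f t - f 0 - D1 S f * t) =
     kappa * f t - kappa * f 0 - t * (kappa * D1 S f) by ring.
  rewrite /D1 mulVKf ?kappa_neq0// -E1 -E0 /sqint.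
  have c1 w : bdry (- S) S (- S) S w -> cdiff (fun w => f w * ((w - 0)^-1 * (w - 0)^-1)) w.
    move=> bw; have [fw fM] := fb w bw; have [i0 it] := inv w bw.
    by do 2! [apply: cdiffM => //].
  have c2 w : bdry (- S) S (- S) S w -> cdiff (fun w => f w / (w - t)) w.
    by move=> bw; have [fw fM] := fb w bw; have [i0 it] := inv w bw; exact: cdiffM.
  have c3 w : bdry (- S) S (- S) S w -> cdiff (fun w => f w / (w - 0)) w.
    by move=> bw; have [fw fM] := fb w bw; have [i0 it] := inv w bw; exact: cdiffM.
  apply/eqP; rewrite !subr_eq; apply/eqP.
  rewrite -(cdiff_rintZ t SS SS c1).
  have c4 w : bdry (- S) S (- S) S w -> cdiff (fun w => t * (f w * ((w - 0)^-1 * (w - 0)^-1))) w.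
    by move=> bw; apply: cdiffM; [exact: cdiff_cst|exact: c1].
  rewrite -cdiff_rintD//; last by move=> w bw; split; [exact: (Gb w bw).1|exact: c4].
  rewrite -cdiff_rintD//; last first.
    by move=> w bw; split; [apply: cdiffD; [exact: (Gb w bw).1|exact: c4]|exact: c3].
  apply: eq_rint => // w h1 h2 h3.
  have [_ w0 wt] := sq_bdry S0 (And3 h1 h2 h3); have [_ wt2] := wt t tS.
  rewrite /G !subr0; field.
  by rewrite subr_eq0 wt2 w0.
have k0 := nkappa_gt0.
have := sq_bound S0 Gb; rewrite -E normcM mulrC -ler_pdivlMr// => h; apply: le_trans h _.
rewrite /K0 le_eqVlt; apply/orP; left; apply/eqP; field.
by rewrite gt_eqF// gt_eqF.
Qed.

Lemma cderiv_unique f l D (s K : R) : 0 < s -> cderiv f 0 l ->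
  (forall t, normc t <= s -> normc (f t - f 0 - D * t) <= K * normc t ^+ 2) -> l = D.
Proof.
move=> s0 fl H; apply/eqP; rewrite -subr_eq0 -normc_eq0 eq_le normc_ge0 andbT.
apply/ler_addgt0Pl => e e0; rewrite addr0.
have e2 : 0 < e / 2 by lra.
have [d d0 Hd] := fl _ e2.
have eK : 0 < e / 2 / (`|K| + 1) by rewrite divr_gt0// ltr_wpDl.
have [p [p0 pd ps]] := pos_min d0 s0; have [q [q0 qp qK]] := pos_min p0 eK.
pose t := (q / 2)%:C; have nt : normc t = q / 2 by rewrite normc_real ger0_norm; lra.
have h1 : normc (f (0 + t) - f 0 - l * t) <= e / 2 * normc t by apply: Hd; rewrite nt; lra.
have h2 : normc (f t - f 0 - D * t) <= K * normc t ^+ 2 by apply: H; rewrite nt; lra.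
have := normcB_le h2 h1; rewrite add0r.
have -> : f t - f 0 - D * t - (f t - f 0 - l * t) = (l - D) * t by ring.
rewrite normcM nt (_ : K * _ + _ = (K * (q / 2) + e / 2) * (q / 2)); last by ring.
rewrite ler_pM2r; last lra.
move=> h; apply: le_trans h _.
have : K * (q / 2) <= e / 2.
  apply: (@le_trans _ _ ((`|K| + 1) * q)).
    have := ler_norm K; have := normr_ge0 K; nra.
  by rewrite -ler_pdivlMl ?ltr_wpDl// mulrC.
lra.
Qed.

Lemma taylor2 S M f l : 0 < S ->
  (forall w, - S <= Re w <= S -> - S <= Im w <= S -> cdiff f w /\ normc (f w) <= M) ->
  cderiv f 0 l ->
  l = D1 S f /\
  (forall t, normc t <= S / 2 -> normc (f t - f 0 - l * t) <= K0 * M * normc t ^+ 2 / S ^+ 2).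
Proof.
move=> S0 H fl; have T := taylor2_D1 S0 H.
have -> : l = D1 S f.
  have S2 : 0 < S / 2 by lra.
  apply: (cderiv_unique (K := K0 * M / S ^+ 2) S2 fl) => t /T h.
  by apply: le_trans h _; rewrite mulrAC.
by [].
Qed.

End Taylor1.

(** * Taylor estimate in several variables and limits of holomorphic functions *)

Section Several.
Variables (R : realType) (n : nat).
Local Notation C := R[i].
Local Notation V := 'rV[C]_n.
Local Notation kappa := (kappa R).
Local Notation K0 := (K0 R).
Implicit Types (f g : V -> C) (z h : V).

Definition hderiv f z (c : 'I_n -> C) := forall e, 0 < e ->
  exists2 d, 0 < d & forall h, vn h < d ->
    normc (f (z + h) - f z - lf c h) <= e * vn h.

Lemma vnZ (a : C) h : vn (a *: h) = normc a * vn h.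
Proof. by rewrite /vn mulr_sumr; apply: eq_bigr => k _; rewrite mxE normcM. Qed.

Lemma vn0 : vn (0 : V) = 0.
Proof. by rewrite /vn big1// => k _; rewrite mxE normc0. Qed.

Lemma vn_eq0 h : vn h = 0 -> h = 0.
Proof.
move=> h0; apply/rowP => k; rewrite mxE; apply/eqP; rewrite -normc_eq0.
by rewrite eq_le normc_ge0 andbT -h0 normc_le_vn.
Qed.

Lemma vnD h h' : vn (h + h') <= vn h + vn h'.
Proof. by rewrite /vn -big_split /=; apply: ler_sum => k _; rewrite mxE le_normcD. Qed.

Lemma vnN h : vn (- h) = vn h.
Proof. by rewrite -scaleN1r vnZ normcN normc1 mul1r. Qed.

Lemma lf_bound (c : 'I_n -> C) (K : R) h : (forall k, normc (c k) <= K) ->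
  normc (lf c h) <= K * vn h.
Proof.
move=> cK; apply: le_trans (normc_sum _ _ _) _; rewrite /vn mulr_sumr.
by apply: ler_sum => k _; rewrite normcM mulrC ler_wpM2r ?normc_ge0.
Qed.

Lemma hderiv_line f z c h : hderiv f z c -> cderiv (fun t => f (z + t *: h)) 0 (lf c h).
Proof.
move=> H e e0; have v0 := vn_ge0 h; have v1 : 0 < vn h + 1 by lra.
have [d d0 Hd] := H _ (divr_gt0 e0 v1).
exists (d / (vn h + 1)); first exact: divr_gt0.
move=> t; rewrite ltr_pdivlMr// => td.
have tv : vn (t *: h) < d.
  by rewrite vnZ; apply: le_lt_trans td; rewrite ler_wpM2l ?normc_ge0// lerDl.
have := Hd _ tv; rewrite add0r scale0r addr0 linearZ /= => h1.
have -> : lf c h * t = t *: lf c h by rewrite mulrC.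
apply: le_trans h1 _; rewrite vnZ mulrCA [e * _]mulrC ler_wpM2l ?normc_ge0//.
by rewrite -mulrA ler_piMr ?(ltW e0)// mulrC ler_pdivrMr// mul1r lerDl.
Qed.

Lemma hd_line f z h t : hd f (z + t *: h) -> cdiff (fun t => f (z + t *: h)) t.
Proof.
move=> [c H]; have [l Hl] : cdiff (fun s => f (z + t *: h + s *: h)) 0.
  by exists (lf c h); exact: hderiv_line.
exists l => e /Hl[d d0 Hd]; exists d => // s /Hd.
by rewrite add0r scale0r addr0 scalerDl [z + (_ + _)]addrA.
Qed.

Lemma hd_ball_line f z h r M : (forall z', vn (z' - z) < r -> hd f z' /\ normc (f z') <= M) ->
  forall S, 0 < S -> 2 * S * vn h < r ->
  forall w : C, - S <= Re w <= S -> - S <= Im w <= S ->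
    cdiff (fun t => f (z + t *: h)) w /\ normc (f (z + w *: h)) <= M.
Proof.
move=> H S S0 Sr w h1 h2.
have nw : normc w <= 2 * S.
  apply: le_trans (normc_le_parts _) _; rewrite mulr_natl mulr2n.
  by apply: lerD; rewrite ler_norml.
have [|f1 f2] := H (z + w *: h).
  rewrite addrAC subrr add0r vnZ; apply: le_lt_trans Sr.
  by rewrite ler_wpM2r// vn_ge0.
by split=> //; exact: hd_line.
Qed.

Definition K1 : R := 16 * K0.

Definition ek (k : 'I_n) : V := delta_mx 0 k.

Lemma vn_ek k : vn (ek k) = 1.
Proof.
rewrite /vn (bigD1 k) //= big1 ?addr0 => [|i ik].
  by rewrite mxE !eqxx normc1.
by rewrite mxE eqxx (negPf ik) normc0.
Qed.

Lemma lf_ek c k : lf c (ek k) = c k.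
Proof.
rewrite /lf (bigD1 k) //= big1 ?addr0 => [|i ik].
  by rewrite mxE !eqxx mul1r.
by rewrite mxE eqxx (negPf ik) mul0r.
Qed.

Definition Dk (s : R) f z k : C := D1 s (fun w => f (z + w *: ek k)).

(** Restriction to complex lines through [z]. The gradient is an integral of the values of [f], and
    the remainder depends only on the bound [M]; both points are what makes the estimate pass to
    limits and to integrals. *)
Lemma taylorV f z r M c : 0 < r ->
  (forall z', vn (z' - z) < r -> hd f z' /\ normc (f z') <= M) -> hderiv f z c ->
  (forall k, c k = Dk (r / 4) f z k) /\
  (forall h, vn h <= r / 8 -> normc (f (z + h) - f z - lf c h) <= K1 * M * vn h ^+ 2 / r ^+ 2).
Proof.
move=> r0 H cf; split.
  move=> k; rewrite -(lf_ek c k); have r4 : 0 < r / 4 by lra.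
  apply: (proj1 (taylor2 (M := M) r4 _ (hderiv_line _ cf))).
  by apply: (hd_ball_line (h := ek k) H) => //; rewrite vn_ek; lra.
move=> h hr; have [h0|h0] := eqVneq (vn h) 0.
  rewrite (vn_eq0 h0) addr0 subrr linear0 subr0 normc0 vn0 expr0n /=.
  by rewrite mulr0 mul0r.
have hp : 0 < vn h by rewrite lt_def h0 vn_ge0.
(* With this half-side [S] the square of the line in the direction [h] stays in the ball, as
   [2 * S * vn h = r / 2], and [t = 1] is admissible because [vn h <= r / 8]. *)
have S0 : 0 < r / (4 * vn h) by rewrite divr_gt0// mulr_gt0.
have := proj2 (taylor2 (M := M) S0 _ (hderiv_line h cf)).
have -> : (r / (4 * vn h)) = r / 4 / vn h by field.
move=> /(_ _ 1); rewrite normc1 scale1r scale0r addr0 mulr1 => T; apply: le_trans (T _ _) _.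
- apply: (hd_ball_line (h := h) H); first by rewrite !divr_gt0.
  by rewrite -mulrA divfK//; lra.
- by rewrite mulrAC ler_pdivlMr//; lra.
rewrite le_eqVlt; apply/orP; left; apply/eqP; rewrite /K1; field.
by rewrite h0 gt_eqF.
Qed.

Lemma hd_cont f z : hd f z -> forall e, 0 < e -> exists2 d, 0 < d &
  forall h, vn h < d -> normc (f (z + h) - f z) < e.
Proof.
move=> [c H] e e0; have [d d0 Hd] := H 1 ltr01.
pose K := \sum_k normc (c k).
have K0 : 0 <= K by apply: sumr_ge0 => k _; exact: normc_ge0.
have cK k : normc (c k) <= K.
  by rewrite /K (bigD1 k) //= lerDl; apply: sumr_ge0 => i _; exact: normc_ge0.
have k1 : 0 < 1 + K by lra.
have [q [q0 qd qe]] := pos_min d0 (divr_gt0 e0 k1).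
exists q => // h hq; have := Hd h (lt_le_trans hq qd); rewrite mul1r => h1.
rewrite -[f (z + h) - f z](subrK (lf c h)).
apply: (le_lt_trans (normcD_le h1 (lf_bound h cK))).
have -> : vn h + K * vn h = (1 + K) * vn h by ring.
rewrite mulrC -ltr_pdivlMr//; exact: lt_le_trans qe.
Qed.

(** Only continuity is asked of [F], which will be a limit not yet known to be holomorphic. *)
Lemma D1_close S (F G : C -> C) e : 0 < S ->
  (forall w, bdry (- S) S (- S) S w -> [/\ ccont F w, cdiff G w & normc (F w - G w) <= e]) ->
  normc (D1 S F - D1 S G) <= 16 * e / (S * normc kappa).
Proof.
move=> S0 H; have SS : - S <= S by lra.
pose u (w : C) := (w - 0)^-1 * (w - 0)^-1.
have cm (A : C -> C) w : bdry (- S) S (- S) S w -> ccont A w ->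
    ccont (fun w => A w * u w) w.
  move=> bw Ac; have [_ w0 _] := sq_bdry S0 bw.
  have uc : ccont u w by apply: cdiff_cont; apply: cdiffM; exact: cdiff_inv.
  move=> d d0.
  have Ap : 0 < normc (A w) + 1 by rewrite ltr_wpDl ?normc_ge0.
  have up : 0 < normc (u w) + 1 by rewrite ltr_wpDl ?normc_ge0.
  have d2 : 0 < d / 2 by lra.
  have [p [p0 p1 pd]] := pos_min ltr01 (divr_gt0 d2 up).
  have [d1 d10 H1] := Ac _ p0; have [d3 d30 H3] := uc _ (divr_gt0 d2 Ap).
  have [q [q0 q1 q2]] := pos_min d10 d30; exists q => // w' wq.
  have h1 := H1 _ (lt_le_trans wq q1); have h3 := H3 _ (lt_le_trans wq q2).
  have -> : A w' * u w' - A w * u w = A w' * (u w' - u w) + (A w' - A w) * u w by ring.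
  have Aw : normc (A w') <= normc (A w) + 1.
    rewrite -[A w'](subrK (A w)) addrC; apply: normcD_le => //; lra.
  rewrite (splitr d); apply: (le_lt_trans (le_normcD _ _)).
  rewrite (normcM (A w')) (normcM (A w' - A w)).
  apply: ltr_leD.
    apply: (@le_lt_trans _ _ ((normc (A w) + 1) * normc (u w' - u w))).
      by rewrite ler_wpM2r ?normc_ge0.
    by rewrite mulrC -ltr_pdivlMr.
  apply: (@le_trans _ _ (p * (normc (u w) + 1))).
    by rewrite ler_pM ?normc_ge0 ?(ltW h1) ?lerDl.
  by rewrite -ler_pdivlMr.
have segs (A : C -> C) : (forall w, bdry (- S) S (- S) S w -> ccont A w) ->
  [/\ hseg A (- S) S (- S), hseg A (- S) S S, vseg A (- S) (- S) S & vseg A S (- S) S].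
  move=> Ac; split.
  - by apply: ccont_hseg => x xab; apply/Ac; split; rewrite /= ?lexx//; apply: Or43.
  - by apply: ccont_hseg => x xab; apply/Ac; split; rewrite /= ?lexx ?SS//; apply: Or44.
  - by apply: ccont_vseg => x xab; apply/Ac; split; rewrite /= ?lexx//; apply: Or41.
  - by apply: ccont_vseg => x xab; apply/Ac; split; rewrite /= ?lexx ?SS//; apply: Or42.
have cF w : bdry (- S) S (- S) S w -> ccont (fun w => F w * u w) w.
  by move=> bw; apply: cm => //; case: (H w bw).
have cG w : bdry (- S) S (- S) S w -> ccont (fun w => -1 * (G w * u w)) w.
  move=> bw; have [_ w0 _] := sq_bdry S0 bw.
  apply: cdiff_cont; apply: cdiffM; first exact: cdiff_cst.
  by apply: cdiffM; [case: (H w bw)|apply: cdiffM; exact: cdiff_inv].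
have cG' w : bdry (- S) S (- S) S w -> cdiff (fun w => (G w * u w)) w.
  move=> bw; have [_ w0 _] := sq_bdry S0 bw.
  by apply: cdiffM; [case: (H w bw)|apply: cdiffM; exact: cdiff_inv].
have [F1 F2 F3 F4] := segs _ cF; have [G1 G2 G3 G4] := segs _ cG.
have E : sqint S (fun w => F w * u w) - sqint S (fun w => G w * u w) =
   sqint S (fun w => F w * u w + -1 * (G w * u w)).
  by rewrite /sqint rintD// cdiff_rintZ// mulN1r.
rewrite /D1 -mulrBr E normcM normcV mulrC.
have k0 := nkappa_gt0 R.
rewrite ler_pdivrMr//.
have [S1 S2 S3 S4] : [/\ hseg (fun w => F w * u w + -1 * (G w * u w)) (- S) S (- S),
   hseg (fun w => F w * u w + -1 * (G w * u w)) (- S) S S,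
   vseg (fun w => F w * u w + -1 * (G w * u w)) (- S) (- S) S &
   vseg (fun w => F w * u w + -1 * (G w * u w)) S (- S) S].
  by apply: segs => w bw; apply: ccontD; [exact: cF|exact: cG].
apply: le_trans (rint_bound (M := e * (S^-1 * S^-1)) SS SS S1 S2 S3 S4 _) _.
  move=> w h1 h2 h3; have bw := And3 h1 h2 h3; have [Sw w0 _] := sq_bdry S0 bw.
  rewrite mulN1r -mulrBl; have [_ _ FG] := H w bw.
  have iw : normc ((w - 0)^-1) <= S^-1.
    by rewrite normcV subr0 lef_pV2 ?posrE//; exact: lt_le_trans Sw.
  by apply: normcM_le => //; exact: normcM_le.
rewrite le_eqVlt; apply/orP; left; apply/eqP; field.
by rewrite !gt_eqF.
Qed.

(** The candidate gradient of [f] is given by Cauchy integrals of [f] itself. These are close to the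
    gradients of the approximants, whose Taylor remainders are uniformly bounded, so the Taylor
    estimate passes to the limit. *)
Lemma weierstrass f z r : 0 < r ->
  (forall e, 0 < e -> exists g, forall z', vn (z' - z) < r ->
     hd g z' /\ normc (f z' - g z') <= e) -> hd f z.
Proof.
move=> r0 H; have [g1 H1] := H 1 ltr01.
have zr : vn (z - z) < r by rewrite subrr vn0.
have [d d0 Hd] := hd_cont (H1 z zr).1 ltr01.
have [s [s0 sr sd]] := pos_min r0 d0.
(* A bound near [z] for every approximant of accuracy at most 1: the variation of [g1] and two
   approximation errors contribute at most 1 each. *)
pose B := normc (g1 z) + 3.
have gB e g : 0 < e <= 1 -> (forall z', vn (z' - z) < r ->
     hd g z' /\ normc (f z' - g z') <= e) ->
   forall z', vn (z' - z) < s -> hd g z' /\ normc (g z') <= B.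
  move=> /andP[e0 e1] Hg z' zs; have zr' := lt_le_trans zs sr.
  have [g2 g3] := Hg z' zr'; split=> //.
  have [_ f1] := H1 z' zr'.
  have f2 := Hd _ (lt_le_trans zs sd); rewrite [z + _]addrC subrK in f2.
  have -> : g z' = g1 z + (g1 z' - g1 z) + (f z' - g1 z') - (f z' - g z') by ring.
  have -> : B = normc (g1 z) + 1 + 1 + 1 by rewrite /B; lra.
  apply: normcB_le; last exact: le_trans e1.
  apply: normcD_le => //; apply: normcD_le => //; exact: ltW.
have s4 : 0 < s / 4 by lra.
have k0 := nkappa_gt0 R.
pose A := 16 / (s / 4 * normc kappa).
have A0 : 0 < A by rewrite divr_gt0// mulr_gt0.
pose T := K1 * B / s ^+ 2.
have approx e g : 0 < e <= 1 -> (forall z', vn (z' - z) < r ->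
     hd g z' /\ normc (f z' - g z') <= e) ->
   forall h, vn h <= s / 8 ->
     normc (f (z + h) - f z - lf (Dk (s / 4) f z) h) <= (2 + A * vn h) * e + T * vn h ^+ 2.
  move=> e01 Hg h hs; have Hb := gB e g e01 Hg.
  have [c cg] := (Hg z zr).1.
  have [cD cT] := taylorV s0 Hb cg.
  have cc k : normc (Dk (s / 4) f z k - c k) <= A * e.
    rewrite cD /Dk; have -> : A * e = 16 * e / (s / 4 * normc kappa) by rewrite /A; ring.
    apply: D1_close => // w bw.
    have wline : vn (w *: ek k) < s.
      rewrite vnZ vn_ek mulr1; apply: le_lt_trans (normc_le_parts _) _.
      have [hw1 hw2 _] := bw; apply: (@le_lt_trans _ _ (s / 4 + s / 4)); last lra.
      by apply: lerD; rewrite ler_norml.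
    have gd (g' : V -> C) : (forall z', vn (z' - z) < r -> hd g' z') ->
        cdiff (fun w => g' (z + w *: ek k)) w.
      move=> g'd; apply: hd_line; apply: g'd; rewrite addrAC subrr add0r.
      exact: lt_le_trans sr.
    split.
    - move=> e' e'0; have e'3 : 0 < e' / 3 by lra.
      have [g' Hg'] := H _ e'3.
      have /cdiff_cont/(_ _ e'3)[d' d'0 Hd'] := gd g' (fun z' zz => (Hg' z' zz).1).
      have q3 : 0 < s - vn (w *: ek k) by lra.
      have [q [q0 q1 q2]] := pos_min d'0 q3.
      exists q => // w' wq; have h1 := Hd' _ (lt_le_trans wq q1).
      have w's : vn (w' *: ek k) < s.
        have -> : w' *: ek k = (w' - w) *: ek k + w *: ek k by rewrite -scalerDl subrK.
        apply: le_lt_trans (vnD _ _) _; rewrite [vn ((w' - w) *: _)]vnZ vn_ek mulr1; lra.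
      have [_ h2] := Hg' (z + w *: ek k) ltac:(by rewrite addrAC subrr add0r; lra).
      have [_ h3] := Hg' (z + w' *: ek k) ltac:(by rewrite addrAC subrr add0r; lra).
      have -> : f (z + w' *: ek k) - f (z + w *: ek k) =
        (f (z + w' *: ek k) - g' (z + w' *: ek k)) + (g' (z + w' *: ek k) - g' (z + w *: ek k))
        - (f (z + w *: ek k) - g' (z + w *: ek k)) by ring.
      apply: le_lt_trans (normcB_le (normcD_le h3 (lexx _)) h2) _; lra.
    - by apply: gd => z' /Hg[].
    - by apply: (Hg _ _).2; rewrite addrAC subrr add0r; lra.
  have hr : vn h < r by lra.
  have [_ f1] := Hg (z + h) ltac:(by rewrite addrAC subrr add0r).
  have [_ f2] := Hg z zr.
  have f3 := cT h hs.
  have f4 := lf_bound h cc.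
  have E : f (z + h) - f z - lf (Dk (s / 4) f z) h =
    (f (z + h) - g (z + h)) - (f z - g z) + (g (z + h) - g z - lf c h)
    - lf (fun k => Dk (s / 4) f z k - c k) h.
    have -> : lf (fun k => Dk (s / 4) f z k - c k) h = lf (Dk (s / 4) f z) h - lf c h.
      by rewrite /lf -sumrB; apply: eq_bigr => k _; rewrite mulrBr.
    by ring.
  rewrite E; apply: le_trans (normcB_le (normcD_le (normcB_le f1 f2) f3) f4) _.
  rewrite le_eqVlt; apply/orP; left; apply/eqP; rewrite /T; ring.
exists (Dk (s / 4) f z) => e e0.
have T0 : 0 <= T.
  rewrite /T divr_ge0 ?sqr_ge0// mulr_ge0//.
    by rewrite mulr_ge0// ltW// K0_gt0.
  by rewrite /B addr_ge0 ?normc_ge0.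
have s8 : 0 < s / 8 by lra.
have eT : 0 < e / 2 / (T + 1) by rewrite divr_gt0; lra.
have [q [q0 q1 q2]] := pos_min s8 eT.
exists q => // h hq; have [h0|h0] := eqVneq (vn h) 0.
  by rewrite (vn_eq0 h0) addr0 subrr linear0 subr0 normc0 vn0 mulr0.
have hp : 0 < vn h by rewrite lt_def h0 vn_ge0.
have cp : 0 < 2 + A * vn h by rewrite addr_gt0// mulr_gt0.
(* The accuracy may depend on [h], because [A] and [T] do not depend on the approximant. *)
have e2 : 0 < e / 2 * vn h / (2 + A * vn h) by rewrite divr_gt0// mulr_gt0//; lra.
have [p [p0 p1 p2]] := pos_min ltr01 e2.
have [g Hg] := H _ p0.
have p01 : 0 < p <= 1 by rewrite p0.
have hs : vn h <= s / 8 by lra.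
apply: le_trans (approx _ _ p01 Hg h hs) _.
have i1 : (2 + A * vn h) * p <= e / 2 * vn h by rewrite mulrC -ler_pdivlMr.
have i2 : T * vn h ^+ 2 <= e / 2 * vn h.
  rewrite expr2 mulrA ler_pM2r//.
  apply: (@le_trans _ _ ((T + 1) * (e / 2 / (T + 1)))).
    by apply: ler_pM => //; [exact: vn_ge0|lra|lra].
  by rewrite mulrC divfK// gt_eqF//; lra.
lra.
Qed.

End Several.

(** * Holomorphy of integrals depending on parameters *)

Section ParamIntegral.
Variables (R : realType) (n : nat).
Local Notation C := R[i].
Local Notation V := 'rV[C]_n.
Local Notation K1 := (K1 R).
Implicit Types (f g : V -> C) (z h : V).

Lemma K1_gt0 : 0 < K1.
Proof. by rewrite mulr_gt0 ?K0_gt0. Qed.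

Lemma contin_sum (I : Type) (r : seq I) (F : I -> R -> C) (a b : R) :
  (forall i, contin (F i) a b) -> contin (fun x => \sum_(i <- r) F i x) a b.
Proof.
move=> H; elim: r => [|i r IH].
  have -> : (fun x => \sum_(i <- [::]) F i x) = (fun=> 0).
    by apply/funext => x; rewrite big_nil.
  by move=> x _; exact: rcont_cst.
have -> : (fun x => \sum_(j <- i :: r) F j x) = (fun x => F i x + \sum_(j <- r) F j x).
  by apply/funext => x; rewrite big_cons.
by move=> x xab; apply: rcontD; [exact: H|exact: IH].
Qed.

Lemma ci_sum (I : Type) (r : seq I) (F : I -> R -> C) (a b : R) : a <= b ->
  (forall i, contin (F i) a b) ->
  ci (fun x => \sum_(i <- r) F i x) a b = \sum_(i <- r) ci (F i) a b.
Proof.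
move=> ab H; elim: r => [|i r IH].
  rewrite big_nil (_ : (fun x => _) = (fun=> 0)).
    by rewrite ci_cst// mulr0.
  by apply/funext => x; rewrite big_nil.
rewrite big_cons -IH -ciD; [|exact: H|exact: contin_sum].
by apply: eq_ci => x _; rewrite big_cons.
Qed.

Lemma contin_lf (c : R -> 'I_n -> C) h (a b : R) :
  (forall k, contin (c^~ k) a b) -> contin (fun t => lf (c t) h) a b.
Proof. by move=> H; apply: contin_sum => k x xab; apply: rcontZ; exact: H. Qed.

Lemma ci_lf (c : R -> 'I_n -> C) h (a b : R) : a <= b ->
  (forall k, contin (c^~ k) a b) ->
  ci (fun t => lf (c t) h) a b = lf (fun k => ci (c^~ k) a b) h.
Proof.
move=> ab H; rewrite /lf ci_sum//; last by move=> k x xab; apply: rcontZ; exact: H.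
by apply: eq_bigr => k _; rewrite ciZ.
Qed.

(** The Taylor remainder of [taylorV] is uniform in the integration variable, so it can be
    integrated. *)
Let hd_ci_total (K : R -> V -> C) (a b : R) z (r M : R) : a <= b -> 0 < r ->
  (forall t z', vn (z' - z) < r -> hd (K t) z' /\ normc (K t z') <= M) ->
  (forall z', vn (z' - z) < r -> contin (K^~ z') a b) ->
  hd (fun z' => ci (K^~ z') a b) z.
Proof.
move=> ab r0 HK Kc.
have zr : vn (z - z) < r by rewrite subrr vn0.
have M0 : 0 <= M by apply: le_trans (normc_ge0 _) (HK a z zr).2.
have [c Hc] := choice (fun t => (HK t z zr).1).
have T t := proj2 (taylorV r0 (HK t) (Hc t)).
pose A := K1 * M / r ^+ 2.
have A0 : 0 <= A by rewrite divr_ge0 ?sqr_ge0// mulr_ge0// ltW// K1_gt0.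
have {}T t h : vn h <= r / 8 -> normc (K t (z + h) - K t z - lf (c t) h) <= A * vn h ^+ 2.
  by move=> /(T t) H; rewrite /A mulrAC.
have r8 : 0 < r / 8 by rewrite divr_gt0.
have inball h : vn h <= r / 8 -> vn (z + h - z) < r.
  by rewrite addrC addKr; move: r0; clear; lra.
(* The partial derivatives are continuous in the integration variable, since difference quotients of
   step [s] approximate them with an error [A * s] uniform in that variable. *)
have cc k : contin (c^~ k) a b.
  move=> x xab e e0.
  have e3 : 0 < e / 4 / (A + 1) by rewrite !divr_gt0//; move: A0; clear; lra.
  have [s [s0 s1 s2]] := pos_min r8 e3.
  have vs : vn (s%:C *: ek _ k) = s by rewrite vnZ vn_ek mulr1 normc_real ger0_norm// ltW.
  pose q t := K t (z + s%:C *: ek _ k) - K t z.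
  have qc : rcont q x.
    apply: rcontB; apply: Kc => //; apply: inball; by rewrite vs.
  have se : 0 < s * (e / 4) by rewrite mulr_gt0// divr_gt0.
  have [d d0 Hd] := qc _ se.
  exists d => // y yx; have {Hd} := Hd y yx.
  have Ty t : normc (q t - s%:C * c t k) <= A * s ^+ 2.
    have := T t (s%:C *: ek _ k); rewrite vs => /(_ s1).
    by rewrite linearZ /= lf_ek.
  have As : A * s ^+ 2 <= s * (e / 4).
    rewrite expr2 mulrCA ler_pM2l//.
    apply: (@le_trans _ _ ((A + 1) * (e / 4 / (A + 1)))).
      by rewrite ler_pM// ?lerDl// ltW.
    by rewrite mulrC divfK// gt_eqF// ltr_wpDl.
  move=> h1; have := normcB_le (normcD_le (ltW h1) (Ty x)) (Ty y).
  have -> : q y - q x + (q x - s%:C * c x k) - (q y - s%:C * c y k) =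
     s%:C * (c y k - c x k) by ring.
  rewrite normcM normc_real ger0_norm; last exact: ltW.
  move=> h2; have h3 : s * normc (c y k - c x k) < s * e.
    by apply: le_lt_trans h2 _; move: As (mulr_gt0 s0 e0); clear; lra.
  by rewrite -(ltr_pM2l s0).
exists (fun k => ci (c^~ k) a b) => e e0.
have BA : 0 < 2 * A * (b - a) + 1 by rewrite ltr_wpDl//; apply: mulr_ge0; [exact: mulr_ge0|rewrite subr_ge0].
have [s [s0 s1 s2]] := pos_min r8 (divr_gt0 e0 BA).
exists s => // h hs.
have h8 : vn h <= r / 8 by exact: le_trans (ltW hs) s1.
have c1 := Kc _ (inball h h8); have c2 := Kc _ zr; have c3 := contin_lf h cc.
rewrite -ci_lf// -!ciB//; last exact: continB.
apply: le_trans (ci_bound (M := A * vn h ^+ 2) ab _ _) _.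
- by apply: continB => //; exact: continB.
- by move=> x _; exact: T.
have -> : 2 * (A * vn h ^+ 2) * (b - a) = 2 * A * (b - a) * vn h * vn h by ring.
rewrite ler_wpM2r ?vn_ge0//.
apply: (@le_trans _ _ ((2 * A * (b - a) + 1) * (e / (2 * A * (b - a) + 1)))).
  apply: ler_pM => //; [|exact: vn_ge0| |exact: le_trans (ltW hs) s2].
    by apply: mulr_ge0; [exact: mulr_ge0|rewrite subr_ge0].
  by rewrite lerDl.
by rewrite mulrC divfK// gt_eqF.
Qed.

(** Reduced to a kernel defined for all real parameters by the 1-Lipschitz retraction [cl] onto
    [[a, b]]. *)
Lemma hd_ci (K : R -> V -> C) (a b : R) z (r M : R) : a <= b -> 0 < r ->
  (forall t z', a <= t <= b -> vn (z' - z) < r -> hd (K t) z' /\ normc (K t z') <= M) ->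
  (forall z', vn (z' - z) < r -> contin (K^~ z') a b) ->
  hd (fun z' => ci (K^~ z') a b) z.
Proof.
move=> ab r0 HK Kc.
pose cl (t : R) := if t <= a then a else if b <= t then b else t.
have clin t : a <= cl t <= b.
  by rewrite /cl; case: ifPn => [_|]; [rewrite lexx|case: ifPn => [_|]; rewrite ?lexx ?ab -?ltNge //;
     move=> h1 h2; rewrite !ltW].
have clid t : a <= t <= b -> cl t = t.
  move=> /andP[h1 h2]; rewrite /cl; case: ifPn => h3; first by apply/eqP; rewrite eq_le h1.
  by case: (lerP b t) => h4 //; apply: le_anti; rewrite h4 h2.
have cllip t u : `|cl t - cl u| <= `|t - u|.
  rewrite /cl; have tu := ler_norm (t - u); have tu' := ler_norm (u - t).
  rewrite distrC in tu'; have n0 := normr_ge0 (t - u).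
  move: (`|t - u|) tu tu' n0 => p tu tu' n0; rewrite ler_norml.
  by case: (lerP t a) => h1; case: (lerP u a) => h2; case: (lerP b t) => h3;
    case: (lerP b u) => h4; lra.
have -> : (fun z' => ci (K^~ z') a b) = (fun z' => ci ((fun t => K (cl t))^~ z') a b).
  by apply/funext => z'; apply: eq_ci => t /clid ->.
apply: (@hd_ci_total (fun t => K (cl t)) a b z r M) => // [t z' zz|z' zz x xab e e0].
  exact: HK.
have [d d0 Hd] := Kc z' zz _ (clin x) e e0; exists d => // y yx.
by apply: Hd; apply: le_lt_trans yx; exact: cllip.
Qed.

End ParamIntegral.

Lemma fin_min (R : realType) (J : finType) (F : J -> R) : (forall j, 0 < F j) ->
  exists2 r, 0 < r & forall j, r <= F j.
Proof.
move=> F0; suff [r r0 H] : exists2 r, 0 < r & forall j, j \in enum J -> r <= F j.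
  by exists r => // j; apply: H; rewrite mem_enum.
elim: (enum J) => [|j s [r r0 H]]; first by exists 1.
have [q [q0 q1 q2]] := pos_min r0 (F0 j); exists q => // i; rewrite inE => /orP[/eqP->//|/H].
exact: le_trans.
Qed.

(** * Open sets, substitutions and Cauchy kernels in a projective coordinate *)

Section HdTools.
Variables (R : realType) (n : nat).
Local Notation C := R[i].
Local Notation V := 'rV[C]_n.
Implicit Types (f g : V -> C) (z h : V).

Definition opn (U : set V) := forall z, U z -> exists2 r : R, 0 < r &
  forall z', vn (z' - z) < r -> U z'.

Lemma opnI (U W : set V) : opn U -> opn W -> opn (U `&` W).
Proof.
move=> oU oW z [/oU[r r0 H] /oW[s s0 H']]; have [q [q0 q1 q2]] := pos_min r0 s0.
exists q => // z' zz; split; [apply: H|apply: H']; exact: lt_le_trans zz _.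
Qed.

Lemma hd_near f g z (d : R) : 0 < d -> (forall z', vn (z' - z) < d -> f z' = g z') ->
  hd f z -> hd g z.
Proof.
move=> d0 fg [c H]; exists c => e /H[r r0 Hr].
have [q [q0 q1 q2]] := pos_min d0 r0; exists q => // h hq.
rewrite -!fg ?subrr ?vn0//; last by rewrite addrC addKr; exact: lt_le_trans q1.
by apply: Hr; exact: lt_le_trans q2.
Qed.

Lemma hd_nearU (U : set V) f g z : opn U -> U z -> (forall z', U z' -> f z' = g z') ->
  hd f z -> hd g z.
Proof.
by move=> oU /oU[r r0 H] fg; apply: (hd_near r0) => z' /H; exact: fg.
Qed.

Lemma hd_sum (I : Type) (r : seq I) (F : I -> V -> C) z : (forall i, hd (F i) z) ->
  hd (fun z => \sum_(i <- r) F i z) z.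
Proof.
move=> H; elim: r => [|i r IH].
  have -> : (fun z => \sum_(i <- [::]) F i z) = (fun=> 0) by apply/funext => x; rewrite big_nil.
  exact: hd_cst.
have -> : (fun z => \sum_(j <- i :: r) F j z) = (fun z => F i z + \sum_(j <- r) F j z).
  by apply/funext => x; rewrite big_cons.
exact: hdD.
Qed.

Lemma hdZ (k : C) f z : hd f z -> hd (fun z => k * f z) z.
Proof. by move=> fd; apply: hdM => //; exact: hd_cst. Qed.

Lemma hdN f z : hd f z -> hd (fun z => - f z) z.
Proof.
by move=> fd; rewrite (_ : (fun z => - f z) = (fun z => -1 * f z));
  [exact: hdZ|apply/funext => x; rewrite mulN1r].
Qed.

Lemma hdB f g z : hd f z -> hd g z -> hd (fun z => f z - g z) z.
Proof. by move=> fd gd; apply: hdD => //; exact: hdN. Qed.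

Lemma hdX f z k : hd f z -> hd (fun z => f z ^+ k) z.
Proof.
move=> fd; elim: k => [|k IH]; first exact: hd_cst.
rewrite (_ : (fun z => f z ^+ k.+1) = (fun z => f z * f z ^+ k)); last first.
  by apply/funext => x; rewrite exprS.
exact: hdM.
Qed.

Lemma hd_lin f z (A : 'M[C]_n) : hd f (z *m A) -> hd (fun z => f (z *m A)) z.
Proof.
move=> [c H]; exists (fun k => lf c (row k A)).
pose K : R := \sum_k vn (row k A) + 1.
have K0 : 0 < K by rewrite ltr_wpDl// sumr_ge0// => k _; exact: vn_ge0.
have vA h : vn (h *m A) <= K * vn h.
  have -> : h *m A = \sum_k h 0 k *: row k A.
    by apply/rowP => j; rewrite !mxE summxE; apply: eq_bigr => k _; rewrite !mxE.
  apply: (@le_trans _ _ (\sum_k vn (h 0 k *: row k A))).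
    elim/big_rec2: _ => [|k a b _ ab]; first by rewrite vn0.
    by apply: le_trans (vnD _ _) _; rewrite lerD2l.
  rewrite /vn mulr_sumr; apply: ler_sum => k _; rewrite -/(vn _) vnZ mulrC ler_wpM2r ?normc_ge0//.
  rewrite /K (bigD1 k) //= -addrA lerDl addr_ge0 ?ler01// sumr_ge0// => i _; exact: vn_ge0.
have lE h : lf (fun k => lf c (row k A)) h = lf c (h *m A).
  rewrite /lf; under eq_bigr => k _ do rewrite mulr_sumr.
  rewrite exchange_big; apply: eq_bigr => j _; rewrite mxE mulr_suml.
  by apply: eq_bigr => k _; rewrite mxE mulrA.
move=> e e0; have [d d0 Hd] := H _ (divr_gt0 e0 K0).
exists (d / K); first exact: divr_gt0.
move=> h; rewrite ltr_pdivlMr// => hd; rewrite lE mulmxDl.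
apply: le_trans (Hd _ _) _; first by apply: le_lt_trans (vA h) _; rewrite mulrC.
by rewrite mulrAC ler_pdivrMr// -mulrA ler_pM2l// mulrC vA.
Qed.

(* [subst k i w z] is [z] with its [k]-th coordinate replaced by [w * z_i]. *)
Definition subst (k i : 'I_n) (w : C) z : V := \row_j (if j == k then w * z 0 i else z 0 j).

Lemma subst_line k i w z : k != i ->
  subst k i w z = subst k i 0 z + w *: (z 0 i *: ek R k).
Proof.
move=> ki; apply/rowP => j; rewrite !mxE; have [jk|jk] := eqVneq j k.
  by rewrite eqxx mul0r add0r mulr1.
by rewrite andbF mulr0n !mulr0 addr0.
Qed.

Lemma substE k i z : k != i -> z 0 i != 0 -> subst k i (z 0 k / z 0 i) z = z.
Proof.
move=> ki zi; apply/rowP => j; rewrite mxE; case: eqP => [->|//].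
by rewrite divfK.
Qed.

Lemma hd_subst f k i w z : k != i -> hd f (subst k i w z) -> hd (fun z => f (subst k i w z)) z.
Proof.
move=> ki; pose A : 'M[C]_n := \matrix_(a, j) (if j == k then w * (a == i)%:R else (a == j)%:R).
have E z' : subst k i w z' = z' *m A.
  apply/rowP => j; rewrite !mxE; case: eqP => [->|jk].
    rewrite (bigD1 i) //= mxE !eqxx mulr1 mulrC big1 ?addr0// => a ai.
    by rewrite mxE eqxx (negPf ai) !mulr0.
  rewrite (bigD1 j) //= mxE eqxx; case: eqP => // _; rewrite mulr1 big1 ?addr0// => a aj.
  by rewrite mxE; case: eqP => // _; rewrite (negPf aj) mulr0.
rewrite E => /hd_lin; congr hd; apply/funext => z'; by rewrite E.
Qed.

Lemma cdiff_subst f k i w z : k != i -> hd f (subst k i w z) ->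
  cdiff (fun w => f (subst k i w z)) w.
Proof.
move=> ki fd; rewrite (_ : (fun w => _) = fun w => f (subst k i 0 z + w *: (z 0 i *: ek R k))).
  by apply: hd_line; rewrite -subst_line.
by apply/funext => w'; rewrite -subst_line.
Qed.

Lemma hd_ratio k i z : z 0 i != 0 -> hd (fun z => z 0 k / z 0 i) z.
Proof.
by move=> zi; apply: hdM; [exact: hd_coord|apply: hdV => //; exact: hd_coord].
Qed.

Lemma cdiff_comp_affine (F : C -> C) (t w : C) : t != 0 -> cdiff F (t * w) ->
  cdiff (fun w => F (t * w)) w.
Proof.
move=> t0 [l H]; have nt : 0 < normc t by rewrite normc_gt0.
exists (l * t) => e e0; have [d d0 Hd] := H _ (divr_gt0 e0 nt).
exists (d / normc t); first exact: divr_gt0.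
move=> h; rewrite ltr_pdivlMr// => hd; have := Hd (t * h).
rewrite normcM [_ * normc h]mulrC => /(_ hd); rewrite -mulrDr mulrA => h1.
by apply: le_trans h1 _; rewrite mulrCA divfK ?gt_eqF// mulrC.
Qed.

(* The Cauchy kernel in the variable [t^-1 * z_k / z_i] of the chart [z_i != 0]. *)
Lemma hd_kernel f k i (t : C) (g : R -> C) (a b : R) z (r M d : R) :
  k != i -> t != 0 -> a <= b -> 0 < r -> 0 < d ->
  (forall F x, a <= x <= b -> ccont F (g x) -> rcont (fun x => F (g x)) x) ->
  (forall z' x, vn (z' - z) < r -> a <= x <= b ->
    [/\ z' 0 i != 0, hd f (subst k i (t * g x) z') &
        normc (f (subst k i (t * g x) z')) <= M]) ->
  (forall x, a <= x <= b -> d <= normc (g x - t^-1 * (z 0 k / z 0 i))) ->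
  hd (fun z => ci (fun x => f (subst k i (t * g x) z) / (g x - t^-1 * (z 0 k / z 0 i))) a b) z.
Proof.
move=> ki t0 ab r0 d0 gc H far.
have a1 : a <= a <= b by rewrite lexx.
have zz : vn (z - z) < r by rewrite subrr vn0.
pose U z := t^-1 * (z 0 k / z 0 i).
have Ud : hd U z by apply: hdZ; apply: hd_ratio; have [] := H z a zz a1.
have d2 : 0 < d / 2 by rewrite divr_gt0.
have [s s0 Hs] := hd_cont Ud d2.
have [q [q0 q1 q2]] := pos_min r0 s0.
have far' z' x : vn (z' - z) < q -> a <= x <= b -> d / 2 <= normc (g x - U z').
  move=> zq xab; have := Hs (z' - z) (lt_le_trans zq q2); rewrite [z + _]addrC subrK.
  have := far x xab; have := le_normcD (g x - U z') (U z' - U z).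
  rewrite addrA subrK /U; move: (normc _) (normc _) (normc _) => p1 p2 p3; lra.
have nz z' x : vn (z' - z) < q -> a <= x <= b -> g x - U z' != 0.
  by move=> zq xab; rewrite -normc_gt0; apply: lt_le_trans d2 _; exact: far'.
apply: (@hd_ci R n _ a b z q (M * (d / 2)^-1)) => // [x z' xab zq|z' zq x xab].
  have [zi fd fM] := H z' x (lt_le_trans zq q1) xab; split.
    apply: hdM; first exact: hd_subst.
    apply: hdV; last exact: nz.
    by apply: hdB; [exact: hd_cst|apply: hdZ; exact: hd_ratio].
  apply: normcM_le => //; have f' := far' z' x zq xab.
  by rewrite normcV lef_pV2 ?posrE//; exact: lt_le_trans f'.
have [zi fd fM] := H z' x (lt_le_trans zq q1) xab.
apply: (gc (fun w => f (subst k i (t * w) z') / (w - U z'))) => //.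
apply: cdiff_cont; apply: cdiff_div; last by rewrite -subr_eq0; exact: nz.
apply: (@cdiff_comp_affine (fun w => f (subst k i w z'))) => //.
exact: cdiff_subst.
Qed.

Lemma hd_rint_kernel f k i (t : C) (a b c d : R) z (r M e : R) :
  k != i -> t != 0 -> a <= b -> c <= d -> 0 < r -> 0 < e ->
  (forall z' w, vn (z' - z) < r -> bdry a b c d w ->
    [/\ z' 0 i != 0, hd f (subst k i (t * w) z') &
        normc (f (subst k i (t * w) z')) <= M]) ->
  (forall w, bdry a b c d w -> e <= normc (w - t^-1 * (z 0 k / z 0 i))) ->
  hd (fun z => rint (fun w => f (subst k i (t * w) z) / (w - t^-1 * (z 0 k / z 0 i))) a b c d) z.
Proof.
move=> ki t0 ab cd r0 e0 H far.
have b1 x : a <= x <= b -> bdry a b c d (x +i* c).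
  by move=> xab; split; rewrite /= ?lexx//; apply: Or43.
have b2 x : a <= x <= b -> bdry a b c d (x +i* d).
  by move=> xab; split; rewrite /= ?lexx ?cd//; apply: Or44.
have b3 x : c <= x <= d -> bdry a b c d (a +i* x).
  by move=> xab; split; rewrite /= ?lexx//; apply: Or41.
have b4 x : c <= x <= d -> bdry a b c d (b +i* x).
  by move=> xab; split; rewrite /= ?lexx ?ab//; apply: Or42.
have gh y F x : ccont F (x +i* y) -> rcont (fun x => F (x +i* y)) x := @ccont_h R F x y.
have gv y F x : ccont F (y +i* x) -> rcont (fun x => F (y +i* x)) x := @ccont_v R F y x.
pose K z w := f (subst k i (t * w) z) / (w - t^-1 * (z 0 k / z 0 i)).
have k1 := @hd_kernel f k i t (fun x => x +i* c) a b z r M e ki t0 ab r0 e0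
  (fun F x _ => gh c F x) (fun z' x zr xab => H z' _ zr (b1 x xab)) (fun x xab => far _ (b1 x xab)).
have k2 := @hd_kernel f k i t (fun x => x +i* d) a b z r M e ki t0 ab r0 e0
  (fun F x _ => gh d F x) (fun z' x zr xab => H z' _ zr (b2 x xab)) (fun x xab => far _ (b2 x xab)).
have k3 := @hd_kernel f k i t (fun x => a +i* x) c d z r M e ki t0 cd r0 e0
  (fun F x _ => gv a F x) (fun z' x zr xab => H z' _ zr (b3 x xab)) (fun x xab => far _ (b3 x xab)).
have k4 := @hd_kernel f k i t (fun x => b +i* x) c d z r M e ki t0 cd r0 e0
  (fun F x _ => gv b F x) (fun z' x zr xab => H z' _ zr (b4 x xab)) (fun x xab => far _ (b4 x xab)).
have zz : vn (z - z) < r by rewrite subrr vn0.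
have aa : a <= a <= b by rewrite lexx.
have Ud : hd (fun z => t^-1 * (z 0 k / z 0 i)) z.
  by apply: hdZ; apply: hd_ratio; have [] := H z _ zz (b1 a aa).
have [s s0 Hs] := hd_cont Ud e0.
have [q [q0 q1 q2]] := pos_min r0 s0.
apply: (hd_near q0 _ (hdD (hdB k1 k2) (hdZ 'i (hdB k4 k3)))).
move=> z' zq.
have Kc w : bdry a b c d w -> ccont (K z') w.
  move=> bw; have [zi fd _] := H z' w (lt_le_trans zq q1) bw.
  apply: cdiff_cont; apply: cdiff_div.
    by apply: (@cdiff_comp_affine (fun w => f (subst k i w z'))) => //; exact: cdiff_subst.
  apply/eqP => wU; have := Hs (z' - z) (lt_le_trans zq q2).
  by rewrite [z + _]addrC subrK -wU ltNge far.
rewrite /rint !ciB// => x xab.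
- exact/(gv b (K z'))/Kc/b4.
- exact/(gv a (K z'))/Kc/b3.
- exact/(gh c (K z'))/Kc/b1.
- exact/(gh d (K z'))/Kc/b2.
Qed.

End HdTools.

(** * Cauchy's formula outside a square; Laurent parts in one variable *)

Section Exterior.
Variable R : realType.
Local Notation C := R[i].
Local Notation kappa := (kappa R).
Implicit Types (F f : C -> C) (w : C).

Section Strips.
Variables (F : C -> C) (a b c d a' b' c' d' : R).
Hypotheses (aa : a <= a') (ab : a' <= b') (bb : b' <= b) (cc : c <= c') (cd : c' <= d') (dd : d' <= d).

Let inner w := a' < Re w < b' /\ c' < Im w < d'.

Let segs w0 : (forall w, a <= Re w <= b -> c <= Im w <= d -> ~ inner w -> w != w0 -> cdiff F w) ->
  (forall y p q, a <= p -> q <= b -> c <= y -> y <= d -> (y <= c') || (d' <= y) ->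
     y != Im w0 -> hseg F p q y) /\
  (forall y p q, c <= p -> q <= d -> a <= y -> y <= b -> (y <= a') || (b' <= y) ->
     y != Re w0 -> vseg F y p q).
Proof.
move=> H; split=> y p q pp qq y1 y2 ny yw.
  apply: ccont_hseg => x /andP[x1 x2]; apply/cdiff_cont/H => /=.
  - by rewrite (le_trans pp x1) (le_trans x2 qq).
  - by rewrite y1.
  - by case=> _ /= /andP[? ?]; move: ny; rewrite !leNgt => /orP[/negP|/negP]; apply.
  - by apply/eqP => h; move: yw; rewrite -h eqxx.
apply: ccont_vseg => x /andP[x1 x2]; apply/cdiff_cont/H => /=.
- by rewrite y1.
- by rewrite (le_trans pp x1) (le_trans x2 qq).
- by case=> /= /andP[? ?] _; move: ny; rewrite !leNgt => /orP[/negP|/negP]; apply.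
- by apply/eqP => h; move: yw; rewrite -h eqxx.
Qed.

Let D w0 := forall w, a <= Re w <= b -> c <= Im w <= d -> ~ inner w -> w != w0 -> cdiff F w.

Let cd' : c' <= d := le_trans cd dd.
Let cc' : c <= d' := le_trans cc cd.
Let ab' : a' <= b := le_trans ab bb.
Let aa' : a <= b' := le_trans aa ab.
Let le_ab : a <= b := le_trans aa' bb.
Let le_cd : c <= d := le_trans cc' dd.

(** A pole above the inner rectangle is isolated in a horizontal strip; what is left is a frame, to
    which [rint_nest] applies. The next three lemmas treat the other positions of the pole. *)
Lemma strip_top w0 : D w0 -> a < Re w0 < b -> d' < Im w0 < d ->
  rint F a b c d = rint F a' b' c' d' + rint F a b d' d.
Proof.
move=> H /andP[w1 w2] /andP[w3 w4]; have [hs vs] := segs H.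
rewrite (@rint_splity _ F a b c d' d) //.
- congr (_ + _); apply: rint_nest => // w /andP[x1 x2] /andP[x3 x4] nw; apply: H => //.
  + by rewrite x1.
  + by rewrite x3 (le_trans x4).
  + by apply/eqP => h; move: w3; rewrite -h ltNge x4.
- by apply: hs; rewrite ?lexx ?cc // lt_eqF// (le_lt_trans cc').
- by apply: hs; rewrite ?lexx ?orbT // lt_eqF.
- by apply: hs; rewrite ?lexx ?dd ?orbT // gt_eqF.
- by apply: vs; rewrite ?lexx ?aa // lt_eqF.
- by apply: vs; rewrite ?lexx ?bb ?orbT // gt_eqF.
Qed.

Lemma strip_bottom w0 : D w0 -> a < Re w0 < b -> c < Im w0 < c' ->
  rint F a b c d = rint F a' b' c' d' + rint F a b c c'.
Proof.
move=> H /andP[w1 w2] /andP[w3 w4]; have [hs vs] := segs H.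
rewrite (@rint_splity _ F a b c c' d) //.
- rewrite addrC; congr (_ + _); apply: rint_nest => // w /andP[x1 x2] /andP[x3 x4] nw; apply: H => //.
  + by rewrite x1.
  + by rewrite x4 (le_trans cc).
  + by apply/eqP => h; move: w4; rewrite -h ltNge x3.
- by apply: hs; rewrite ?lexx ?cc // lt_eqF.
- by apply: hs; rewrite ?lexx // gt_eqF.
- by apply: hs; rewrite ?lexx ?dd ?orbT // gt_eqF// (lt_le_trans w4).
- by apply: vs; rewrite ?lexx ?aa // lt_eqF.
- by apply: vs; rewrite ?lexx ?bb ?orbT // gt_eqF.
Qed.

Lemma strip_right w0 : D w0 -> b' < Re w0 < b -> c < Im w0 < d ->
  rint F a b c d = rint F a' b' c' d' + rint F b' b c d.
Proof.
move=> H /andP[w1 w2] /andP[w3 w4]; have [hs vs] := segs H.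
rewrite (@rint_splitx _ F a b' b c d) //.
- congr (_ + _); apply: rint_nest => // w /andP[x1 x2] /andP[x3 x4] nw; apply: H => //.
  + by rewrite x1 (le_trans x2).
  + by rewrite x3.
  + by apply/eqP => h; move: w1; rewrite -h ltNge x2.
- by apply: hs; rewrite ?lexx ?cc // lt_eqF.
- by apply: hs; rewrite ?lexx ?dd ?orbT // gt_eqF.
- by apply: vs; rewrite ?lexx ?aa // lt_eqF// (le_lt_trans aa').
- by apply: vs; rewrite ?lexx ?orbT // lt_eqF.
- by apply: vs; rewrite ?lexx ?bb ?orbT // gt_eqF.
Qed.

Lemma strip_left w0 : D w0 -> a < Re w0 < a' -> c < Im w0 < d ->
  rint F a b c d = rint F a' b' c' d' + rint F a a' c d.
Proof.
move=> H /andP[w1 w2] /andP[w3 w4]; have [hs vs] := segs H.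
rewrite (@rint_splitx _ F a a' b c d) //.
- rewrite addrC; congr (_ + _); apply: rint_nest => // w /andP[x1 x2] /andP[x3 x4] nw; apply: H => //.
  + by rewrite x2 (le_trans aa).
  + by rewrite x3.
  + by apply/eqP => h; move: w2; rewrite -h ltNge x1.
- by apply: hs; rewrite ?lexx ?cc // lt_eqF.
- by apply: hs; rewrite ?lexx ?dd ?orbT // gt_eqF.
- by apply: vs; rewrite ?lexx ?aa // lt_eqF.
- by apply: vs; rewrite ?lexx // gt_eqF.
- by apply: vs; rewrite ?lexx ?bb ?orbT // gt_eqF// (lt_le_trans w2).
Qed.

End Strips.

Definition outq (q : R) w := ~ (- q < Re w < q /\ - q < Im w < q).

Lemma outqP q w : outq q w -> q <= normc w.
Proof.
move=> ow; rewrite leNgt; apply/negP => wq; apply: ow.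
have := normc_ge_Re_r w; have := normc_ge_Im_r w; rewrite !ler_norml.
by move: wq; clear; move: (normc w) => u ? ? ?; split; lra.
Qed.

(* The boundary values on two concentric squares recover [f] in between. *)
Lemma cauchy_annulus f q S w : 0 < q -> 2 * q < normc w -> normc w < S ->
  (forall v, - S <= Re v <= S -> - S <= Im v <= S -> outq q v -> cdiff f v) ->
  sqint S (fun v => f v / (v - w)) - sqint q (fun v => f v / (v - w)) = kappa * f w.
Proof.
move=> q0 qw wS H.
have q2 : - q <= q by lra.
have qS : q <= S by lra.
have Sq : - S <= - q by lra.
have w1 : - S < Re w < S by have := normc_ge_Re_r w; rewrite ler_norml; lra.
have w2 : - S < Im w < S by have := normc_ge_Im_r w; rewrite ler_norml; lra.
have F v : - S <= Re v <= S -> - S <= Im v <= S -> outq q v -> v != w ->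
   cdiff (fun v => f v / (v - w)) v.
  by move=> h1 h2 h3 h4; apply: cdiff_div => //; exact: H.
have out : [\/ q < Im w, Im w < - q, q < Re w | Re w < - q].
  have := normc_le_parts w; move: w1 w2 => _ _ hw.
  have [h|h1] := ltP q (Im w); first exact: Or41.
  have [h|h2] := ltP (Im w) (- q); first exact: Or42.
  have [h|h3] := ltP q (Re w); first exact: Or43.
  apply: Or44; rewrite ltNge; apply/negP => h4.
  have i1 : `|Re w| <= q by rewrite ler_norml h4.
  have i2 : `|Im w| <= q by rewrite ler_norml h2.
  lra.
rewrite /sqint; case: out => h.
- have h' : q < Im w < S by lra.
  rewrite (strip_top Sq q2 qS Sq q2 qS F w1 h') addrAC subrr add0r.
  by apply: cauchy => // v v1 v2; apply: H => //; [lra|move=> [_]; lra].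
- have h' : - S < Im w < - q by lra.
  rewrite (strip_bottom Sq q2 qS Sq q2 qS F w1 h') addrAC subrr add0r.
  by apply: cauchy => // v v1 v2; apply: H => //; [lra|move=> [_]; lra].
- have h' : q < Re w < S by lra.
  rewrite (strip_right Sq q2 qS Sq q2 qS F h' w2) addrAC subrr add0r.
  by apply: cauchy => // v v1 v2; apply: H => //; [lra|move=> [+ _]; lra].
- have h' : - S < Re w < - q by lra.
  rewrite (strip_left Sq q2 qS Sq q2 qS F h' w2) addrAC subrr add0r.
  by apply: cauchy => // v v1 v2; apply: H => //; [lra|move=> [+ _]; lra].
Qed.

Definition vanishes f := forall e : R, 0 < e -> exists B : R, forall w, B <= normc w -> normc (f w) <= e.

(** The contour has length of order [S] and the kernel is of order [1/S], so the decay of [f]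
    decides. *)
Lemma sq_vanish f r' w e : 0 < e -> (forall v, r' < normc v -> cdiff f v) -> vanishes f ->
  exists S0 : R, forall S, S0 <= S -> 2 * normc w < S -> 0 < S ->
   normc (sqint S (fun v => f v / (v - w))) <= e.
Proof.
move=> e0 fd fv; have e32 : 0 < e / 32 by lra.
have [B HB] := fv _ e32; exists (`|B| + `|r'| + 1) => S SB wS S0.
have Br : B <= S /\ r' < S.
  have := ler_norm B; have := ler_norm r'; have := normr_ge0 B; have := normr_ge0 r'.
  by move: SB; clear; split; lra.
apply: (@le_trans _ _ (16 * (e / 32 * (S / 2)^-1) * S)); last first.
  by rewrite le_eqVlt; apply/orP; left; apply/eqP; field; rewrite gt_eqF.
apply: sq_bound => // v bv; have [Sv v0 vt] := sq_bdry S0 bv.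
have [|vw1 vw2] := vt w; first by move: wS; clear; lra.
split; first by apply: cdiff_div => //; apply: fd; apply: lt_le_trans Sv; case: Br.
apply: normcM_le; first by apply: HB; apply: le_trans Sv; case: Br.
by rewrite normcV lef_pV2 ?posrE//; move: vw1 S0; clear; lra.
Qed.

(** The contour can be pushed to infinity without meeting a pole. *)
Lemma cauchy_ext0 f r' q w : 0 < q -> r' < q -> normc w < q ->
  (forall v, r' < normc v -> cdiff f v) -> vanishes f ->
  sqint q (fun v => f v / (v - w)) = 0.
Proof.
move=> q0 rq wq fd fv; apply/eqP; rewrite -normc_eq0 eq_le normc_ge0 andbT.
apply/ler_addgt0Pl => e e0; rewrite addr0.
have [S0 HS] := sq_vanish w e0 fd fv.
pose S := `|S0| + 2 * q + 2 * normc w + 1.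
have [s1 s2 s3 s4] : [/\ S0 <= S, 2 * normc w < S, 0 < S & q <= S].
  rewrite /S; have := ler_norm S0; have := normr_ge0 S0; have := normc_ge0 w; move: q0; clear.
  by move: (normc w) (`|S0|) => a b; split; lra.
apply: le_trans (HS S s1 s2 s3); rewrite /sqint.
rewrite -(@rint_nest _ (fun v => f v / (v - w)) (- S) S (- S) S (- q) q (- q) q) //;
  try (by rewrite lerN2); try (by move: q0; clear; lra).
move=> v v1 v2 /outqP qv; apply: cdiff_div; first by apply: fd; exact: lt_le_trans qv.
by apply/eqP => h; move: wq; rewrite -h ltNge qv.
Qed.

(** The limit of [cauchy_annulus] as the outer square goes to infinity. *)
Lemma cauchy_ext f r' q w : 0 < q -> r' < q -> 2 * q < normc w ->
  (forall v, r' < normc v -> cdiff f v) -> vanishes f ->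
  kappa * f w = - sqint q (fun v => f v / (v - w)).
Proof.
move=> q0 rq wq fd fv; apply/eqP; rewrite -subr_eq0 opprK -normc_eq0 eq_le normc_ge0 andbT.
apply/ler_addgt0Pl => e e0; rewrite addr0.
have [S0 HS] := sq_vanish w e0 fd fv.
pose S := `|S0| + 2 * normc w + 1.
have [s1 s2 s3 s4] : [/\ S0 <= S, 2 * normc w < S, 0 < S & normc w < S].
  rewrite /S; have := ler_norm S0; have := normr_ge0 S0; have := normc_ge0 w; clear.
  by move: (normc w) (`|S0|) => a b; split; lra.
have := HS S s1 s2 s3; rewrite -(@cauchy_annulus f q S w) ?subrK// => v v1 v2 /outqP qv.
by apply: fd; exact: lt_le_trans qv.
Qed.

Definition KL : R := 1 + 32 / normc kappa + 16 * (2 + 32 / normc kappa) / normc kappa.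

Lemma KL_gt0 : 0 < KL.
Proof.
by rewrite /KL addr_gt0 ?addr_gt0 ?divr_gt0 ?mulr_gt0 ?addr_gt0 ?divr_gt0 ?nkappa_gt0.
Qed.

(* A bounded sum of an interior and a decaying exterior part has both parts bounded. *)
Lemma laurent_parts (fp fm : C -> C) (r' r e : R) : 32 * r' < r -> 0 < r -> 0 <= e ->
  (forall w, normc w < r -> cdiff fp w) -> (forall w, r' < normc w -> cdiff fm w) ->
  vanishes fm ->
  (forall w, r' < normc w -> normc w < r -> normc (fp w + fm w) <= e) ->
  (forall w, normc w < r -> normc (fp w) <= KL * e) /\
  (forall w, r' < normc w -> normc (fm w) <= KL * e).
Proof.
move=> rr r0 e0 fpd fmd fmv H; have k0 := nkappa_gt0 R.
pose A := 32 / normc kappa; have A0 : 0 < A by rewrite divr_gt0.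
pose B := 16 * (2 + A) / normc kappa.
have B0 : 0 < B by rewrite divr_gt0// mulr_gt0// addr_gt0.
have KLE : KL * e = e + A * e + B * e by rewrite /KL -/A -/B; ring.
have [Ae Be] : 0 <= A * e /\ 0 <= B * e by split; rewrite mulr_ge0// ltW.
have q0 : 0 < r / 4 by lra.
have rq : r' < r / 4 by lra.
(* For small [w], Cauchy's formula on the square of half-side [r / 4] recovers [fp] from the sum,
   because the exterior part contributes 0 by [cauchy_ext0]. *)
have small w : normc w <= r / 8 -> normc (fp w) <= A * e.
  move=> wr.
  have in1 : - (r / 4) < Re w < r / 4.
    by have := normc_ge_Re_r w; rewrite ler_norml; move: wr r0; clear; lra.
  have in2 : - (r / 4) < Im w < r / 4.
    by have := normc_ge_Im_r w; rewrite ler_norml; move: wr r0; clear; lra.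
  have fpd' v : - (r / 4) <= Re v <= r / 4 -> - (r / 4) <= Im v <= r / 4 -> cdiff fp v.
    move=> v1 v2; apply: fpd; apply: le_lt_trans (normc_le_parts _) _.
    apply: (@le_lt_trans _ _ (r / 4 + r / 4)); last by move: r0; clear; lra.
    by apply: lerD; rewrite ler_norml.
  have wq : normc w < r / 4 by move: wr r0; clear; lra.
  have E1 := cauchy in1 in2 fpd'; have E2 := cauchy_ext0 q0 rq wq fmd fmv.
  have SS : - (r / 4) <= r / 4 by move: r0; clear; lra.
  have wh : normc w <= r / 4 / 2 by move: wr; clear; lra.
  have bd v : bdry (- (r / 4)) (r / 4) (- (r / 4)) (r / 4) v ->
     [/\ cdiff fp v, cdiff fm v, r / 4 / 2 <= normc (v - w), v != w & normc (fp v + fm v) <= e].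
    move=> bv; have [vq v0 vt] := sq_bdry q0 bv; have [h1 h2] := vt w wh.
    have vr : normc v < r.
      have [w1 w2 _] := bv; apply: le_lt_trans (normc_le_parts _) _.
      apply: (@le_lt_trans _ _ (r / 4 + r / 4)); last by move: r0; clear; lra.
      by apply: lerD; rewrite ler_norml.
    have vr' : r' < normc v by exact: lt_le_trans vq.
    by split=> //; [exact: fpd|exact: fmd|exact: H].
  have E : kappa * fp w = sqint (r / 4) (fun v => (fp v + fm v) / (v - w)).
    rewrite -[LHS]addr0 -E1 -E2 /sqint -cdiff_rintD//.
      by apply: eq_rint => // v _ _ _; rewrite mulrDl.
    by move=> v /bd[b1 b2 b3 b4 _]; split; exact: cdiff_div.
  have : normc (kappa * fp w) <= 16 * (e * (r / 4 / 2)^-1) * (r / 4).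
    rewrite E; apply: sq_bound => // v /bd[b1 b2 b3 b4 b5]; split.
      by apply: cdiff_div => //; exact: cdiffD.
    apply: normcM_le => //; rewrite normcV lef_pV2 ?posrE//.
      by rewrite normc_gt0 subr_eq0.
    by move: r0; clear; lra.
  rewrite normcM mulrC -ler_pdivlMr// => h; apply: le_trans h _.
  rewrite le_eqVlt; apply/orP; left; apply/eqP; rewrite /A; field.
  by rewrite gt_eqF//= gt_eqF.
have mid w : r' < normc w -> normc w <= r / 8 -> normc (fm w) <= e + A * e.
  move=> w1 w2; have -> : fm w = (fp w + fm w) - fp w by ring.
  by apply: normcB_le; [apply: H => //; move: w2 r0; clear; lra|exact: small].
have p0 : 0 < r / 32 by move: r0; clear; lra.
have rp : r' < r / 32 by move: rr; clear; lra.
(* Far out, [fm] is recovered by [cauchy_ext] from the square of half-side [r / 32], on which [mid]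
   bounds it. *)
have big w : r / 8 <= normc w -> normc (fm w) <= B * e.
  move=> wr.
  have wq : 2 * (r / 32) < normc w by move: wr r0; clear; lra.
  have E := cauchy_ext p0 rp wq fmd fmv.
  have : normc (kappa * fm w) <= 16 * ((e + A * e) * (r / 32)^-1) * (r / 32).
    rewrite E normcN; apply: sq_bound => // v bv; have [vq v0 vt] := sq_bdry p0 bv.
    have vr : normc v <= r / 16.
      have [w1 w2 _] := bv; apply: le_trans (normc_le_parts _) _.
      apply: (@le_trans _ _ (r / 32 + r / 32)); last by move: r0; clear; lra.
      by apply: lerD; rewrite ler_norml.
    have vw : r / 32 <= normc (v - w).
      have := le_normcD (w - v) v; rewrite subrK normcB.
      by move: vr wr r0; clear; move: (normc (v - w)) => u; lra.
    have vr' : r' < normc v by exact: lt_le_trans vq.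
    split.
      apply: cdiff_div; first exact: fmd.
      by apply/eqP => h; move: vw; rewrite h subrr normc0; move: p0; clear; lra.
    apply: normcM_le; first by apply: mid => //; move: vr r0; clear; lra.
    by rewrite normcV lef_pV2 ?posrE//; exact: lt_le_trans vw.
  rewrite normcM mulrC -ler_pdivlMr// => h; apply: le_trans h _.
  rewrite (_ : 16 * _ * _ / _ = 16 * (e + A * e) / normc kappa); last first.
    by field; rewrite gt_eqF//= gt_eqF.
  have -> : B * e = 16 * (2 * e + A * e) / normc kappa by rewrite /B; ring.
  rewrite ler_pM2r ?invr_gt0//.
  by move: Ae e0; clear; lra.
split=> w wr; rewrite KLE.
  have [h|h] := leP (normc w) (r / 8).
    by apply: le_trans (small w h) _; move: e0 Be; clear; lra.
  have -> : fp w = (fp w + fm w) - fm w by ring.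
  apply: le_trans (normcB_le (H w _ wr) (big w (ltW h))) _; first by move: h rr r0; clear; lra.
  by move: Ae; clear; lra.
have [h|h] := leP (normc w) (r / 8).
  by apply: le_trans (mid w wr h) _; move: Be; clear; lra.
by apply: le_trans (big w (ltW h)) _; move: e0 Ae; clear; lra.
Qed.

End Exterior.

(** * Cones over enlarged standard charts, and homogeneous functions on them *)

Section Cones.
Variables (R : realType) (n : nat).
Local Notation C := R[i].
Local Notation V := 'rV[C]_n.
Local Notation kappa := (kappa R).
Implicit Types (f g : V -> C) (z h : V) (w u : C).

(** Any factor above 1 would give a cover of [V] minus the origin; 32 is the ratio of radii that
    [laurent_parts] asks for. *)
Definition om (i : 'I_n) : set V := [set z | forall j, normc (z 0 j) < 32 * normc (z 0 i)].

Definition omx (k i : 'I_n) : set V :=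
  [set z | forall j, j != k -> normc (z 0 j) < 32 * normc (z 0 i)].

Definition put (k : 'I_n) (u : C) z : V := \row_j (if j == k then u else z 0 j).

Lemma om_omx k i z : om i z -> omx k i z.
Proof. by move=> H j _. Qed.

Lemma omx_gt0 k i z : k != i -> omx k i z -> 0 < normc (z 0 i).
Proof.
move=> ki /(_ i); rewrite eq_sym => /(_ ki); have := normc_ge0 (z 0 i).
by move: (normc _) => a; lra.
Qed.

Lemma om_gt0 i z : om i z -> 0 < normc (z 0 i).
Proof. by move=> /(_ i); have := normc_ge0 (z 0 i); move: (normc _) => a; lra. Qed.

Lemma lip_coord z z' j : normc (z' 0 j) <= normc (z 0 j) + vn (z' - z).
Proof.
have -> : z' 0 j = z 0 j + (z' - z) 0 j by rewrite !mxE addrCA subrr addr0.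
by apply: normcD_le => //; exact: normc_le_vn.
Qed.

Lemma opn_lt (a b : R) (i j : 'I_n) : 0 <= a -> 0 <= b ->
  opn [set z : V | a * normc (z 0 j) < b * normc (z 0 i)].
Proof.
move=> a0 b0 z /= H; have ab : 0 < a + b + 1 by lra.
exists ((b * normc (z 0 i) - a * normc (z 0 j)) / (a + b + 1)).
  by rewrite divr_gt0// subr_gt0.
move=> z'; rewrite ltr_pdivlMr// => zz.
have h1 := lip_coord z z' j; have h2 := lip_coord z' z i.
rewrite -opprB vnN in h2.
move: (normc (z 0 i)) (normc (z 0 j)) (normc (z' 0 i)) (normc (z' 0 j)) (vn (z' - z)) (vn_ge0 (z' - z)) h1 h2 zz H.
move=> p q p' q' v v0 h1 h2 zz H.
have := ler_wpM2l a0 h1; have := ler_wpM2l b0 h2; lra.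
Qed.

Lemma opn_fin (J : finType) (U : J -> set V) : (forall j, opn (U j)) ->
  opn [set z | forall j, U j z].
Proof.
move=> H z Uz; have [r Hr] := choice (fun j => let: ex_intro2 r r0 Hr := H j z (Uz j) in
  ex_intro (fun r => 0 < r /\ forall z', vn (z' - z) < r -> U j z') r (conj r0 Hr)).
have [s s0 Hs] := fin_min (fun j => (Hr j).1).
exists s => // z' zz j; apply: (Hr j).2; exact: lt_le_trans zz (Hs j).
Qed.

Lemma om_open i : opn (om i).
Proof.
apply: opn_fin => j; have := @opn_lt 1 32 i j ler01 (ler0n _ _).
by congr opn; apply/funext => z; rewrite /= mul1r.
Qed.

Lemma omx_open k i : opn (omx k i).
Proof.
rewrite (_ : omx k i = [set z | forall j : {j | j != k}, normc (z 0 (val j)) < 32 * normc (z 0 i)]).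
  apply: opn_fin => j; have := @opn_lt 1 32 i (val j) ler01 (ler0n _ _).
  by congr opn; apply/funext => z; rewrite /= mul1r.
by apply/funext => z; apply/propext; split => [H [j jk]|H j jk]; [exact: H|exact: (H (exist _ j jk))].
Qed.

Lemma subst_put k i w u z : k != i -> subst k i w (put k u z) = subst k i w z.
Proof.
move=> ki; apply/rowP => j; rewrite !mxE; case: (eqVneq j k) => // _.
by rewrite eq_sym (negPf ki).
Qed.

Lemma put_id k z : put k (z 0 k) z = z.
Proof. by apply/rowP => j; rewrite mxE; case: eqP => [->|]. Qed.

Lemma put_line k u z : put k u z = put k 0 z + u *: ek R k.
Proof.
apply/rowP => j; rewrite !mxE; case: (eqVneq j k) => jk.
  by rewrite mulr1 add0r.
by rewrite andbF mulr0 addr0.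
Qed.

Lemma cdiff_put f k u z : hd f (put k u z) -> cdiff (fun u => f (put k u z)) u.
Proof.
move=> fd; rewrite (_ : (fun u => _) = fun u => f (put k 0 z + u *: ek R k)).
  by apply: hd_line; rewrite -put_line.
by apply/funext => w'; rewrite -put_line.
Qed.

Lemma subst_in k i w z : k != i -> omx k i z -> 1 <= normc w -> normc w < 32 ->
  (om k `&` om i) (subst k i w z).
Proof.
move=> ki zi w1 w32; have zp := omx_gt0 ki zi.
have ik : (i == k) = false by rewrite eq_sym (negPf ki).
split=> j; rewrite !mxE ?eqxx ?ik; case: (eqVneq j k) => jk; rewrite ?normcM.
- by have := mulr_gt0 (lt_le_trans ltr01 w1) zp; lra.
- apply: lt_le_trans (zi j jk) _; rewrite ler_pM2l//.
  by rewrite ler_peMl ?(ltW zp).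
- by rewrite ltr_pM2r.
- exact: zi.
Qed.

(** A holomorphic section of [O(d)] over the image of the cone [U] in projective space, with
    supremum norm at most [M]. *)
Definition sec (U : set V) (d : nat) (M : R) f := [/\ forall z, U z -> hd f z,
  forall z (a : C), U z -> a != 0 -> f (a *: z) = a ^+ d * f z &
  forall z, U z -> normc (f z) <= M * vn z ^+ d].

(** The radius beyond which replacing the [k]-th coordinate by [u] gives a point of [om k]. *)
Definition lowr (k : 'I_n) z : R := (\big[Num.max/0]_(j | j != k) normc (z 0 j)) / 32.

Lemma lowr_lt k z (u : R) : lowr k z < u -> forall j, j != k -> normc (z 0 j) < 32 * u.
Proof.
rewrite /lowr ltr_pdivrMr// mulrC => H j jk; apply: le_lt_trans H.
exact: (le_bigmax_cond _ (fun j => normc (z 0 j))).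
Qed.

Lemma lt_lowr k z (u : R) : 0 < u -> (forall j, j != k -> normc (z 0 j) < 32 * u) -> lowr k z < u.
Proof.
move=> u0 H; rewrite /lowr ltr_pdivrMr// mulrC; apply/bigmax_ltP; split=> //.
by rewrite mulr_gt0.
Qed.

(** On each line in the direction [e_k], [r] consists of the negative powers in a Laurent expansion:
    it continues to infinity and vanishes there. *)
Definition negpart (k i : 'I_n) (r : V -> C) := forall z, om i z ->
  exists phi : C -> C, [/\ forall u, lowr k z < normc u -> cdiff phi u,
    forall u, (om k `&` om i) (put k u z) -> phi u = r (put k u z) & vanishes phi].

End Cones.

(** * Laurent splitting in one homogeneous coordinate *)

Section Split.
Variables (R : realType) (n : nat).
Local Notation C := R[i].
Local Notation V := 'rV[C]_n.
Local Notation kappa := (kappa R).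

Definition KS (d : nat) : R := (1 + 64 / normc kappa) * 17 ^+ d.

Lemma KS_gt0 d : 0 < KS d.
Proof. by rewrite mulr_gt0 ?exprn_gt0// addr_gt0// divr_gt0// nkappa_gt0. Qed.

(** Laurent splitting in [w = z_k / z_i], which runs over an annulus on [om k] and [om i]. The
    nonnegative part [g] is a Cauchy integral over a large square, the negative part minus the one
    over a small square. The squares have half-sides 8 and 2, hence lie in [2 <= |w| <= 16]; this
    accounts for the factor [17 ^+ d] in [KS]. *)
Lemma split_neg (k i : 'I_n) (d : nat) (f : V -> C) (M : R) : k != i -> 0 <= M -> sec (om k `&` om i) d M f ->
  exists g, sec (om i) d (KS d * M) g /\ negpart k i (fun z => f z - g z).
Proof.
move=> ki M0 [fd fh fb]; have k0 := nkappa_gt0 R.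
(* The factors 1 and [1^-1] match [hd_rint_kernel], which allows a rotated coordinate. *)
pose T q z : C := kappa^-1 * rint (fun w => f (subst k i (1 * w) z) / (w - 1^-1 * (z 0 k / z 0 i)))
  (- q) q (- q) q.
have cont (q : R) (w : C) : 0 < q -> bdry (- q) q (- q) q w -> q <= normc w <= 2 * q.
  move=> q0 bw; have [-> _ _] := sq_bdry q0 bw; have [h1 h2 _] := bw => /=.
  by apply: le_trans (normc_le_parts _) _; rewrite mulr_natl mulr2n; apply: lerD; rewrite ler_norml.
have inq (q : R) (w : C) (z : V) : 1 <= q <= 8 -> omx k i z -> bdry (- q) q (- q) q w ->
    (om k `&` om i) (subst k i (1 * w) z).
  move=> /andP[q1 q8] zi bw; rewrite mul1r.
  have /andP[w1 w2] := cont q w (lt_le_trans ltr01 q1) bw.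
  by apply: subst_in => //; [exact: le_trans w1|move: w2 q8; clear; lra].
have vs (q : R) (w : C) (z : V) : 1 <= q <= 8 -> bdry (- q) q (- q) q w -> vn (subst k i (1 * w) z) <= 17 * vn z.
  move=> /andP[q1 q8] bw; have /andP[w1 w2] := cont q w (lt_le_trans ltr01 q1) bw.
  have w16 : normc w <= 16 by move: w2 q8; clear; lra.
  rewrite mul1r subst_line//; apply: le_trans (vnD _ _) _.
  have -> : 17 * vn z = vn z + 16 * vn z by ring.
  apply: lerD.
    by apply: ler_sum => j _; rewrite mxE; case: eqP => // _; rewrite mul0r normc0 normc_ge0.
  rewrite !vnZ vn_ek mulr1; apply: ler_pM; rewrite ?normc_ge0//.
  exact: normc_le_vn.
have fsub (q : R) (w : C) (z : V) : 1 <= q <= 8 -> omx k i z -> bdry (- q) q (- q) q w ->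
    normc (f (subst k i (1 * w) z)) <= M * 17 ^+ d * vn z ^+ d.
  move=> q8 zi bw; apply: le_trans (fb _ (inq q w z q8 zi bw)) _.
  rewrite -mulrA ler_wpM2l// -exprMn; apply: lerXn2r; rewrite ?nnegrE ?vn_ge0//.
    by rewrite mulr_ge0// vn_ge0.
  exact: vs bw.
have q8 : 1 <= (8 : R) <= 8 by rewrite lexx andbT ler1n.
have q2 : 1 <= (2 : R) <= 8 by rewrite ler1n ler_nat.
have Thd (q : R) (z : V) (e : R) : 1 <= q <= 8 -> omx k i z -> 0 < e ->
    (forall w, bdry (- q) q (- q) q w -> e <= normc (w - 1^-1 * (z 0 k / z 0 i))) -> hd (T q) z.
  move=> qq zi e0 far; apply: hdZ.
  have [r r0 Hr] := omx_open zi.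
  have q0 : 0 < q by case/andP: qq => ? _; exact: lt_le_trans ltr01 _.
  have qN : - q <= q by move: q0; clear; lra.
  have [s s0 Hs] : exists2 s, 0 < s & forall z', vn (z' - z) < s -> vn z' <= vn z + 1.
    exists 1 => // z' zz; rewrite -[z'](subrK z) addrC; apply: le_trans (vnD _ _) _.
    by rewrite lerD2l ltW.
  have [p [p0 p1 p2]] := pos_min r0 s0.
  apply: (@hd_rint_kernel _ _ f k i 1 (- q) q (- q) q z p (M * 17 ^+ d * (vn z + 1) ^+ d) e) => //.
  move=> z' w zz bw; have zi' := Hr _ (lt_le_trans zz p1); split.
  - by rewrite -normc_gt0; exact: omx_gt0 zi'.
  - exact: fd (inq _ _ _ qq zi' bw).
  - apply: le_trans (fsub _ _ _ qq zi' bw) _; rewrite ler_wpM2l ?mulr_ge0 ?exprn_ge0//.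
    apply: lerXn2r; rewrite ?nnegrE ?vn_ge0//; first by rewrite addr_ge0 ?vn_ge0.
    exact: Hs (lt_le_trans zz p2).
have icd (q : R) (z : V) (w : C) : 1 <= q <= 8 -> omx k i z -> bdry (- q) q (- q) q w -> w != 1^-1 * (z 0 k / z 0 i) ->
    cdiff (fun w => f (subst k i (1 * w) z) / (w - 1^-1 * (z 0 k / z 0 i))) w.
  move=> qq zi bw nw; apply: cdiff_div => //.
  apply: (@cdiff_comp_affine _ (fun w => f (subst k i w z))); first by rewrite oner_eq0.
  by apply: cdiff_subst => //; apply: fd; exact: (inq q w z qq zi bw).
have nU (z : V) : omx k i z -> normc ((1 : C)^-1 * (z 0 k / z 0 i)) = normc (z 0 k) / normc (z 0 i).
  by move=> _; rewrite invr1 mul1r normcM normcV.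
have Tb (q : R) (z : V) (e : R) : 1 <= q <= 8 -> omx k i z -> 0 < e ->
    (forall w, bdry (- q) q (- q) q w -> e <= normc (w - 1^-1 * (z 0 k / z 0 i))) ->
    normc (T q z) <= 16 * q / e / normc kappa * (M * 17 ^+ d * vn z ^+ d).
  move=> qq zi e0 far; rewrite /T normcM normcV mulrC ler_pdivrMr//.
  have q0 : 0 < q by case/andP: qq => ? _; exact: lt_le_trans ltr01 _.
  apply: (@le_trans _ _ (16 * (M * 17 ^+ d * vn z ^+ d * e^-1) * q)).
    apply: (@sq_bound _ q) => // w bw; split.
      apply: (icd _ _ _ qq zi bw); rewrite -subr_eq0 -normc_gt0.
      exact: lt_le_trans (far w bw).
    apply: normcM_le; first exact: fsub bw.
    by rewrite normcV lef_pV2 ?posrE ?far//; apply: lt_le_trans (far w bw).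
  rewrite le_eqVlt; apply/orP; left; apply/eqP; field.
  by rewrite !gt_eqF.
have far8 (z : V) : omx k i z -> normc (z 0 k) < 8 * normc (z 0 i) ->
    forall w : C, bdry (- 8) 8 (- 8) 8 w -> 8 - normc (z 0 k) / normc (z 0 i) <= normc (w - 1^-1 * (z 0 k / z 0 i)).
  move=> zi h w /(cont 8 w (ltr0n _ _))/andP[w8 _]; rewrite -nU//.
  have := le_normcD (w - 1^-1 * (z 0 k / z 0 i)) (1^-1 * (z 0 k / z 0 i)); rewrite subrK.
  by move: w8; clear; move: (normc _) (normc _) (normc _) => a b c; lra.
have far2 (z : V) : omx k i z -> 4 * normc (z 0 i) < normc (z 0 k) ->
    forall w : C, bdry (- 2) 2 (- 2) 2 w -> normc (z 0 k) / normc (z 0 i) - 4 <= normc (w - 1^-1 * (z 0 k / z 0 i)).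
  move=> zi h w /(cont 2 w (ltr0n _ _))/andP[_ w2]; rewrite -nU//.
  have := le_normcD (1^-1 * (z 0 k / z 0 i) - w) w; rewrite subrK normcB.
  by move: w2; clear; move: (normc _) (normc _) (normc _) => a b c; lra.
have in_om (z : V) : omx k i z -> normc (z 0 k) < 32 * normc (z 0 i) -> om i z.
  by move=> zi h j; have [->//|jk] := eqVneq j k; exact: zi.
have in_omk (z : V) : omx k i z -> normc (z 0 i) < normc (z 0 k) -> om k z.
  move=> zi h j; have [->|jk] := eqVneq j k.
    by have := normc_ge0 (z 0 i); move: h; clear; move: (normc _) (normc _) => a b; lra.
  apply: lt_le_trans (zi j jk) _; rewrite ler_pM2l// ltW//.
have glue (z : V) : omx k i z -> 4 * normc (z 0 i) < normc (z 0 k) ->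
    normc (z 0 k) < 8 * normc (z 0 i) -> T 8 z - T 2 z = f z.
  move=> zi h4 h8; have zp := omx_gt0 ki zi.
  have zi0 : z 0 i != 0 by rewrite -normc_gt0.
  rewrite /T -mulrBr; apply: (mulfI (kappa_neq0 R)); rewrite mulVKf ?kappa_neq0//.
  have := @cauchy_annulus R (fun w => f (subst k i (1 * w) z)) 2 8 (1^-1 * (z 0 k / z 0 i)).
  rewrite !invr1 !mul1r substE// /sqint => -> //.
  - by rewrite normcM normcV ltr_pdivlMr//; move: h4; clear; lra.
  - by rewrite normcM normcV ltr_pdivrMr.
  - move=> v v1 v2 ov; apply: (@cdiff_comp_affine _ (fun w => f (subst k i w z))); first by rewrite oner_eq0.
    apply: cdiff_subst => //; apply: fd; rewrite mul1r; apply: subst_in => //.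
      by apply: le_trans (outqP ov); rewrite ler1n.
    apply: le_lt_trans (normc_le_parts _) _.
    by apply: (@le_lt_trans _ _ (8 + 8)); [apply: lerD; rewrite ler_norml|rewrite -natrD ltr_nat].
(* Two formulas for the nonnegative part. They agree for [4 < |w| < 8] by [glue], so each is used
   where its contour stays away from [w]. *)
pose g (z : V) := if normc (z 0 k) < 6 * normc (z 0 i) then T 8 z else f z + T 2 z.
have gE8 (z : V) : omx k i z -> normc (z 0 k) < 8 * normc (z 0 i) -> g z = T 8 z.
  move=> zi h; rewrite /g; case: ltP => // h6.
  have zp := omx_gt0 ki zi.
  by rewrite -(glue z)// ?subrK//; move: h6 zp; clear; lra.
have gE4 (z : V) : omx k i z -> 4 * normc (z 0 i) < normc (z 0 k) -> g z = f z + T 2 z.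
  move=> zi h; rewrite /g; case: ltP => // h6.
  have zp := omx_gt0 ki zi.
  by rewrite -(glue z)// ?subrK//; move: h6 zp; clear; lra.
have o8 : opn [set z : V | omx k i z /\ normc (z 0 k) < 8 * normc (z 0 i)].
  have := opnI (@omx_open R n k i) (@opn_lt R n 1 8 i k ler01 (ler0n _ _)).
  by congr opn; apply/funext => z; rewrite /setI /= mul1r.
have o4 : opn [set z : V | omx k i z /\ 4 * normc (z 0 i) < normc (z 0 k)].
  have := opnI (@omx_open R n k i) (@opn_lt R n 4 1 k i (ler0n _ _) ler01).
  by congr opn; apply/funext => z; rewrite /setI /= mul1r.
have T8d (z : V) : omx k i z -> normc (z 0 k) < 8 * normc (z 0 i) -> hd (T 8) z.
  move=> zi h8; apply: (Thd _ _ _ q8 zi _ (far8 z zi h8)).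
  by rewrite subr_gt0 ltr_pdivrMr// (omx_gt0 ki zi).
have T2d (z : V) : omx k i z -> 4 * normc (z 0 i) < normc (z 0 k) -> hd (T 2) z.
  move=> zi h4; apply: (Thd _ _ _ q2 zi _ (far2 z zi h4)).
  by rewrite subr_gt0 ltr_pdivlMr// (omx_gt0 ki zi).
have gd (z : V) : om i z -> hd g z.
  move=> zi; have zi' := (@om_omx _ _ k _ _ zi); have zp := om_gt0 zi.
  have [h|h] := ltP (normc (z 0 k)) (8 * normc (z 0 i)).
    by apply: (hd_nearU o8 _ _ (T8d z zi' h)) => // z' [h1 h2]; rewrite gE8.
  have h4 : 4 * normc (z 0 i) < normc (z 0 k) by move: h zp; clear; lra.
  apply: (hd_nearU o4 _ _ (hdD (fd z _) (T2d z zi' h4))) => // [z' [h1 h2]|].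
    by rewrite gE4.
  by split=> //; apply: in_omk => //; move: h4 zp; clear; lra.
have Th (q : R) (z : V) (a : C) : 1 <= q <= 8 -> omx k i z -> (exists2 e : R, 0 < e & forall w,
    bdry (- q) q (- q) q w -> e <= normc (w - 1^-1 * (z 0 k / z 0 i))) -> a != 0 ->
    T q (a *: z) = a ^+ d * T q z.
  move=> qq zi [e e0 far] a0; rewrite /T [RHS]mulrCA; congr (_ * _).
  have q0 : 0 < q by case/andP: qq => ? _; exact: lt_le_trans ltr01 _.
  have qN : - q <= q by move: q0; clear; lra.
  rewrite -cdiff_rintZ//; last first.
    move=> w bw; apply: (icd _ _ _ qq zi bw); rewrite -subr_eq0 -normc_gt0.
    exact: lt_le_trans (far w bw).
  apply: eq_rint => // w w1 w2 w3; rewrite mulrA; congr (_ / (_ - _ * _)).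
    rewrite -fh//; last exact: (inq q w z qq zi (And3 w1 w2 w3)).
    congr f; apply/rowP => j; rewrite !mxE; case: ifP => // _; ring.
  by rewrite !mxE invfM mulrACA divff// mul1r.
exists g; split; first split.
- exact: gd.
- move=> z a zi a0; have zi' := (@om_omx _ _ k _ _ zi); have zp := om_gt0 zi.
  have ap : 0 < normc a by rewrite normc_gt0.
  rewrite {1}/g !mxE !normcM mulrCA ltr_pM2l//.
  have [h|h] := ltP (normc (z 0 k)) (6 * normc (z 0 i)).
    have h8 : normc (z 0 k) < 8 * normc (z 0 i) by move: h zp; clear; lra.
    rewrite gE8// Th//; exists (8 - normc (z 0 k) / normc (z 0 i)); last exact: far8.
    by rewrite subr_gt0 ltr_pdivrMr.
  have h4 : 4 * normc (z 0 i) < normc (z 0 k) by move: h zp; clear; lra.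
  rewrite gE4// Th//; last first.
    exists (normc (z 0 k) / normc (z 0 i) - 4); last exact: far2.
    by rewrite subr_gt0 ltr_pdivlMr.
  rewrite fh// ?mulrDr//; split=> //; apply: in_omk => //; move: h4 zp; clear; lra.
- move=> z zi; have zi' := (@om_omx _ _ k _ _ zi); have zp := om_gt0 zi; have v0 := vn_ge0 z.
  have W0 : 0 <= M * 17 ^+ d * vn z ^+ d by rewrite !mulr_ge0 ?exprn_ge0.
  have -> : KS d * M * vn z ^+ d = M * 17 ^+ d * vn z ^+ d + 64 / normc kappa * (M * 17 ^+ d * vn z ^+ d).
    by rewrite /KS; ring.
  have [h|h] := ltP (normc (z 0 k)) (6 * normc (z 0 i)).
    have h8 : normc (z 0 k) < 8 * normc (z 0 i) by move: h zp; clear; lra.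
    rewrite gE8//; apply: ler_wpDl => //.
    have -> : 64 / normc kappa = 16 * 8 / 2 / normc kappa.
      by congr (_ / _); move: k0; clear; lra.
    apply: Tb => // w bw; apply: le_trans (far8 z zi' h8 w bw).
    have : normc (z 0 k) / normc (z 0 i) < 6 by rewrite ltr_pdivrMr.
    by move: (_ / _) => a; clear; lra.
  have h4 : 4 * normc (z 0 i) < normc (z 0 k) by move: h zp; clear; lra.
  rewrite gE4//; apply: normcD_le.
    apply: le_trans (fb _ _) _.
      by split=> //; apply: in_omk => //; move: h4 zp; clear; lra.
    rewrite ler_wpM2r ?exprn_ge0// ler_peMr// exprn_ege1// ler1n//.
  apply: (@le_trans _ _ (16 * 2 / 2 / normc kappa * (M * 17 ^+ d * vn z ^+ d))).
    apply: Tb => // w bw; apply: le_trans (far2 z zi' h4 w bw).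
    have : 6 <= normc (z 0 k) / normc (z 0 i) by rewrite ler_pdivlMr.
    by move: (_ / _) => a; clear; lra.
  rewrite ler_wpM2r// ler_pM2r ?invr_gt0//; clear; lra.
move=> z zi; have zi' := (@om_omx _ _ k _ _ zi); have zp := om_gt0 zi.
have zi0 : z 0 i != 0 by rewrite -normc_gt0.
have ik : (i == k) = false by rewrite eq_sym (negPf ki).
have pk (u : C) : put k u z 0 k = u by rewrite mxE eqxx.
have pi (u : C) : put k u z 0 i = z 0 i by rewrite mxE ik.
have px (u : C) : omx k i (put k u z).
  by move=> j jk; rewrite pi mxE (negPf jk); exact: zi.
(* The negative part is [f - g] where both are defined, and [- T 2] continues it to infinity. *)
pose phi u := if normc u < 6 * normc (z 0 i) then f (put k u z) - g (put k u z) else - T 2 (put k u z).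
have phi8 u : normc u < 8 * normc (z 0 i) -> phi u = f (put k u z) - g (put k u z).
  move=> h; rewrite /phi; case: ltP => // h6.
  rewrite gE4 ?pk ?pi//; first by rewrite opprD addNKr.
  by move: h6 zp; clear; lra.
exists phi; split.
- move=> u lu; have u0 : 0 < normc u.
    have := lowr_lt lu; move=> /(_ i); rewrite ik => /(_ isT).
    by move: zp; clear; lra.
  have jk j : j != k -> normc (z 0 j) < 32 * normc u by exact: lowr_lt.
  have [h|h] := ltP (normc u) (8 * normc (z 0 i)).
    have [l Hl] : cdiff (fun u => f (put k u z) - g (put k u z)) u.
      have oi : om i (put k u z) by apply: in_om => //; rewrite pk pi; move: h zp; clear; lra.
      have ok : om k (put k u z).
        move=> j; rewrite pk mxE; case: eqP => [_|/eqP jk']; last exact: jk.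
        by move: u0; clear; lra.
      apply: (@cdiff_put R n (fun z => f z - g z)).
      by apply: hdB; [apply: fd|exact: gd].
    exists l => e /Hl[s s0 Hs].
    have h' : 0 < 8 * normc (z 0 i) - normc u by rewrite subr_gt0.
    have [q [q0 q1 q2']] := pos_min s0 h'; exists q => // v vq.
    rewrite !phi8//; first exact: Hs (lt_le_trans vq q1).
    by apply: le_lt_trans (le_normcD _ _) _; move: vq q2'; clear; lra.
  have [l Hl] : cdiff (fun u => - T 2 (put k u z)) u.
    apply: (@cdiff_put R n (fun z => - T 2 z)); apply: hdN; apply: T2d => //.
    by rewrite pk pi; move: h zp; clear; lra.
  exists l => e /Hl[s s0 Hs].
  have h' : 0 < normc u - 6 * normc (z 0 i) by move: h zp; clear; lra.
  have [q [q0 q1 q2']] := pos_min s0 h'; exists q => // v vq.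
  have [a1 a2] : 6 * normc (z 0 i) <= normc (u + v) /\ 6 * normc (z 0 i) <= normc u.
    have := le_normcD (u + v) (- v); rewrite addrK normcN.
    by move: vq q2' h zp; clear; lra.
  by rewrite /phi !ltNge a1 a2 /=; exact: Hs (lt_le_trans vq q1).
- move=> u [h1 h2]; rewrite /phi; case: ltP => // h6.
  rewrite gE4 ?pk ?pi//; first by rewrite opprD addNKr.
  by move: h6 zp; clear; lra.
- move=> e e0; have v0 := vn_ge0 z.
  pose W := M * 17 ^+ d * vn z ^+ d.
  have W0 : 0 <= W by rewrite !mulr_ge0 ?exprn_ge0.
  pose A := 32 / normc kappa * W / e.
  have A0 : 0 <= A by apply: divr_ge0 (ltW e0); apply: mulr_ge0 => //; apply: divr_ge0 => //; exact: ltW.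
  exists ((A + 8) * normc (z 0 i)) => u ub.
  have Az : 0 <= A * normc (z 0 i) by rewrite mulr_ge0// ltW.
  have h6 : 6 * normc (z 0 i) <= normc u by move: ub Az zp; clear; lra.
  rewrite /phi ltNge h6 /= normcN.
  have h4 : 4 * normc (z 0 i) < normc u by move: h6 zp; clear; lra.
  have Te : normc (T 2 (put k u z)) <= 16 * 2 / (A + 1) / normc kappa * W.
    have -> : T 2 (put k u z) = kappa^-1 *
      rint (fun w => f (subst k i (1 * w) z) / (w - 1^-1 * (u / z 0 i))) (- 2) 2 (- 2) 2.
      have two : (- 2 : R) <= 2 by clear; lra.
      rewrite /T; congr (_ * _); apply: eq_rint => [//|//|w _ _ _].
      by rewrite subst_put// pk pi.
    have far w : bdry (- 2) 2 (- 2) 2 w -> A + 1 <= normc (w - 1^-1 * (u / z 0 i)).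
      move=> bw; have := far2 _ (px u); rewrite pk pi => /(_ h4 w bw); apply: le_trans.
      have : A + 8 <= normc u / normc (z 0 i) by rewrite ler_pdivlMr.
      by move: (_ / _) => a; clear; lra.
    have A1 : 0 < A + 1 by move: A0; clear; lra.
    rewrite normcM normcV mulrC ler_pdivrMr//.
    apply: (@le_trans _ _ (16 * (W * (A + 1)^-1) * 2)).
      have two0 : 0 < (2 : R) by [].
      apply: (sq_bound two0) => w bw; split.
        have := icd 2 (put k u z) w q2 (px u) bw; rewrite pk pi.
        have -> : (fun w0 : C => f (subst k i (1 * w0) (put k u z)) / (w0 - 1^-1 * (u / z 0 i))) =
           (fun w0 : C => f (subst k i (1 * w0) z) / (w0 - 1^-1 * (u / z 0 i))).
          by apply/funext => w0; rewrite subst_put.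
        apply; rewrite -subr_eq0 -normc_gt0; exact: lt_le_trans (far w bw).
      apply: normcM_le; first exact: fsub bw.
      by rewrite normcV lef_pV2 ?posrE ?far//; apply: lt_le_trans (far w bw).
    rewrite le_eqVlt; apply/orP; left; apply/eqP; field.
    by rewrite !gt_eqF.
  apply: le_trans Te _.
  have A1 : 0 < A + 1 by move: A0; clear; lra.
  have -> : 16 * 2 / (A + 1) / normc kappa * W = (A * e) / (A + 1).
    have h1 : A + 1 != 0 by rewrite gt_eqF.
    have h2 : normc kappa != 0 by rewrite gt_eqF.
    have h3 : e != 0 by rewrite gt_eqF.
    have -> : A * e = 32 / normc kappa * W by rewrite /A divfK.
    by move: h1 h2; clear; move: (A + 1) (normc kappa) => p q p0 q0; field; rewrite p0 q0.
  rewrite ler_pdivrMr//; move: e0; clear; lra.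
Qed.

End Split.

(** * Composition, and a form of Liouville's theorem *)

Section OneVar.
Variable R : realType.
Local Notation C := R[i].
Local Notation kappa := (kappa R).
Implicit Types (f g : C -> C) (u w : C).

Lemma cdiff_comp f g u : cdiff g u -> cdiff f (g u) -> cdiff (fun u => f (g u)) u.
Proof.
move=> [lg Hg] [l Hf]; exists (l * lg) => e e0.
have A0 : 0 < normc lg + 1 by have := normc_ge0 lg; move: (normc _) => a; lra.
have B0 : 0 < normc l + 1 by have := normc_ge0 l; move: (normc _) => a; lra.
have e1 : 0 < e / 2 / (normc lg + 1) by rewrite !divr_gt0.
have e2 : 0 < e / 2 / (normc l + 1) by rewrite !divr_gt0.
have [d1 d10 H1] := Hf _ e1; have [d2 d20 H2] := Hg _ e2; have [d3 d30 H3] := Hg _ ltr01.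
have [a [a0 a1 a2]] := pos_min d20 d30.
have [b [b0 b1 b2]] := pos_min a0 (divr_gt0 d10 A0); exists b => // h hb.
pose k := g (u + h) - g u.
have kE : normc (k - lg * h) <= e / 2 / (normc l + 1) * normc h.
  by apply: H2; apply: lt_le_trans hb (le_trans b1 a1).
have kh : normc k <= (normc lg + 1) * normc h.
  rewrite -[k](subrK (lg * h)) mulrDl mul1r addrC; apply: normcD_le; first by rewrite normcM.
  by rewrite -[normc h]mul1r; apply: H3; apply: lt_le_trans hb (le_trans b1 a2).
have gE : g (u + h) = g u + k by rewrite /k [RHS]addrC subrK.
rewrite gE.
have -> : f (g u + k) - f (g u) - l * lg * h = (f (g u + k) - f (g u) - l * k) + l * (k - lg * h) by ring.
rewrite [X in _ <= X * _](splitr e) mulrDl; apply: normcD_le.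
  apply: le_trans (H1 _ _) _.
    apply: le_lt_trans kh _; rewrite mulrC -ltr_pdivlMr//; exact: lt_le_trans hb b2.
  apply: le_trans (ler_wpM2l (ltW e1) kh) _; rewrite mulrA divfK// gt_eqF//.
rewrite normcM; apply: le_trans (ler_wpM2l (normc_ge0 _) kE) _.
rewrite mulrA ler_wpM2r ?normc_ge0// mulrA ler_pdivrMr// mulrC ler_wpM2l ?lerDl//.
by rewrite divr_ge0// ltW.
Qed.

(** Removable singularity and Liouville in one: by [cauchy_ext], [f w] is an integral over an
    arbitrarily small square around 0, where [f] is bounded, so it is arbitrarily small. *)
Lemma isolated_zero f w : w != 0 -> (forall u, u != 0 -> cdiff f u) -> vanishes f ->
  (exists2 B : R, 0 <= B & exists2 d : R, 0 < d & forall u, 0 < normc u < d -> normc (f u) <= B) ->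
  f w = 0.
Proof.
move=> w0 fd fv [B B0 [d d0 Hd]]; have wp : 0 < normc w by rewrite normc_gt0.
have k0 := nkappa_gt0 R.
apply/eqP; rewrite -[_ == _]negbK -normc_gt0; apply/negP => a0.
have B1 : 0 < 64 * (B + 1) by lra.
have [p [p0 p1 p2]] := pos_min d0 wp.
have [q' [q0' q1 q2]] := pos_min p0 (divr_gt0 (mulr_gt0 (mulr_gt0 a0 k0) wp) B1).
pose q := q' / 4; have q0 : 0 < q by rewrite divr_gt0.
have q4 : q' = 4 * q by rewrite /q; clear; lra.
rewrite q4 in q1 q2.
have H : normc (sqint q (fun v => f v / (v - w))) <= 16 * (B * (normc w / 2)^-1) * q.
  apply: sq_bound => // v bv; have [v1 v2 _] := sq_bdry q0 bv.
  have v3 : normc v <= 2 * q.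
    have [h1 h2 _] := bv; apply: le_trans (normc_le_parts _) _.
    by rewrite mulr_natl mulr2n; apply: lerD; rewrite ler_norml.
  have far : normc w / 2 <= normc (v - w).
    have := le_normcD (w - v) v; rewrite subrK normcB.
    by move: p2 q1 v3; clear; move: (normc _) (normc _) (normc _) => x y z; lra.
  have far0 : 0 < normc (v - w) by apply: lt_le_trans far; rewrite divr_gt0.
  split; first by apply: cdiff_div; [exact: fd|rewrite -subr_eq0 -normc_gt0].
  apply: normcM_le; first by apply: Hd; move: p1 q1 q0 v1 v3; clear; move: (normc _) => x; lra.
  by rewrite normcV lef_pV2 ?posrE// divr_gt0.
have E := @cauchy_ext R f (q / 2) q w q0.
rewrite -normcN -E in H; last first.
- exact: fv.
- by move=> v vq; apply: fd; rewrite -normc_gt0; apply: lt_trans vq; rewrite divr_gt0.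
- by move: p2 q1 q0; clear; lra.
- by move: q0; clear; lra.
rewrite ler_pdivlMr// in q2; rewrite normcM invfM invrK in H.
have : normc kappa * normc (f w) * normc w <= 32 * (B * q).
  have -> : 32 * (B * q) = 16 * (B * ((normc w)^-1 * 2)) * q * normc w.
    by field; rewrite gt_eqF.
  by rewrite ler_pM2r.
have : 0 < normc (f w) * normc kappa * normc w by rewrite !mulr_gt0.
have : 0 <= B * q by rewrite mulr_ge0// ltW.
have -> : normc kappa * normc (f w) * normc w = normc (f w) * normc kappa * normc w by ring.
move: (normc (f w) * _ * _) q2 q0; clear => t q2 q0 h1 h2 h3; nra.
Qed.

End OneVar.

(** * Uniqueness of Laurent parts on the cones *)

Section Cousin.
Variables (R : realType) (m : nat).
Local Notation C := R[i].
Local Notation V := 'rV[C]_m.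
Local Notation KL := (KL R).
Implicit Types (f g F : V -> C) (z : V) (u w : C) (i j k : 'I_m).

Lemma om_put k i z u : k != i -> omx k i z -> normc u < 32 * normc (z 0 i) -> om i (put k u z).
Proof.
move=> ki zi h j; rewrite !mxE [i == k]eq_sym (negPf ki).
by case: (eqVneq j k) => // jk; exact: zi.
Qed.

Lemma omk_put k z u : lowr k z < normc u -> om k (put k u z).
Proof.
move=> h j; rewrite !mxE eqxx; case: (eqVneq j k) => jk; last exact: (lowr_lt h).
have : 0 < normc u by apply: le_lt_trans h; rewrite /lowr divr_ge0//; apply/bigmax_ge_id.
by move: (normc _) => a; lra.
Qed.

Lemma om_lowr k z : om k z -> lowr k z < normc (z 0 k).
Proof. by move=> zk; apply: lt_lowr; [exact: om_gt0 zk|move=> j _; exact: zk]. Qed.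

Lemma put_lt k i z u : k != i -> om i (put k u z) -> normc u < 32 * normc (z 0 i).
Proof. by move=> ki /(_ k); rewrite !mxE eqxx [i == k]eq_sym (negPf ki). Qed.

Lemma vn_put k i z u : k != i -> om i (put k u z) -> vn (put k u z) <= 33 * vn z.
Proof.
move=> ki /(put_lt ki) h; rewrite put_line; apply: le_trans (vnD _ _) _.
have -> : 33 * vn z = vn z + 32 * vn z by ring.
apply: lerD; first by apply: ler_sum => j _; rewrite mxE; case: eqP => // _; rewrite normc0 normc_ge0.
rewrite vnZ vn_ek mulr1; have := normc_le_vn z i; move: h; move: (normc _) (normc _) (vn _) => a b c; lra.
Qed.

(** Along a line in the direction [e_k], [F] is the nonnegative and [fm] the negative Laurent part
    of the sum, so a bound on the sum bounds each of them. *)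
Lemma one_var_parts i j k F z (fm : C -> C) e : k != i -> k != j -> om i z -> om j z -> 0 <= e ->
  (forall z', om i z' -> om j z' -> hd F z') ->
  (forall u, lowr k z < normc u -> cdiff fm u) -> vanishes fm ->
  (forall u, om k (put k u z) -> om i (put k u z) -> om j (put k u z) ->
     normc (F (put k u z) + fm u) <= e) ->
  normc (F z) <= KL * e /\ forall u, lowr k z < normc u -> normc (fm u) <= KL * e.
Proof.
move=> ki kj zi zj e0 Fd fmd fmv H.
have [p1 p2] : omx k i z /\ omx k j z by split=> l _; [exact: zi|exact: zj].
have [i0 j0] := (om_gt0 zi, om_gt0 zj); have [s [s0 s1 s2]] := pos_min i0 j0.
(* [F] is holomorphic on the disc of radius [32 * r], [fm] outside that of radius [lowr k z < r]. *)
pose r := Num.min (normc (z 0 i)) (normc (z 0 j)).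
have r0 : 0 < r by rewrite lt_min i0 j0.
have lr : lowr k z < r by apply: lt_lowr => // l lk; rewrite /r minEle; case: ifP => _; [exact: zi|exact: zj].
have P u : normc u < 32 * r -> om i (put k u z) /\ om j (put k u z).
  rewrite /r => h; split; apply: om_put => //; 
  by apply: lt_le_trans h _; rewrite ler_pM2l// ge_min lexx ?orbT.
have [||||h1 h2] := @laurent_parts R (fun u => F (put k u z)) fm (lowr k z) (32 * r) e _ _ e0 _ fmd fmv.
- by rewrite ltr_pM2l.
- by rewrite mulr_gt0.
- by move=> u /P[a b]; apply: cdiff_put; exact: Fd.
- move=> u lu /P[a b]; apply: H => //; exact: omk_put.
split=> //; rewrite -[X in F X](put_id k); apply: h1.
by rewrite /r minEle; case: ifP => _; [exact: zi|exact: zj].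
Qed.

Lemma omZ i (a : C) z : a != 0 -> om i z -> om i (a *: z).
Proof.
by move=> a0 zi j; rewrite !mxE !normcM mulrCA ltr_pM2l ?normc_gt0//; exact: zi.
Qed.

Lemma sec_sub (U W : set V) d (M M' : R) f : (forall z, W z -> U z) -> M <= M' ->
  sec U d M f -> sec W d M' f.
Proof.
move=> WU MM [h1 h2 h3]; split=> [z /WU/h1//|z a /WU|z /WU/h3]; first exact: h2.
by move=> h; apply: le_trans h _; rewrite ler_wpM2r// exprn_ge0// vn_ge0.
Qed.

Lemma secD (U : set V) d (M M' : R) f g : sec U d M f -> sec U d M' g ->
  sec U d (M + M') (fun z => f z + g z).
Proof.
move=> [f1 f2 f3] [g1 g2 g3]; split=> [z Uz|z a Uz a0|z Uz].
- by apply: hdD; [exact: f1|exact: g1].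
- by rewrite f2// g2// mulrDr.
- by rewrite mulrDl; apply: normcD_le; [exact: f3|exact: g3].
Qed.

Lemma secZ (U : set V) d (M : R) (a : C) f : sec U d M f ->
  sec U d (normc a * M) (fun z => a * f z).
Proof.
move=> [f1 f2 f3]; split=> [z Uz|z b Uz b0|z Uz].
- by apply: hdZ; exact: f1.
- by rewrite f2// mulrCA.
- by rewrite normcM -mulrA ler_wpM2l ?normc_ge0//; exact: f3.
Qed.

Lemma secN (U : set V) d (M : R) f : sec U d M f -> sec U d M (fun z => - f z).
Proof.
move=> [f1 f2 f3]; split=> [z Uz|z b Uz b0|z Uz]; first by apply: hdN; exact: f1.
  by rewrite f2// mulrN.
by rewrite normcN; exact: f3.
Qed.

Lemma secB (U : set V) d (M M' : R) f g : sec U d M f -> sec U d M' g ->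
  sec U d (M + M') (fun z => f z - g z).
Proof. by move=> h /secN; exact: secD. Qed.

Lemma cdiff_near (f g : C -> C) u (d : R) : 0 < d -> (forall v, normc (v - u) < d -> f v = g v) ->
  cdiff f u -> cdiff g u.
Proof.
move=> d0 fg [l H]; exists l => e /H[s s0 Hs].
have [q [q0 q1 q2]] := pos_min d0 s0; exists q => // h hq.
rewrite -!fg ?subrr ?normc0//; last by rewrite addrC addKr; exact: lt_le_trans q1.
by apply: Hs; exact: lt_le_trans q2.
Qed.

Lemma cdiffX (f : C -> C) u d : cdiff f u -> cdiff (fun u => f u ^+ d) u.
Proof.
move=> fd; elim: d => [|d IH]; first exact: cdiff_cst.
rewrite (_ : (fun u => _) = fun u => f u * f u ^+ d); first exact: cdiffM.
by apply/funext => x; rewrite exprS.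
Qed.

(** With only two coordinates and degree [d >= 0], a function with negative powers of [z_o] alone
    has positive powers of [z_p], hence equals its own nonnegative part [g] in [z_p]. In detail,
    [f - g] along [e_p] becomes a function on the punctured plane that is bounded at 0 and vanishes
    at infinity. *)
Lemma two_negparts (o p : 'I_m) d (M M' : R) f g : o != p -> (forall i, (i == o) || (i == p)) ->
  sec (om p `&` om o) d M f -> negpart o p f ->
  sec (om o) d M' g -> negpart p o (fun z => f z - g z) -> 0 <= M' ->
  forall z, om o z -> om p z -> f z = g z.
Proof.
move=> op cov [_ fh _] nf [gd _ gb] ng M'0 z zo zp.
have po : p != o by rewrite eq_sym.
have [phi [phid phiE phiv]] := nf z zp; have [chi [chid chiE chiv]] := ng z zo.
have zo0 := om_gt0 zo; have zp0 := om_gt0 zp.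
have [a0 b0] : z 0 o != 0 /\ z 0 p != 0 by rewrite -!normc_gt0.
have opf : (o == p) = false by exact: negbTE.
have pof : (p == o) = false by exact: negbTE.
have lo : lowr o z <= normc (z 0 p) / 32.
  rewrite ler_pM2r ?invr_gt0//; apply/bigmax_leP; split; first exact: normc_ge0.
  by move=> j jo; have := cov j; rewrite (negPf jo) /= => /eqP ->.
have lp : lowr p z <= normc (z 0 o) / 32.
  rewrite ler_pM2r ?invr_gt0//; apply/bigmax_leP; split; first exact: normc_ge0.
  by move=> j jp; have := cov j; rewrite (negPf jp) orbF => /eqP ->.
have zx : omx p o z by move=> j _; exact: zo.
have Po (u : C) : normc u < 32 * normc (z 0 o) -> om o (put p u z) by exact: om_put.
have Pp (u : C) : normc (z 0 o) / 32 < normc u -> om p (put p u z).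
  by move=> h; apply: omk_put; apply: le_lt_trans h.
(* By homogeneity, [f] at [put p u z] is read off the line in the direction [e_o] at the parameter
   [z_o z_p / u], which goes to infinity as [u] goes to 0. *)
pose h1 (u : C) := (u / z 0 p) ^+ d * phi (z 0 o * z 0 p / u) - g (put p u z).
have h1E (u : C) : normc (z 0 o) / 32 < normc u -> normc u < 32 * normc (z 0 o) -> h1 u = chi u.
  move=> u1 u2; have u0 : u != 0.
    by rewrite -normc_gt0; apply: lt_trans u1; rewrite divr_gt0.
  rewrite chiE; last by split; [exact: Pp|exact: Po].
  congr (_ - _).
  have E : put p u z = (u / z 0 p) *: put o (z 0 o * z 0 p / u) z.
    apply/rowP => j; rewrite !mxE; have := cov j; case/orP => /eqP ->; rewrite ?eqxx ?opf ?pof.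
      by field; rewrite u0 b0.
    by field; rewrite b0.
  have c0 : u / z 0 p != 0 by rewrite mulf_neq0// invr_eq0.
  have H : (om o `&` om p) (put o (z 0 o * z 0 p / u) z).
    have -> : put o (z 0 o * z 0 p / u) z = (u / z 0 p)^-1 *: put p u z by rewrite E scalerA mulVf// scale1r.
    by split; apply: omZ; rewrite ?invr_eq0//; [exact: Po|exact: Pp].
  rewrite E fh//; last by case: H.
  by rewrite phiE.
pose h (u : C) := if normc u < normc (z 0 o) then h1 u else chi u.
have hE1 (u : C) : normc u < 32 * normc (z 0 o) -> h u = h1 u.
  move=> u2; rewrite /h; case: ltP => // u1; rewrite h1E//.
  by apply: lt_le_trans u1; move: zo0; clear; lra.
have hE2 (u : C) : normc (z 0 o) / 32 < normc u -> h u = chi u.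
  move=> u2; rewrite /h; case: ltP => // u1; rewrite h1E//.
  by apply: lt_trans u1 _; move: zo0; clear; lra.
suff h0 (u : C) : u != 0 -> h u = 0.
  have := h0 _ b0; rewrite hE2; last by rewrite ltr_pdivrMr// mulrC; exact: zp.
  by rewrite chiE put_id => [/eqP|]; [rewrite subr_eq0 => /eqP|split].
move=> u0; apply: isolated_zero => // {u u0} [u u0|e e0|].
- have up : 0 < normc u by rewrite normc_gt0.
  have [ul|ul] := ltP (normc u) (2 * normc (z 0 o)).
    have d0 : 0 < 32 * normc (z 0 o) - normc u by move: ul zo0; clear; lra.
    apply: (@cdiff_near h1 _ _ _ d0) => [v vu|].
      rewrite hE1//; have := le_normcD (v - u) u; rewrite subrK.
      by move: vu; clear; move: (normc _) (normc _) (normc _) (normc _) => a b c e; lra.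
    apply: cdiffD; last first.
      rewrite (_ : (fun w => _) = fun w => -1 * g (put p w z)).
        apply: cdiffM; first exact: cdiff_cst.
        apply: cdiff_put; apply: gd; apply: Po; move: ul zo0; clear; lra.
      by apply/funext => w; rewrite mulN1r.
    apply: cdiffM.
      apply: cdiffX; rewrite (_ : (fun w => _) = fun w => 0 + (z 0 p)^-1 * (w - 0)).
        exact: cdiff_affine.
      by apply/funext => w; rewrite add0r subr0 mulrC.
    apply: (@cdiff_comp _ phi (fun u => z 0 o * z 0 p / u)).
      apply: cdiffM; first exact: cdiff_cst.
      by have := @cdiff_inv R 0 u u0; congr cdiff; apply/funext => w; rewrite subr0.
    apply: phid; apply: le_lt_trans lo _.
    rewrite !normcM normcV ltr_pdivlMr// mulrAC ltr_pdivrMr// mulrC mulrAC ltr_pM2r//.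
    by move: ul zo0; clear; lra.
  have d0 : 0 < normc u - normc (z 0 o) / 32 by move: ul zo0; clear; lra.
  apply: (@cdiff_near chi _ _ _ d0) => [v vu|].
    rewrite hE2//; have := le_normcD (u - v) v; rewrite subrK normcB.
    by move: vu; clear; move: (normc _) (normc _) (normc _) (normc _) => a b c e; lra.
  by apply: chid; apply: le_lt_trans lp _; move: ul zo0; clear; lra.
- have [B HB] := chiv e e0; exists (Num.max B (normc (z 0 o))) => w.
  rewrite ge_max => /andP[w1 w2]; rewrite hE2 ?HB//.
  by apply: lt_le_trans w2; move: zo0; clear; lra.
- have [B HB] := phiv 1 ltr01.
  have B0 : 0 < `|B| + 1 by rewrite ltr_wpDl.
  have [q [q0 q1 q2]] := pos_min zo0 zp0.
  have [s [s0 s1 s2]] := pos_min q0 (divr_gt0 (mulr_gt0 zo0 zp0) B0).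
  exists (1 + M' * (33 * vn z) ^+ d).
    by rewrite addr_ge0// mulr_ge0// exprn_ge0// mulr_ge0// vn_ge0.
  exists s => // u /andP[u0 us].
  have ul : normc u < 32 * normc (z 0 o) by move: us s1 q1 zo0; clear; lra.
  rewrite hE1//; apply: normcB_le.
    rewrite -[leRHS]mulr1; apply: normcM_le.
      have -> : normc ((u / z 0 p) ^+ d) = (normc u / normc (z 0 p)) ^+ d.
        by elim: (d) => [|k IH]; rewrite ?expr0 ?normc1// !exprS normcM IH normcM normcV.
      rewrite exprn_ile1 ?divr_ge0 ?normc_ge0// ler_pdivrMr// mul1r.
      by move: us s1 q2; clear; lra.
    apply: HB; apply: le_trans (ler_norm _) _; rewrite !normcM normcV ler_pdivlMr//.
    rewrite ler_pdivlMr// in s2; apply: le_trans s2; rewrite mulrC.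
    apply: ler_pM; rewrite ?normc_ge0//; [exact: ltW|by rewrite lerDl].
  apply: le_trans (gb _ (Po _ ul)) _; rewrite ler_wpM2l//.
  apply: lerXn2r; rewrite ?nnegrE ?vn_ge0//; first by rewrite mulr_ge0 ?vn_ge0.
  by apply: (@vn_put p o) => //; exact: Po.
Qed.

End Cousin.

(** * Vanishing of [H^1(O(d))] with bounds *)

Section Cousin1.
Variables (R : realType) (m : nat).
Local Notation C := R[i].
Local Notation V := 'rV[C]_m.
Local Notation KL := (KL R).
Local Notation KS := (KS R).
Implicit Types (f g F : V -> C) (z : V) (u w : C) (i j k : 'I_m).

Lemma vanishesB (f g : C -> C) : vanishes f -> vanishes g -> vanishes (fun u => f u - g u).
Proof.
move=> fv gv e e0; have e2 : 0 < e / 2 by rewrite divr_gt0.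
have [B HB] := fv _ e2; have [B' HB'] := gv _ e2; exists (Num.max B B') => w.
rewrite ge_max => /andP[w1 w2]; rewrite [e](splitr e); apply: normcB_le; [exact: HB|exact: HB'].
Qed.

Definition KC d : R := KL * 33 ^+ d.

Lemma KC_gt0 d : 0 < KC d.
Proof. by rewrite mulr_gt0 ?KL_gt0// exprn_gt0. Qed.

(** [one_var_parts] for the direction [e_o], with [f - g] as the negative part. *)
Lemma negpart_bound o i j d (eta : R) F f g z : o != i -> o != j -> om i z -> om j z -> 0 <= eta ->
  (forall z', om i z' -> om j z' -> hd F z') -> negpart o j f -> negpart o i g ->
  (forall p, om o p -> om i p -> om j p -> normc (F p + (f p - g p)) <= eta * vn p ^+ d) ->
  normc (F z) <= KC d * eta * vn z ^+ d /\
  (om o z -> normc (f z - g z) <= KC d * eta * vn z ^+ d).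
Proof.
move=> oi oj zi zj e0 Fd nf ng H.
have [phi [phid phiE phiv]] := nf z zj; have [chi [chid chiE chiv]] := ng z zi.
have E0 : 0 <= eta * (33 * vn z) ^+ d by rewrite mulr_ge0// exprn_ge0// mulr_ge0 ?vn_ge0.
have -> : KC d * eta * vn z ^+ d = KL * (eta * (33 * vn z) ^+ d) by rewrite exprMn /KC; ring.
have [|||h1 h2] := @one_var_parts R m i j o F z (fun u => phi u - chi u) _ oi oj zi zj E0 Fd.
- move=> u lu; have -> : (fun u => phi u - chi u) = (fun u => phi u + -1 * chi u).
    by apply/funext => x; rewrite mulN1r.
  apply: cdiffD; first exact: phid.
  by apply: cdiffM; [exact: cdiff_cst|exact: chid].
- exact: vanishesB.
- move=> u uo ui uj; rewrite phiE// chiE//.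
  apply: le_trans (H _ uo ui uj) _; rewrite ler_wpM2l//.
  apply: lerXn2r; rewrite ?nnegrE ?vn_ge0//; first by rewrite mulr_ge0 ?vn_ge0.
  exact: (@vn_put R m o i).
split=> // zo; have := h2 (z 0 o) (om_lowr zo).
by rewrite phiE ?chiE ?put_id//; split; rewrite put_id.
Qed.

Opaque KC.

Definition KH d : R := KS d * (1 + KS d) + (1 + KC d) ^+ 3 + 2.

(** Fix the chart [o] and let [g i] be the nonnegative part in [z_o] of [c o i]. The cocycle
    condition for [o, i, j] is a sum of a nonnegative part, [g j - g i - c i j], and a negative one,
    so both are small: the [g i] solve the problem away from the chart [o]. The remainders
    [c o i - g i] nearly agree with one another; another Laurent splitting, in [z_p], extends them
    over the chart [o]. *)
Theorem cousin d (o p : 'I_m) (c : 'I_m -> 'I_m -> V -> C) (M eta : R) : o != p ->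
  0 <= M -> 0 <= eta ->
  (forall i j, sec (om i `&` om j) d M (c i j)) ->
  (forall i j k z, om i z -> om j z -> om k z ->
     normc (c i j z + c j k z - c i k z) <= eta * vn z ^+ d) ->
  exists h : 'I_m -> V -> C, (forall i, sec (om i) d (KH d * M) (h i)) /\
    forall i j z, om i z -> om j z -> normc (h j z - h i z - c i j z) <= KH d * eta * vn z ^+ d.
Proof.
move=> op M0 eta0 cs cc; have po : p != o by rewrite eq_sym.
have [S0 C0] : 0 < KS d /\ 0 < KC d by split; [exact: KS_gt0|exact: KC_gt0].
have sp i : exists g, i != o -> sec (om i) d (KS d * M) g /\ negpart o i (fun z => c o i z - g z).
  have [->|io] := eqVneq i o; first by exists (fun=> 0).
  have oi : o != i by rewrite eq_sym.
  by have [g Hg] := split_neg oi M0 (cs o i); exists g.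
have [g Hg] := choice sp => {sp}.
have E0 i j z : i != o -> j != o -> om i z -> om j z ->
    normc (g j z - g i z - c i j z) <= KC d * eta * vn z ^+ d /\
    (om o z -> normc ((c o j z - g j z) - (c o i z - g i z)) <= KC d * eta * vn z ^+ d).
  move=> io jo zi zj; have [[gi _ _] ni] := Hg i io; have [[gj _ _] nj] := Hg j jo.
  have [oi oj] : o != i /\ o != j by split; rewrite eq_sym.
  apply: (@negpart_bound o i j d eta (fun z => g j z - g i z - c i j z) (fun z => c o j z - g j z) (fun z => c o i z - g i z)) => //.
    move=> z' zi' zj'; apply: hdB; first by apply: hdB; [exact: gj|exact: gi].
    by case: (cs i j) => h _ _; apply: h.
  move=> q qo qi qj; rewrite -normcN; have := cc o i j q qo qi qj; congr (normc _ <= _); ring.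
(* The function to be extended over the chart [o], up to the errors bounded by [E0]. *)
pose r z := c o p z - g p z.
have rs : sec (om p `&` om o) d ((1 + KS d) * M) r.
  have [gp _] := Hg p po; have := @secB R m (om p `&` om o) d M (KS d * M) (c o p) (g p).
  rewrite mulrDl mul1r; apply.
    by apply: sec_sub (cs o p) => // z [].
  by apply: sec_sub gp => // z [].
have M1 : 0 <= (1 + KS d) * M by rewrite mulr_ge0// addr_ge0// ltW.
have [g' [gs gn]] := split_neg po M1 rs.
have rn : negpart o p r by case: (Hg p po).
pose K2 := KC d * (KC d * eta).
have K20 : 0 <= K2 by exact: mulr_ge0 (ltW C0) (mulr_ge0 (ltW C0) eta0).
have E1 i z : i != o -> i != p -> om o z -> om i z ->
    normc ((c o i z - g i z) - g' z) <= K2 * vn z ^+ d /\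
    (om p z -> normc (r z - g' z) <= K2 * vn z ^+ d).
  move=> io ip zo zi; have pi : p != i by rewrite eq_sym.
  have [[gi _ _] ni] := Hg i io; have [gd _ _] := gs.
  have n0 : negpart p i (fun=> 0 : C).
    by move=> y _; exists (fun=> 0); split=> // [u _|e e0]; [exact: cdiff_cst|exists 0 => w _; rewrite normc0 ltW].
  have [|||h1 h2] := @negpart_bound p i o d (KC d * eta) (fun z => g' z - (c o i z - g i z)) (fun z => r z - g' z)
    (fun=> 0) z pi po zi zo _ _ gn n0.
  - exact: mulr_ge0 (ltW C0) eta0.
  - move=> z' zi' zo'; apply: hdB; first exact: gd.
    by apply: hdB; [case: (cs o i) => h _ _; apply: h|exact: gi].
  - move=> q qp qi qo; rewrite subr0.
    have [_ /(_ qo)] := E0 i p q io po qi qp; congr (normc _ <= _); rewrite /r; ring.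
  rewrite /K2; split=> [|zp]; first by have := h1; rewrite -normcN opprB !mulrA.
  by have := h2 zp; rewrite subr0 !mulrA.
(* For the chart [p] itself a third coordinate [q] is used: the bound known on the part of the
   overlap inside [om q] spreads by Laurent uniqueness in [z_q]. Without a third coordinate
   [two_negparts] gives equality. *)
have E2 z : om o z -> om p z -> normc (r z - g' z) <= KC d * K2 * vn z ^+ d.
  have [[q /andP[qo qp]]|no] := pselect (exists q, (q != o) && (q != p)); last first.
    have cov i : (i == o) || (i == p).
      by apply: contrapT => /negP h; apply: no; exists i; rewrite -negb_or.
    move=> zo zp; rewrite (two_negparts op cov rs rn gs gn _ zo zp).
      rewrite subrr normc0; apply: mulr_ge0; last by rewrite exprn_ge0// vn_ge0.
      exact: mulr_ge0 (ltW C0) K20.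
    exact: mulr_ge0 (ltW S0) M1.
  move=> zo zp; have [oq pq] : q != o /\ q != p by [].
  have n0 i : negpart q i (fun=> 0 : C).
    by move=> y _; exists (fun=> 0); split=> // [u _|e e0]; [exact: cdiff_cst|exists 0 => w _; rewrite normc0 ltW].
  have [||h1 _] := @negpart_bound q p o d K2 (fun z => r z - g' z) (fun=> 0) (fun=> 0) z qp qo zp zo K20 _ (n0 o) (n0 p).
  - move=> z' zp' zo'; apply: hdB; first by case: rs => h _ _; exact: h.
    by case: gs => h _ _; exact: h.
  - by move=> y yq yp yo; rewrite subrr addr0; case: (E1 q y oq pq yo yq) => _; apply.
  by move: h1; rewrite !mulrA.
have C1 : 1 <= 1 + KC d by rewrite lerDl ltW.
have b1 : KC d * K2 <= (1 + KC d) ^+ 3 * eta.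
  have -> : KC d * K2 = KC d ^+ 3 * eta by rewrite /K2; ring.
  by rewrite ler_wpM2r//; apply: lerXn2r; rewrite ?nnegrE ?(ltW C0) ?lerDr// (le_trans ler01).
have b2 : K2 <= (1 + KC d) ^+ 3 * eta.
  have -> : K2 = KC d ^+ 2 * eta by rewrite /K2; ring.
  rewrite ler_wpM2r//; apply: (@le_trans _ _ ((1 + KC d) ^+ 2)).
    by apply: lerXn2r; rewrite ?nnegrE ?(ltW C0) ?lerDr// (le_trans ler01).
  by rewrite [leRHS]exprS ler_peMl// exprn_ge0// (le_trans ler01).
have b3 : KC d * eta <= (1 + KC d) ^+ 3 * eta.
  rewrite ler_wpM2r//; apply: (@le_trans _ _ (1 + KC d)); first by rewrite lerDr.
  by rewrite [leRHS]exprS ler_peMr ?exprn_ege1// (le_trans ler01).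
have kh : (1 + KC d) ^+ 3 * eta + 2 * eta <= KH d * eta.
  by rewrite -mulrDl ler_wpM2r// /KH -addrA lerDr mulr_ge0// ?addr_ge0// ltW.
have e2 : 0 <= 2 * eta by rewrite mulr_ge0.
have up (A B : R) z : A <= B * vn z ^+ d -> B <= (1 + KC d) ^+ 3 * eta + 2 * eta -> A <= KH d * eta * vn z ^+ d.
  move=> h1 h2; apply: le_trans h1 _; rewrite ler_wpM2r ?exprn_ge0 ?vn_ge0//; exact: le_trans h2 kh.
have C3 : 0 <= (1 + KC d) ^+ 3 * eta by rewrite mulr_ge0// exprn_ge0// (le_trans ler01).
have Eo i z : i != o -> om o z -> om i z -> normc ((c o i z - g i z) - g' z) <= (1 + KC d) ^+ 3 * eta * vn z ^+ d.
  move=> io zo zi; have v0 : 0 <= vn z ^+ d by rewrite exprn_ge0// vn_ge0.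
  have [ip|ip] := eqVneq i p.
    by rewrite ip in zi *; apply: le_trans (E2 z zo zi) _; rewrite ler_wpM2r.
  by have [h _] := E1 i z io ip zo zi; apply: le_trans h _; rewrite ler_wpM2r.
have coo i z : om i z -> normc (c i i z) <= eta * vn z ^+ d.
  by move=> zi; have := cc i i i z zi zi zi; rewrite addrK.
exists (fun i => if i == o then fun z => - g' z else g i); split=> [i|i j z zi zj].
  case: eqVneq => [->|io].
    apply: secN; apply: sec_sub gs => //; rewrite mulrA ler_wpM2r//.
    by rewrite /KH -addrA lerDl addr_ge0// exprn_ge0// (le_trans ler01).
  have [h _] := Hg i io; apply: sec_sub h => //; rewrite ler_wpM2r// /KH -addrA.
  by rewrite ler_wpDr ?addr_ge0 ?exprn_ge0 ?(le_trans ler01 C1)// ler_peMr ?lerDl ?(ltW S0).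
have vd0 : 0 <= vn z ^+ d by rewrite exprn_ge0// vn_ge0.
case: (eqVneq i o) => [io|io]; case: (eqVneq j o) => [jo|jo].
- rewrite io jo subrr sub0r normcN in zi zj *; apply: up (coo o z zi) _.
  by rewrite ler_wpDl// ler_peMl// ler1n.
- rewrite io in zi *; rewrite -normcN; apply: (@up _ ((1 + KC d) ^+ 3 * eta)); last by rewrite lerDl.
  by have := Eo j z jo zi zj; congr (normc _ <= _); ring.
- rewrite jo in zj *.
  have -> : - g' z - g i z - c i o z = (c o i z - g i z - g' z) - ((c o i z + c i o z - c o o z) + c o o z) by ring.
  apply: (@up _ ((1 + KC d) ^+ 3 * eta + (eta + eta))); last by rewrite lerD2l mulr_natl mulr2n.
  rewrite !mulrDl; apply: normcB_le; first exact: Eo.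
  by apply: normcD_le; [exact: cc|exact: coo].
- have [h _] := E0 i j z io jo zi zj; apply: up h _; apply: ler_wpDr => //.
Qed.

End Cousin1.

(** * Global sections of [O(1)] and [O(2)]: linear and quadratic forms *)

Section Global.
Variables (R : realType) (m : nat).
Local Notation C := R[i].
Local Notation V := 'rV[C]_m.
Local Notation KH := (KH R).
Implicit Types (f g F : V -> C) (x y z : V) (s t u w : C) (i j k : 'I_m).

Definition nz : set V := [set z | z != 0].

Lemma om_cover z : z != 0 -> exists i, om i z.
Proof.
move=> /rV0Pn[i0 zi0]; exists [arg max_(i > i0) normc (z 0 i)]%O.
case: arg_maxP => // i _ H j; apply: le_lt_trans (H j isT) _.
rewrite ltr_pMl ?ltr1n//; apply: lt_le_trans (H i0 isT); by rewrite normc_gt0.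
Qed.

Lemma om_nz i z : om i z -> z != 0.
Proof. by move=> /om_gt0; rewrite normc_gt0; apply: contraNneq => ->; rewrite mxE. Qed.

Lemma KH_gt0 d : 0 < KH d.
Proof.
have S0 := KS_gt0 R d; have C0 := KC_gt0 R d.
apply: addr_gt0 => //; apply: addr_gt0; first by apply: mulr_gt0 => //; exact: addr_gt0.
by rewrite exprn_gt0// addr_gt0.
Qed.

(** The differences [q j - q i] form an exact cocycle of size [eta], which [cousin] solves by
    functions of size [KH d * eta]; subtracting them makes the [q i] agree. The value at 0 is a
    convention. *)
Lemma glob d (o p : 'I_m) (q : 'I_m -> V -> C) (M eta : R) : o != p -> 0 <= M -> 0 <= eta ->
  (forall i, sec (om i) d M (q i)) ->
  (forall i j z, om i z -> om j z -> normc (q j z - q i z) <= eta * vn z ^+ d) ->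
  exists f, [/\ sec nz d (M + KH d * eta) f, f 0 = 0 &
    forall i z, om i z -> normc (f z - q i z) <= KH d * eta * vn z ^+ d].
Proof.
move=> op M0 e0 qs qc.
have cs i j : sec (om i `&` om j) d eta (fun z => q j z - q i z).
  have [h1 h2 _] := qs i; have [h1' h2' _] := qs j; split=> [z [zi zj]|z a [zi zj] a0|z [zi zj]].
  - by apply: hdB; [exact: h1'|exact: h1].
  - by rewrite h2// h2'// mulrBr.
  - exact: qc.
have [|h [hs hE]] := cousin op e0 (lexx 0) cs.
  move=> i j k z zi zj zk; rewrite mul0r; have -> : q j z - q i z + (q k z - q j z) - (q k z - q i z) = 0 by ring.
  by rewrite normc0.
pose ix z := xget o [set i | om i z].
have ixP z : z != 0 -> om (ix z) z by move=> /om_cover H; exact: (@xgetPex _ o [set i | om i z] H).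
pose f z := if z == 0 then 0 else q (ix z) z - h (ix z) z.
have fE i z : om i z -> f z = q i z - h i z.
  move=> zi; have z0 := om_nz zi; rewrite /f (negPf z0).
  have := hE i (ix z) z zi (ixP z z0); rewrite mulr0 mul0r => h0.
  have : normc (h (ix z) z - h i z - (q (ix z) z - q i z)) = 0 by apply/eqP; rewrite eq_le h0 normc_ge0.
  move=> /eqP; rewrite normc_eq0 subr_eq0 => /eqP E.
  by rewrite -[q (ix z) z](subrK (q i z)) -E; ring.
exists f; split=> [|//|i z zi]; last 2 first.
- by rewrite /f eqxx.
- rewrite (fE _ _ zi) addrAC subrr sub0r normcN; have [_ _ h3] := hs i; exact: h3.
split=> [z z0|z a z0 a0|z z0].
- have zi := ixP z z0; apply: (@hd_nearU _ _ (om (ix z)) (fun z' => q (ix z) z' - h (ix z) z')) => //.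
  + exact: om_open.
  + by move=> z' zi'; rewrite (fE _ _ zi').
  + by apply: hdB; [case: (qs (ix z))|case: (hs (ix z))] => H _ _; exact: H.
- have zi := ixP z z0; rewrite (fE _ _ zi) (fE _ _ (omZ a0 zi)) mulrBr.
  by case: (qs (ix z)) => _ H _; rewrite H//; case: (hs (ix z)) => _ H' _; rewrite H'.
- have zi := ixP z z0; rewrite (fE _ _ zi) mulrDl; apply: normcB_le.
    by case: (qs (ix z)) => _ _; exact.
  by case: (hs (ix z)) => _ _; exact.
Qed.

(** Liouville: the difference quotient minus its expected value is bounded near 0 and vanishes at
    infinity. *)
Lemma entire_quad (f : C -> C) (b c : C) : (forall t, cdiff f t) ->
  vanishes (fun t => (f t - c * t ^+ 2) / t - b) ->
  forall t, f t = f 0 + b * t + c * t ^+ 2.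
Proof.
move=> fd fv t; have [->|t0] := eqVneq t 0; first by rewrite expr2 !mulr0 !addr0.
suff : (fun t => (f t - c * t ^+ 2) / t - b - f 0 / t) t = 0.
  move=> /= /(congr1 (fun x : C => t * x)); rewrite mulr0 => h.
  by apply/eqP; rewrite -subr_eq0 -[X in _ == X]h; apply/eqP; field.
apply: (@isolated_zero R (fun t => (f t - c * t ^+ 2) / t - b - f 0 / t) t t0) => {t t0} [t t0||].
- rewrite (_ : (fun t => _) = (fun t => (f t - c * (t * t) - f 0) * (t - 0)^-1 + - b)).
    apply: cdiffD; last exact: cdiff_cst.
    have cid : cdiff (fun u : C => u) t.
      have := cdiff_affine 0 1 0 t; congr cdiff; apply/funext => u; ring.
    apply: cdiffM; last exact: cdiff_inv.
    rewrite (_ : (fun t => _) = (fun t => f t + (- c) * (t * t) + - f 0)).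
      apply: cdiffD; last exact: cdiff_cst.
      apply: cdiffD => //; apply: cdiffM; first exact: cdiff_cst.
      exact: cdiffM.
    by apply/funext => u; ring.
  by apply/funext => u; rewrite subr0 expr2; ring.
- move=> e e0; have e2 : 0 < e / 2 by rewrite divr_gt0.
  have [B HB] := fv _ e2; exists (Num.max B (2 * normc (f 0) / e + 1)) => t.
  rewrite ge_max => /andP[t1 t2]; rewrite [e](splitr e); apply: normcB_le; first exact: HB.
  have N0 := normc_ge0 (f 0).
  have tp : 0 < normc t by apply: lt_le_trans t2; rewrite ltr_wpDl// divr_ge0 ?mulr_ge0// ltW.
  rewrite normcM normcV ler_pdivrMr//.
  have : 2 * normc (f 0) / e <= normc t by apply: le_trans t2; rewrite lerDl.
  by rewrite ler_pdivrMr// => h; rewrite mulrAC ler_pdivlMr// mulrC [e * _]mulrC.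
- have [l H] := fd 0; have [d d0 Hd] := H _ ltr01.
  exists (1 + normc l + normc c * d + normc b).
    by rewrite !addr_ge0 ?mulr_ge0 ?normc_ge0// ltW.
  exists d => // t /andP[t0 td]; have tn : t != 0 by rewrite -normc_gt0.
  have -> : (f t - c * t ^+ 2) / t - b - f 0 / t = (f t - f 0 - l * t) / t + l - c * t - b by field.
  apply: normcB_le => //; apply: normcB_le; last by rewrite normcM ler_wpM2l ?normc_ge0// ltW.
  apply: normcD_le => //; rewrite normcM normcV ler_pdivrMr//.
  by have := Hd t td; rewrite add0r.
Qed.

Section Homog.
Variables (d : nat) (M : R) (f : V -> C).
Hypotheses (fs : sec nz d M f) (f0 : f 0 = 0) (d0 : (0 < d)%N).

Lemma homogZ t x : f (t *: x) = t ^+ d * f x.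
Proof.
have [->|t0] := eqVneq t 0; first by rewrite scale0r f0 expr0n eqn0Ngt d0 /= mul0r.
have [->|x0] := eqVneq x 0; first by rewrite scaler0 f0 mulr0.
by case: fs => _ h _; exact: h.
Qed.

(** Separates collinear vectors, where homogeneity suffices, from lines that avoid the origin. *)
Lemma line_cases x y : x = 0 \/ (exists t, y = t *: x) \/
  (forall t, y + t *: x != 0) /\ (forall s, x + s *: y != 0).
Proof.
have [->|x0] := eqVneq x 0; [by left|right].
have [[t yt]|no] := pselect (exists t, y = t *: x); [by left; exists t|right].
split=> t; apply/eqP => h.
  by apply: no; exists (- t); apply/eqP; rewrite scaleNr -addr_eq0 h.
have t0 : t != 0 by apply: contraNneq x0 => t0; rewrite t0 scale0r addr0 in h; rewrite h.
apply: no; exists (- t^-1); apply: (scalerI t0); rewrite scalerA mulrN divff// scaleN1r.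
by apply/eqP; rewrite -addr_eq0 addrC h.
Qed.

Lemma line_dual x y t : t != 0 -> f (y + t *: x) = t ^+ d * f (x + t^-1 *: y).
Proof. by move=> t0; rewrite -homogZ scalerDr scalerA divff// scale1r addrC. Qed.

Lemma line_cdiff x y : (forall t, y + t *: x != 0) -> forall t, cdiff (fun t => f (y + t *: x)) t.
Proof. by move=> h t; apply: hd_line; case: fs => H _ _; apply: H; exact: h. Qed.

End Homog.

Lemma inv_small (e : R) : 0 < e -> exists B : R, forall t, B <= normc t -> t != 0 /\ normc (t^-1) < e.
Proof.
move=> e0; exists (e^-1 + 1) => t h.
have ei : 0 < e^-1 by rewrite invr_gt0.
have t0 : 0 < normc t by apply: lt_le_trans h; rewrite addr_gt0.
split; first by rewrite -normc_gt0.
rewrite normcV -[e]invrK ltf_pV2 ?posrE//; apply: lt_le_trans h; rewrite ltrDl//.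
Qed.

(** On a line [y + t x] avoiding 0, homogeneity gives [f(y + t x) = t f(x + y / t)], which grows
    like [t f(x)]; so [f] is affine along the line. *)
Lemma homog1D M f : sec nz 1 M f -> f 0 = 0 -> forall x y, f (x + y) = f x + f y.
Proof.
move=> fs f0 x y; have fZ := homogZ fs f0 isT.
case: (line_cases x y) => [->|[[t ->]|[h1 h2]]]; first by rewrite f0 !add0r.
  have -> : x + t *: x = (1 + t) *: x by rewrite scalerDl scale1r.
  by rewrite !fZ !expr1 mulrDl mul1r.
have d1 := line_cdiff fs h1; have d2 := line_cdiff fs h2.
have := @entire_quad _ (f x) 0 d1; rewrite /= => H.
have := H _ 1; rewrite scale1r scale0r addr0 mulr1 mul0r addr0 addrC [f y + _]addrC; apply.
move=> e e0; have [d dd0 Hd] := cdiff_cont (d2 0) e0; have [B HB] := inv_small dd0.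
exists B => t /HB[t0 ti]; rewrite mul0r subr0 (line_dual fs f0 isT _ _ t0) expr1 mulrAC divff// mul1r.
by have := Hd t^-1; rewrite subr0 scale0r addr0 => /(_ ti)/ltW.
Qed.

Definition polar f x y := f (x + y) - f x - f y.

(** As in degree 1, the behaviour at infinity is that of [f] near [x]; its derivative there gives
    the linear coefficient. *)
Lemma homog2_line M f : sec nz 2 M f -> f 0 = 0 -> forall x y,
  exists b, forall t, f (y + t *: x) = f y + b * t + f x * t ^+ 2.
Proof.
move=> fs f0 x y; have fZ := homogZ fs f0 isT.
case: (line_cases x y) => [->|[[s ->]|[h1 h2]]].
- by exists 0 => t; rewrite scaler0 addr0 f0 !mul0r !addr0.
- by exists (2 * s * f x) => t; rewrite -scalerDl !fZ; ring.
have d1 := line_cdiff fs h1; have [l Hl] := line_cdiff fs h2 0.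
exists l => t; have := @entire_quad _ l (f x) d1; rewrite /= scale0r addr0; apply.
move=> e e0; have [d dd0 Hd] := Hl e e0; have [B HB] := inv_small dd0.
exists B => {}t /HB[t0 ti]; rewrite (line_dual fs f0 isT _ _ t0).
have := Hd _ ti; rewrite add0r scale0r addr0 => h.
have -> : (t ^+ 2 * f (x + t^-1 *: y) - f x * t ^+ 2) / t - l = t * (f (x + t^-1 *: y) - f x - l * t^-1).
  by field.
have tp : 0 < normc t by rewrite normc_gt0.
by rewrite normcM mulrC -ler_pdivlMr// -normcV.
Qed.

Section Quadratic.
Variables (M : R) (f : V -> C).
Hypotheses (fs : sec nz 2 M f) (f0 : f 0 = 0).
Local Notation B := (polar f).

Lemma quadE x y t : f (y + t *: x) = f y + t * B x y + t ^+ 2 * f x.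
Proof.
have [b Hb] := homog2_line fs f0 x y; have := Hb 1; rewrite scale1r mulr1 expr1n mulr1 => h1.
rewrite Hb /polar [x + y]addrC h1; ring.
Qed.

Lemma parallelogram x y : f (x + y) + f (x - y) = 2 * f x + 2 * f y.
Proof.
have := quadE y x 1; have := quadE y x (-1); rewrite scale1r scaleN1r => -> ->; ring.
Qed.

Lemma polarC x y : B x y = B y x.
Proof. by rewrite /polar [y + x]addrC; ring. Qed.

Lemma polarZ t x y : B (t *: x) y = t * B x y.
Proof. by rewrite {1}/polar [t *: x + y]addrC quadE (homogZ fs f0 isT); ring. Qed.

(** The Jordan and von Neumann argument from the parallelogram law. *)
Lemma polarD x y z : B (x + y) z = B x z + B y z.
Proof.
have A := parallelogram (x + z) y; have A' := parallelogram (x + y) z.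
have D := parallelogram x (y - z); have E := parallelogram y z.
have e1 : x + z + y = x + y + z by rewrite addrAC.
have e2 : x + z - y = x - (y - z) by rewrite opprB addrCA addrC addrAC -addrA addrCA.
have e3 : x + y - z = x + (y - z) by rewrite addrA.
rewrite e1 e2 in A; rewrite e3 in A'.
have two : (2 : C) != 0 by rewrite pnatr_eq0.
apply: (mulfI two); rewrite /polar.
have : f (x + y + z) + f (x + y + z) = 2 * f (x + z) + 2 * f y + (2 * f (x + y) + 2 * f z) - (2 * f x + 2 * (2 * f y + 2 * f z - f (y + z))).
  by rewrite -E -A -A'; move: D => /(canRL (addrK _)) ->; ring.
move=> h; have -> : 2 * (f (x + y + z) - f (x + y) - f z) = f (x + y + z) + f (x + y + z) - 2 * f (x + y) - 2 * f z by ring.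
rewrite h; ring.
Qed.

Lemma polarxx x : B x x = 2 * f x.
Proof. by rewrite /polar -mulr2n -scaler_nat (homogZ fs f0 isT); ring. Qed.

Lemma polar_sum y z : \sum_l z 0 l * B (ek R l) y = B z y.
Proof.
have B0 : B 0 y = 0 by rewrite /polar add0r f0; ring.
rewrite {2}[z]row_sum_delta (big_morph (fun x => B x y) (fun x x' => polarD x x' y) B0).
by apply: eq_bigr => l _; rewrite polarZ.
Qed.

End Quadratic.

Lemma homog1_sum M f : sec nz 1 M f -> f 0 = 0 -> forall z, \sum_l z 0 l * f (ek R l) = f z.
Proof.
move=> fs f0 z; rewrite [in RHS](row_sum_delta z) (big_morph f (homog1D fs f0) f0).
by apply: eq_bigr => l _; rewrite (homogZ fs f0 isT).
Qed.

End Global.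

(** With [wedge3_diff1], the finite differences that extract a directional derivative of [wedge3 P]
    from its values; scalars replace the components so that [field] can decide the identity. *)
Lemma wedge3_diff2 (F : numFieldType) (s zl za zc zb ea ec eb p1 p2 p3 p4 b1 b2 b3 b4 q1 q2 q3 q4 : F) :
  s != 0 ->
  p1 + zl * b1 - (ea * p2 + za * b2) - (ec * p3 + zc * b3) - (eb * p4 + zb * b4) =
  s^-1 * (((zl + s * 1) * (p1 + s * b1 + s ^+ 2 * q1) - (za + s * ea) * (p2 + s * b2 + s ^+ 2 * q2)
    - (zc + s * ec) * (p3 + s * b3 + s ^+ 2 * q3) - (zb + s * eb) * (p4 + s * b4 + s ^+ 2 * q4)
    - ((zl + - s * 1) * (p1 + - s * b1 + (- s) ^+ 2 * q1) - (za + - s * ea) * (p2 + - s * b2 + (- s) ^+ 2 * q2)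
    - (zc + - s * ec) * (p3 + - s * b3 + (- s) ^+ 2 * q3) - (zb + - s * eb) * (p4 + - s * b4 + (- s) ^+ 2 * q4))) / 2
    - (s * 1 * (s ^+ 2 * q1) - s * ea * (s ^+ 2 * q2) - s * ec * (s ^+ 2 * q3) - s * eb * (s ^+ 2 * q4))).
Proof. by move=> s0; field. Qed.

Lemma wedge3_diff1 (F : numFieldType) (s zl za zc zb ea ec eb p1 p2 p3 p4 b1 b2 b3 b4 : F) :
  s != 0 ->
  p1 + zl * b1 - (ea * p2 + za * b2) - (ec * p3 + zc * b3) - (eb * p4 + zb * b4) =
  s^-1 * ((zl + s * 1) * (p1 + s ^+ 1 * b1) - (za + s * ea) * (p2 + s ^+ 1 * b2)
    - (zc + s * ec) * (p3 + s ^+ 1 * b3) - (zb + s * eb) * (p4 + s ^+ 1 * b4)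
    - (zl * p1 - za * p2 - zc * p3 - zb * p4)
    - (s * 1 * (s ^+ 1 * b1) - s * ea * (s ^+ 1 * b2) - s * ec * (s ^+ 1 * b3) - s * eb * (s ^+ 1 * b4))).
Proof. by move=> s0; field. Qed.

(** * A Koszul homotopy with bounds *)

Section Koszul.
Variables (R : realType) (n : nat).
Local Notation C := R[i].
Local Notation I := 'I_n.+1.
Local Notation V := 'rV[C]_n.+1.
Local Notation e := (@ek R n.+1).
Implicit Types (x y z : V) (s t u w : C) (a b c k l : I).

(** The homotopy formula for [z /\ _] on 3-forms with coefficients of degree [d]: by Euler's
    identity the divergence of [z /\ P] is [(n + d - 2) P] minus [z /\] the divergence of [P]. Here
    [dP l] is the derivative in the direction [e_l]. *)
Lemma contraction (P : I -> I -> I -> C) (dP : I -> I -> I -> I -> C) (d : C) z :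
  (forall l a c b, dP l c a b = - dP l a c b) -> (forall l a c b, dP l a b c = - dP l a c b) ->
  (forall a c b, \sum_l z 0 l * dP l a c b = d * P a c b) -> forall a c b,
  \sum_l (P a c b + z 0 l * dP l a c b - (e l 0 a * P l c b + z 0 a * dP l l c b)
    - (e l 0 c * P a l b + z 0 c * dP l a l b) - (e l 0 b * P a c l + z 0 b * dP l a c l)) =
  (n.+1%:R + d - 3) * P a c b -
  (z 0 a * (\sum_l dP l l c b) + z 0 c * (\sum_l dP l l b a) + z 0 b * (\sum_l dP l l a c)).
Proof.
move=> a1 a2 eu a c b.
have dl (F : I -> C) (x : I) : \sum_l e l 0 x * F l = F x.
  rewrite (bigD1 x) //= mxE !eqxx mul1r big1 ?addr0// => l lx.
  by rewrite mxE eqxx /= eq_sym (negPf lx) mul0r.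
rewrite !sumrB !big_split /= sumr_const card_ord eu !dl -!mulr_sumr.
have -> : \sum_l dP l a l b = \sum_l dP l l b a.
  by apply: eq_bigr => l _; rewrite a1 a2 opprK.
have -> : \sum_l dP l a c l = \sum_l dP l l a c.
  by apply: eq_bigr => l _; rewrite a2 a1 opprK.
rewrite -mulr_natl; ring.
Qed.

Lemma normc_nat (k : nat) : normc (k%:R : C) = k%:R.
Proof.
have -> : (k%:R : C) = (k%:R +i* 0) by rewrite -[k%:R in RHS]/(k%:R : R) -raddfMn.
by rewrite normc_real ger0_norm.
Qed.

Lemma vn_gt0 z : z != 0 -> 0 < vn z.
Proof. by move=> z0; rewrite lt0r vn_ge0 andbT; apply: contraNneq z0 => /vn_eq0 ->. Qed.

Lemma hd_lf (k : I -> C) z : hd (lf k) z.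
Proof.
rewrite (_ : lf k = fun z => \sum_j k j * z 0 j); last first.
  by apply/funext => y; apply: eq_bigr => j _; rewrite mulrC.
by apply: hd_sum => j; apply: hdZ; exact: hd_coord.
Qed.

Definition form3 (P : I -> I -> I -> V -> C) := (forall a c b z, P c a b z = - P a c b z) /\
  forall a c b z, P a b c z = - P a c b z.

Definition wedge3 (P : I -> I -> I -> V -> C) l a c b z :=
  z 0 l * P a c b z - z 0 a * P l c b z - z 0 c * P a l b z - z 0 b * P a c l z.

Lemma vn_add_ek z l t : normc t = vn z -> vn (z + t *: e l) <= 2 * vn z.
Proof.
move=> tz; apply: le_trans (vnD _ _) _; rewrite vnZ vn_ek mulr1 tz.
by rewrite mulr_natl mulr2n.
Qed.

Section Deg.
Variables (M eta : R) (P : I -> I -> I -> V -> C).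
Hypotheses (PA : form3 P) (P0 : forall a c b, P a c b 0 = 0) (e0 : 0 <= eta) (M0 : 0 <= M).

Lemma wedge3_bound d : (forall l a c b z, normc (wedge3 P l a c b z) <= eta * vn z ^+ d) ->
  forall z l t a c b r, normc t = vn z ->
  normc (wedge3 P r a c b (z + t *: e l)) <= 2 ^+ d * eta * vn z ^+ d.
Proof.
move=> H z l t a c b r tz; apply: le_trans (H _ _ _ _ _) _.
rewrite [2 ^+ d * _]mulrC -mulrA ler_wpM2l// -exprMn; apply: lerXn2r; rewrite ?nnegrE ?vn_ge0//.
  by rewrite mulr_ge0 ?vn_ge0.
exact: vn_add_ek.
Qed.

(** If [z /\ P] is small then [P] is close to [z /\ L], with [L] the divergence of [P] divided by
    [n]. The derivatives of [z /\ P] are bounded by differences of step [|z|], which yields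
    [9 = (8 + 8) / 2 + 1]. *)
Lemma koszul2 : (0 < n)%N -> (forall a c b, sec (@nz R n.+1) 2 M (P a c b)) ->
  (forall l a c b z, normc (wedge3 P l a c b z) <= eta * vn z ^+ 3) ->
  exists L : I -> I -> V -> C, [/\ forall c b z, L b c z = - L c b z,
    forall c b, sec setT 1 (6 * n.+1%:R * M) (L c b) &
    forall a c b z, normc (P a c b z - (z 0 a * L c b z + z 0 c * L b a z + z 0 b * L a c z)) <=
      9 * n.+1%:R * eta * vn z ^+ 2].
Proof.
move=> n0 Ps q; have [A1 A2] := PA.
(* For a quadratic form, the polarization with [e_l] is the derivative in that direction. *)
pose B l a c b z := polar (P a c b) (e l) z.
have nn0 : (n%:R : C) != 0 by rewrite pnatr_eq0 -lt0n.
have ninv : normc ((n%:R : C)^-1) <= 1.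
  rewrite normcV invf_le1; last by rewrite normc_gt0.
  by rewrite normc_nat ler1n.
pose L c b z := n%:R^-1 * \sum_l B l l c b z.
have B1 l a c b z : B l c a b z = - B l a c b z.
  by rewrite /B /polar !(A1 a c); ring.
have B2 l a c b z : B l a b c z = - B l a c b z.
  by rewrite /B /polar !(A2 a c b); ring.
have Bb l a c b z : normc (B l a c b z) <= 6 * M * vn z.
  have [z0|z0] := eqVneq z 0.
    by rewrite z0 /B /polar addr0 P0 subrr subr0 normc0 vn0 mulr0.
  have s0 : 0 < vn z by exact: vn_gt0.
  have [_ _ Pb] := Ps a c b.
  have := quadE (Ps a c b) (P0 a c b) (e l) z (vn z)%:C.
  set y := z + _ => H; have -> : B l a c b z = (vn z)%:C^-1 * (P a c b y - P a c b z - (vn z)%:C ^+ 2 * P a c b (e l)).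
    by rewrite H /B; field; rewrite -normc_gt0 normc_real ger0_norm// ltW.
  have ns : normc ((vn z)%:C) = vn z by rewrite normc_real ger0_norm// vn_ge0.
  have Pb' (w : V) : normc (P a c b w) <= M * vn w ^+ 2.
    have [->|w0] := eqVneq w 0; last exact: Pb.
    by rewrite P0 normc0 mulr_ge0// exprn_ge0// vn_ge0.
  rewrite normcM normcV ns mulrC ler_pdivrMr//.
  have -> : 6 * M * vn z * vn z = M * (2 * vn z) ^+ 2 + M * vn z ^+ 2 + vn z ^+ 2 * M by ring.
  apply: normcB_le.
    apply: normcB_le; last exact: Pb'.
    apply: le_trans (Pb' _) _; rewrite ler_wpM2l//; apply: lerXn2r; rewrite ?nnegrE ?vn_ge0 ?mulr_ge0 ?vn_ge0//.
    exact: vn_add_ek.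
  rewrite normcM expr2 normcM ns ler_wpM2l ?mulr_ge0 ?vn_ge0//.
  by apply: le_trans (Pb' _) _; rewrite vn_ek expr1n mulr1.
have LB c b z : normc (L c b z) <= 6 * n.+1%:R * M * vn z.
  rewrite -[leRHS]mul1r; apply: normcM_le ninv _.
  apply: le_trans (normc_sum _ _ _) _; apply: (@le_trans _ _ (\sum_(l : I) 6 * M * vn z)).
    by apply: ler_sum => l _; exact: Bb.
  by rewrite sumr_const card_ord -mulr_natl le_eqVlt; apply/orP; left; apply/eqP; ring.
exists L; split.
- move=> c b z; rewrite /L -mulrN -sumrN; congr (_ * _); apply: eq_bigr => l _; exact: B2.
- move=> c b; split=> [z _|z t _ t0|z _]; last by rewrite expr1; exact: LB.
  + apply: hdZ; apply: hd_sum => l.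
    have -> : B l l c b = lf (fun x : I => polar (P l c b) (e x) (e l)); last exact: hd_lf.
    by apply/funext => y; rewrite /B polarC /lf (polar_sum (Ps l c b) (P0 l c b)).
  + rewrite /L expr1 [RHS]mulrCA; congr (_ * _); rewrite mulr_sumr; apply: eq_bigr => l _.
    by rewrite /B polarC (polarZ (Ps l c b) (P0 l c b)) polarC.
move=> a c b z; have [z0|z0] := eqVneq z 0.
  by rewrite z0 P0 !mxE !mul0r !addr0 subrr normc0 mulr_ge0 ?exprn_ge0 ?vn_ge0 ?mulr_ge0.
have s0 : 0 < vn z by exact: vn_gt0.
have [s ns] : exists s : C, normc s = vn z by exists (vn z)%:C; rewrite normc_real ger0_norm// ltW.
have sn0 : s != 0 by rewrite -normc_gt0 ns.
have con := @contraction (fun a c b => P a c b z) (fun l a c b => B l a c b z) 2 z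
  (fun l a c b => B1 l a c b z) (fun l a c b => B2 l a c b z) _ a c b.
have E : P a c b z - (z 0 a * L c b z + z 0 c * L b a z + z 0 b * L a c z) =
    n%:R^-1 * \sum_l (P a c b z + z 0 l * B l a c b z - (e l 0 a * P l c b z + z 0 a * B l l c b z)
    - (e l 0 c * P a l b z + z 0 c * B l a l b z) - (e l 0 b * P a c l z + z 0 b * B l a c l z)).
  rewrite con; last by move=> a' c' b'; rewrite (polar_sum (Ps a' c' b') (P0 a' c' b')) (polarxx (Ps a' c' b') (P0 a' c' b')).
  have -> : (n.+1%:R : C) = n%:R + 1 by rewrite -natr1.
  by rewrite /L; field.
rewrite E -[leRHS]mul1r; apply: normcM_le ninv _.
apply: le_trans (normc_sum _ _ _) _; apply: (@le_trans _ _ (\sum_(l : I) 9 * eta * vn z ^+ 2)); last first.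
  by rewrite sumr_const card_ord -mulr_natl le_eqVlt; apply/orP; left; apply/eqP; ring.
apply: ler_sum => l _.
have X (t : C) : normc t = vn z -> normc (wedge3 P l a c b (z + t *: e l)) <= 8 * eta * vn z ^+ 3.
  move=> tz; have -> : (8 : R) = 2 ^+ 3 by rewrite -natrX.
  exact: wedge3_bound.
have Xs := X s ns; have := X (- s); rewrite normcN => /(_ ns) Xn.
have Xe := q l a c b (s *: e l); rewrite vnZ ns vn_ek mulr1 in Xe.
set Q := (X in normc X <= _).
have -> : Q = s^-1 * ((wedge3 P l a c b (z + s *: e l) - wedge3 P l a c b (z + (- s) *: e l)) / 2 - wedge3 P l a c b (s *: e l)).
  have qE (t : C) a' c' b' : P a' c' b' (z + t *: e l) = P a' c' b' z + t * B l a' c' b' z + t ^+ 2 * P a' c' b' (e l).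
    exact: (quadE (Ps a' c' b') (P0 a' c' b')).
  have hE a' c' b' : P a' c' b' (s *: e l) = s ^+ 2 * P a' c' b' (e l).
    exact: (homogZ (Ps a' c' b') (P0 a' c' b')).
  have zE (t : C) (x : I) : (z + t *: e l) 0 x = z 0 x + t * e l 0 x by rewrite !mxE.
  have sE (x : I) : (s *: e l) 0 x = s * e l 0 x by rewrite mxE.
  have eE : e l 0 l = 1 by rewrite mxE !eqxx.
  rewrite /Q /wedge3.
  rewrite (qE s a c b) (qE s l c b) (qE s a l b) (qE s a c l) (zE s l) (zE s a) (zE s c) (zE s b).
  rewrite (qE (- s) a c b) (qE (- s) l c b) (qE (- s) a l b) (qE (- s) a c l) (zE (- s) l) (zE (- s) a) (zE (- s) c) (zE (- s) b).
  rewrite (hE a c b) (hE l c b) (hE a l b) (hE a c l) (sE l) (sE a) (sE c) (sE b) eE.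
  exact: wedge3_diff2.
rewrite normcM normcV ns mulrC ler_pdivrMr//.
have -> : 9 * eta * vn z ^+ 2 * vn z = (8 * eta * vn z ^+ 3 + 8 * eta * vn z ^+ 3) * 2^-1 + eta * vn z ^+ 3 by field.
apply: normcB_le => //; apply: normcM_le; first exact: normcB_le.
by rewrite normcV normc_nat.
Qed.

(** The homotopy of [koszul2] in degree 1, where the divisor is [n - 1]. *)
Lemma koszul1 : (0 < n)%N -> (forall a c b, sec (@nz R n.+1) 1 M (P a c b)) ->
  (forall l a c b z, normc (wedge3 P l a c b z) <= eta * vn z ^+ 2) ->
  exists Y : I -> I -> C, [/\ forall c b, Y b c = - Y c b,
    forall c b, normc (Y c b) <= n.+1%:R * M &
    forall a c b z, normc (P a c b z - (z 0 a * Y c b + z 0 c * Y b a + z 0 b * Y a c)) <=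
      6 * n.+1%:R * eta * vn z].
Proof.
move=> n0 Ps q; have [A1 A2] := PA.
(* For [n = 1] the divisor vanishes, but an alternating 3-form in two variables is 0. *)
have [n1|n1] := leqP n 1.
  exists (fun _ _ => 0); split=> [_ _|_ _|a c b z]; first by rewrite oppr0.
    by rewrite normc0 mulr_ge0.
  have P1 (x y : I) (w : V) : P x x y w = 0.
    by have := A1 x x y w => /eqP; rewrite -subr_eq0 opprK -mulr2n mulrn_eq0 => /eqP.
  have P2 (x y : I) (w : V) : P x y y w = 0.
    by have := A2 x y y w => /eqP; rewrite -subr_eq0 opprK -mulr2n mulrn_eq0 => /eqP.
  have -> : P a c b z = 0.
    have [->|ac] := eqVneq a c; first exact: P1.
    have [->|cb] := eqVneq c b; first exact: P2.
    have ab : a = b.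
      apply/val_inj => /=; move: ac cb; rewrite -!val_eqE /=.
      have := ltn_ord a; have := ltn_ord b; have := ltn_ord c; move: n0 n1; clear.
      by case: n a b c => [|[|]]//= a b c _ _; case: a => [[|[]]]//=; case: b => [[|[]]]//=; case: c => [[|[]]].
    by rewrite ab A1 P2 oppr0.
  by rewrite !mulr0 !addr0 subrr normc0 !mulr_ge0 ?vn_ge0.
have nn0 : (n.-1%:R : C) != 0 by rewrite pnatr_eq0; case: (n) n1 => [|[]].
have ninv : normc ((n.-1%:R : C)^-1) <= 1.
  rewrite normcV invf_le1; last by rewrite normc_gt0.
  by rewrite normc_nat ler1n; case: (n) n1 => [|[]].
pose B l a c b := P a c b (e l).
pose Y c b := n.-1%:R^-1 * \sum_l B l l c b.
have Pb' a c b (w : V) : normc (P a c b w) <= M * vn w ^+ 1.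
  have [->|w0] := eqVneq w 0; last by case: (Ps a c b) => _ _; exact.
  by rewrite P0 normc0 mulr_ge0// exprn_ge0// vn_ge0.
exists Y; split.
- by move=> c b; rewrite /Y -mulrN -sumrN; congr (_ * _); apply: eq_bigr => l _; exact: A2.
- move=> c b; rewrite -[leRHS]mul1r; apply: normcM_le ninv _.
  apply: le_trans (normc_sum _ _ _) _; apply: (@le_trans _ _ (\sum_(l : I) M)).
    by apply: ler_sum => l _; apply: le_trans (Pb' _ _ _ _) _; rewrite vn_ek expr1 mulr1.
  by rewrite sumr_const card_ord -[M *+ _]mulr_natl.
move=> a c b z; have [z0|z0] := eqVneq z 0.
  by rewrite z0 P0 !mxE !mul0r !addr0 subrr normc0 mulr_ge0 ?exprn_ge0 ?vn_ge0 ?mulr_ge0.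
have s0 : 0 < vn z by exact: vn_gt0.
have [s ns] : exists s : C, normc s = vn z by exists (vn z)%:C; rewrite normc_real ger0_norm// ltW.
have sn0 : s != 0 by rewrite -normc_gt0 ns.
have con := @contraction (fun a c b => P a c b z) B 1 z
  (fun l a c b => A1 a c b (e l)) (fun l a c b => A2 a c b (e l)) _ a c b.
have E : P a c b z - (z 0 a * Y c b + z 0 c * Y b a + z 0 b * Y a c) =
    n.-1%:R^-1 * \sum_l (P a c b z + z 0 l * B l a c b - (e l 0 a * P l c b z + z 0 a * B l l c b)
    - (e l 0 c * P a l b z + z 0 c * B l a l b) - (e l 0 b * P a c l z + z 0 b * B l a c l)).
  rewrite con; last by move=> a' c' b'; rewrite (homog1_sum (Ps a' c' b') (P0 a' c' b')) mul1r.
  have -> : (n.+1%:R : C) = n.-1%:R + 2 by rewrite -natrD; case: (n) n1 => [|k] // _; rewrite addn2.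
  rewrite /Y; field; exact: nn0.
rewrite E -[leRHS]mul1r; apply: normcM_le ninv _.
apply: le_trans (normc_sum _ _ _) _; apply: (@le_trans _ _ (\sum_(l : I) 6 * eta * vn z)); last first.
  by rewrite sumr_const card_ord -mulr_natl le_eqVlt; apply/orP; left; apply/eqP; ring.
apply: ler_sum => l _.
have Xs : normc (wedge3 P l a c b (z + s *: e l)) <= 4 * eta * vn z ^+ 2.
  have -> : (4 : R) = 2 ^+ 2 by rewrite -natrX.
  exact: wedge3_bound.
have Xz := q l a c b z.
have Xe := q l a c b (s *: e l); rewrite vnZ ns vn_ek mulr1 in Xe.
set Q := (X in normc X <= _).
have -> : Q = s^-1 * (wedge3 P l a c b (z + s *: e l) - wedge3 P l a c b z - wedge3 P l a c b (s *: e l)).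
  have qE a' c' b' : P a' c' b' (z + s *: e l) = P a' c' b' z + P a' c' b' (s *: e l).
    exact: (homog1D (Ps a' c' b') (P0 a' c' b')).
  have hE a' c' b' : P a' c' b' (s *: e l) = s ^+ 1 * P a' c' b' (e l).
    exact: (homogZ (Ps a' c' b') (P0 a' c' b')).
  have zE (t : C) (x : I) : (z + t *: e l) 0 x = z 0 x + t * e l 0 x by rewrite !mxE.
  have sE (x : I) : (s *: e l) 0 x = s * e l 0 x by rewrite mxE.
  have eE : e l 0 l = 1 by rewrite mxE !eqxx.
  rewrite /Q /wedge3 (qE a c b) (qE l c b) (qE a l b) (qE a c l) (hE a c b) (hE l c b) (hE a l b) (hE a c l).
  rewrite (zE s l) (zE s a) (zE s c) (zE s b) (sE l) (sE a) (sE c) (sE b) eE /B.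
  exact: wedge3_diff1.
rewrite normcM normcV ns mulrC ler_pdivrMr//.
have -> : 6 * eta * vn z * vn z = 4 * eta * vn z ^+ 2 + eta * vn z ^+ 2 + eta * vn z ^+ 2 by ring.
by apply: normcB_le => //; exact: normcB_le.
Qed.

End Deg.
End Koszul.

(** * Vanishing of [H^1(E)] with bounds *)

Section CousinE.
Variables (R : realType) (n : nat).
Local Notation C := R[i].
Local Notation I := 'I_n.+1.
Local Notation V := 'rV[C]_n.+1.
Local Notation tens := (I -> I -> I -> C).
Local Notation field3 := (I -> I -> I -> V -> C).
Implicit Types (x y z : V) (s u w : C) (a b c i j k l : I) (t : tens).

Definition skew3 t := forall k a b, t k b a = - t k a b.
Definition wdg z t k a c b := z 0 a * t k c b + z 0 c * t k b a + z 0 b * t k a c.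
Definition cyc3 t k a b := t k a b + t a b k + t b k a.
(** Linear equations for the image of [psi_z] in the tensors: skew in the last two indices, killed
    by [z /\ _] there, and of zero cyclic sum. *)
Definition inE z t := [/\ skew3 t, forall k a c b, wdg z t k a c b = 0 & forall k a b, cyc3 t k a b = 0].

Definition at3 (T : field3) z : tens := fun k a b => T k a b z.

Lemma wdg_bound z t e d : (forall k a b, normc (t k a b) <= e * vn z ^+ d) ->
  forall k a c b, normc (wdg z t k a c b) <= 3 * e * vn z ^+ d.+1.
Proof.
move=> H k a c b; have -> : 3 * e * vn z ^+ d.+1 = vn z * (e * vn z ^+ d) + vn z * (e * vn z ^+ d) + vn z * (e * vn z ^+ d).
  by rewrite exprS; ring.
by apply: normcD_le; first (apply: normcD_le); apply: normcM_le => //; exact: normc_le_vn.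
Qed.

Lemma cyc3_bound t (e : R) : (forall k a b, normc (t k a b) <= e) ->
  forall k a b, normc (cyc3 t k a b) <= 3 * e.
Proof.
move=> H k a b; have -> : 3 * e = e + e + e by ring.
by apply: normcD_le; [apply: normcD_le|]; exact: H.
Qed.

(** The projection onto alternating tensors, applied to functions that [glob] produces component by
    component. *)
Definition alt (P : field3) a c b z : C := 6^-1 *
  (P a c b z + P c b a z + P b a c z - P c a b z - P a b c z - P b c a z).

Lemma alt_form3 P : form3 (alt P).
Proof. by split=> a c b z; rewrite /alt -mulrN; congr (_ * _); ring. Qed.

Lemma normc_alt (x1 x2 x3 x4 x5 x6 : C) (e : R) :
  normc x1 <= e -> normc x2 <= e -> normc x3 <= e -> normc x4 <= e -> normc x5 <= e -> normc x6 <= e ->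
  normc (6^-1 * (x1 + x2 + x3 - x4 - x5 - x6)) <= e.
Proof.
move=> h1 h2 h3 h4 h5 h6; have -> : e = 6^-1 * (e + e + e + e + e + e) by field.
apply: normcM_le; first by rewrite normcV normc_nat.
by do 3?[apply: normcB_le => //]; do 2?[apply: normcD_le => //].
Qed.

Lemma sec_alt (U : set V) d (M : R) P : (forall a c b, sec U d M (P a c b)) ->
  forall a c b, sec U d M (alt P a c b).
Proof.
move=> Ps a c b; split=> [z Uz|z s Uz s0|z Uz].
- apply: hdZ; have H a' c' b' : hd (P a' c' b') z by case: (Ps a' c' b') => H _ _; exact: H.
  by do 3?[apply: hdB => //]; do 2?[apply: hdD => //].
- have H a' c' b' : P a' c' b' (s *: z) = s ^+ d * P a' c' b' z by case: (Ps a' c' b') => _ H _; exact: H.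
  by rewrite /alt !H; ring.
- by apply: normc_alt; [case: (Ps a c b)|case: (Ps c b a)|case: (Ps b a c)|case: (Ps c a b)|case: (Ps a b c)|case: (Ps b c a)] => _ _; exact.
Qed.

Lemma alt_close P z (Q : tens) (e : R) : (forall a c b, Q c a b = - Q a c b) -> (forall a c b, Q a b c = - Q a c b) ->
  (forall a c b, normc (P a c b z - Q a c b) <= e) -> forall a c b, normc (alt P a c b z - Q a c b) <= e.
Proof.
move=> q1 q2 H a c b.
have -> : alt P a c b z - Q a c b = 6^-1 * ((P a c b z - Q a c b) + (P c b a z - Q c b a) + (P b a c z - Q b a c)
   - (P c a b z - Q c a b) - (P a b c z - Q a b c) - (P b c a z - Q b c a)).
  by rewrite /alt (q2 c a b) (q1 a c b) (q1 a b c) (q2 a c b) (q1 c b a) (q2 c a b) (q1 a c b); field.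
by apply: normc_alt.
Qed.

Lemma alt0 P : (forall a c b, P a c b 0 = 0) -> forall a c b, alt P a c b 0 = 0.
Proof. by move=> H a c b; rewrite /alt !H; ring. Qed.

Lemma sec_coordM (U : set V) d M f a : sec U d M f -> sec U d.+1 M (fun z => z 0 a * f z).
Proof.
move=> [h1 h2 h3]; split=> [z Uz|z s Uz s0|z Uz].
- by apply: hdM; [exact: hd_coord|exact: h1].
- by rewrite h2// mxE exprS; ring.
- rewrite exprS mulrCA; apply: normcM_le; [exact: normc_le_vn|exact: h3].
Qed.

Lemma wedge3_near (P : field3) (Q : tens) z (e e' : R) d :
  (forall a c b, normc (P a c b z - Q a c b) <= e * vn z ^+ d) ->
  (forall l a c b, normc (z 0 l * Q a c b - z 0 a * Q l c b - z 0 c * Q a l b - z 0 b * Q a c l) <= e' * vn z ^+ d.+1) ->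
  forall l a c b, normc (wedge3 P l a c b z) <= (4 * e + e') * vn z ^+ d.+1.
Proof.
move=> H H' l a c b.
have -> : wedge3 P l a c b z = (z 0 l * (P a c b z - Q a c b) - z 0 a * (P l c b z - Q l c b)
   - z 0 c * (P a l b z - Q a l b) - z 0 b * (P a c l z - Q a c l)) +
   (z 0 l * Q a c b - z 0 a * Q l c b - z 0 c * Q a l b - z 0 b * Q a c l).
  by rewrite /wedge3; ring.
rewrite mulrDl; apply: normcD_le => //.
set B := vn z * (e * vn z ^+ d); have -> : 4 * e * vn z ^+ d.+1 = B + B + B + B.
  by rewrite /B exprS; ring.
by do 3?[apply: normcB_le]; apply: normcM_le => //; exact: normc_le_vn.
Qed.

Section Solve.
Hypothesis n0 : (0 < n)%N.
Variables (c : I -> I -> field3) (M eta : R).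
Hypotheses (e0 : 0 <= eta) (eM : eta <= M).
Hypotheses (cs : forall i j k a b, sec (om i `&` om j) 1 M (c i j k a b)).
Hypotheses (cE : forall i j z, om i z -> om j z -> inE z (at3 (c i j) z)).
Hypotheses (cc : forall i j l k a b z, om i z -> om j z -> om l z ->
  normc (c i j k a b z + c j l k a b z - c i l k a b z) <= eta * vn z).
Let M0 : 0 <= M := le_trans e0 eM.
Let op : (ord0 : I) != ord_max. Proof. by rewrite -val_eqE /= neq_ltn n0. Qed.
Let K1 : R := KH R 1.
Let K1p : 0 <= K1. Proof. exact/ltW/KH_gt0. Qed.

Lemma step_h : exists h : I -> field3, [/\ forall i k a b, sec (om i) 1 (K1 * M) (h i k a b),
  forall i z, skew3 (at3 (h i) z) &
  forall i j k a b z, om i z -> om j z -> normc (h j k a b z - h i k a b z - c i j k a b z) <= K1 * eta * vn z].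
Proof.
have H k a b : exists h : I -> V -> C, (forall i, sec (om i) 1 (K1 * M) (h i)) /\
    forall i j z, om i z -> om j z -> normc (h j z - h i z - c i j k a b z) <= K1 * eta * vn z ^+ 1.
  by apply: (cousin op M0 e0) => // i j l z zi zj zl; rewrite expr1; exact: cc.
have [h1 Hh1] := choice (fun kab : I * I * I => H kab.1.1 kab.1.2 kab.2).
pose h0 i k a b := h1 (k, a, b) i.
have hs i k a b : sec (om i) 1 (K1 * M) (h0 i k a b) by case: (Hh1 (k, a, b)) => H' _; exact: H'.
have hc i j k a b z : om i z -> om j z -> normc (h0 j k a b z - h0 i k a b z - c i j k a b z) <= K1 * eta * vn z.
  by move=> zi zj; case: (Hh1 (k, a, b)) => _ /(_ i j z zi zj); rewrite expr1.
have half : normc ((2 : C)^-1) = 2^-1 by rewrite normcV normc_nat.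
exists (fun i k a b z => 2^-1 * (h0 i k a b z - h0 i k b a z)); split.
- move=> i k a b; have := secZ 2^-1 (secB (hs i k a b) (hs i k b a)).
  have E2 : 2^-1 * (K1 * M + K1 * M) = K1 * M by field.
  by rewrite half E2.
- by move=> i z k a b; rewrite /at3; ring.
- move=> i j k a b z zi zj; have [sk _ _] := cE zi zj.
  have := sk k a b; rewrite /at3 => skc.
  have -> : 2^-1 * (h0 j k a b z - h0 j k b a z) - 2^-1 * (h0 i k a b z - h0 i k b a z) - c i j k a b z =
    2^-1 * ((h0 j k a b z - h0 i k a b z - c i j k a b z) - (h0 j k b a z - h0 i k b a z - c i j k b a z)).
    by rewrite skc; field.
  have -> : K1 * eta * vn z = 2^-1 * (K1 * eta * vn z + K1 * eta * vn z) by field.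
  by apply: normcM_le; [rewrite half|apply: normcB_le; exact: hc].
Qed.

Let k2 : R := KH R 2 * (3 * K1).
Let m2 : R := 3 * K1 + k2.
Let k3 : R := 9 * n.+1%:R * (4 * k2).
Let m3 : R := K1 + 6 * n.+1%:R * m2.

(** Since [c] satisfies [z /\ c = 0], the forms [z /\ h i] nearly agree and glue to global quadratic
    forms [P]. As [z /\ P] is nearly 0, [koszul2] writes [P] approximately as [z /\ L] with [L]
    global. Subtracting [L] from all [h i] leaves the coboundary unchanged and makes [z /\ h i]
    small. *)
Lemma step_h' : exists h : I -> field3, [/\ forall i k a b, sec (om i) 1 (m3 * M) (h i k a b),
  forall i z, skew3 (at3 (h i) z),
  forall i j k a b z, om i z -> om j z -> normc (h j k a b z - h i k a b z - c i j k a b z) <= K1 * eta * vn z &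
  forall i k a c b z, om i z -> normc (wdg z (at3 (h i) z) k a c b) <= (k2 + k3) * eta * vn z ^+ 2].
Proof.
have [h [hs hA hc]] := step_h.
have k2p : 0 <= k2 by rewrite !mulr_ge0 ?(ltW (KH_gt0 _ _)).
have HP k a c' b : exists f, [/\ sec (@nz R n.+1) 2 (m2 * M) f, f 0 = 0 &
    forall i z, om i z -> normc (f z - wdg z (at3 (h i) z) k a c' b) <= k2 * eta * vn z ^+ 2].
  have [||||f [f1 f2 f3]] := @glob R n.+1 2 _ _ (fun i z => wdg z (at3 (h i) z) k a c' b) (3 * (K1 * M)) (3 * (K1 * eta)) op.
  - by rewrite !mulr_ge0.
  - by rewrite !mulr_ge0.
  - move=> i; have := secD (secD (sec_coordM a (hs i k c' b)) (sec_coordM c' (hs i k b a))) (sec_coordM b (hs i k a c')).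
    by have -> : 3 * (K1 * M) = K1 * M + K1 * M + K1 * M by ring.
  - move=> i j z zi zj; have [_ w0 _] := cE zi zj.
    have -> : wdg z (at3 (h j) z) k a c' b - wdg z (at3 (h i) z) k a c' b =
      wdg z (fun k a b => h j k a b z - h i k a b z - c i j k a b z) k a c' b.
      have := w0 k a c' b; rewrite /wdg /at3 => w1.
      rewrite -[LHS]subr0 -w1; ring.
    by apply: wdg_bound => k' a' b'; rewrite expr1; exact: hc.
  exists f; split=> // [|i z zi].
    apply: sec_sub f1 => //; have -> : m2 * M = 3 * K1 * M + k2 * M by rewrite /m2; ring.
    have -> : 3 * (K1 * M) = 3 * K1 * M by ring.
    have -> : KH R 2 * (3 * (K1 * eta)) = k2 * eta by rewrite /k2; ring.
    by rewrite lerD2l ler_wpM2l.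
  by have := f3 i z zi; rewrite /k2 !mulrA.
have [P0' HP0] := choice (fun q : I * I * I * I => HP q.1.1.1 q.1.1.2 q.1.2 q.2).
pose P0 k a c' b := P0' (k, a, c', b).
have P0P k a c' b := HP0 (k, a, c', b).
have Ps k a c' b : sec (@nz R n.+1) 2 (m2 * M) (alt (P0 k) a c' b).
  by apply: sec_alt => a1 c1 b1; case: (P0P k a1 c1 b1).
have Pz k a c' b : alt (P0 k) a c' b 0 = 0 by apply: alt0 => a1 c1 b1; case: (P0P k a1 c1 b1).
have Pn i k z : om i z -> forall a c' b, normc (alt (P0 k) a c' b z - wdg z (at3 (h i) z) k a c' b) <= k2 * eta * vn z ^+ 2.
  move=> zi; have sk := hA i z k; apply: alt_close => [a1 c1 b1|a1 c1 b1|a1 c1 b1].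
  - by rewrite /wdg (sk a1 c1) (sk b1 a1) (sk c1 b1); ring.
  - by rewrite /wdg (sk a1 c1) (sk b1 a1) (sk c1 b1); ring.
  - by case: (P0P k a1 c1 b1) => _ _; apply.
(* Because [z /\ (z /\ h i)] is identically 0. *)
have Pw k l a c' b z : normc (wedge3 (alt (P0 k)) l a c' b z) <= 4 * k2 * eta * vn z ^+ 3.
  have [->|z0] := eqVneq z 0.
    by rewrite /wedge3 !mxE !mul0r !subr0 normc0 vn0 expr0n mulr0.
  have [i zi] := om_cover z0.
  have -> : 4 * k2 * eta = 4 * (k2 * eta) + 0 by ring.
  apply: (wedge3_near (Q := fun a c' b => wdg z (at3 (h i) z) k a c' b)) => [a1 c1 b1|l1 a1 c1 b1].
    exact: Pn.
  rewrite mul0r; have sk := hA i z k; rewrite /wdg (sk c1 l1) (sk l1 b1) (sk l1 a1).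
  set Q := (X in normc X); suff -> : Q = 0 by rewrite normc0.
  rewrite /Q; ring.
have HL k : exists L : I -> I -> V -> C, [/\ forall c b z, L b c z = - L c b z,
    forall c b, sec setT 1 (6 * n.+1%:R * (m2 * M)) (L c b) &
    forall a c b z, normc (alt (P0 k) a c b z - (z 0 a * L c b z + z 0 c * L b a z + z 0 b * L a c z)) <=
      9 * n.+1%:R * (4 * k2 * eta) * vn z ^+ 2].
  have e4 : 0 <= 4 * k2 * eta by apply: mulr_ge0 => //; apply: mulr_ge0.
  have m4 : 0 <= m2 * M by apply: mulr_ge0 => //; apply: addr_ge0 => //; apply: mulr_ge0.
  exact: (koszul2 (alt_form3 _) (Pz k) e4 m4 n0 (Ps k) (Pw k)).
have [L HL'] := choice HL.
exists (fun i k a b z => h i k a b z - L k a b z); split.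
- move=> i k a b; have [_ Ls _] := HL' k.
  rewrite /m3 mulrDl; apply: secB => //; rewrite -mulrA; apply: (sec_sub _ (lexx _) (Ls a b)) => //.
- by move=> i z k a b; have [La _ _] := HL' k; rewrite /at3 La; have := hA i z k a b; rewrite /at3 => ->; ring.
- by move=> i j k a b z zi zj; have := hc i j k a b z zi zj; congr (normc _ <= _); ring.
- move=> i k a c' b z zi; have [_ _ Lc] := HL' k.
  have -> : wdg z (at3 (fun k a b z => h i k a b z - L k a b z) z) k a c' b =
    (alt (P0 k) a c' b z - (z 0 a * L k c' b z + z 0 c' * L k b a z + z 0 b * L k a c' z))
     - (alt (P0 k) a c' b z - wdg z (at3 (h i) z) k a c' b) by rewrite /wdg /at3; ring.
  have -> : (k2 + k3) * eta * vn z ^+ 2 = k3 * eta * vn z ^+ 2 + k2 * eta * vn z ^+ 2 by ring.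
  apply: normcB_le; last exact: Pn.
  by have := Lc a c' b z; rewrite /k3 !mulrA.
Qed.

Let k4 : R := k2 + k3.
Let k5 : R := K1 * (3 * K1).
Let m4 : R := 3 * m3 + k5.
Let k7 : R := 6 * n.+1%:R * (4 * k5 + 4 * k4).
Let m5 : R := m3 + n.+1%:R * m4.
Let k8 : R := k5 + k7.

Let k2p : 0 <= k2. Proof. by apply: mulr_ge0; [exact/ltW/KH_gt0|apply: mulr_ge0]. Qed.
Let k3p : 0 <= k3. Proof. by apply: mulr_ge0; [apply: mulr_ge0|apply: mulr_ge0]. Qed.
Let m2p : 0 <= m2. Proof. by apply: addr_ge0 => //; apply: mulr_ge0. Qed.
Let m3p : 0 <= m3. Proof. by apply: addr_ge0 => //; apply: mulr_ge0 => //; apply: mulr_ge0. Qed.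
Let k4p : 0 <= k4. Proof. exact: addr_ge0. Qed.
Let k5p : 0 <= k5. Proof. by apply: mulr_ge0 => //; apply: mulr_ge0. Qed.
Let m4p : 0 <= m4. Proof. by apply: addr_ge0 => //; apply: mulr_ge0. Qed.
Let k7p : 0 <= k7.
Proof. by apply: mulr_ge0; [apply: mulr_ge0|apply: addr_ge0; apply: mulr_ge0]. Qed.
Let m5p : 0 <= m5. Proof. by apply: addr_ge0 => //; apply: mulr_ge0. Qed.
Let k8p : 0 <= k8. Proof. exact: addr_ge0. Qed.

Lemma sec_cst (U : set V) (s : C) : sec U 0 (normc s) (fun=> s).
Proof.
by split=> [z _|z w _ _|z _]; [exact: hd_cst|rewrite mul1r|rewrite mulr1].
Qed.

Lemma step_cyc : exists h : I -> field3, [/\ forall i k a b, sec (om i) 1 (m5 * M) (h i k a b),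
  forall i z, skew3 (at3 (h i) z),
  forall i j k a b z, om i z -> om j z -> normc (h j k a b z - h i k a b z - c i j k a b z) <= K1 * eta * vn z &
  forall i z, om i z -> (forall k a c b, normc (wdg z (at3 (h i) z) k a c b) <= k4 * eta * vn z ^+ 2) /\
    forall k a b, normc (cyc3 (at3 (h i) z) k a b) <= k8 * eta * vn z].
Proof.
have [h [hs hA hc hw]] := step_h'.
have HP k a b : exists f, [/\ sec (@nz R n.+1) 1 (m4 * M) f, f 0 = 0 &
    forall i z, om i z -> normc (f z - cyc3 (at3 (h i) z) k a b) <= k5 * eta * vn z ^+ 1].
  have [||||f [f1 f2 f3]] := @glob R n.+1 1 _ _ (fun i z => cyc3 (at3 (h i) z) k a b) (3 * (m3 * M)) (3 * (K1 * eta)) op.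
  - by apply: mulr_ge0 => //; apply: mulr_ge0.
  - by apply: mulr_ge0 => //; apply: mulr_ge0.
  - move=> i; have := secD (secD (hs i k a b) (hs i a b k)) (hs i b k a).
    by have -> : 3 * (m3 * M) = m3 * M + m3 * M + m3 * M by ring.
  - move=> i j z zi zj; have [_ _ w0] := cE zi zj.
    have -> : cyc3 (at3 (h j) z) k a b - cyc3 (at3 (h i) z) k a b =
      cyc3 (fun k a b => h j k a b z - h i k a b z - c i j k a b z) k a b.
      have := w0 k a b; rewrite /cyc3 /at3 => w1.
      rewrite -[LHS]subr0 -w1; ring.
    have -> : 3 * (K1 * eta) * vn z ^+ 1 = 3 * (K1 * eta * vn z) by ring.
    by apply: cyc3_bound => k' a' b'; exact: hc.
  exists f; split=> // [|i z zi].
    apply: sec_sub f1 => //; have -> : m4 * M = 3 * (m3 * M) + k5 * M by rewrite /m4; ring.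
    have -> : KH R 1 * (3 * (K1 * eta)) = k5 * eta by rewrite /k5 /K1; ring.
    by rewrite lerD2l ler_wpM2l.
  by have := f3 i z zi; rewrite /k5 !mulrA.
have [P0' HP0] := choice (fun q : I * I * I => HP q.1.1 q.1.2 q.2).
pose P0 k a b := P0' (k, a, b).
have P0P k a b := HP0 (k, a, b).
have Ps k a b : sec (@nz R n.+1) 1 (m4 * M) (alt P0 k a b).
  by apply: sec_alt => a1 c1 b1; case: (P0P a1 c1 b1).
have Pz k a b : alt P0 k a b 0 = 0 by apply: alt0 => a1 c1 b1; case: (P0P a1 c1 b1).
have Pn i z : om i z -> forall k a b, normc (alt P0 k a b z - cyc3 (at3 (h i) z) k a b) <= k5 * eta * vn z ^+ 1.
  move=> zi; have sk := hA i z; apply: alt_close => [a1 c1 b1|a1 c1 b1|a1 c1 b1].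
  - by rewrite /cyc3 (sk a1 c1 b1) (sk c1 b1 a1) (sk b1 a1 c1); ring.
  - by rewrite /cyc3 (sk a1 c1 b1) (sk c1 b1 a1) (sk b1 a1 c1); ring.
  - by case: (P0P a1 c1 b1) => _ _; apply.
(* The product of [z] with a cyclic sum is a combination of four values of [wdg], already small by
   [step_h']. *)
have Pw l k a b z : normc (wedge3 (alt P0) l k a b z) <= (4 * k5 + 4 * k4) * eta * vn z ^+ 2.
  have [->|z0] := eqVneq z 0.
    by rewrite /wedge3 !mxE !mul0r !subr0 normc0 vn0 expr0n mulr0.
  have [i zi] := om_cover z0.
  have -> : (4 * k5 + 4 * k4) * eta = 4 * (k5 * eta) + 4 * (k4 * eta) by ring.
  apply: (wedge3_near (Q := cyc3 (at3 (h i) z))) => [a1 c1 b1|l1 k1 a1 b1]; first exact: Pn.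
  have sk := hA i z; set Q := (X in normc X).
  have -> : Q = wdg z (at3 (h i) z) k1 l1 a1 b1 + wdg z (at3 (h i) z) a1 l1 b1 k1 + wdg z (at3 (h i) z) b1 l1 k1 a1
      - wdg z (at3 (h i) z) l1 k1 a1 b1.
    rewrite /Q /wdg /cyc3; set t := at3 (h i) z in sk *.
    rewrite (sk k1 l1 b1) (sk k1 a1 l1) (sk a1 l1 k1) (sk a1 b1 l1) (sk b1 l1 a1) (sk b1 k1 l1).
    rewrite (sk l1 k1 b1); ring.
  set B := k4 * eta * vn z ^+ 2.
  have -> : 4 * (k4 * eta) * vn z ^+ 2 = B + B + B + B by rewrite /B; ring.
  by apply: normcB_le; [apply: normcD_le; [apply: normcD_le|]|]; exact: hw.
have E0 : 0 <= (4 * k5 + 4 * k4) * eta.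
  by apply: mulr_ge0 => //; apply: addr_ge0; apply: mulr_ge0.
have M4 : 0 <= m4 * M by exact: mulr_ge0.
have [Y [YA Yb Yc]] := koszul1 (alt_form3 P0) Pz E0 M4 n0 Ps Pw.
(* The correction is a multiple of [z /\ Y k], so it preserves [wdg]; as [Y] is skew, it changes the
   cyclic sum by [- z /\ Y]. *)
exists (fun i k a b z => h i k a b z + 2^-1 * (z 0 a * Y k b - z 0 b * Y k a)); split.
- move=> i k a b; have -> : m5 * M = m3 * M + n.+1%:R * m4 * M by rewrite /m5; ring.
  apply: secD => //.
  have Ys (x y : I) : sec (om i) 1 (n.+1%:R * m4 * M) (fun z => z 0 x * Y k y).
    by apply: sec_coordM; apply: (sec_sub _ _ (sec_cst (om i) (Y k y))) => //; have := Yb k y; rewrite mulrA.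
  have := secZ 2^-1 (secB (Ys a b) (Ys b a)); rewrite normcV normc_nat.
  by have -> : 2^-1 * (n.+1%:R * m4 * M + n.+1%:R * m4 * M) = n.+1%:R * m4 * M by field.
- by move=> i z k a b; rewrite /at3; have := hA i z k a b; rewrite /at3 => ->; ring.
- by move=> i j k a b z zi zj; have := hc i j k a b z zi zj; congr (normc _ <= _); ring.
- move=> i z zi; split=> [k a c' b|k a b].
    by have := hw i k a c' b z zi; congr (normc _ <= _); rewrite /wdg /at3; ring.
  have -> : cyc3 (at3 (fun k a b z => h i k a b z + 2^-1 * (z 0 a * Y k b - z 0 b * Y k a)) z) k a b =
    (alt P0 k a b z - (z 0 k * Y a b + z 0 a * Y b k + z 0 b * Y k a))
     - (alt P0 k a b z - cyc3 (at3 (h i) z) k a b).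
    by rewrite /cyc3 /at3 (YA a k) (YA b a) (YA k b); field.
  have -> : k8 * eta * vn z = k7 * eta * vn z + k5 * eta * vn z ^+ 1 by rewrite /k8; ring.
  apply: normcB_le; last exact: Pn.
  by have := Yc k a b z; rewrite /k7 !mulrA.
Qed.

Let W : R := 32 * n.+1%:R.
Let k9 : R := k4 * W + (k8 * W + k4 * W ^+ 2).

Lemma vn_om i z : om i z -> vn z <= W * normc (z 0 i).
Proof.
move=> zi; rewrite /W [32 * _]mulrC -mulrA.
apply: (@le_trans _ _ (\sum_(j : I) 32 * normc (z 0 i))); first by apply: ler_sum => j _; exact: ltW.
by rewrite sumr_const card_ord -[_ *+ _]mulr_natl.
Qed.

Lemma om_divr i z (x : C) (e : R) d : om i z -> 0 <= e -> normc x <= e * vn z ^+ d.+1 ->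
  normc (x / z 0 i) <= e * W * vn z ^+ d.
Proof.
move=> zi e0' h; have zp := om_gt0 zi; rewrite normcM normcV ler_pdivrMr//; apply: le_trans h _.
rewrite exprS; have -> : e * W * vn z ^+ d * normc (z 0 i) = e * (W * normc (z 0 i) * vn z ^+ d) by ring.
by rewrite ler_wpM2l// ler_wpM2r ?exprn_ge0 ?vn_ge0//; exact: vn_om.
Qed.

(** The symmetric matrix with zero [(i, i)] entry that [psi_z] sends to [t], when [t] lies in the
    fibre of [E] (see [nfm_psit]). *)
Definition nf i z t k b : C := (t k i b + t b i k) / (2 * z 0 i) + (z 0 b * t i i k + z 0 k * t i i b) / (2 * z 0 i ^+ 2).

Definition proj i z t k a b : C := z 0 a * nf i z t k b - z 0 b * nf i z t k a.

Lemma proj_inE i z t : inE z (proj i z t).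
Proof.
have S k b : nf i z t k b = nf i z t b k by rewrite /nf; congr (_ / _ + _ / _); exact: addrC.
split=> [k a b|k a c' b|k a b].
- by rewrite /proj; ring.
- by rewrite /wdg /proj; ring.
- by rewrite /cyc3 /proj (S k b) (S a k) (S b a); ring.
Qed.

(** The distance from [t] to the fibre of [E] is controlled by the defects in the equations of
    [inE]. *)
Lemma projE i z t k a b : z 0 i != 0 -> skew3 t ->
  proj i z t k a b - t k a b = wdg z t k a i b / z 0 i - 2^-1 *
   (z 0 a * (cyc3 t k i b / z 0 i - wdg z t i i b k / z 0 i ^+ 2) -
    z 0 b * (cyc3 t k i a / z 0 i - wdg z t i i a k / z 0 i ^+ 2)).
Proof.
move=> zi sk; rewrite /proj /nf /wdg /cyc3.
rewrite (sk k i a) (sk i i k) (sk b i k) (sk a i k) (sk i k b) (sk i k a) (sk k a b).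
by field.
Qed.

Let Wp : 0 <= W. Proof. exact: mulr_ge0. Qed.
Let k9p : 0 <= k9.
Proof.
apply: addr_ge0; first exact: mulr_ge0.
by apply: addr_ge0; apply: mulr_ge0 => //; apply: exprn_ge0.
Qed.

Definition KE : R := (m5 + k9) + (2 * k9 + K1).

Lemma KE_ge0 : 0 <= KE.
Proof. by apply: addr_ge0; apply: addr_ge0 => //; apply: mulr_ge0. Qed.

(** The approximate solution of [step_cyc] is projected onto [E]; by [projE] this moves it by a
    multiple of [eta] only. *)
Lemma cousinE : exists h : I -> field3, [/\ forall i k a b, sec (om i) 1 (KE * M) (h i k a b),
  forall i z, om i z -> inE z (at3 (h i) z) &
  forall i j k a b z, om i z -> om j z -> normc (h j k a b z - h i k a b z - c i j k a b z) <= KE * eta * vn z].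
Proof.
have [h [hs hA hc hw]] := step_cyc.
have close i z k a b : om i z -> normc (proj i z (at3 (h i) z) k a b - h i k a b z) <= k9 * eta * vn z.
  move=> zi; have [w1 w2] := hw i z zi; have zi0 : z 0 i != 0 by rewrite -normc_gt0; exact: om_gt0.
  have [B1 B2] : 0 <= k4 * eta /\ 0 <= k8 * eta by split; apply: mulr_ge0.
  rewrite (projE _ _ _ zi0 (hA i z)).
  have hw1 (x y u v : I) : normc (wdg z (at3 (h i) z) x y u v / z 0 i) <= k4 * eta * W * vn z ^+ 1.
    by apply: om_divr => //; exact: w1.
  have hD (x y : I) : normc (cyc3 (at3 (h i) z) x i y / z 0 i - wdg z (at3 (h i) z) i i y x / z 0 i ^+ 2) <= (k8 * W + k4 * W ^+ 2) * eta.
    have -> : (k8 * W + k4 * W ^+ 2) * eta = k8 * eta * W * vn z ^+ 0 + k4 * eta * W * W * vn z ^+ 0 by rewrite expr0; ring.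
    apply: normcB_le; first by apply: om_divr => //; rewrite expr1; exact: w2.
    have -> : wdg z (at3 (h i) z) i i y x / z 0 i ^+ 2 = wdg z (at3 (h i) z) i i y x / z 0 i / z 0 i by field.
    apply: om_divr => //; first by apply: mulr_ge0.
  have -> : k9 * eta * vn z = k4 * eta * W * vn z ^+ 1 + 2^-1 * (vn z * ((k8 * W + k4 * W ^+ 2) * eta) + vn z * ((k8 * W + k4 * W ^+ 2) * eta)).
    by rewrite /k9; field.
  apply: normcB_le; first exact: hw1.
  apply: normcM_le; first by rewrite normcV normc_nat.
  by apply: normcB_le; apply: normcM_le; rewrite ?normc_le_vn.
have [K5 K9] : m5 + k9 <= KE /\ 2 * k9 + K1 <= KE.
  by split; [rewrite lerDl; apply: addr_ge0 => //; apply: mulr_ge0|rewrite lerDr; apply: addr_ge0].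
exists (fun i k a b z => proj i z (at3 (h i) z) k a b); split.
- move=> i k a b; split=> [z zi|z s zi s0|z zi].
  + have zi0 : z 0 i != 0 by rewrite -normc_gt0; exact: om_gt0.
    have H (x y w : I) : hd (fun z => at3 (h i) z x y w) z by case: (hs i x y w) => H _ _; exact: H.
    have two0 : (2 : C) != 0 by rewrite pnatr_eq0.
    have N (x y : I) : hd (fun z => nf i z (at3 (h i) z) x y) z.
      apply: hdD; apply: hdM.
      * by apply: hdD; exact: H.
      * by apply: hdV; [apply: hdZ; exact: hd_coord|rewrite mulf_neq0].
      * by apply: hdD; apply: hdM; try exact: H; exact: hd_coord.
      * apply: hdV; first by apply: hdZ; apply: hdX; exact: hd_coord.
        by rewrite mulf_neq0// expf_neq0.
    by apply: hdB; apply: hdM; try exact: N; exact: hd_coord.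
  + have zi0 : z 0 i != 0 by rewrite -normc_gt0; exact: om_gt0.
    have H (x y w : I) : at3 (h i) (s *: z) x y w = s * at3 (h i) z x y w.
      by case: (hs i x y w) => _ H _; rewrite /at3 H// expr1.
    rewrite /proj /nf !H !mxE expr1; field.
    by rewrite zi0 s0.
  + rewrite expr1 -[X in normc X](subrK (h i k a b z)).
    have -> : KE * M * vn z = (k9 + (KE - k9)) * M * vn z by rewrite [k9 + _]addrC subrK.
    rewrite mulrDl mulrDl; apply: normcD_le.
      apply: le_trans (close i z k a b zi) _; rewrite ler_wpM2r ?vn_ge0//; exact: ler_wpM2l.
    case: (hs i k a b) => _ _ H; apply: le_trans (H z zi) _; rewrite expr1 ler_wpM2r ?vn_ge0//.
    by rewrite ler_wpM2r// lerBrDr.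
- by move=> i z zi; exact: proj_inE.
- move=> i j k a b z zi zj.
  have -> : proj j z (at3 (h j) z) k a b - proj i z (at3 (h i) z) k a b - c i j k a b z =
    (proj j z (at3 (h j) z) k a b - h j k a b z) - (proj i z (at3 (h i) z) k a b - h i k a b z) + (h j k a b z - h i k a b z - c i j k a b z) by ring.
  apply: (@le_trans _ _ ((2 * k9 + K1) * eta * vn z)); last by rewrite !ler_wpM2r ?vn_ge0.
  have -> : (2 * k9 + K1) * eta * vn z = k9 * eta * vn z + k9 * eta * vn z + K1 * eta * vn z by ring.
  by apply: normcD_le; [apply: normcB_le; exact: close|exact: hc].
Qed.

End Solve.
End CousinE.

(** * Limits of sections along geometric sequences *)

Section Limits.
Variable R : realType.
Local Notation C := R[i].

Lemma half_ge0 k : 0 <= (2 : R)^-1 ^+ k.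
Proof. by rewrite exprn_ge0// invr_ge0. Qed.

Lemma real_lim (s : nat -> R) (c : R) : (forall k, `|s k.+1 - s k| <= c * 2^-1 ^+ k) ->
  exists l, forall k, `|l - s k| <= 2 * c * 2^-1 ^+ k.
Proof.
move=> H; pose e k : R := 2 * c * 2^-1 ^+ k.
have eS k : e k = c * 2^-1 ^+ k + e k.+1 by rewrite /e exprS; field.
have aS k : s k - e k <= s k.+1 - e k.+1.
  by have := H k; rewrite ler_norml (eS k) => /andP[]; move: (e _) (_ ^+ _ : R) => x y; move: (c * y) => w; lra.
have bS k : s k.+1 + e k.+1 <= s k + e k.
  by have := H k; rewrite ler_norml (eS k) => /andP[]; move: (e _) (_ ^+ _ : R) => x y; move: (c * y) => w; lra.
have e0 k : 0 <= e k.
  have c0 : 0 <= c by have := le_trans (normr_ge0 _) (H 0%N); rewrite expr0 mulr1.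
  by rewrite /e !mulr_ge0// half_ge0.
have am j d : s j - e j <= s (j + d)%N - e (j + d)%N.
  by elim: d => [|d IH]; rewrite ?addn0// addnS; exact: le_trans IH (aS _).
have bm j d : s (j + d)%N + e (j + d)%N <= s j + e j.
  by elim: d => [|d IH]; rewrite ?addn0// addnS; exact: le_trans (bS _) IH.
have ab j k : s j - e j <= s k + e k.
  apply: le_trans (am j k) _; rewrite addnC; apply: le_trans (bm k j).
  by have := e0 (k + j)%N; move: (e _) (s _) => x y; lra.
pose A : set R := [set x | exists k, x = s k - e k].
have Ab k : ubound A (s k + e k) by move=> x [j ->].
exists (sup A) => k; rewrite ler_norml; apply/andP; split.
  have : s k - e k <= sup A by apply: ub_le_sup; [exists (s 0%N + e 0%N); exact: Ab|exists k].
  by rewrite /e; move: (2 * c * _) (sup A) => x y; lra.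
have : sup A <= s k + e k by apply: ge_sup (Ab k); exists (s 0%N - e 0%N); exists 0%N.
by rewrite /e; move: (2 * c * _) (sup A) => x y; lra.
Qed.

Lemma complex_lim (s : nat -> C) (c : R) : (forall k, normc (s k.+1 - s k) <= c * 2^-1 ^+ k) ->
  exists l, forall k, normc (l - s k) <= 4 * c * 2^-1 ^+ k.
Proof.
move=> H.
have [|x Hx] := @real_lim (fun k => Re (s k)) c.
  by move=> k; apply: le_trans (Re_lip _ _) (H k).
have [|y Hy] := @real_lim (fun k => Im (s k)) c.
  by move=> k; apply: le_trans (Im_lip _ _) (H k).
exists (x +i* y) => k; apply: le_trans (normc_le_parts _) _.
have -> : 4 * c * 2^-1 ^+ k = 2 * c * 2^-1 ^+ k + 2 * c * 2^-1 ^+ k by ring.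
have -> : Re ((x +i* y) - s k) = x - Re (s k) by case: (s k).
have -> : Im ((x +i* y) - s k) = y - Im (s k) by case: (s k).
exact: lerD.
Qed.

Lemma half_lt (c e : R) : 0 <= c -> 0 < e -> exists k, c * 2^-1 ^+ k <= e.
Proof.
move=> c0 e0; have h k : (2 : R)^-1 ^+ k * k%:R <= 1.
  by rewrite exprVn mulrC ler_pdivrMr ?exprn_gt0// mul1r -natrX ler_nat ltnW// ltn_expl.
pose k := (Num.Def.archi_bound (c / e)).+1.
have ck : c / e <= k%:R.
  have := archi_boundP (divr_ge0 c0 (ltW e0)) => /ltW/le_trans; apply; by rewrite ler_nat.
exists k; rewrite ler_pdivrMr// in ck; apply: le_trans (ler_wpM2r (half_ge0 _) ck) _.
by rewrite mulrAC mulrC -[leRHS]mulr1 ler_wpM2l ?(ltW e0)// mulrC h.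
Qed.

Lemma le_half (a c : R) : 0 <= c -> (forall k, a <= c * 2^-1 ^+ k) -> a <= 0.
Proof.
move=> c0 H; rewrite leNgt; apply/negP => a0.
have [k hk] := half_lt c0 (divr_gt0 a0 (ltr0n R 2)).
by have := le_trans (H k) hk; move: a0; lra.
Qed.

(** Convergence is uniform near each point, so [weierstrass] applies; the other properties pass to
    the limit by [le_half]. *)
Lemma sec_lim m (U : set 'rV[C]_m) d (M c : R) (f : nat -> 'rV[C]_m -> C) : opn U ->
  (forall a z, a != 0 -> U z -> U (a *: z)) -> 0 <= c ->
  (forall k, sec U d M (f k)) ->
  (forall k z, U z -> normc (f k.+1 z - f k z) <= c * vn z ^+ d * 2^-1 ^+ k) ->
  exists g, sec U d M g /\ forall k z, U z -> normc (g z - f k z) <= 4 * c * vn z ^+ d * 2^-1 ^+ k.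
Proof.
move=> oU cU c0 fs fc.
have H z : exists l, U z -> forall k, normc (l - f k z) <= 4 * c * vn z ^+ d * 2^-1 ^+ k.
  have [Uz|] := pselect (U z); last by exists 0.
  have [l Hl] := @complex_lim (fun k => f k z) (c * vn z ^+ d) (fun k => fc k z Uz).
  by exists l => _ k; have := Hl k; rewrite !mulrA.
have [g Hg] := choice H; exists g; split=> [|k z Uz]; last exact: Hg.
split=> [z Uz|z a Uz a0|z Uz].
- have [r r0 Hr] := oU z Uz; have r1 : 0 < Num.min r 1 by rewrite lt_min r0 ltr01.
  apply: (@weierstrass _ _ g z (Num.min r 1)) => // e e0.
  have B0 : 0 <= 4 * c * (vn z + 1) ^+ d by rewrite !mulr_ge0// exprn_ge0// addr_ge0// vn_ge0.
  have [k hk] := half_lt B0 e0; exists (f k) => z'; rewrite lt_min => /andP[z1 z2].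
  have Uz' := Hr z' z1; split; first by case: (fs k) => h _ _; exact: h.
  apply: le_trans (Hg z' Uz' k) _; apply: le_trans hk; rewrite ler_wpM2r ?half_ge0//.
  rewrite ler_wpM2l ?mulr_ge0//; apply: lerXn2r; rewrite ?nnegrE ?vn_ge0// ?addr_ge0 ?vn_ge0//.
  by rewrite -[z'](subrK z) addrC; apply: le_trans (vnD _ _) _; rewrite lerD2l ltW.
- have Uaz := cU a z a0 Uz.
  have nX : normc (a ^+ d) = normc a ^+ d.
    by elim: (d) => [|k IH]; rewrite ?expr0 ?normc1// !exprS normcM IH.
  apply/eqP; rewrite -subr_eq0 -normc_eq0 eq_le normc_ge0 andbT.
  pose c1 := 4 * c * vn (a *: z) ^+ d + normc a ^+ d * (4 * c * vn z ^+ d).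
  apply: (@le_half _ c1) => [|k].
    by rewrite addr_ge0// !mulr_ge0 ?exprn_ge0 ?vn_ge0 ?normc_ge0.
  have fk : f k (a *: z) = a ^+ d * f k z by case: (fs k) => _ h _; exact: h.
  have -> : g (a *: z) - a ^+ d * g z = (g (a *: z) - f k (a *: z)) - a ^+ d * (g z - f k z) by rewrite fk; ring.
  rewrite /c1 mulrDl; apply: normcB_le; first exact: Hg.
  by rewrite -[leRHS]mulrA; apply: normcM_le; [rewrite nX|exact: Hg].
- rewrite -subr_le0; apply: (@le_half _ (4 * c * vn z ^+ d)).
    by rewrite !mulr_ge0// exprn_ge0// vn_ge0.
  move=> k; rewrite lerBlDr addrC; have -> : g z = f k z + (g z - f k z) by ring.
  by apply: normcD_le; [case: (fs k) => _ _; exact|exact: Hg].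
Qed.

End Limits.

(** * Global sections of a bundle close to one with a bounded solver *)

Section Neumann.
Variables (R : realType) (m r : nat).
Local Notation C := R[i].
Local Notation V := 'rV[C]_m.
Local Notation I := 'I_m.
Implicit Types (i j k : I) (p q : 'I_r) (z : V).

Definition ov i j : set V := om i `&` om j.

Lemma sec_sum (U : set V) d (J : Type) (s : seq J) (M : J -> R) (f : J -> V -> C) :
  (forall t, sec U d (M t) (f t)) -> sec U d (\sum_(t <- s) M t) (fun z => \sum_(t <- s) f t z).
Proof.
move=> H; split=> [z Uz|z a Uz a0|z Uz].
- by apply: hd_sum => j; case: (H j) => h _ _; exact: h.
- by rewrite mulr_sumr; apply: eq_bigr => j _; case: (H j) => _ h _; exact: h.
- by rewrite mulr_suml; apply: le_trans (normc_sum _ _ _) _; apply: ler_sum => j _; case: (H j) => _ _; exact.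
Qed.

Lemma secM (U : set V) d d' (M M' : R) (f g : V -> C) : sec U d M f -> sec U d' M' g ->
  sec U (d + d') (M * M') (fun z => f z * g z).
Proof.
move=> [f1 f2 f3] [g1 g2 g3]; split=> [z Uz|z a Uz a0|z Uz].
- by apply: hdM; [exact: f1|exact: g1].
- by rewrite f2// g2// exprD; ring.
- by rewrite exprD mulrACA; apply: normcM_le; [exact: f3|exact: g3].
Qed.

Variables (G G0 : I -> I -> V -> 'M[C]_r) (K B eps : R).
Hypotheses (K0 : 0 <= K) (B0 : 0 <= B) (ep0 : 0 <= eps).
Hypothesis solver : forall (c : I -> I -> 'I_r -> V -> C) (M eta : R), 0 <= eta -> eta <= M ->
  (forall i j p, sec (ov i j) 0 M (c i j p)) ->
  (forall i j k p z, om i z -> om j z -> om k z ->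
     normc (\sum_q c i j q z * G0 j k z q p + c j k p z - c i k p z) <= eta) ->
  exists b : I -> 'I_r -> V -> C, (forall i p, sec (om i) 0 (K * M) (b i p)) /\
    forall i j p z, om i z -> om j z ->
      normc (b j p z - \sum_q b i q z * G0 i j z q p - c i j p z) <= K * eta.
Hypothesis Gs : forall i j q p, sec (ov i j) 0 B (fun z => G i j z q p).
Hypothesis GG : forall i j k z, om i z -> om j z -> om k z -> G i j z *m G j k z = G i k z.
Hypothesis Geps : forall i j q p z, om i z -> om j z -> normc (G i j z q p - G0 i j z q p) <= eps.
Hypothesis small : (2 * K + 1) * (r%:R * eps) <= 2^-1.

Local Notation chain := (I -> 'I_r -> V -> C).
(** Cech coboundary of a 0-cochain of row vectors, where a global section satisfies
    [x i * G i j = x j]. *)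
Definition delta (x : chain) i j p z := \sum_q x i q z * G i j z q p - x j p z.

Lemma sum_eps (f : 'I_r -> C) i j p z (M : R) : om i z -> om j z -> (forall q, normc (f q) <= M) ->
  normc (\sum_q f q * (G0 i j z q p - G i j z q p)) <= r%:R * eps * M.
Proof.
move=> zi zj H; apply: le_trans (normc_sum _ _ _) _.
apply: (@le_trans _ _ (\sum_(q < r) M * eps)).
  by apply: ler_sum => q _; apply: normcM_le => //; rewrite normcB; exact: Geps.
by rewrite sumr_const card_ord -[_ *+ _]mulr_natl mulrA mulrAC.
Qed.

Lemma delta_cocycle x i j k p z : om i z -> om j z -> om k z ->
  \sum_q delta x i j q z * G j k z q p + delta x j k p z = delta x i k p z.
Proof.
move=> zi zj zk; rewrite /delta addrA; congr (_ - _).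
rewrite (eq_bigr (fun q => \sum_s x i s z * G i j z s q * G j k z q p - x j q z * G j k z q p)); last first.
  by move=> q _; rewrite mulrBl mulr_suml.
rewrite sumrB subrK exchange_big; apply: eq_bigr => s _.
rewrite -(GG zi zj zk) mxE mulr_sumr; apply: eq_bigr => q _; exact/esym/mulrA.
Qed.

Definition inv (x : chain) (N : R) := [/\ 0 <= N, exists M, forall i p, sec (om i) 0 M (x i p) &
  forall i j p z, om i z -> om j z -> normc (delta x i j p z) <= N].

Lemma delta_sec x M i j p : (forall i p, sec (om i) 0 M (x i p)) ->
  exists M', sec (ov i j) 0 M' (delta x i j p).
Proof.
move=> xs; exists (\sum_(q < r) M * B + M); apply: secB.
  apply: (@sec_sum _ 0%N _ _ (fun=> M * B) (fun q z => x i q z * G i j z q p)) => q.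
  apply: (@secM _ 0 0 _ _ _ _ _ (Gs i j q p)); apply: sec_sub (xs i q) => // z; by case.
by apply: sec_sub (xs j p) => // z; case.
Qed.

(** The solver for [G0] corrects [x]; what remains is due to [G - G0] and to the inexactness of the
    solver, and is at most half of the former defect by [small]. *)
Lemma neumann_step (x : chain) (N : R) : inv x N -> exists b : chain,
  (forall i p, sec (om i) 0 (K * N) (b i p)) /\ inv (fun i p z => x i p z + b i p z) (N / 2).
Proof.
move=> [N0 [M xs] xN]; pose eta := r%:R * eps * N.
have re0 : 0 <= r%:R * eps by rewrite mulr_ge0.
have rs : 2 * K * (r%:R * eps) <= 2^-1 /\ r%:R * eps <= 1.
  have : 0 <= K * (r%:R * eps) by rewrite mulr_ge0.
  by move: small re0; rewrite mulrDl mul1r -mulrA; move: (r%:R * eps) (K * _) => y w; lra.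
have [||||b [bs bc]] := solver (c := delta x) (M := N) (eta := eta).
- by rewrite mulr_ge0.
- by rewrite /eta ler_piMl//; case: rs.
- move=> i j p; have [M' [h1 h2 _]] := delta_sec i j p xs; split=> // z [zi zj].
  by rewrite expr0 mulr1; exact: xN.
(* The coboundary is an exact cocycle for [G], hence one for [G0] up to [eta]. *)
- move=> i j k p z zi zj zk; rewrite -(delta_cocycle x p zi zj zk).
  have -> : \sum_q delta x i j q z * G0 j k z q p + delta x j k p z - (\sum_q delta x i j q z * G j k z q p + delta x j k p z) =
    \sum_q delta x i j q z * (G0 j k z q p - G j k z q p).
    by rewrite opprD addrACA subrr addr0 -sumrB; apply: eq_bigr => q _; rewrite mulrBr.
  by apply: sum_eps => // q; exact: xN.
exists b; split=> //; split; first by rewrite divr_ge0.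
  by exists (M + K * N) => i p; exact: secD.
move=> i j p z zi zj.
have -> : delta (fun i p z => x i p z + b i p z) i j p z =
   - (b j p z - \sum_q b i q z * G0 i j z q p - delta x i j p z) - \sum_q b i q z * (G0 i j z q p - G i j z q p).
  rewrite /delta (eq_bigr (fun q => x i q z * G i j z q p + b i q z * G i j z q p)); last by move=> q _; rewrite mulrDl.
  rewrite big_split /= [X in _ = _ - X](eq_bigr (fun q => b i q z * G0 i j z q p - b i q z * G i j z q p)); last by move=> q _; rewrite mulrBr.
  rewrite sumrB; ring.
apply: (@le_trans _ _ (K * eta + r%:R * eps * (K * N))).
  apply: normcB_le; first by rewrite normcN; exact: bc.
  by apply: sum_eps => // q; case: (bs i q) => _ _ /(_ z zi); rewrite expr0 mulr1.
have -> : K * eta + r%:R * eps * (K * N) = 2 * K * (r%:R * eps) * N by rewrite /eta; ring.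
by rewrite [N / 2]mulrC ler_wpM2r//; case: rs.
Qed.

(** Iteration of [neumann_step]: the corrections decrease geometrically, and the limit is a section
    of the bundle of [G] close to [x0]. *)
Theorem neumann (x0 : chain) (M N : R) : (forall i p, sec (om i) 0 M (x0 i p)) -> 0 <= N ->
  (forall i j p z, om i z -> om j z -> normc (delta x0 i j p z) <= N) ->
  exists x : chain, [/\ forall i p, exists M', sec (om i) 0 M' (x i p),
    forall i p z, om i z -> normc (x i p z - x0 i p z) <= 4 * (K * N) &
    forall i j p z, om i z -> om j z -> \sum_q x i q z * G i j z q p = x j p z].
Proof.
move=> xs N0 xN; pose st := (chain * R)%type.
have Hs (s : st) : exists b : chain, inv s.1 s.2 ->
    (forall i p, sec (om i) 0 (K * s.2) (b i p)) /\ inv (fun i p z => s.1 i p z + b i p z) (s.2 / 2).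
  have [h|] := pselect (inv s.1 s.2); last by exists (fun _ _ _ => 0).
  by have [b Hb] := neumann_step h; exists b.
have [nx Hnx] := choice Hs.
pose sx (k : nat) : st := iter k (fun s => (fun i p z => s.1 i p z + nx s i p z, s.2 / 2)) (x0, N).
have SN (k : nat) : (sx k).2 = N * 2^-1 ^+ k.
  elim: k => [|k IH]; first by rewrite expr0 mulr1.
  by rewrite exprSr mulrA -IH.
have Sinv (k : nat) : inv (sx k).1 (sx k).2.
  elim: k => [|k IH]; first by split=> //; exists M.
  by case: (Hnx (sx k) IH).
have Sb (k : nat) i p : sec (om i) 0 (K * N * 2^-1 ^+ k) (nx (sx k) i p).
  by case: (Hnx (sx k) (Sinv k)) => h _; have := h i p; rewrite SN mulrA.
have KN : 0 <= K * N by exact: mulr_ge0.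
have gsum (k : nat) : \sum_(j < k) (K * N * 2^-1 ^+ j : R) <= 2 * (K * N).
  suff -> : \sum_(j < k) (K * N * 2^-1 ^+ j : R) = 2 * (K * N) - 2 * (K * N) * 2^-1 ^+ k.
    by rewrite gerBl mulr_ge0 ?half_ge0// mulr_ge0.
  elim: k => [|k IH]; first by rewrite big_ord0 expr0; ring.
  by rewrite big_ord_recr /= IH exprS; field.
have Ss (k : nat) i p : sec (om i) 0 (M + 2 * (K * N)) ((sx k).1 i p).
  have : sec (om i) 0 (M + \sum_(j < k) (K * N * 2^-1 ^+ j : R)) ((sx k).1 i p).
    elim: k => [|k IH]; first by rewrite big_ord0 addr0.
    by rewrite big_ord_recr addrA; apply: secD.
  by apply: sec_sub => //; rewrite lerD2l.
have L i p : exists g, sec (om i) 0 (M + 2 * (K * N)) g /\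
    forall (k : nat) z, om i z -> normc (g z - (sx k).1 i p z) <= 4 * (K * N) * vn z ^+ 0 * 2^-1 ^+ k.
  apply: (@sec_lim R m (om i) 0 _ (K * N) (fun k : nat => (sx k).1 i p)) => //; [exact: om_open|by move=> a z a0; exact: omZ|].
  move=> k z zi /=; rewrite addrC addrA addNr add0r.
  by case: (Sb k i p) => _ _ /(_ z zi); rewrite !expr0 !mulr1.
have [x Hx] := choice (fun ip : I * 'I_r => L ip.1 ip.2).
exists (fun i p => x (i, p)); split.
- by move=> i p; exists (M + 2 * (K * N)); case: (Hx (i, p)).
- by move=> i p z zi; case: (Hx (i, p)) => _ /(_ 0%N z zi); rewrite !expr0 !mulr1.
move=> i j p z zi zj; apply/eqP; rewrite -subr_eq0 -normc_eq0 eq_le normc_ge0 andbT.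
pose c1 := 4 * (K * N); have c10 : 0 <= c1 by rewrite mulr_ge0.
have xk (k : nat) i' p' : om i' z -> normc (x (i', p') z - (sx k).1 i' p' z) <= c1 * 2^-1 ^+ k.
  by move=> zi'; case: (Hx (i', p')) => _ /(_ k z zi'); rewrite expr0 mulr1.
apply: (@le_half _ _ (N + (\sum_(q < r) c1 * B + c1))) => [|k].
  by rewrite !addr_ge0// sumr_ge0// => q _; rewrite mulr_ge0.
have -> : \sum_q x (i, q) z * G i j z q p - x (j, p) z = delta (sx k).1 i j p z +
   (\sum_q (x (i, q) z - (sx k).1 i q z) * G i j z q p - (x (j, p) z - (sx k).1 j p z)).
  rewrite /delta [X in _ = _ + (X - _)](eq_bigr (fun q => x (i, q) z * G i j z q p - (sx k).1 i q z * G i j z q p)); last by move=> q _; rewrite mulrBl.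
  rewrite sumrB; ring.
rewrite mulrDl mulrDl; apply: normcD_le.
  by case: (Sinv k) => _ _ /(_ i j p z zi zj); rewrite SN.
apply: normcB_le; last exact: xk.
apply: le_trans (normc_sum _ _ _) _; rewrite mulr_suml; apply: ler_sum => q _; rewrite mulrAC.
by apply: normcM_le; [exact: xk|case: (Gs i j q p) => _ _ /(_ z (conj zi zj)); rewrite expr0 mulr1].
Qed.

End Neumann.

(** * Additive splitting of a holomorphic function across a hyperplane *)

Section Split.
Variables (R : realType) (m : nat).
Local Notation C := R[i].
Local Notation V := 'rV[C]_m.
Local Notation kappa := (kappa R).
Implicit Types (z : V) (w u t : C) (f : V -> C) (i j k : 'I_m).

Definition chcoord i k t z : C := t^-1 * (z 0 k / z 0 i).

Definition seg f i k t (g : R -> C) (a b : R) z : C :=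
  ci (fun x => f (subst k i (t * g x) z) / (g x - chcoord i k t z)) a b.

Lemma seg_sec f i k t (g : R -> C) (a b M d : R) (O W : set V) : k != i -> t != 0 -> a <= b -> 0 < d -> 0 <= M ->
  (forall F x, a <= x <= b -> ccont F (g x) -> rcont (fun x => F (g x)) x) ->
  opn W -> sec O 0 M f -> (forall z, W z -> z 0 i != 0) ->
  (forall z x, W z -> a <= x <= b -> O (subst k i (t * g x) z)) ->
  (forall z x, W z -> a <= x <= b -> d <= normc (g x - chcoord i k t z)) ->
  sec W 0 (2 * (M / d) * (b - a)) (seg f i k t g a b).
Proof.
move=> ki t0 ab d0 M0 gc oW [fd fh fb] Wi WO far; split=> [z Wz|z s Wz s0|z Wz].
- have [r r0 Hr] := oW z Wz.
  apply: (@hd_kernel _ _ f k i t g a b z r M d) => // [z' x zr xab|x xab]; last exact: far.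
  have Wz' := Hr z' zr; split; [exact: Wi|by apply: fd; exact: WO|].
  by have := fb _ (WO z' x Wz' xab); rewrite expr0 mulr1.
- rewrite expr0 mul1r; apply: eq_ci => x xab; congr (_ / (_ - _)).
    have -> : subst k i (t * g x) (s *: z) = s *: subst k i (t * g x) z.
      by apply/rowP => l; rewrite !mxE; case: ifP => // _; ring.
    by rewrite fh ?expr0 ?mul1r//; exact: WO.
  by rewrite /chcoord !mxE invfM mulrACA divff// mul1r.
- rewrite expr0 mulr1; apply: ci_bound => // [x xab|x xab].
    apply: (gc (fun w => f (subst k i (t * w) z) / (w - chcoord i k t z))) => //.
    apply: cdiff_cont; apply: cdiff_div; last by rewrite -subr_eq0 -normc_gt0; exact: lt_le_trans d0 (far z x Wz xab).
    apply: (@cdiff_comp_affine _ (fun w => f (subst k i w z))) => //.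
    by apply: cdiff_subst => //; apply: fd; exact: WO.
  apply: normcM_le; first by have := fb _ (WO z x Wz xab); rewrite expr0 mulr1.
  have h := far z x Wz xab; rewrite normcV lef_pV2 ?posrE//; exact: lt_le_trans h.
Qed.

(** Cauchy's formula on a rectangle in the coordinate [chcoord]: the left side gives [fr],
    holomorphic to the right of it, and the other three sides give [fl]. *)
Lemma additive_split f i k t (a b c d e M : R) (O WL WR : set V) : k != i -> t != 0 -> a <= b -> c <= d ->
  0 < e -> 0 <= M -> opn WL -> opn WR -> sec O 0 M f ->
  (forall z, WL z \/ WR z -> z 0 i != 0) ->
  (forall z w, WL z \/ WR z -> a <= Re w <= b -> c <= Im w <= d -> O (subst k i (t * w) z)) ->
  (forall z, WL z -> Re (chcoord i k t z) <= b - e /\ c + e <= Im (chcoord i k t z) <= d - e) ->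
  (forall z, WR z -> a + e <= Re (chcoord i k t z)) ->
  let M' := 4 * ((b - a) + (d - c)) / normc kappa * (M / e) in
  exists fl fr, [/\ sec WL 0 M' fl, sec WR 0 M' fr & forall z, WL z -> WR z -> f z = fl z + fr z].
Proof.
move=> ki t0 ab cd e0 M0 oL oR fs Wi WO HL HR M'; have k0 := nkappa_gt0 R.
have gh (y : R) F x : ccont F (x +i* y) -> rcont (fun x => F (x +i* y)) x := @ccont_h R F x y.
have gv (y : R) F x : ccont F (y +i* x) -> rcont (fun x => F (y +i* x)) x := @ccont_v R F y x.
have reB w w' : Re (w - w') = Re w - Re w' by case: w w' => [? ?] [? ?].
have imB w w' : Im (w - w') = Im w - Im w' by case: w w' => [? ?] [? ?].
have [aa bb] : a <= a <= b /\ a <= b <= b by rewrite !lexx ab.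
have [cc dd] : c <= c <= d /\ c <= d <= d by rewrite !lexx cd.
have sB := @seg_sec f i k t (fun x => x +i* c) a b M e O WL ki t0 ab e0 M0 (fun F x _ => gh c F x) oL fs.
have sT := @seg_sec f i k t (fun x => x +i* d) a b M e O WL ki t0 ab e0 M0 (fun F x _ => gh d F x) oL fs.
have sR := @seg_sec f i k t (fun x => b +i* x) c d M e O WL ki t0 cd e0 M0 (fun F x _ => gv b F x) oL fs.
have sL := @seg_sec f i k t (fun x => a +i* x) c d M e O WR ki t0 cd e0 M0 (fun F x _ => gv a F x) oR fs.
have {}sB := sB (fun z h => Wi z (or_introl h)) (fun z x h xab => WO z (x +i* c) (or_introl h) xab cc).
have {}sT := sT (fun z h => Wi z (or_introl h)) (fun z x h xab => WO z (x +i* d) (or_introl h) xab dd).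
have {}sR := sR (fun z h => Wi z (or_introl h)) (fun z x h xab => WO z (b +i* x) (or_introl h) bb xab).
have {}sL := sL (fun z h => Wi z (or_intror h)) (fun z x h xab => WO z (a +i* x) (or_intror h) aa xab).
have hB : sec WL 0 (2 * (M / e) * (b - a)) (seg f i k t (fun x => x +i* c) a b).
  apply: sB => z x Wz xab; apply: le_trans (normc_ge_Im_r _); rewrite imB /= distrC.
  by have [_ /andP[h _]] := HL z Wz; rewrite ger0_norm; move: h e0; clear; lra.
have hT : sec WL 0 (2 * (M / e) * (b - a)) (seg f i k t (fun x => x +i* d) a b).
  apply: sT => z x Wz xab; apply: le_trans (normc_ge_Im_r _); rewrite imB /=.
  by have [_ /andP[_ h]] := HL z Wz; rewrite ger0_norm; move: h e0; clear; lra.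
have hR : sec WL 0 (2 * (M / e) * (d - c)) (seg f i k t (fun x => b +i* x) c d).
  apply: sR => z x Wz xab; apply: le_trans (normc_ge_Re_r _); rewrite reB /=.
  by have [h _] := HL z Wz; rewrite ger0_norm; move: h e0; clear; lra.
have hL : sec WR 0 (2 * (M / e) * (d - c)) (seg f i k t (fun x => a +i* x) c d).
  apply: sL => z x Wz xab; apply: le_trans (normc_ge_Re_r _); rewrite reB /= distrC.
  by have h := HR z Wz; rewrite ger0_norm; move: h e0; clear; lra.
have Me : 0 <= M / e by rewrite divr_ge0// ltW.
have [ba dc] : 0 <= b - a /\ 0 <= d - c by rewrite !subr_ge0.
exists (fun z => kappa^-1 * (seg f i k t (fun x => x +i* c) a b z - seg f i k t (fun x => x +i* d) a b z +
   'i * seg f i k t (fun x => b +i* x) c d z)).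
exists (fun z => kappa^-1 * (- ('i * seg f i k t (fun x => a +i* x) c d z))); split.
- apply: sec_sub (secZ kappa^-1 (secD (secB hB hT) (secZ 'i hR))) => //.
  rewrite normc_i normcV mulrC /M' ler_pdivrMr//.
  have -> : 4 * ((b - a) + (d - c)) / normc kappa * (M / e) * normc kappa = 4 * ((b - a) + (d - c)) * (M / e).
    by field; rewrite !gt_eqF.
  have := mulr_ge0 Me dc; have := mulr_ge0 Me ba.
  move: (M / e) (b - a) (d - c) => x y v; clear; nra.
- apply: sec_sub (secZ kappa^-1 (secN (secZ 'i hL))) => //.
  rewrite normc_i normcV mulrC /M' ler_pdivrMr//.
  have -> : 4 * ((b - a) + (d - c)) / normc kappa * (M / e) * normc kappa = 4 * ((b - a) + (d - c)) * (M / e).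
    by field; rewrite !gt_eqF.
  have := mulr_ge0 Me dc; have := mulr_ge0 Me ba.
  move: (M / e) (b - a) (d - c) => x y v; clear; nra.
move=> z Lz Rz; rewrite -mulrDr; apply: (mulfI (kappa_neq0 R)); rewrite mulVKf ?kappa_neq0//.
have [h1 /andP[h2 h3]] := HL z Lz; have h4 := HR z Rz; have [fd _ _] := fs.
have zi := Wi z (or_introl Lz).
have zE : subst k i (t * chcoord i k t z) z = z by rewrite /chcoord mulVKf// substE.
have cd1 w : a <= Re w <= b -> c <= Im w <= d -> cdiff (fun w => f (subst k i (t * w) z)) w.
  move=> wab wcd; apply: (@cdiff_comp_affine _ (fun w => f (subst k i w z))) => //.
  by apply: cdiff_subst => //; apply: fd; apply: WO => //; left.
have := @cauchy R (fun w => f (subst k i (t * w) z)) a b c d (chcoord i k t z) _ _ cd1.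
rewrite zE => <-; last 2 first.
- by apply/andP; split; move: h1 h4 e0; clear; lra.
- by apply/andP; split; move: h2 h3 e0; clear; lra.
have Kc w : a <= Re w <= b -> c <= Im w <= d -> w != chcoord i k t z ->
    ccont (fun w => f (subst k i (t * w) z) / (w - chcoord i k t z)) w.
  by move=> wab wcd wz; apply: cdiff_cont; apply: cdiff_div => //; exact: cd1.
have ne w : Re w != Re (chcoord i k t z) \/ Im w != Im (chcoord i k t z) -> w != chcoord i k t z.
  by move=> h; apply/eqP => wE; case: h; rewrite wE eqxx.
rewrite /rint !ciB.
- by rewrite /seg mulrBr addrA.
- move=> x xcd; apply: (gv b (fun w => f (subst k i (t * w) z) / (w - chcoord i k t z))).
  by apply: Kc => //; apply: ne; left; rewrite /= gt_eqF//; move: h1 e0; clear; lra.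
- move=> x xcd; apply: (gv a (fun w => f (subst k i (t * w) z) / (w - chcoord i k t z))).
  by apply: Kc => //; apply: ne; left; rewrite /= lt_eqF//; move: h4 e0; clear; lra.
- move=> x xcd; apply: (gh c (fun w => f (subst k i (t * w) z) / (w - chcoord i k t z))).
  by apply: Kc => //; apply: ne; right; rewrite /= lt_eqF//; move: h2 e0; clear; lra.
- move=> x xcd; apply: (gh d (fun w => f (subst k i (t * w) z) / (w - chcoord i k t z))).
  by apply: Kc => //; apply: ne; right; rewrite /= gt_eqF//; move: h3 e0; clear; lra.
Qed.

End Split.

Lemma invCi (R : realType) : ('i : R[i])^-1 = - 'i.
Proof.
have i0 : ('i : R[i]) != 0 by rewrite -normc_gt0 normc_i.
by apply: (mulfI i0); rewrite divff// mulrN -expr2 sqr_i opprK.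
Qed.

(** * Boxes in an affine chart *)

Section Boxes.
Variables (R : realType) (m : nat) (i : 'I_m).
Local Notation C := R[i].
Local Notation V := 'rV[C]_m.
Local Notation D := ('I_m * bool)%type.
Implicit Types (z : V) (w u t : C) (lo hi : D -> R) (d : D).

Definition part (b : bool) (u : C) : R := if b then Im u else Re u.
Definition X d z : R := part d.2 (z 0 d.1 / z 0 i).
(** A box in the real coordinates of the chart, thickened by [s], as a cone. *)
Definition U (s : R) lo hi : set V := [set z : V | z 0 i != 0 /\ forall d, lo d - s < X d z < hi d + s].

Lemma part_lip b u v : `|part b u - part b v| <= normc (u - v).
Proof. by case: b; [exact: Im_lip|exact: Re_lip]. Qed.

Lemma X_cont d z : z 0 i != 0 -> forall e : R, 0 < e -> exists2 r : R, 0 < r &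
  forall z', vn (z' - z) < r -> `|X d z' - X d z| < e.
Proof.
move=> zi e e0; have [r r0 Hr] := hd_cont (hd_ratio d.1 zi) e0; exists r => // z' zz.
by apply: le_lt_trans (part_lip _ _ _) _; have := Hr _ zz; rewrite [z + _]addrC subrK.
Qed.

Lemma nzi_open : opn [set z : V | z 0 i != 0].
Proof.
move=> z zi; exists (normc (z 0 i)); first by rewrite normc_gt0.
move=> z' zz; apply: contraTneq zz => z0; rewrite -leNgt.
by have := normc_le_vn (z' - z) i; rewrite !mxE z0 sub0r normcN.
Qed.

Lemma U_open s lo hi : opn (U s lo hi).
Proof.
move=> z [zi Hz]; have [r0 r00 Hr0] := nzi_open zi.
have H d : exists r, 0 < r /\ forall z', vn (z' - z) < r -> lo d - s < X d z' < hi d + s.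
  have /andP[h1 h2] := Hz d.
  have e0 : 0 < X d z - (lo d - s) by rewrite subr_gt0.
  have e1 : 0 < hi d + s - X d z by rewrite subr_gt0.
  have [e [ep e2 e3]] := pos_min e0 e1; have [r rp Hr] := X_cont d zi ep; exists r; split=> // z' zz.
  have := Hr z' zz; rewrite ltr_norml => /andP[]; move: e2 e3; move: (X d z) (X d z') (lo d) (hi d) => a b c e'; clear -i; lra.
have [r Hr] := choice H; have [q q0 Hq] := fin_min (fun d => (Hr d).1).
have [p [p0 p1 p2]] := pos_min r00 q0; exists p => // z' zz; split; first exact: Hr0 (lt_le_trans zz p1).
by move=> d; apply: (Hr d).2; exact: lt_le_trans zz (le_trans p2 (Hq d)).
Qed.

Lemma X_Z d (a : C) z : a != 0 -> X d (a *: z) = X d z.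
Proof. by move=> a0; rewrite /X !mxE invfM mulrACA divff// mul1r. Qed.

Lemma U_cone s lo hi (a : C) z : a != 0 -> U s lo hi z -> U s lo hi (a *: z).
Proof.
move=> a0 [zi Hz]; split; first by rewrite mxE mulf_neq0.
by move=> d; rewrite X_Z.
Qed.

Lemma X_subst k d w z : k != i -> z 0 i != 0 ->
  X d (subst k i w z) = if d.1 == k then part d.2 w else X d z.
Proof.
move=> ki zi; rewrite /X !mxE [i == k]eq_sym (negPf ki); case: eqP => // _.
by rewrite mulfK.
Qed.

Definition KA (T : R) : R := 64 * T / normc (kappa R).

(** The slab around the face common to two boxes. Each of the two parts extends over one whole box,
    at the cost of some thickness, by which the bound is divided. *)
Lemma box_split k (b : bool) (mid s s' T M : R) lo hi f : k != i -> 0 < s' -> s' < s -> s <= 1 -> 1 <= T ->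
  (forall d, lo d <= hi d /\ hi d - lo d <= T) -> lo (k, b) <= mid <= hi (k, b) -> 0 <= M ->
  let lo' := upd lo (k, b) mid in let hi' := upd hi (k, b) mid in
  sec (U s lo' hi') 0 M f ->
  exists fl fr, [/\ sec (U s' lo hi') 0 (KA T * M / (s - s')) fl,
    sec (U s' lo' hi) 0 (KA T * M / (s - s')) fr & forall z, U s' lo' hi' z -> f z = fl z + fr z].
Proof.
move=> ki s0 ss s1 T1 lh md M0 lo' hi' fs; have k0 := nkappa_gt0 R.
(* Dividing by [i] exchanges the roles of the real and imaginary coordinates, so one splitting lemma
   serves both directions. *)
pose t : C := if b then 'i else 1; have t0 : t != 0.
  by rewrite /t; case: (b); rewrite ?oner_eq0// -normc_gt0 normc_i.
pose q := (s + s') / 2; pose e := (s - s') / 2.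
pose c := if b then - hi (k, ~~ b) else lo (k, ~~ b).
pose d := if b then - lo (k, ~~ b) else hi (k, ~~ b).
have q1 : q <= 1 by rewrite /q; move: ss s1; clear -i; lra.
have [qe qs] : q - e = s' /\ q + e = s by rewrite /q /e; split; field.
have e0 : 0 < e by rewrite /e divr_gt0// subr_gt0.
have q0 : 0 < q by rewrite -[q](subrK e) addr_gt0// qe.
have [lh1 lh2] := lh (k, ~~ b).
have dcE : d - c = hi (k, ~~ b) - lo (k, ~~ b) by rewrite /d /c; case: (b); ring.
have cd : c - q <= d + q by move: dcE lh1 q0; move: (lo _) (hi _) => x y; clear -i c d; lra.
have ab : mid - q <= mid + q by move: q0; clear -i; lra.
have upd1 (lo0 : D -> R) x : upd lo0 (k, b) x (k, b) = x by rewrite /upd eqxx.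
have upd2 (lo0 : D -> R) x (d0 : D) : d0 != (k, b) -> upd lo0 (k, b) x d0 = lo0 d0 by rewrite /upd => /negPf ->.
have nb : (k, ~~ b) != (k, b) by rewrite xpair_eqE eqxx; case: (b).
have RE z : Re (chcoord i k t z) = X (k, b) z.
  by rewrite /chcoord /X /t /=; case: (b); rewrite /part /= ?invr1 ?mul1r// invCi; case: (_ / _) => x y /=; ring.
have IE z : Im (chcoord i k t z) = if b then - X (k, ~~ b) z else X (k, ~~ b) z.
  by rewrite /chcoord /X /t /=; case: (b); rewrite /part /= ?invr1 ?mul1r// invCi; case: (_ / _) => x y /=; ring.
have tE (w : C) : part b (t * w) = Re w /\ part (~~ b) (t * w) = if b then - Im w else Im w.
  by rewrite /t /part; case: (b); case: w => x y /=; split; ring.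
pose O := U s lo' hi'.
have WX z : U s' lo hi' z \/ U s' lo' hi z -> z 0 i != 0 /\ forall d0 : D, d0.1 != k -> lo d0 - s' < X d0 z < hi d0 + s'.
  have ne (d0 : D) : d0.1 != k -> d0 != (k, b) by apply: contraNneq => ->.
  case=> -[zi h]; split=> // d0 dk; have := h d0; rewrite /lo' /hi' upd2 ?ne//.
have [|||fl [fr [hl hr hf]]] := @additive_split R m f i k t (mid - q) (mid + q) (c - q) (d + q) e M O (U s' lo hi') (U s' lo' hi)
   ki t0 ab cd e0 M0 (@U_open _ _ _) (@U_open _ _ _) fs (fun z h => (WX z h).1).
- move=> z w /WX[zi Hz] wab wcd; split; first by rewrite mxE [i == k]eq_sym (negPf ki).
  move=> d0; rewrite X_subst//; case: (eqVneq d0.1 k) => dk; last first.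
    have dn : d0 != (k, b) by apply: contraNneq dk => ->.
    rewrite /lo' /hi' !upd2//; case/andP: (Hz d0 dk); move: ss; move: (lo d0) (hi d0) (X d0 z) => x y v; clear -i => h1 h2 h3.
    by apply/andP; split; lra.
  have [tE1 tE2] := tE w.
  have [db|db] := eqVneq d0.2 b.
    have -> : d0 = (k, b) by case: (d0) dk db => /= ? ? -> ->.
    rewrite /lo' /hi' !upd1 /= tE1; case/andP: wab; move: qs e0; clear -i => h1 h2 h3 h4.
    by apply/andP; split; lra.
  have -> : d0 = (k, ~~ b) by case: (d0) dk db => /= ? b' ->; case: b' b {tE tE1 tE2 WX IE RE nb upd1 upd2 dcE cd fs hi' lo' md t t0 c d lh1 lh2 Hz O wcd} => -[].
  rewrite /lo' /hi' !upd2//= tE2; move: wcd; rewrite /c /d; case: (b) => /=;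
  move: qs e0; move: (lo _) (hi _) (Im w) => x y v; clear -i => h1 h2 /andP[h3 h4]; apply/andP; split; lra.
- move=> z [zi Hz]; rewrite RE IE; split.
    by have := Hz (k, b); rewrite /hi' upd1 => /andP[_]; move: qe; move: (X _ _) => x; clear -i; lra.
  have := Hz (k, ~~ b); rewrite /hi' upd2// /c /d; case: (b) => /=;
  move: qe; move: (lo _) (hi _) (X _ _) => x y v; clear -i => h1 /andP[h3 h4]; apply/andP; split; lra.
- move=> z [zi Hz]; rewrite RE; have := Hz (k, b); rewrite /lo' upd1 => /andP[].
  by move: qe; move: (X _ _) => x; clear -i; lra.
have MM : 4 * ((mid + q - (mid - q)) + (d + q - (c - q))) / normc (kappa R) * (M / e) <= KA T * M / (s - s').
  have [_ hT] := lh (k, ~~ b).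
  have -> : KA T * M / (s - s') = 32 * T / normc (kappa R) * (M / e).
    by rewrite /KA /e; field; rewrite !gt_eqF// subr_gt0.
  apply: ler_wpM2r; first by rewrite divr_ge0// ltW.
  apply: ler_wpM2r; first by rewrite invr_ge0 ltW.
  by move: dcE hT q1 T1; move: (lo _) (hi _) => x y; clear -i; lra.
exists fl, fr; split.
- exact: sec_sub hl.
- exact: sec_sub hr.
- move=> z [zi Hz]; apply: hf; split=> // d0; have := Hz d0; have [->|dn] := eqVneq d0 (k, b).
  + rewrite /lo' /hi' !upd1 => /andP[h1 h2]; case/andP: md => m1 m2; rewrite h2 andbT.
    by move: h1 m1; move: (lo _) (X _ _) => x y; clear -i; lra.
  + by rewrite /lo' /hi' !upd2.
  + rewrite /lo' /hi' !upd1 => /andP[h1 h2]; case/andP: md => m1 m2; rewrite h1 /=.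
    by move: h2 m2; move: (hi _) (X _ _) => x y; clear -i; lra.
  + by rewrite /lo' /hi' !upd2.
Qed.

End Boxes.

(** * Matrices of bounded sections *)

Section MatrixSections.
Variables (R : realType) (m r : nat).
Local Notation C := R[i].
Local Notation V := 'rV[C]_m.
Implicit Types (W : set V) (A B g : V -> 'M[C]_r) (a b e : R) (p q : 'I_r).

Definition msec W e A := forall p q, sec W 0 e (fun z => A z p q).

Lemma msecM W a b A B : msec W a A -> msec W b B -> msec W (r%:R * a * b) (fun z => A z *m B z).
Proof.
move=> HA HB p q; have := @sec_sum R m W 0 _ (index_enum 'I_r) (fun=> a * b) (fun s z => A z p s * B z s q)
  (fun s => @secM R m W 0 0 _ _ _ _ (HA p s) (HB s q)).
rewrite sumr_const card_ord -[_ *+ _]mulr_natl mulrA; congr sec.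
by apply/funext => z; rewrite mxE.
Qed.

Lemma msecD W a b A B : msec W a A -> msec W b B -> msec W (a + b) (fun z => A z + B z).
Proof.
move=> HA HB p q; have := secD (HA p q) (HB p q); congr sec; by apply/funext => z; rewrite mxE.
Qed.

Lemma msecN W a A : msec W a A -> msec W a (fun z => - A z).
Proof. by move=> HA p q; have := secN (HA p q); congr sec; apply/funext => z; rewrite mxE. Qed.

Lemma msecB W a b A B : msec W a A -> msec W b B -> msec W (a + b) (fun z => A z - B z).
Proof. by move=> HA HB; apply: msecD => //; exact: msecN. Qed.

Lemma msec_sub W W' a b A : (forall z, W' z -> W z) -> a <= b -> msec W a A -> msec W' b A.
Proof. by move=> h h' HA p q; apply: sec_sub (HA p q). Qed.

Lemma normc_delta p q : normc ((p == q)%:R : C) <= 1.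
Proof. by rewrite normc_nat; case: (p == q). Qed.

Lemma msec1 W : msec W 1 (fun=> 1%:M).
Proof.
move=> p q; split=> [z _|z a _ _|z _]; first exact: hd_cst.
  by rewrite expr0 mul1r.
by rewrite mxE expr0 mulr1 normc_delta.
Qed.

Lemma le_near1 (N : 'M[C]_r) p q e : normc ((N - 1%:M) p q) <= e -> normc (N p q) <= 1 + e.
Proof.
move=> h; have -> : N p q = (p == q)%:R + (N - 1%:M) p q by rewrite !mxE; ring.
by apply: normcD_le => //; exact: normc_delta.
Qed.

Lemma eq_msec W a A B : (forall z, A z = B z) -> msec W a A -> msec W a B.
Proof. by move=> /funext ->. Qed.

End MatrixSections.

(** * Cartan's factorization of matrices close to the identity *)

Section Cartan.
Variables (R : realType) (m r : nat) (i : 'I_m).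
Local Notation C := R[i].
Local Notation V := 'rV[C]_m.
Local Notation D := ('I_m * bool)%type.
Local Notation half k := ((2 : R)^-1 ^+ k).
Implicit Types (lo hi : D -> R) (A B g : V -> 'M[C]_r).

Variables (s0 T : R).
Hypotheses (s00 : 0 < s0) (s01 : s0 <= 1) (T1 : 1 <= T).

Definition c0 : R := 4 * KA T / s0 + 1.
Definition KB : R := 8 * r%:R * c0.
Definition e0 : R := (16 * (r%:R + 1) * c0 ^+ 2)^-1.

Lemma c0_ge1 : 1 <= c0.
Proof.
rewrite lerDr divr_ge0 ?(ltW s00)// mulr_ge0// mulr_ge0 ?invr_ge0 ?normc_ge0// mulr_ge0//.
exact: le_trans T1.
Qed.

Lemma e0_gt0 : 0 < e0.
Proof.
have := lt_le_trans ltr01 c0_ge1 => c00.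
by rewrite invr_gt0 mulr_gt0 ?exprn_gt0// mulr_gt0// ltr_wpDl.
Qed.

Lemma KB_ge0 : 0 <= KB.
Proof. by rewrite mulr_ge0 ?mulr_ge0// (le_trans ler01 c0_ge1). Qed.

Section Step.
Variables (k : 'I_m) (b : bool) (mid : R) (lo hi : D -> R).
Hypotheses (ki : k != i) (lh : forall d, lo d <= hi d /\ hi d - lo d <= T) (md : lo (k, b) <= mid <= hi (k, b)).
Let lo' := upd lo (k, b) mid.
Let hi' := upd hi (k, b) mid.
Local Notation WL s := (U i s lo hi').
Local Notation WR s := (U i s lo' hi).
Local Notation WO s := (U i s lo' hi').
Variables (g : V -> 'M[C]_r) (eta : R).
Hypotheses (eta0 : 0 <= eta) (etae : eta <= e0) (gs : msec (WO s0) eta (fun z => g z - 1%:M)).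

Let s_ (j : nat) : R := s0 / 2 + s0 / 2 * half j.

Lemma U_sub s s' lo1 hi1 z : s' <= s -> U i s' lo1 hi1 z -> U i s lo1 hi1 z.
Proof.
move=> ss [zi h]; split=> // d; have /andP[h1 h2] := h d; apply/andP; split.
  by apply: le_lt_trans h1; rewrite lerD2l lerN2.
by apply: lt_le_trans h2 _; rewrite lerD2l.
Qed.

Lemma U_both s z : WL s z -> WR s z -> WO s z.
Proof.
move=> [zi h1] [_ h2]; split=> // d; have := h1 d; have := h2 d; rewrite /lo' /hi' /upd.
by case: eqP => [->|_] // /andP[-> _] /andP[_ ->].
Qed.

Lemma U_lo' s z : 0 <= s -> WO s z -> WL s z /\ WR s z.
Proof.
case/andP: md => m1 m2 s_0 [zi h]; split; split=> // d; have := h d; rewrite /lo' /hi' /upd.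
  case: eqP => [->|_] // /andP[h1 h2]; rewrite h2 andbT; apply: le_lt_trans h1.
  by rewrite lerD2r.
case: eqP => [->|_] // /andP[h1 h2]; rewrite h1 /=; apply: lt_le_trans h2 _.
by rewrite lerD2r.
Qed.

(** State after [j] steps: the thickness has shrunk towards [s0 / 2] and the defect is of order
    [4^-j]. *)
Definition cinv (j : nat) (AB : (V -> 'M[C]_r) * (V -> 'M[C]_r)) :=
  [/\ msec (WL (s_ j)) (KB / 2 * eta * (1 - half j)) (fun z => AB.1 z - 1%:M),
      msec (WR (s_ j)) (KB / 2 * eta * (1 - half j)) (fun z => AB.2 z - 1%:M) &
      msec (WO (s_ j)) (eta * half j ^+ 2) (fun z => AB.1 z *m g z *m AB.2 z - 1%:M)].

Lemma KBeta : KB / 2 * eta <= 1 /\ 16 * (r%:R * c0 ^+ 2) * eta <= 1.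
Proof.
have c1 := c0_ge1; have c2 := lt_le_trans ltr01 c1.
have r0 : 0 <= (r%:R : R) by [].
have h : 16 * (r%:R + 1) * c0 ^+ 2 * eta <= 1.
  rewrite mulrC -ler_pdivlMr ?div1r// mulr_gt0 ?exprn_gt0// mulr_gt0// ltr_wpDl//.
have h' : 16 * (r%:R * c0 ^+ 2) * eta <= 1.
  apply: le_trans h; rewrite ler_wpM2r// -[leRHS]mulrA ler_wpM2l// ler_wpM2r ?exprn_ge0 ?(ltW c2)//.
  by rewrite lerDl.
split=> //; apply: le_trans h'; rewrite ler_wpM2r// /KB.
have : r%:R * c0 <= r%:R * c0 ^+ 2 by rewrite ler_wpM2l// expr2 ler_peMl// ltW.
have : 0 <= r%:R * c0 by rewrite mulr_ge0// ltW.
have -> : 8 * r%:R * c0 / 2 = 4 * (r%:R * c0) by field.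
by move: (r%:R * c0 ^+ 2) (r%:R * c0) => y x; lra.
Qed.

(** With [E = A g B - 1] split as [FL + FR], replacing [A] by [(1 - FL) A] and [B] by [B (1 - FR)]
    leaves a defect that is quadratic in [E, FL, FR]. The loss of thickness is of order [2^-j], so
    [FL] and [FR] are of order [4^-j / 2^-j = 2^-j], and their squares again of order [4^-j]. *)
Lemma cartan_step j AB : cinv j AB -> exists FG : (V -> 'M[C]_r) * (V -> 'M[C]_r),
  [/\ msec (WL (s_ j.+1)) (KB / 4 * eta * half j) (fun z => FG.1 z *m AB.1 z),
      msec (WR (s_ j.+1)) (KB / 4 * eta * half j) (fun z => AB.2 z *m FG.2 z) &
      cinv j.+1 (fun z => AB.1 z - FG.1 z *m AB.1 z, fun z => AB.2 z - AB.2 z *m FG.2 z)].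
Proof.
case: AB => A B /= [hA hB hE]; set h := half j in hA hB hE *.
have h0 : 0 < h by rewrite exprn_gt0// invr_gt0.
have h1 : h <= 1 by rewrite /h exprn_ile1// ?invr_ge0// invf_le1// ler1n.
have hS : half j.+1 = h / 2 by rewrite exprS mulrC.
have sj : s_ j.+1 < s_ j by rewrite /s_ hS ltrD2l ltr_pM2l ?divr_gt0// ltr_pdivrMr// ltr_pMr// ltr1n.
have sj0 : 0 < s_ j.+1 by rewrite /s_ hS; have := mulr_gt0 s00 h0; move: (s00); nra.
have sj1 : s_ j <= 1.
  have : s0 / 2 * h <= s0 / 2 by rewrite ler_piMr// divr_ge0// ltW.
  by move: s01; rewrite /s_ -/h; move: (s0 / 2 * h) => x; lra.
pose E z := A z *m g z *m B z - 1%:M.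
have N0 : 0 <= eta * h ^+ 2 by rewrite mulr_ge0// exprn_ge0// ltW.
pose F : R := c0 * eta * h.
have FE : KA T * (eta * h ^+ 2) / (s_ j - s_ j.+1) <= F.
  have -> : s_ j - s_ j.+1 = s0 / 4 * h by rewrite /s_ hS -/h; field.
  have -> : KA T * (eta * h ^+ 2) / (s0 / 4 * h) = (4 * KA T / s0) * (eta * h) by field; rewrite !gt_eqF.
  by rewrite /F -[leRHS]mulrA ler_wpM2r ?mulr_ge0 ?(ltW h0)// /c0 lerDl.
have NF : eta * h ^+ 2 <= F.
  rewrite /F expr2 mulrA ler_wpM2r ?(ltW h0)//; rewrite [c0 * _]mulrC ler_wpM2l//.
  exact: le_trans h1 c0_ge1.
have HS (pq : 'I_r * 'I_r) : exists fg : (V -> C) * (V -> C), [/\ sec (WL (s_ j.+1)) 0 F fg.1,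
    sec (WR (s_ j.+1)) 0 F fg.2 & forall z, WO (s_ j.+1) z -> E z pq.1 pq.2 = fg.1 z + fg.2 z].
  have [fl [fr [f1 f2 f3]]] := @box_split R m i k b mid (s_ j) (s_ j.+1) T (eta * h ^+ 2) lo hi _ ki sj0 sj sj1 T1 lh md N0 (hE pq.1 pq.2).
  by exists (fl, fr); split=> //; [apply: sec_sub f1|apply: sec_sub f2].
have [fg Hfg] := choice HS.
pose FL z : 'M[C]_r := \matrix_(p, q) (fg (p, q)).1 z.
pose FR z : 'M[C]_r := \matrix_(p, q) (fg (p, q)).2 z.
have hFL : msec (WL (s_ j.+1)) F FL.
  by move=> p q; case: (Hfg (p, q)) => h' _ _; move: h'; congr sec; apply/funext => z; rewrite mxE.
have hFR : msec (WR (s_ j.+1)) F FR.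
  by move=> p q; case: (Hfg (p, q)) => _ h' _; move: h'; congr sec; apply/funext => z; rewrite mxE.
have EF z : WO (s_ j.+1) z -> E z = FL z + FR z.
  by move=> zO; apply/matrixP => p q; case: (Hfg (p, q)) => _ _ H; rewrite [RHS]mxE !mxE; have := H z zO; rewrite /E /= !mxE.
have [kb1 kb2] := KBeta.
have k0 := KB_ge0; have c1 := c0_ge1.
have kb0 : 0 <= KB / 2 * eta by apply: mulr_ge0 => //; apply: divr_ge0.
have near1 (W W' : set V) (X : V -> 'M[C]_r) : (forall z, W' z -> W z) ->
    msec W (KB / 2 * eta * (1 - h)) (fun z => X z - 1%:M) -> msec W' 2 X.
  move=> WW hX; have := msecD (msec_sub WW (lexx _) hX) (@msec1 R m r W').
  move=> /(eq_msec (fun z => subrK _ _)); apply: msec_sub => //.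
  have : KB / 2 * eta * (1 - h) <= 1.
    by apply: le_trans kb1; rewrite ler_piMr// lerBlDr lerDl ltW.
  by lra.
have A2 : msec (WL (s_ j.+1)) 2 A by apply: near1 hA => z; apply: U_sub; exact: ltW.
have B2 : msec (WR (s_ j.+1)) 2 B by apply: near1 hB => z; apply: U_sub; exact: ltW.
have rF : r%:R * F * 2 = KB / 4 * eta * h by rewrite /F /KB; field.
exists (FL, FR); split=> /=.
- by rewrite -rF; exact: msecM.
- have -> : KB / 4 * eta * h = r%:R * 2 * F by rewrite -rF; ring.
  exact: msecM.
have KE1 : KB / 2 * eta * (1 - half j.+1) = KB / 2 * eta * (1 - h) + KB / 4 * eta * h by rewrite hS; field.
split=> /=.
- rewrite KE1 -rF; apply: (eq_msec (A := fun z => (A z - 1%:M) - FL z *m A z)) => [z|]; first by rewrite addrAC.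
  by apply: msecB; [apply: msec_sub hA => // z; apply: U_sub; exact: ltW|exact: msecM].
- rewrite KE1; have -> : KB / 4 * eta * h = r%:R * 2 * F by rewrite -rF; ring.
  apply: (eq_msec (A := fun z => (B z - 1%:M) - B z *m FR z)) => [z|]; first by rewrite addrAC.
  by apply: msecB; [apply: msec_sub hB => // z; apply: U_sub; exact: ltW|exact: msecM].
have wl z : WO (s_ j.+1) z -> WL (s_ j.+1) z by move=> /(U_lo' (ltW sj0))[].
have wr z : WO (s_ j.+1) z -> WR (s_ j.+1) z by move=> /(U_lo' (ltW sj0))[].
have F0 : 0 <= F by rewrite mulr_ge0 ?(ltW h0)// mulr_ge0// (le_trans ler01).
have hE' : msec (WO (s_ j.+1)) F E by apply: msec_sub hE => // z; apply: U_sub; exact: ltW.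
have hl : msec (WO (s_ j.+1)) F FL by apply: msec_sub hFL.
have hr : msec (WO (s_ j.+1)) F FR by apply: msec_sub hFR.
have hQ := msecD (msecB (msecB (msecM hl hr) (msecM hl hE')) (msecM hE' hr)) (msecM (msecM hl hE') hr).
(* The gain of a factor 4 comes from [16 * (r * c0 ^+ 2) * eta <= 1], which is why [e0] is chosen as
   it is. *)
have fin : r%:R * F * F + r%:R * F * F + r%:R * F * F + r%:R * (r%:R * F * F) * F <= eta * half j.+1 ^+ 2.
  have X : r%:R * F * F = (r%:R * c0 ^+ 2 * eta) * (eta * h ^+ 2) by rewrite /F; ring.
  have rF1 : r%:R * F <= 1.
    have -> : r%:R * F = KB / 8 * eta * h by rewrite /F /KB; field.
    apply: (@le_trans _ _ (KB / 2 * eta)) => //; rewrite -[leRHS]mulr1; apply: ler_pM => //; first by apply: mulr_ge0 => //; apply: divr_ge0.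
      exact: ltW.
    by rewrite ler_wpM2r// ler_wpM2l// lef_pV2 ?posrE// ler_nat.
  have Y : r%:R * (r%:R * F * F) * F <= r%:R * F * F.
    have -> : r%:R * (r%:R * F * F) * F = (r%:R * F) * (r%:R * F * F) by ring.
    by rewrite ler_piMl//; apply: mulr_ge0 => //; apply: mulr_ge0.
  have -> : eta * half j.+1 ^+ 2 = 4^-1 * (eta * h ^+ 2) by rewrite hS; field.
  apply: (@le_trans _ _ (4 * (r%:R * F * F))).
    by move: Y; move: (r%:R * F * F) (r%:R * _ * F) => x y; lra.
  rewrite X mulrA ler_wpM2r//.
  by move: kb2; rewrite -mulrA; move: (r%:R * c0 ^+ 2 * eta) => x; lra.
have {}hQ := msec_sub (fun z h => h) fin hQ.
have QE z : WO (s_ j.+1) z -> FL z *m FR z - FL z *m E z - E z *m FR z + FL z *m E z *m FR z =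
    (A z - FL z *m A z) *m g z *m (B z - B z *m FR z) - 1%:M.
  move=> zO; have AgB : A z *m g z *m B z = 1%:M + E z by rewrite /E addrC subrK.
  have -> : A z - FL z *m A z = (1%:M - FL z) *m A z by rewrite mulmxBl mul1mx.
  have -> : B z - B z *m FR z = B z *m (1%:M - FR z) by rewrite mulmxBr mulmx1.
  have -> : (1%:M - FL z) *m A z *m g z *m (B z *m (1%:M - FR z)) = (1%:M - FL z) *m (A z *m g z *m B z) *m (1%:M - FR z).
    by rewrite !mulmxA.
  rewrite AgB; have := EF z zO; move: (E z) (FL z) (FR z) => e f g' eE.
  have -> : (1%:M - f) *m (1%:M + e) *m (1%:M - g') = 1%:M + (e - (f + g')) - f *m e - e *m g' + f *m e *m g' + f *m g'.
    rewrite !(mulmxDl, mulmxDr, mulNmx, mulmxN, mul1mx, mulmx1).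
    move: (f *m g') (e *m g') (f *m e) (f *m e *m g') => x4 x3 x2 x1.
    by apply/matrixP => p q; rewrite !mxE; ring.
  rewrite -eE subrr addr0; move: (f *m g') (e *m g') (f *m e) (f *m e *m g') => x4 x3 x2 x1.
  by apply/matrixP => p q; rewrite !mxE; ring.
move=> p q; have [q1 q2 q3] := hQ p q; split=> [z zO|z a zO a0|z zO].
- by apply: (hd_nearU (@U_open _ _ _ _ _ _) zO) (q1 z zO) => z' zO'; rewrite -(QE z' zO').
- have E1 := congr1 (fun M : 'M[C]_r => M p q) (QE z zO).
  have E2 := congr1 (fun M : 'M[C]_r => M p q) (QE (a *: z) (U_cone a0 zO)).
  exact: (etrans (esym E2) (etrans (q2 z a zO a0) (congr1 (fun x => a ^+ 0 * x) E1))).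
- by rewrite -QE//; exact: q3.
Qed.

Lemma cartan_limit : exists A B,
  [/\ msec (WL (s0 / 2)) (KB * 2 * eta) (fun z => A z - 1%:M),
      msec (WR (s0 / 2)) (KB * 2 * eta) (fun z => B z - 1%:M) &
      forall z, WO (s0 / 2) z -> A z *m g z *m B z = 1%:M].
Proof.
pose st := ((V -> 'M[C]_r) * (V -> 'M[C]_r))%type.
have Hs (x : nat * st) : exists FG : st, cinv x.1 x.2 ->
  [/\ msec (WL (s_ x.1.+1)) (KB / 4 * eta * half x.1) (fun z => FG.1 z *m x.2.1 z),
      msec (WR (s_ x.1.+1)) (KB / 4 * eta * half x.1) (fun z => x.2.2 z *m FG.2 z) &
      cinv x.1.+1 (fun z => x.2.1 z - FG.1 z *m x.2.1 z, fun z => x.2.2 z - x.2.2 z *m FG.2 z)].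
  have [h|] := pselect (cinv x.1 x.2); last by exists x.2.
  by have [FG H] := cartan_step h; exists FG.
have [nx Hnx] := choice Hs.
pose st0 : st := (fun=> 1%:M, fun=> 1%:M).
pose next (x : nat * st) : nat * st := (x.1.+1,
  (fun z => x.2.1 z - (nx x).1 z *m x.2.1 z, fun z => x.2.2 z - x.2.2 z *m (nx x).2 z)).
pose sx (j : nat) := iter j next (0%N, st0).
have sx1 j : (sx j).1 = j by elim: j => //= j ->.
have s_0 : s_ 0 = s0 by rewrite /s_ expr0; field.
have z0sec (W : set V) : msec W 0 (fun=> 1%:M - 1%:M : 'M[C]_r).
  by move=> p q; split=> [z _|z a _ _|z _]; rewrite ?subrr ?mxE ?mulr0 ?mul0r ?normc0//; exact: hd_cst.
have si j : cinv j (sx j).2.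
  elim: j => [|j IH]; last by have := Hnx (sx j); rewrite sx1 => /(_ IH)[].
  have z1 : KB / 2 * eta * (1 - half 0) = 0 by rewrite expr0 subrr mulr0.
  split=> /=; rewrite ?s_0 ?z1; [exact: z0sec|exact: z0sec|].
  rewrite expr0 expr1n mulr1; apply: eq_msec gs => z; by rewrite mul1mx mulmx1.
have half1 j : half j <= 1 by rewrite exprn_ile1// ?invr_ge0// invf_le1// ler1n.
have sj j : s0 / 2 <= s_ j by rewrite lerDl mulr_ge0 ?half_ge0// divr_ge0// ltW.
have kb0 : 0 <= KB / 2 * eta by apply: mulr_ge0 => //; apply: divr_ge0 => //; exact: KB_ge0.
have kb4 : 0 <= KB / 4 * eta by apply: mulr_ge0 => //; apply: divr_ge0 => //; exact: KB_ge0.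
have b1 j : KB / 2 * eta * (1 - half j) <= KB / 2 * eta by rewrite ler_piMr// lerBlDr lerDl half_ge0.
have LA (pq : 'I_r * 'I_r) : exists a, sec (WL (s0 / 2)) 0 (KB / 2 * eta) a /\ forall j z, WL (s0 / 2) z ->
    normc (a z - ((sx j).2.1 z - 1%:M) pq.1 pq.2) <= 4 * (KB / 4 * eta) * vn z ^+ 0 * half j.
  apply: (@sec_lim R m (WL (s0 / 2)) 0 _ (KB / 4 * eta) (fun j z => ((sx j).2.1 z - 1%:M) pq.1 pq.2)) => //.
  - exact: U_open.
  - by move=> a z a0; exact: U_cone.
  - move=> j; case: (si j) => h _ _; apply: sec_sub (h pq.1 pq.2) => // z; exact: U_sub.
  - move=> j z zL; case: (Hnx (sx j)); rewrite sx1; first exact: si.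
    move=> /(_ pq.1 pq.2)[_ _ h] _ _; rewrite expr0 mulr1; have := h z (U_sub (sj _) zL); rewrite expr0 mulr1.
    by rewrite -normcN; congr (normc _ <= _); rewrite !mxE; ring.
have LB (pq : 'I_r * 'I_r) : exists a, sec (WR (s0 / 2)) 0 (KB / 2 * eta) a /\ forall j z, WR (s0 / 2) z ->
    normc (a z - ((sx j).2.2 z - 1%:M) pq.1 pq.2) <= 4 * (KB / 4 * eta) * vn z ^+ 0 * half j.
  apply: (@sec_lim R m (WR (s0 / 2)) 0 _ (KB / 4 * eta) (fun j z => ((sx j).2.2 z - 1%:M) pq.1 pq.2)) => //.
  - exact: U_open.
  - by move=> a z a0; exact: U_cone.
  - move=> j; case: (si j) => _ h _; apply: sec_sub (h pq.1 pq.2) => // z; exact: U_sub.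
  - move=> j z zL; case: (Hnx (sx j)); rewrite sx1; first exact: si.
    move=> _ /(_ pq.1 pq.2)[_ _ h] _; rewrite expr0 mulr1; have := h z (U_sub (sj _) zL); rewrite expr0 mulr1.
    by rewrite -normcN; congr (normc _ <= _); rewrite !mxE; ring.
have [fa Hfa] := choice LA; have [fb Hfb] := choice LB.
pose A z : 'M[C]_r := \matrix_(p, q) fa (p, q) z + 1%:M.
pose B z : 'M[C]_r := \matrix_(p, q) fb (p, q) z + 1%:M.
have kb2 : KB / 2 * eta <= KB * 2 * eta.
  by rewrite ler_wpM2r// ler_wpM2l ?KB_ge0// (@le_trans _ _ 1)// ?invf_le1// ler1n.
have hA : msec (WL (s0 / 2)) (KB * 2 * eta) (fun z => A z - 1%:M).
  move=> p q; case: (Hfa (p, q)) => h _; apply: (sec_sub (fun z h => h) kb2).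
  by move: h; congr sec; apply/funext => z; rewrite /A addrK mxE.
have hB : msec (WR (s0 / 2)) (KB * 2 * eta) (fun z => B z - 1%:M).
  move=> p q; case: (Hfb (p, q)) => h _; apply: (sec_sub (fun z h => h) kb2).
  by move: h; congr sec; apply/funext => z; rewrite /B addrK mxE.
exists A, B; split=> // z zO; have [zL zR] := U_lo' (divr_ge0 (ltW s00) (ler0n _ 2)) zO.
have ml (M N : 'M[C]_r) (x y : R) : (forall p q, normc (M p q) <= x) -> (forall p q, normc (N p q) <= y) ->
    forall p q, normc ((M *m N) p q) <= r%:R * (x * y).
  move=> hM hN p q; rewrite mxE; apply: le_trans (normc_sum _ _ _) _.
  apply: (@le_trans _ _ (\sum_(s < r) x * y)); first by apply: ler_sum => s _; apply: normcM_le.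
  by rewrite sumr_const card_ord -[_ *+ _]mulr_natl.
pose c4 := 4 * (KB / 4 * eta).
have dA j p q : normc ((A z - (sx j).2.1 z) p q) <= c4 * half j.
  case: (Hfa (p, q)) => _ /(_ j z zL); rewrite expr0 mulr1 /=; congr (normc _ <= _).
  by rewrite /A !mxE; ring.
have dB j p q : normc ((B z - (sx j).2.2 z) p q) <= c4 * half j.
  case: (Hfb (p, q)) => _ /(_ j z zR); rewrite expr0 mulr1 /=; congr (normc _ <= _).
  by rewrite /B !mxE; ring.
have zO0 : WO s0 z by apply: U_sub zO; have := sj 0; rewrite s_0.
pose K1 := 1 + eta; pose K2 := 1 + KB * 2 * eta.
have gb p q : normc (g z p q) <= K1.
  by apply: le_near1; case: (gs p q) => _ _ /(_ z zO0); rewrite expr0 mulr1.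
have Bb p q : normc (B z p q) <= K2.
  by apply: le_near1; case: (hB p q) => _ _ /(_ z zR); rewrite expr0 mulr1.
have Ab j p q : normc ((sx j).2.1 z p q) <= 1 + KB / 2 * eta.
  apply: le_near1; case: (si j) => /(_ p q)[_ _ h] _ _.
  by have := h z (U_sub (sj _) zL); rewrite expr0 mulr1 => /le_trans; apply; exact: b1.
have c40 : 0 <= c4 by rewrite /c4; apply: mulr_ge0.
have K10 : 0 <= K1 by apply: addr_ge0.
have K20 : 0 <= K2.
  by apply: addr_ge0 => //; apply: mulr_ge0 => //; apply: mulr_ge0 => //; exact: KB_ge0.
apply/matrixP => p q; apply/eqP; rewrite -subr_eq0 -normc_eq0 eq_le normc_ge0 andbT.
pose K3 := 1 + KB / 2 * eta; have K30 : 0 <= K3 by apply: addr_ge0.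
have c5 : 0 <= r%:R * (r%:R * (c4 * K1) * K2) + r%:R * (r%:R * (K3 * K1) * c4) + eta.
  by apply: addr_ge0 => //; apply: addr_ge0; repeat (apply: mulr_ge0 => //).
apply: (le_half c5) => j.
have -> : (A z *m g z *m B z) p q - (1%:M : 'M[C]_r) p q = ((A z - (sx j).2.1 z) *m g z *m B z) p q +
   ((sx j).2.1 z *m g z *m (B z - (sx j).2.2 z)) p q + ((sx j).2.1 z *m g z *m (sx j).2.2 z - 1%:M) p q.
  rewrite !mulmxBl mulmxBr; move: (A z *m g z *m B z) (_ *m B z) (_ *m (sx j).2.2 z) => M1 M2 M3.
  by rewrite !mxE; ring.
have DD (x y w : R) : (x + y + w) * half j = x * half j + y * half j + w * half j by ring.
rewrite DD; apply: normcD_le; first apply: normcD_le.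
- have -> : r%:R * (r%:R * (c4 * K1) * K2) * half j = r%:R * (r%:R * ((c4 * half j) * K1) * K2) by ring.
  by apply: (@ml _ _ _ K2) => // p' q'; apply: (@ml _ _ _ K1) => // ? ?; exact: dA.
- have -> : r%:R * (r%:R * (K3 * K1) * c4) * half j = r%:R * (r%:R * (K3 * K1) * (c4 * half j)) by ring.
  by apply: (@ml _ _ (r%:R * (K3 * K1))) => p' q'; [apply: (@ml _ _ K3) => // ? ?; exact: Ab|exact: dB].
case: (si j) => _ _ /(_ p q)[_ _ h]; have := h z (U_sub (sj _) zO); rewrite expr0 mulr1 => /le_trans; apply.
by rewrite ler_wpM2l// expr2 ler_piMl ?half_ge0.
Qed.

End Step.
End Cartan.

(** * A matrix norm; continuity of inversion *)

Section MatrixNorm.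
Variable R : realType.
Local Notation C := R[i].

Definition mn p q (A : 'M[C]_(p, q)) : R := \sum_(x : 'I_p * 'I_q) normc (A x.1 x.2).

Lemma mn_ge0 p q (A : 'M[C]_(p, q)) : 0 <= mn A.
Proof. by apply: sumr_ge0 => x _; exact: normc_ge0. Qed.

Lemma normc_le_mn p q (A : 'M[C]_(p, q)) a b : normc (A a b) <= mn A.
Proof.
rewrite /mn (bigD1 (a, b)) //= lerDl; apply: sumr_ge0 => x _; exact: normc_ge0.
Qed.

Lemma mn_le p q (A : 'M[C]_(p, q)) e : (forall a b, normc (A a b) <= e) -> mn A <= (p * q)%:R * e.
Proof.
move=> H; apply: (@le_trans _ _ (\sum_(x : 'I_p * 'I_q) e)); first by apply: ler_sum => x _; exact: H.
by rewrite sumr_const card_prod !card_ord mulr_natl.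
Qed.

Lemma mnD p q (A B : 'M[C]_(p, q)) : mn (A + B) <= mn A + mn B.
Proof. by rewrite /mn -big_split; apply: ler_sum => x _; rewrite mxE; exact: le_normcD. Qed.

Lemma mnN p q (A : 'M[C]_(p, q)) : mn (- A) = mn A.
Proof. by apply: eq_bigr => x _; rewrite mxE normcN. Qed.

Lemma mnM p q r (A : 'M[C]_(p, q)) (B : 'M[C]_(q, r)) : mn (A *m B) <= mn A * mn B.
Proof.
apply: (@le_trans _ _ (\sum_(x : 'I_p * 'I_r) \sum_j normc (A x.1 j) * normc (B j x.2))).
  apply: ler_sum => x _; rewrite mxE; apply: le_trans (normc_sum _ _ _) _.
  by apply: ler_sum => j _; rewrite normcM.
rewrite -(pair_bigA _ (fun a b => \sum_j normc (A a j) * normc (B j b))) /=.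
have -> : mn A = \sum_a \sum_j normc (A a j) by rewrite /mn pair_bigA.
rewrite mulr_suml; apply: ler_sum => a _; rewrite exchange_big mulr_suml /=.
apply: ler_sum => j _; rewrite -mulr_sumr ler_wpM2l ?normc_ge0//.
have -> : mn B = \sum_j \sum_b normc (B j b) by rewrite /mn pair_bigA.
by rewrite (bigD1 j) //= lerDl; apply: sumr_ge0 => ? _; apply: sumr_ge0 => ? _; exact: normc_ge0.
Qed.

Lemma mn_eq0 p q (A : 'M[C]_(p, q)) : mn A <= 0 -> A = 0.
Proof.
move=> h; apply/matrixP => a b; rewrite mxE; apply/eqP; rewrite -normc_eq0 eq_le normc_ge0 andbT.
exact: le_trans (normc_le_mn _ _ _) h.
Qed.

Lemma mn_mul_close p q r (A A0 : 'M[C]_(p, q)) (B B0 : 'M[C]_(q, r)) :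
  mn (A *m B - A0 *m B0) <= mn (A - A0) * (mn B0 + mn (B - B0)) + mn A0 * mn (B - B0).
Proof.
have -> : A *m B - A0 *m B0 = (A - A0) *m B + A0 *m (B - B0).
  by rewrite mulmxBl mulmxBr addrA subrK.
apply: le_trans (mnD _ _) _; apply: lerD; last exact: mnM.
apply: le_trans (mnM _ _) _; rewrite ler_wpM2l ?mn_ge0//.
by rewrite -[X in mn X <= _](subrK B0) addrC; exact: mnD.
Qed.

(** A vector [v] with [v (1 + W) = 0] has norm at most half of its own. *)
Lemma near1_unit r (W : 'M[C]_r) : mn W <= 2^-1 ->
  1%:M + W \in unitmx /\ mn (invmx (1%:M + W) - 1%:M) <= 2 * mn (1%:M : 'M[C]_r) * mn W.
Proof.
move=> W2; have u : 1%:M + W \in unitmx.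
  rewrite -row_free_unit -kermx_eq0; apply/eqP/row_matrixP => a; rewrite row0.
  set v := row a _; have : v *m (1%:M + W) = 0 by rewrite /v -row_mul mulmx_ker row0.
  rewrite mulmxDr mulmx1 => /eqP; rewrite addr_eq0 => /eqP vW; apply: mn_eq0.
  have : mn v <= mn v * mn W by rewrite {1}vW mnN; exact: mnM.
  have := mn_ge0 v; have := ler_wpM2l (mn_ge0 v) W2; move: (mn v * mn W) (mn v) => x y; lra.
split=> //; set Y := invmx _.
have YE : Y = 1%:M - Y *m W.
  have : Y *m (1%:M + W) = 1%:M by rewrite mulVmx.
  by rewrite mulmxDr mulmx1 => <-; rewrite addrK.
have Y1 : mn Y <= 2 * mn (1%:M : 'M[C]_r).
  have : mn Y <= mn (1%:M : 'M[C]_r) + mn Y * mn W.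
    by rewrite {1}YE; apply: le_trans (mnD _ _) _; rewrite mnN lerD2l; exact: mnM.
  have := ler_wpM2l (mn_ge0 Y) W2; move: (mn Y * mn W) (mn Y) (mn 1%:M) => x y v; lra.
rewrite {1}YE addrAC subrr sub0r mnN; apply: le_trans (mnM _ _) _.
by rewrite ler_wpM2r ?mn_ge0.
Qed.

Lemma inv_close r (A0 : 'M[C]_r) : A0 \in unitmx -> forall e : R, 0 < e -> exists2 d : R, 0 < d &
  forall A, mn (A - A0) < d -> A \in unitmx /\ mn (invmx A - invmx A0) < e.
Proof.
move=> u e e0; set B := invmx A0; have B1 : 0 < mn B + 1 by rewrite ltr_wpDl ?mn_ge0.
pose K := 2 * mn (1%:M : 'M[C]_r) * (mn B + 1) * (mn B + 1) + 1.
have K0 : 0 < K by rewrite ltr_wpDl// !mulr_ge0 ?mn_ge0// ltW.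
have B2 : 0 < (2 * (mn B + 1))^-1 by rewrite invr_gt0 mulr_gt0.
have [d [d0 d1 d2]] := pos_min (divr_gt0 e0 K0) B2.
exists d => // A dA; pose W := B *m (A - A0).
have BA : B *m A0 = 1%:M by rewrite mulVmx.
have AE : A = A0 *m (1%:M + W).
  by rewrite mulmxDr mulmx1 /W mulmxA mulmxV// mul1mx addrC subrK.
have Wd : mn W <= (mn B + 1) * mn (A - A0).
  by apply: le_trans (mnM _ _) _; rewrite ler_wpM2r ?mn_ge0// lerDl.
have W2 : mn W <= 2^-1.
  apply: le_trans Wd _; apply: (@le_trans _ _ ((mn B + 1) * (2 * (mn B + 1))^-1)).
    by rewrite ler_wpM2l ?(ltW B1)//; exact: le_trans (ltW dA) d2.
  by rewrite invfM mulrCA divff ?mulr1// gt_eqF.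
have [u1 h1] := near1_unit W2.
have Au : A \in unitmx by rewrite AE unitmx_mul u u1.
split=> //; have iA : invmx A = invmx (1%:M + W) *m B.
  have h : (invmx (1%:M + W) *m B) *m A = 1%:M.
    by rewrite AE mulmxA -[_ *m B *m A0]mulmxA BA mulmx1 mulVmx.
  by have := congr1 (mulmx^~ (invmx A)) h; rewrite /= -[_ *m A *m _]mulmxA mulmxV// mulmx1 mul1mx => ->.
have -> : invmx A - B = (invmx (1%:M + W) - 1%:M) *m B by rewrite mulmxBl mul1mx iA.
apply: le_lt_trans (mnM _ _) _.
apply: (@le_lt_trans _ _ (2 * mn (1%:M : 'M[C]_r) * ((mn B + 1) * mn (A - A0)) * (mn B + 1))).
  apply: ler_pM; rewrite ?mn_ge0 ?lerDl//; apply: le_trans h1 _; rewrite ler_wpM2l// mulr_ge0 ?mn_ge0//.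
have -> : 2 * mn (1%:M : 'M[C]_r) * ((mn B + 1) * mn (A - A0)) * (mn B + 1) = (K - 1) * mn (A - A0) by rewrite /K; ring.
apply: (@le_lt_trans _ _ (K * mn (A - A0))); first by rewrite ler_wpM2r ?mn_ge0// gerBl.
rewrite mulrC -ltr_pdivlMr//; exact: lt_le_trans dA d1.
Qed.

End MatrixNorm.

(** * Holomorphic matrices *)

Section HdMatrix.
Variables (R : realType) (n : nat).
Local Notation C := R[i].
Local Notation V := 'rV[C]_n.

Definition mhd p q (A : V -> 'M[C]_(p, q)) z := forall a b, hd (fun z => A z a b) z.

Lemma mhdM p q r (A : V -> 'M[C]_(p, q)) (B : V -> 'M[C]_(q, r)) z : mhd A z -> mhd B z ->
  mhd (fun z => A z *m B z) z.
Proof.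
move=> hA hB a b; rewrite (_ : (fun z => _) = fun z => \sum_j A z a j * B z j b); last first.
  by apply/funext => y; rewrite mxE.
by apply: hd_sum => j; apply: hdM.
Qed.

Lemma hd_prod (J : Type) (s : seq J) (P : pred J) (f : J -> V -> C) z : (forall j, hd (f j) z) ->
  hd (fun z => \prod_(j <- s | P j) f j z) z.
Proof.
move=> H; elim: s => [|j s IH].
  have -> : (fun z => \prod_(j <- [::] | P j) f j z) = (fun=> 1) by apply/funext => x; rewrite big_nil.
  exact: hd_cst.
have -> : (fun z => \prod_(x <- j :: s | P x) f x z) =
   if P j then (fun z => f j z * \prod_(x <- s | P x) f x z) else (fun z => \prod_(x <- s | P x) f x z).
  by case: ifP => Pj; apply/funext => x; rewrite big_cons Pj.
by case: ifP => // _; apply: hdM.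
Qed.

Lemma hd_det r (A : V -> 'M[C]_r) z : mhd A z -> hd (fun z => \det (A z)) z.
Proof.
by move=> hA; apply: hd_sum => s; apply: hdM; [exact: hd_cst|apply: hd_prod => j; exact: hA].
Qed.

(** By Cramer's formula. *)
Lemma mhd_inv r (A : V -> 'M[C]_r) z (U : set V) : opn U -> U z -> (forall z', U z' -> A z' \in unitmx) ->
  mhd A z -> mhd (fun z => invmx (A z)) z.
Proof.
move=> oU Uz Au hA a b; apply: (@hd_nearU _ _ U (fun z => (\det (A z))^-1 * cofactor (A z) b a)) => //.
  by move=> z' Uz'; rewrite /invmx Au// !mxE.
apply: hdM.
  by apply: hdV; [exact: hd_det|rewrite -unitfE -unitmxE; exact: Au].
apply: hdM; first exact: hd_cst.
apply: hd_det => a' b'; have := hA (lift b a') (lift a b'); congr hd; by apply/funext => y; rewrite !mxE.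
Qed.

End HdMatrix.

(** * Uniform estimates over closed boxes *)

Section Compact.
Variables (R : realType) (m : nat) (i : 'I_m).
Local Notation C := R[i].
Local Notation V := 'rV[C]_m.
Local Notation D := ('I_m * bool)%type.
Implicit Types (lo hi x : D -> R) (z : V).

Definition pt x : V := \row_j ((x (j, false)) +i* (x (j, true))).

Definition inbox lo hi z := z 0 i != 0 /\ forall d, lo d <= X i d z <= hi d.

Lemma inbox_widen lo hi (th : R) z : 0 < th -> inbox lo hi z ->
  inbox (fun d => lo d - th) (fun d => hi d + th) z.
Proof.
move=> th0 [zi Hz]; split=> // d; have /andP[h1 h2] := Hz d; apply/andP; split.
  by apply: le_trans h1; rewrite gerBl ltW.
by apply: le_trans h2 _; rewrite lerDl ltW.
Qed.

Lemma near_pt lo hi x (w : R) z : inbox lo hi z -> (forall d, lo d <= x d <= hi d) ->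
  (forall d, hi d - lo d <= w) -> vn ((z 0 i)^-1 *: z - pt x) <= m%:R * (2 * w).
Proof.
move=> [zi Hz] Hx Hw; apply: (@le_trans _ _ (\sum_(j < m) 2 * w)).
  apply: ler_sum => j _; rewrite !mxE mulrC; apply: le_trans (normc_le_parts _) _.
  have hr b : `|part b (z 0 j / z 0 i) - x (j, b)| <= w.
    have := Hz (j, b); have := Hx (j, b); have := Hw (j, b); rewrite /X /=.
    move: (part _ _) (x _) (lo _) (hi _) => p q l h h1 /andP[h2 h3] /andP[h4 h5].
    rewrite ler_norml; apply/andP; split; lra.
  rewrite mulr_natl mulr2n; have := hr false; have := hr true; rewrite /part.
  case: (z 0 j / z 0 i) => u v /= h1 h2; exact: lerD.
by rewrite sumr_const card_ord -[_ *+ _]mulr_natl.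
Qed.

(** The coordinates [(i, _)] of a box are constrained, because [z_i / z_i = 1]. When the limit point
    of the bisection violates the constraint, small boxes around it contain no point, and [ek R i]
    serves as a dummy centre for the local hypothesis. *)
Lemma box_local (P : (D -> R) -> (D -> R) -> Prop) lo0 hi0 : (forall d, lo0 d <= hi0 d) ->
  (forall lo hi d, (forall e, lo e <= hi e) ->
     P lo (upd hi d (mid lo hi d)) -> P (upd lo d (mid lo hi d)) hi -> P lo hi) ->
  (forall z0 : V, z0 0 i = 1 -> inbox lo0 hi0 z0 \/ z0 = ek R i -> exists2 rho : R, 0 < rho & forall lo hi (th : R), 0 < th ->
     (forall d, lo0 d <= lo d /\ hi d <= hi0 d) ->
     (forall z, inbox (fun d => lo d - th) (fun d => hi d + th) z -> inbox lo0 hi0 z0 /\ vn ((z 0 i)^-1 *: z - z0) < rho) ->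
     P lo hi) ->
  P lo0 hi0.
Proof.
move=> lh Pcat Hl; apply: box_induction => // x Hx.
pose W := \sum_d (hi0 d - lo0 d) + 1.
have W0 : 0 < W by rewrite ltr_wpDl// sumr_ge0// => d _; rewrite subr_ge0.
have Wd d : hi0 d - lo0 d <= W.
  rewrite /W (bigD1 d) //= -addrA lerDl addr_ge0// sumr_ge0// => e _; by rewrite subr_ge0.
have wd (s : R) lo hi : 0 < s -> (forall d, hi d - lo d = s * (hi0 d - lo0 d)) -> forall d,
    (hi d + s) - (lo d - s) <= s * (W + 2).
  move=> s0 H d; have -> : hi d + s - (lo d - s) = (hi d - lo d) + 2 * s by ring.
  rewrite H; have -> : s * (W + 2) = s * W + 2 * s by ring.
  by rewrite lerD2r ler_wpM2l ?(ltW s0).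
have W3 : 0 < W + 2 by rewrite addr_gt0.
have [/eqP x1|x1] := eqVneq (x (i, false) +i* x (i, true)) 1.
  have z1 : pt x 0 i = 1 by rewrite mxE; apply/eqP.
  have zin : inbox lo0 hi0 (pt x).
    split; first by rewrite z1 oner_eq0.
    move=> d; have := Hx d; rewrite /X z1 divr1 mxE /part; by case: d => j [].
  have [rho r0 Hr] := Hl _ z1 (or_introl zin).
  have M0 : 0 < m%:R * (2 * (W + 2)) + 1 by rewrite ltr_wpDl// !mulr_ge0// ltW.
  exists (rho / (m%:R * (2 * (W + 2)) + 1)); first exact: divr_gt0.
  move=> s lo hi /andP[s0 s1] Hin Hw sub; apply: (Hr lo hi s s0 sub) => z Hz; split=> //.
  have Hx' d : lo d - s <= x d <= hi d + s.
    have /andP[h1 h2] := Hin d; apply/andP; split; first by apply: le_trans h1; rewrite gerBl ltW.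
    by apply: le_trans h2 _; rewrite lerDl ltW.
  apply: le_lt_trans (near_pt Hz Hx' (wd s lo hi s0 Hw)) _.
  have -> : m%:R * (2 * (s * (W + 2))) = s * (m%:R * (2 * (W + 2))) by ring.
  rewrite ltr_pdivlMr// in s1; apply: le_lt_trans s1; rewrite ler_wpM2l ?(ltW s0)// lerDl//.
have e1 : (ek R i : V) 0 i = 1 by rewrite mxE !eqxx.
have [rho r0 Hr] := Hl _ e1 (or_intror erefl).
pose c (b : bool) : R := if b then 0 else 1.
have [b xb] : exists b, x (i, b) != c b.
  apply: contrapT => no; move: x1; have -> : x (i, false) = 1.
    by apply: contrapT => /eqP h; apply: no; exists false.
  have -> : x (i, true) = 0; last by rewrite eqxx.
  by apply: contrapT => /eqP h; apply: no; exists true.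
have g0 : 0 < `|x (i, b) - c b| by rewrite normr_gt0 subr_eq0.
exists (`|x (i, b) - c b| / (W + 2)); first exact: divr_gt0.
move=> s lo hi /andP[s0 s1] Hin Hw sub; apply: (Hr lo hi s s0 sub) => z [zi Hz]; exfalso.
have := Hz (i, b); rewrite /X divff//; have -> : part (i, b).2 (1 : C) = c b by rewrite /part /c; case: (b).
have := wd s lo hi s0 Hw (i, b); have := Hin (i, b); rewrite ltr_pdivlMr// in s1; move: s1 s0.
move: (s * (W + 2)) (x _) (c b) (lo _) (hi _) => p q l h h1; clear => s1 s0 /andP[a1 a2] a3 /andP[a4 a5].
by move: s1; rewrite ltNge ler_norml => /negP; apply; apply/andP; split; lra.
Qed.

(** A property true near each point of the box for all parameters close enough holds over the whole
    box for all parameters close enough. *)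
Lemma compact_uniform (J : Type) (near : R -> set J) (Q : V -> J -> Prop) lo0 hi0 :
  (forall d, lo0 d <= hi0 d) ->
  (forall (d d' : R) t, d <= d' -> near d t -> near d' t) ->
  (forall z (a : C) t, a != 0 -> Q z t -> Q (a *: z) t) ->
  (forall z0, inbox lo0 hi0 z0 -> exists2 d : R, 0 < d & forall z t, vn (z - z0) < d -> near d t -> Q z t) ->
  exists2 d : R, 0 < d & forall z t, inbox lo0 hi0 z -> near d t -> Q z t.
Proof.
move=> lh nm Qs Hl.
apply: (@box_local (fun lo hi => exists2 d : R, 0 < d & forall z t, inbox lo hi z -> near d t -> Q z t)) => //.
  move=> lo hi d lh' [d1 d10 H1] [d2 d20 H2]; have [q [q0 q1 q2]] := pos_min d10 d20.
  exists q => // z t [zi Hz] nt; have [h|h] := leP (X i d z) (mid lo hi d).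
    apply: H1; last exact: nm nt; split=> // e; have := Hz e; rewrite /upd; case: eqP => [->|//].
    by move=> /andP[-> _].
  apply: H2; last exact: nm nt; split=> // e; have := Hz e; rewrite /upd; case: eqP => [->|//].
  by move=> /andP[_ ->]; rewrite ltW.
move=> z0 z01 Hz0; have [inz|ninz] := pselect (inbox lo0 hi0 z0); last first.
  exists 1 => // lo hi th th0 _ H; exists 1 => // z t Hz _; exfalso.
  by have [] := H z (inbox_widen th0 Hz).
have [d d0 Hd] := Hl z0 inz; exists d => // lo hi th th0 _ H; exists d => // z t Hz nt; have [zi _] := Hz.
have -> : z = z 0 i *: ((z 0 i)^-1 *: z) by rewrite scalerA divff// scale1r.
by apply: Qs => //; apply: Hd => //; have [] := H z (inbox_widen th0 Hz).
Qed.

End Compact.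

(** * Functions on projective space as functions of a spanning vector *)

Section Lines.
Variables (R : realType) (n : nat).
Local Notation C := R[i].
Local Notation V := 'rV[C]_n.+1.
Implicit Types (z v : V) (l : line R n).

Definition line0 : line R n.
Proof.
exists <[ek R ord0 : V]>%VS; rewrite dim_vline; suff -> : (ek R ord0 : V) != 0 by [].
by apply: contraTneq isT => /(congr1 (@vn R n.+1)); rewrite vn_ek vn0 => /eqP; rewrite oner_eq0.
Defined.

(** At [z = 0] the value is the default line [line0]. *)
Definition ln z : line R n := insubd line0 <[z]>%VS.

Lemma ln_spans z : z != 0 -> spans z (ln z).
Proof.
move=> z0; rewrite /spans z0 /= /ln val_insubd dim_vline z0 eqxx; exact: memv_line.
Qed.

Lemma spans_ln z l : spans z l -> l = ln z.
Proof.
move=> zl; have [lE _] := spansP zl; have /andP[z0 _] := zl; have [lE' _] := spansP (ln_spans z0).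
by apply: val_inj; rewrite lE lE'.
Qed.

Lemma lnZ z (a : C) : a != 0 -> z != 0 -> ln (a *: z) = ln z.
Proof.
move=> a0 z0; apply/esym/spans_ln; have /andP[_ h] := ln_spans z0.
by rewrite /spans scaler_eq0 (negPf a0) (negPf z0) /= memvZ.
Qed.

Lemma nz_near z : z != 0 -> exists2 d : R, 0 < d & forall z', vn (z' - z) < d -> z' != 0.
Proof.
move=> z0; exists (vn z); first exact: vn_gt0.
move=> z' h; apply: contraTneq h => ->; by rewrite sub0r vnN ltxx.
Qed.

Lemma holo_elim (U : set (PV R n)) (f : PV R n -> C) z0 : isopen U -> holo U f -> z0 != 0 -> U (ln z0) ->
  exists2 d : R, 0 < d & forall z, vn (z - z0) < d -> [/\ z != 0, U (ln z) & hd (fun z => f (ln z)) z].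
Proof.
move=> oU fU z00 Uz; have sz := ln_spans z00.
have [d1 d10 H1] := (nbhs_vn _ _).1 (oU z0 _ sz Uz).
have [F /nbhs_vn[d2 d20 H2]] := fU z0 _ sz Uz.
have [d3 d30 H3] := nz_near z00.
have [q [q0 q1 q2]] := pos_min d10 d20; have [p [p0 p1 p3]] := pos_min q0 d30.
have all z : vn (z - z0) < p -> [/\ z != 0, U (ln z) & F z = f (ln z)].
  move=> zp; have zn := H3 z (lt_le_trans zp p3); have zs := ln_spans zn.
  have Uz' : U (ln z) by apply: (H1 z) => //; exact: lt_le_trans zp (le_trans p1 q1).
  have [_ H] := H2 z (lt_le_trans zp (le_trans p1 q2)); split=> //; exact: (H (ln z)).
exists p => // z zp; have [zn Uz' _] := all z zp; split=> //.
have [Fd _] := H2 z (lt_le_trans zp (le_trans p1 q2)).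
have e0 : 0 < p - vn (z - z0) by rewrite subr_gt0.
apply: (hd_near e0 _ (differentiable_hd Fd)) => z' zz; have [|_ _ ->//] := all z' _.
have -> : z' - z0 = (z' - z) + (z - z0) by rewrite addrA subrK.
by apply: le_lt_trans (vnD _ _) _; rewrite -ltrBrDr.
Qed.

Lemma holo_intro (U : set (PV R n)) (f : PV R n -> C) :
  (forall z0, z0 != 0 -> U (ln z0) -> exists2 d : R, 0 < d & forall z, vn (z - z0) < d -> hd (fun z => f (ln z)) z) ->
  holo U f.
Proof.
move=> H z0 l zl Ul; have /andP[z00 _] := zl; rewrite (spans_ln zl) in Ul.
have [d d0 Hd] := H z0 z00 Ul; exists (fun z => f (ln z)); apply/nbhs_vn; exists d => // z zd; split.
  exact/hd_differentiable/Hd.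
by move=> l' zl' _; rewrite (spans_ln zl').
Qed.

Section Param.
Variables (m : nat) (T : set 'rV[C]_m) (o : set_type T).
Implicit Type t : set_type T.

Definition nearo (d : R) t := vn (set_val t - set_val o) < d.

Lemma nbhs_pair z0 (P : set (V * 'rV[C]_m)) : nbhs (z0, set_val o) P ->
  exists2 d : R, 0 < d & forall z t, vn (z - z0) < d -> nearo d t -> P (z, set_val t).
Proof.
case=> -[Q1 Q2] /= [/nbhs_vn[d1 d10 H1] /nbhs_vn[d2 d20 H2]] sub.
have [q [q0 q1 q2]] := pos_min d10 d20; exists q => // z t zq tq; apply: (sub (z, set_val t)); split.
  by apply: H1; exact: lt_le_trans zq q1.
by apply: H2; exact: lt_le_trans tq q2.
Qed.

Lemma openT_elim (U : set (PVxT n T)) z0 : isopen U -> z0 != 0 -> U (ln z0, o) ->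
  exists2 d : R, 0 < d & forall z t, vn (z - z0) < d -> nearo d t -> z != 0 /\ U (ln z, t).
Proof.
move=> oU z00 Uz; have sz := ln_spans z00.
have [d1 d10 H1] := nbhs_pair (oU (z0, set_val o) (ln z0, o) (conj sz erefl) Uz).
have [d3 d30 H3] := nz_near z00; have [q [q0 q1 q2]] := pos_min d10 d30; exists q => // z t zq tq.
have zn := H3 z (lt_le_trans zq q2); split=> //.
by apply: (H1 z t (lt_le_trans zq q1) (lt_le_trans tq q1) (ln z, t)); split=> //; exact: ln_spans.
Qed.

(** What later arguments use of holomorphy in the family: holomorphy in [z] for each nearby
    parameter, and joint continuity at the points over [o]. *)
Lemma holoT_elim (U : set (PVxT n T)) (f : PVxT n T -> C) z0 : isopen U -> holo U f -> z0 != 0 -> U (ln z0, o) ->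
  (exists2 d : R, 0 < d & forall z t, vn (z - z0) < d -> nearo d t -> hd (fun z => f (ln z, t)) z) /\
  forall e : R, 0 < e -> exists2 d : R, 0 < d & forall z t, vn (z - z0) < d -> nearo d t ->
    normc (f (ln z, t) - f (ln z0, o)) < e.
Proof.
move=> oU fU z00 Uz; have sz := ln_spans z00.
have [d1 d10 H1] := openT_elim oU z00 Uz.
have [F HF] := fU (z0, set_val o) (ln z0, o) (conj sz erefl) Uz.
have [d2 d20 H2] := nbhs_pair HF.
have [q [q0 q1 q2]] := pos_min d10 d20.
have FE z t : vn (z - z0) < q -> nearo q t -> F (z, set_val t) = f (ln z, t).
  move=> zq tq; have [zn Uzt] := H1 z t (lt_le_trans zq q1) (lt_le_trans tq q1).
  have [_ H] := H2 z t (lt_le_trans zq q2) (lt_le_trans tq q2).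
  by apply: (H (ln z, t)) => //; split=> //; exact: ln_spans.
split.
  exists q => // z t zq tq.
  have [Fd _] := H2 z t (lt_le_trans zq q2) (lt_le_trans tq q2).
  have dz : hd (fun z => F (z, set_val t)) z.
    apply: differentiable_hd.
    exact: (differentiable_comp (differentiable_slice (set_val t) z) Fd).
  have e0 : 0 < q - vn (z - z0) by rewrite subr_gt0.
  apply: (hd_near e0 _ dz) => z' zz; apply: FE => //.
  have -> : z' - z0 = (z' - z) + (z - z0) by rewrite addrA subrK.
  by apply: le_lt_trans (vnD _ _) _; rewrite -ltrBrDr.
move=> e e0; have oq : nearo q o by rewrite /nearo subrr vn0.
have zz : vn (z0 - z0) < q by rewrite subrr vn0.
have [Fd _] := H2 z0 o (lt_le_trans zz q2) (lt_le_trans oq q2).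
have Fc := differentiable_continuous Fd.
have eC : 0 < (e%:C : C) by rewrite ltcR.
have Hn := (cvgrPdist_lt _ _).1 Fc _ eC; have [d4 d40 H4] := nbhs_pair (Hn _).
have [p [p0 p1 p2]] := pos_min q0 d40; exists p => // z t zp tp.
have := H4 z t (lt_le_trans zp p2) (lt_le_trans tp p2); rewrite ltc_norm -normcN opprB.
by rewrite (FE z t) ?(FE z0 o)//; [exact: lt_le_trans zp p1|exact: lt_le_trans tp p1].
Qed.

End Param.
End Lines.

(** * Continuity of matrix products, small open balls, scaling *)

Section Closeness.
Variable R : realType.
Local Notation C := R[i].

Lemma prod_close p q r (A0 : 'M[C]_(p, q)) (B0 : 'M[C]_(q, r)) (e : R) : 0 < e -> exists2 d : R, 0 < d &
  forall A B, mn (A - A0) < d -> mn (B - B0) < d -> mn (A *m B - A0 *m B0) < e.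
Proof.
move=> e0; have [a0 b0] := (mn_ge0 A0, mn_ge0 B0).
have K0 : 0 < mn B0 + 1 + mn A0 + 1 by move: a0 b0; move: (mn _) (mn _) => x y; lra.
have [d [d0 d1 d2]] := pos_min ltr01 (divr_gt0 e0 K0); exists d => // A B hA hB.
apply: le_lt_trans (mn_mul_close _ _ _ _) _.
apply: (@le_lt_trans _ _ (d * (mn B0 + 1) + mn A0 * d)).
  apply: lerD; last by rewrite ler_wpM2l// ltW.
  apply: ler_pM; rewrite ?mn_ge0 ?addr_ge0 ?mn_ge0 ?(ltW hA)// lerD2l.
  exact: le_trans (ltW hB) d1.
rewrite ler_pdivlMr// in d2; apply: lt_le_trans d2.
by move: d0; move: (mn B0) (mn A0) => x y; nra.
Qed.

Lemma mn_lt p q (A : 'M[C]_(p, q)) (e : R) : 0 < e ->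
  (forall a b, normc (A a b) < e / ((p * q)%:R + 1)) -> mn A < e.
Proof.
move=> e0 H; have K0 : 0 < (p * q)%:R + 1 :> R by rewrite ltr_wpDl.
apply: le_lt_trans (mn_le (fun a b => ltW (H a b))) _.
by rewrite mulrA ltr_pdivrMr// mulrC ltr_pM2l// ltrDl.
Qed.

Lemma opn_ball n (z0 : 'rV[C]_n) (d : R) : opn [set z | vn (z - z0) < d].
Proof.
move=> z /= h; exists (d - vn (z - z0)); first by rewrite subr_gt0.
move=> z' zz; have -> : z' - z0 = (z' - z) + (z - z0) by rewrite addrA subrK.
by apply: le_lt_trans (vnD _ _) _; rewrite -ltrBrDr.
Qed.

Lemma hd_scale n (f : 'rV[C]_n -> C) (c : C) z : c != 0 -> z != 0 -> (forall w, w != 0 -> f (c^-1 *: w) = f w) ->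
  hd f z -> hd f (c *: z).
Proof.
move=> c0 z0 fc fd; have E w : w *m (c^-1)%:M = c^-1 *: w by rewrite mul_mx_scalar.
have h : hd (fun w => f (w *m (c^-1)%:M)) (c *: z).
  by apply: hd_lin; rewrite E scalerA mulVf// scale1r.
have cz : c *: z != 0 by rewrite scaler_eq0 negb_or c0.
have oN : opn [set w : 'rV[C]_n | w != 0].
  move=> w w0; exists (vn w).
    by rewrite lt0r vn_ge0 andbT; apply: contraNneq w0 => /vn_eq0 ->.
  by move=> w' h'; apply: contraTneq h' => ->; rewrite sub0r vnN ltxx.
by apply: (hd_nearU oN cz) h => w w0; rewrite E fc.
Qed.

End Closeness.

(** * Frames of the central member and their extensions to nearby members *)

Section Frames.
Variables (R : realType) (n m : nat) (T : set 'rV[R[i]]_m) (F : vbundle (PVxT n T)) (o : set_type T).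
Local Notation C := R[i].
Local Notation V := 'rV[C]_n.+1.
Local Notation r := (rk F).
Local Notation I := 'I_n.+1.
Local Notation D := (I * bool)%type.
Implicit Types (z : V) (t : set_type T) (a b : chart F) (i k : I).

(** No regularity is built in: holomorphy is asserted pointwise by [good], so frames can be chosen
    and patched freely. *)
Definition frame := 'I_r -> forall x : PVxT n T, fib F x.
Definition rframe := 'I_r -> forall l : line R n, fib F (l, o).
Implicit Types (s : frame) (e : rframe).

Definition Y a s z t : 'M[C]_r := \matrix_(p, q) triv a (ln z, t) (s p (ln z, t)) 0 q.
Definition RY a e z : 'M[C]_r := \matrix_(p, q) triv a (ln z, o) (e p (ln z)) 0 q.

Definition isframe i e := forall z0, z0 0 i != 0 -> forall a, dom a (ln z0, o) ->
  RY a e z0 \in unitmx /\ exists2 d : R, 0 < d & forall z, vn (z - z0) < d -> mhd (RY a e) z.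

(** Near [z0] and for parameters near [o], the frame [s] is holomorphic along each member and tends
    to the frame [e] of the central member. *)
Definition goodin a e s z0 := forall eps : R, 0 < eps -> exists2 d : R, 0 < d &
  forall z t, vn (z - z0) < d -> nearo o d t ->
    [/\ dom a (ln z, t), mhd (fun z => Y a s z t) z & mn (Y a s z t - RY a e z0) < eps].

Definition good e s z0 := exists a, dom a (ln z0, o) /\ goodin a e s z0.

Lemma nzi i z : z 0 i != 0 -> z != 0.
Proof. by apply: contraNneq => ->; rewrite mxE. Qed.

Lemma Y_chart a b (g : PVxT n T -> 'M[C]_r) :
  (forall x, dom a x -> dom b x -> forall u, triv b x u = triv a x u *m g x) ->
  forall s z t, dom a (ln z, t) -> dom b (ln z, t) -> Y b s z t = Y a s z t *m g (ln z, t).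
Proof.
move=> gE s z t da db; apply/matrixP => p q; rewrite !mxE gE// mxE; apply: eq_bigr => j _.
by rewrite mxE.
Qed.

Lemma RY_chart a b (g : PVxT n T -> 'M[C]_r) :
  (forall x, dom a x -> dom b x -> forall u, triv b x u = triv a x u *m g x) ->
  forall e z, dom a (ln z, o) -> dom b (ln z, o) -> RY b e z = RY a e z *m g (ln z, o).
Proof.
move=> gE e z da db; apply/matrixP => p q; rewrite !mxE gE// mxE; apply: eq_bigr => j _.
by rewrite mxE.
Qed.

Lemma dom_openI a b : isopen (dom a `&` dom b : set (PVxT n T)).
Proof.
move=> z x zx [xa xb]; have h1 := dom_open a z x zx xa; have h2 := dom_open b z x zx xb.
by apply: filterS2 h1 h2 => z' H1 H2 x' zx'; split; [exact: H1|exact: H2].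
Qed.

Lemma goodin_chart a b e s z0 : z0 != 0 -> dom a (ln z0, o) -> dom b (ln z0, o) ->
  goodin a e s z0 -> goodin b e s z0.
Proof.
move=> z00 da db ga eps e0; have [g [gh gE]] := triv_holo a b.
have dab : (dom a `&` dom b) (ln z0, o) by [].
have H pq := holoT_elim (dom_openI (a := a) (b := b)) (gh pq.1 pq.2) z00 dab.
have [d1 d10 H1] := openT_elim (dom_openI (a := a) (b := b)) z00 dab.
have [d2 d20 H2] := prod_close (RY a e z0) (g (ln z0, o)) e0.
have [d3 d30 H3] := ga _ d20.
have Hh : exists2 d4 : R, 0 < d4 & forall z t, vn (z - z0) < d4 -> nearo o d4 t -> mhd (fun z => g (ln z, t)) z.
  have [f Hf] := choice (fun pq : 'I_r * 'I_r => let: ex_intro2 d d0 h := (H pq).1 in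
    ex_intro (fun d => 0 < d /\ forall z t, vn (z - z0) < d -> nearo o d t -> hd (fun z => g (ln z, t) pq.1 pq.2) z) d (conj d0 h)).
  have [d4 d40 Hd4] := fin_min (fun pq => (Hf pq).1); exists d4 => // z t zd td p q.
  by apply: ((Hf (p, q)).2 z t); [exact: lt_le_trans zd (Hd4 _)|exact: lt_le_trans td (Hd4 _)].
have Hc : exists2 d5 : R, 0 < d5 & forall z t, vn (z - z0) < d5 -> nearo o d5 t -> mn (g (ln z, t) - g (ln z0, o)) < d2.
  have e5 : 0 < d2 / ((r * r)%:R + 1) by rewrite divr_gt0// ltr_wpDl.
  have [f Hf] := choice (fun pq : 'I_r * 'I_r => let: ex_intro2 d d0 h := (H pq).2 _ e5 in
    ex_intro (fun d => 0 < d /\ forall z t, vn (z - z0) < d -> nearo o d t -> normc (g (ln z, t) pq.1 pq.2 - g (ln z0, o) pq.1 pq.2) < d2 / ((r * r)%:R + 1)) d (conj d0 h)).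
  have [d4 d40 Hd4] := fin_min (fun pq => (Hf pq).1); exists d4 => // z t zd td; apply: mn_lt => // p q.
  by rewrite !mxE; apply: ((Hf (p, q)).2 z t); [exact: lt_le_trans zd (Hd4 _)|exact: lt_le_trans td (Hd4 _)].
have [d4 d40 H4] := Hh; have [d5 d50 H5] := Hc.
have [x1 [x10 x11 x12]] := pos_min d10 d30; have [x2 [x20 x21 x22]] := pos_min d40 d50.
have [d [d0 dx1 dx2]] := pos_min x10 x20.
have [l1 l3 l4 l5] : [/\ d <= d1, d <= d3, d <= d4 & d <= d5].
  by split; [exact: le_trans dx1 x11|exact: le_trans dx1 x12|exact: le_trans dx2 x21|exact: le_trans dx2 x22].
exists d => // z t zd td.
have YE z' : vn (z' - z0) < d -> Y b s z' t = Y a s z' t *m g (ln z', t).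
  move=> zd'; have [_ [h1 h2]] := H1 z' t (lt_le_trans zd' l1) (lt_le_trans td l1).
  exact: (Y_chart gE).
have [_ [da' db']] := H1 z t (lt_le_trans zd l1) (lt_le_trans td l1).
have [_ Yh Yc] := H3 z t (lt_le_trans zd l3) (lt_le_trans td l3); split=> //.
  move=> p q; apply: (@hd_nearU _ _ _ (fun z => (Y a s z t *m g (ln z, t)) p q) _ _ (opn_ball (z0 := z0) (d := d)) zd).
    by move=> z' zd'; rewrite YE.
  by apply: mhdM => //; apply: H4; [exact: lt_le_trans zd l4|exact: lt_le_trans td l4].
rewrite YE// (RY_chart gE)//; apply: H2 => //; apply: H5; [exact: lt_le_trans zd l5|exact: lt_le_trans td l5].
Qed.

Definition chx (x : PVxT n T) : chart F := sval (cid (dom_cover F x)).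
Lemma chx_dom x : dom (chx x) x. Proof. exact: svalP (cid (dom_cover F x)). Qed.

(** Transition matrix between two frames, computed in an arbitrary chart; by [Gm_chart] the chart
    does not matter. *)
Definition Gm s s' z t := Y (chx (ln z, t)) s z t *m invmx (Y (chx (ln z, t)) s' z t).
Definition RG e e' z := RY (chx (ln z, o)) e z *m invmx (RY (chx (ln z, o)) e' z).

Lemma chart_unit a b (g : PVxT n T -> 'M[C]_r) x :
  (forall x, dom a x -> dom b x -> forall u, triv b x u = triv a x u *m g x) ->
  dom a x -> dom b x -> g x \in unitmx.
Proof.
move=> gE da db; have [h [_ hE]] := triv_holo b a; have [f fK Kf] := triv_bij da.
suff /mulmx1_unit[] : g x *m h x = 1%:M by [].
apply/row_matrixP => p; rewrite row_mul.
have -> : row p (g x) = triv b x (f (row p 1%:M)) by rewrite gE// Kf -row_mul mul1mx.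
by rewrite -hE// Kf.
Qed.

Lemma ratio_chart (A B g : 'M[C]_r) : g \in unitmx -> B \in unitmx ->
  (A *m g) *m invmx (B *m g) = A *m invmx B.
Proof.
move=> gu Bu; have u : B *m g \in unitmx by rewrite unitmx_mul Bu.
have h : A *m invmx B *m (B *m g) = A *m g by rewrite mulmxA mulmxKV.
by rewrite -h mulmxK.
Qed.

Lemma Gm_chart a s s' z t : dom a (ln z, t) -> Y a s' z t \in unitmx ->
  Gm s s' z t = Y a s z t *m invmx (Y a s' z t).
Proof.
move=> da u; have [g [_ gE]] := triv_holo a (chx (ln z, t)); have db := chx_dom (ln z, t).
by rewrite /Gm !(Y_chart gE)// ratio_chart//; exact: chart_unit gE da db.
Qed.

Lemma Gm_expand a s s' z t p : dom a (ln z, t) -> Y a s' z t \in unitmx ->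
  s p (ln z, t) = \sum_q Gm s s' z t p q *: s' q (ln z, t).
Proof.
move=> da u; apply: (bij_inj (triv_bij da)); rewrite linear_sum; apply/rowP => q.
rewrite summxE; have E : Gm s s' z t *m Y a s' z t = Y a s z t by rewrite (Gm_chart s da u) mulmxKV.
have -> : triv a (ln z, t) (s p (ln z, t)) 0 q = Y a s z t p q by rewrite mxE.
by rewrite -E mxE; apply: eq_bigr => j _; rewrite linearZ !mxE.
Qed.

Definition goodQ (e e' : rframe) s s' (G0 : V -> 'M[C]_r) (eps : R) z t :=
  [/\ z != 0, exists2 a : chart F, dom a (ln z, t) & Y a s' z t \in unitmx,
      mhd (fun z => Gm s s' z t) z & mn (Gm s s' z t - G0 z) <= eps].

(** In a chart around [(z0, o)] both frames are close to their central values, and the matrix of the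
    second stays invertible. *)
Lemma trans_good e e' s s' i z0 : z0 0 i != 0 -> isframe i e' -> good e s z0 -> good e' s' z0 ->
  forall eps : R, 0 < eps -> exists2 d : R, 0 < d & forall z t, vn (z - z0) < d -> nearo o d t ->
    [/\ z != 0, exists2 a : chart F, dom a (ln z, t) & Y a s' z t \in unitmx,
      mhd (fun z => Gm s s' z t) z & mn (Gm s s' z t - RG e e' z0) < eps].
Proof.
move=> zi fe [a1 [da1 ga1]] [a2 [da2 ga2]] eps e0; have z00 := nzi zi.
pose a := chx (ln z0, o); have da : dom a (ln z0, o) := chx_dom _.
have g1 := goodin_chart z00 da1 da ga1; have g2 := goodin_chart z00 da2 da ga2.
have [u _] := fe z0 zi a da.
have [d1 d10 H1] := prod_close (RY a e z0) (invmx (RY a e' z0)) e0.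
have [d2 d20 H2] := inv_close u d10.
have [d3 d30 H3] := g1 _ d10; have [d4 d40 H4] := g2 _ d20; have [d5 d50 H5] := nz_near z00.
have [x [x0 x1 x2]] := pos_min d30 d40; have [d [d0 dx dd5]] := pos_min x0 d50.
have [l3 l4] : d <= d3 /\ d <= d4 by split; [exact: le_trans dx x1|exact: le_trans dx x2].
exists d => // z t zd td.
have W z' : vn (z' - z0) < d -> [/\ dom a (ln z', t), Y a s' z' t \in unitmx & Gm s s' z' t = Y a s z' t *m invmx (Y a s' z' t)].
  move=> zd'; have [d' _ Yc] := H4 z' t (lt_le_trans zd' l4) (lt_le_trans td l4).
  by have [u' _] := H2 _ Yc; split=> //; exact: Gm_chart.
have [dz uz GE] := W z zd.
have [_ Yh Yc] := H3 z t (lt_le_trans zd l3) (lt_le_trans td l3).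
have [_ Yh' Yc'] := H4 z t (lt_le_trans zd l4) (lt_le_trans td l4).
split; [exact: H5 (lt_le_trans zd dd5)|by exists a| |].
  move=> p q; apply: (@hd_nearU _ _ _ (fun z => (Y a s z t *m invmx (Y a s' z t)) p q) _ _ (opn_ball (z0 := z0) (d := d)) zd).
    by move=> z' /W[_ _ ->].
  apply: mhdM; first exact: Yh.
  apply: (mhd_inv (opn_ball (z0 := z0) (d := d)) zd _ Yh').
  by move=> z' /W[].
by rewrite GE; apply: H1 => //; case: (H2 _ Yc').
Qed.

Lemma ln_scale (c : C) z : c != 0 -> ln (c *: z) = ln z.
Proof.
move=> c0; have [->|z0] := eqVneq z 0; first by rewrite scaler0.
exact: lnZ.
Qed.

Lemma Y_scale (c : C) a s z t : c != 0 -> Y a s (c *: z) t = Y a s z t.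
Proof. by move=> c0; rewrite /Y ln_scale. Qed.

Lemma Gm_scale (c : C) s s' z t : c != 0 -> Gm s s' (c *: z) t = Gm s s' z t.
Proof. by move=> c0; rewrite /Gm ln_scale// !Y_scale. Qed.

Lemma RG_refl i e z : z 0 i != 0 -> isframe i e -> RG e e z = 1%:M.
Proof. by move=> zi fe; rewrite /RG mulmxV//; case: (fe z zi _ (chx_dom (ln z, o))). Qed.

(** In a chart of the total bundle, the coordinates of [e] are kept constant in the parameter. *)
Lemma frame_local i e z0 : isframe i e -> z0 0 i != 0 -> exists s, exists2 rho : R, 0 < rho &
  forall z1, z1 0 i != 0 -> vn ((z1 0 i)^-1 *: z1 - z0) < rho -> good e s z1.
Proof.
move=> fe zi; have z00 := nzi zi; pose a := chx (ln z0, o); have da : dom a (ln z0, o) := chx_dom _.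
pose s : frame := fun p x => xget 0 [set v | triv a x v = triv a (x.1, o) (e p x.1)].
have sE p x : dom a x -> triv a x (s p x) = triv a (x.1, o) (e p x.1).
  move=> dx; have [f fK Kf] := triv_bij dx.
  by apply: (@xgetPex _ 0 [set v | triv a x v = triv a (x.1, o) (e p x.1)]); exists (f (triv a (x.1, o) (e p x.1))).
have [d1 d10 H1] := openT_elim (dom_open a) z00 da.
exists s, d1 => // z1 z1i z1d; have z10 := nzi z1i.
have oo (d : R) : 0 < d -> nearo o d o by rewrite /nearo subrr vn0.
have d1o : dom a (ln z1, o).
  by have [_] := H1 _ o z1d (oo _ d10); rewrite ln_scale ?invr_eq0.
exists a; split=> // eps e0.
have [d2 d20 H2] := openT_elim (dom_open a) z10 d1o.
have [u [d3 d30 H3]] := fe z1 z1i a d1o.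
have zz : vn (z1 - z1) < d3 by rewrite subrr vn0.
have e5 : 0 < eps / ((r * r)%:R + 1) by rewrite divr_gt0// ltr_wpDl.
have [f Hf] := choice (fun pq : 'I_r * 'I_r => let: ex_intro2 d d0 h := hd_cont (H3 z1 zz pq.1 pq.2) e5 in
    ex_intro (fun d => 0 < d /\ forall h, vn h < d -> normc (RY a e (z1 + h) pq.1 pq.2 - RY a e z1 pq.1 pq.2) < eps / ((r * r)%:R + 1)) d (conj d0 h)).
have [d4 d40 Hd4] := fin_min (fun pq => (Hf pq).1).
have [x [x0 x1 x2]] := pos_min d20 d30; have [d [d0 dx dd4]] := pos_min x0 d40.
have YE z' t : vn (z' - z1) < d2 -> nearo o d2 t -> Y a s z' t = RY a e z'.
  by move=> zd td; have [_ dz] := H2 z' t zd td; apply/matrixP => p q; rewrite !mxE sE.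
exists d => // z t zd td.
have [zd2 td2] : vn (z - z1) < d2 /\ nearo o d2 t.
  by split; [exact: lt_le_trans zd (le_trans dx x1)|exact: lt_le_trans td (le_trans dx x1)].
split; first by case: (H2 z t zd2 td2).
  move=> p q; apply: (@hd_nearU _ _ _ (fun z => RY a e z p q) _ _ (opn_ball (z0 := z1) (d := d2)) zd2).
    by move=> z' zd'; rewrite YE.
  by apply: H3; exact: lt_le_trans zd (le_trans dx x2).
rewrite YE//; apply: mn_lt => // p q; rewrite [X in normc X]mxE [X in _ + X]mxE.
have := (Hf (p, q)).2 (z - z1); rewrite [z1 + _]addrC subrK; apply; exact: lt_le_trans zd (le_trans dd4 (Hd4 _)).
Qed.

(** A frame may be changed by holomorphic matrices that tend to the identity as the parameter tends
    to [o]. *)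
Lemma good_mul e s s' z0 (W : set V) (M : set_type T -> V -> 'M[C]_r) (d0 : R) : z0 != 0 -> opn W -> W z0 -> 0 < d0 ->
  good e s z0 ->
  (forall t z, nearo o d0 t -> W z -> mhd (M t) z) ->
  (forall eps : R, 0 < eps -> exists2 d : R, 0 < d & forall t z, nearo o d t -> W z -> mn (M t z - 1%:M) < eps) ->
  (forall t z p, nearo o d0 t -> W z -> s' p (ln z, t) = \sum_q M t z p q *: s q (ln z, t)) ->
  good e s' z0.
Proof.
move=> z00 oW Wz d00 [a [da ga]] Mh Mc sE; exists a; split=> // eps e0.
have [d1 d10 H1] := prod_close 1%:M (RY a e z0) e0.
have [d2 d20 H2] := Mc _ d10; have [d3 d30 H3] := ga _ d10; have [d4 d40 H4] := oW z0 Wz.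
have [x [x0 x1 x2]] := pos_min d20 d30; have [y [y0 y1 y2]] := pos_min d40 d00.
have [d [dp dx dy]] := pos_min x0 y0.
have [l2 l3 l4 l5] : [/\ d <= d2, d <= d3, d <= d4 & d <= d0].
  by split; [exact: le_trans dx x1|exact: le_trans dx x2|exact: le_trans dy y1|exact: le_trans dy y2].
exists d => // z t zd td.
have YE z' : vn (z' - z0) < d -> Y a s' z' t = M t z' *m Y a s z' t.
  move=> zd'; apply/matrixP => p q; rewrite !mxE sE; [|exact: lt_le_trans td l5|exact: H4 (lt_le_trans zd' l4)].
  by rewrite linear_sum summxE; apply: eq_bigr => j _; rewrite linearZ !mxE.
have [dz Yh Yc] := H3 z t (lt_le_trans zd l3) (lt_le_trans td l3); split=> //.
  move=> p q; apply: (@hd_nearU _ _ _ (fun z => (M t z *m Y a s z t) p q) _ _ (opn_ball (z0 := z0) (d := d)) zd).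
    by move=> z' zd'; rewrite YE.
  by apply: mhdM => //; apply: Mh; [exact: lt_le_trans td l5|exact: H4 (lt_le_trans zd l4)].
rewrite YE//; have -> : RY a e z0 = 1%:M *m RY a e z0 by rewrite mul1mx.
by apply: H1 => //; apply: H2; [exact: lt_le_trans td l2|exact: H4 (lt_le_trans zd l4)].
Qed.

End Frames.

(** * Gluing frames over adjacent boxes *)

Section Merge.
Variables (R : realType) (n m : nat) (T : set 'rV[R[i]]_m) (F : vbundle (PVxT n T)) (o : set_type T).
Local Notation C := R[i].
Local Notation V := 'rV[C]_n.+1.
Local Notation r := (rk F).
Local Notation I := 'I_n.+1.
Local Notation D := (I * bool)%type.
Implicit Types (z : V) (t : set_type T) (i k : I) (lo hi : D -> R).

Lemma nearo_le (d d' : R) t : d <= d' -> nearo o d t -> nearo o d' t.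
Proof. by move=> dd /lt_le_trans; apply. Qed.

Lemma Gm_sec (s s' : frame F) (W : set V) (eta : R) t : (forall z, W z -> z != 0) ->
  (forall z, W z -> mhd (fun z => Gm s s' z t) z) -> (forall z, W z -> mn (Gm s s' z t - 1%:M) <= eta) ->
  msec W eta (fun z => Gm s s' z t - 1%:M).
Proof.
move=> W0 Wh We p q; split=> [z Wz|z c Wz c0|z Wz].
- rewrite (_ : (fun z => _) = fun z => Gm s s' z t p q - (1%:M : 'M[C]_r) p q); last first.
    by apply/funext => y; rewrite mxE [X in _ + X]mxE.
  by apply: hdB; [exact: Wh|exact: hd_cst].
- by rewrite expr0 mul1r Gm_scale.
- by rewrite expr0 mulr1; apply: le_trans (normc_le_mn _ _ _) (We z Wz).
Qed.

Lemma goodQ_scale (e e' : rframe F o) (s s' : frame F) (G0 : V -> 'M[C]_r) (eps : R) z (c : C) t :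
  (forall c z, c != 0 -> G0 (c *: z) = G0 z) -> c != 0 ->
  goodQ e e' s s' G0 eps z t -> goodQ e e' s s' G0 eps (c *: z) t.
Proof.
move=> GZ c0 [z0 [a da ua] Gh Gc]; split.
- by rewrite scaler_eq0 negb_or c0.
- by exists a; rewrite ?(@ln_scale R n c z c0) ?(Y_scale _ _ _ _ c0).
- move=> p q; apply: hd_scale => // w w0; by rewrite Gm_scale// invr_eq0.
- by rewrite (Gm_scale _ _ _ _ c0) GZ.
Qed.

Variables (i : I) (e : rframe F o).
Hypothesis fe : isframe i e.

(** The frame is good on a neighbourhood of the closed box, which leaves room for the thickness lost
    in the factorization. *)
Definition framed lo hi := exists s : frame F, exists2 th : R, 0 < th &
  forall z, inbox i (fun d => lo d - th) (fun d => hi d + th) z -> good e s z.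

Lemma X_self (b : bool) z : z 0 i != 0 -> X i (i, b) z = part b (1 : C).
Proof. by move=> zi; rewrite /X divff. Qed.

Lemma inbox_U th lo hi z : U i th lo hi z -> inbox i (fun d => lo d - th) (fun d => hi d + th) z.
Proof. by move=> [zi H]; split=> // d; have /andP[h1 h2] := H d; rewrite !ltW. Qed.

Lemma inbox_sub lo hi lo' hi' z : (forall d, lo' d <= lo d) -> (forall d, hi d <= hi' d) ->
  inbox i lo hi z -> inbox i lo' hi' z.
Proof.
move=> h1 h2 [zi H]; split=> // d; have /andP[h3 h4] := H d.
by rewrite (le_trans (h1 d) h3) (le_trans h4 (h2 d)).
Qed.

Section Glue.
Variables (k : I) (b : bool) (mid : R) (lo hi : D -> R) (TT : R).
Hypotheses (ki : k != i) (T1 : 1 <= TT) (lh : forall d, lo d <= hi d /\ hi d - lo d <= TT).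
Hypothesis md : lo (k, b) <= mid <= hi (k, b).
Let lo' := upd lo (k, b) mid.
Let hi' := upd hi (k, b) mid.

Lemma upd_lo d : lo d <= lo' d.
Proof. by rewrite /lo' /upd; case: eqP => [->|//]; case/andP: md. Qed.

Lemma upd_hi d : hi' d <= hi d.
Proof. by rewrite /hi' /upd; case: eqP => [->|//]; case/andP: md. Qed.

Lemma upd_lh d : lo' d <= hi' d.
Proof. by rewrite /lo' /hi' /upd; case: eqP => // _; case: (lh d). Qed.

(** Both frames extend the same [e], so on the slab around the common face their transition matrix
    [g] tends to the identity. Cartan's factorization [A g B = 1] gives [A s1 = B^-1 s2], a frame
    over both boxes. *)
Lemma framed_glue : framed lo hi' -> framed lo' hi -> framed lo hi.
Proof.
move=> [s1 [th1 th10 G1]] [s2 [th2 th20 G2]].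
have [x [x0 x1 x2]] := pos_min th10 th20; have [s0 [s00 s0x s01]] := pos_min x0 ltr01.
have [l1 l2] : s0 <= th1 /\ s0 <= th2 by split; [exact: le_trans s0x x1|exact: le_trans s0x x2].
pose lo1 d := lo' d - s0; pose hi1 d := hi' d + s0.
have lh1 d : lo1 d <= hi1 d.
  by have := upd_lh d; rewrite /lo1 /hi1; move: (lo' d) (hi' d) => u v h; lra.
have Hface (eps : R) : 0 < eps -> exists2 d : R, 0 < d & forall z t, inbox i lo1 hi1 z -> nearo o d t ->
    goodQ e e s1 s2 (fun=> 1%:M) eps z t.
  move=> e0'; apply: (@compact_uniform R _ i _ (nearo o) (goodQ e e s1 s2 (fun=> 1%:M) eps) lo1 hi1 lh1).
  - by move=> d d' t; exact: nearo_le.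
  - by move=> z c t; apply: goodQ_scale.
  move=> z0 Hz; have [zi _] := Hz.
  have g1 : good e s1 z0.
    apply: G1; apply: inbox_sub Hz => d; first by apply: lerB => //; exact: upd_lo.
    by apply: lerD.
  have g2 : good e s2 z0.
    apply: G2; apply: inbox_sub Hz => d; first by apply: lerB.
    by apply: lerD => //; exact: upd_hi.
  have [d d0 Hd] := trans_good zi fe g1 g2 e0'; exists d => // z t zd td.
  by have [h1 h2 h3 h4] := Hd z t zd td; split=> //; rewrite -(RG_refl zi fe) ltW.
pose E0 := e0 r s0 TT; have E00 : 0 < E0 := e0_gt0 r s00 T1.
have [d1 d10 H1] := Hface E0 E00.
pose WO := U i s0 lo' hi'; pose WL := U i (s0 / 2) lo hi'; pose WR := U i (s0 / 2) lo' hi.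
have WOin z : WO z -> inbox i lo1 hi1 z by exact: inbox_U.
pose A t : set R := [set x | x = 0 \/ exists2 z, WO z & x = mn (Gm s1 s2 z t - 1%:M)].
have Aub (eps : R) t : 0 <= eps -> (forall z, WO z -> mn (Gm s1 s2 z t - 1%:M) <= eps) -> ubound (A t) eps.
  by move=> e0' H y [->//|[z zO ->]]; exact: H.
(* The exact size of [g - 1] over the slab for the parameter [t]: the bounds on [A] and [B] are
   proportional to it, hence tend to 0 as [t] tends to [o]. The element 0 in [A t] keeps the set
   nonempty. *)
pose eta t := sup (A t).
have eta_le (eps : R) t : 0 <= eps -> (forall z, WO z -> mn (Gm s1 s2 z t - 1%:M) <= eps) -> eta t <= eps.
  by move=> e0' H; apply: ge_sup; [exists 0; left|exact: Aub].
have etaP t : nearo o d1 t -> [/\ 0 <= eta t, eta t <= E0 & forall z, WO z -> mn (Gm s1 s2 z t - 1%:M) <= eta t].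
  move=> td; have B : ubound (A t) E0.
    by apply: Aub => [|z zO]; [exact: ltW|case: (H1 z t (WOin z zO) td)].
  split; [by apply: ub_le_sup; [exists E0|left]|by apply: eta_le => [|z zO]; [exact: ltW|case: (H1 z t (WOin z zO) td)]|].
  by move=> z zO; apply: ub_le_sup; [exists E0|right; exists z].
have HAB t : exists AB : (V -> 'M[C]_r) * (V -> 'M[C]_r), nearo o d1 t ->
  [/\ msec WL (KB r s0 TT * 2 * eta t) (fun z => AB.1 z - 1%:M),
      msec WR (KB r s0 TT * 2 * eta t) (fun z => AB.2 z - 1%:M) &
      forall z, U i (s0 / 2) lo' hi' z -> AB.1 z *m Gm s1 s2 z t *m AB.2 z = 1%:M].
  have [td|] := pselect (nearo o d1 t); last by exists (fun=> 0, fun=> 0).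
  have [h1 h2 h3] := etaP t td.
  have gs : msec (U i s0 lo' hi') (eta t) (fun z => Gm s1 s2 z t - 1%:M).
    by apply: Gm_sec => // z zO; case: (H1 z t (WOin z zO) td).
  have [A1 [B1 [a1 a2 a3]]] := @cartan_limit R _ r i s0 TT s00 s01 T1 k b mid lo hi ki lh md _ _ h1 h2 gs.
  by exists (A1, B1).
have [AB HAB'] := choice HAB.
have KB0 : 0 <= KB r s0 TT := KB_ge0 r s00 T1.
pose K := (r * r)%:R * (KB r s0 TT * 2) + 1.
have K0 : 0 < K by rewrite ltr_wpDl// mulr_ge0// mulr_ge0.
have small (eps : R) : 0 < eps -> exists2 d : R, 0 < d & d <= d1 /\ forall t, nearo o d t ->
    (forall z, WL z -> mn ((AB t).1 z - 1%:M) < eps) /\ (forall z, WR z -> mn ((AB t).2 z - 1%:M) < eps).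
  move=> e0'; have eK : 0 < eps / K by rewrite divr_gt0.
  have [d2 d20 H2] := Hface _ eK; have [d [d0 dd1 dd2]] := pos_min d10 d20.
  exists d => //; split=> // t td; have [h1 h2 h3] := HAB' t (nearo_le dd1 td).
  have [e1 _ _] := etaP t (nearo_le dd1 td).
  have ee : eta t <= eps / K.
    by apply: eta_le => [|z zO]; [exact: ltW|case: (H2 z t (WOin z zO) (nearo_le dd2 td))].
  have bd (M : 'M[C]_r) : (forall p q, normc (M p q) <= KB r s0 TT * 2 * eta t) -> mn M < eps.
    move=> HM; apply: le_lt_trans (mn_le HM) _.
    have -> : (r * r)%:R * (KB r s0 TT * 2 * eta t) = (K - 1) * eta t by rewrite /K; ring.
    apply: (@le_lt_trans _ _ ((K - 1) * (eps / K))).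
      by rewrite ler_wpM2l// subr_ge0 lerDr mulr_ge0// mulr_ge0.
    by rewrite mulrBl mul1r mulrC divfK ?gt_eqF// gtrBl.
  by split=> z zW; apply: bd => p q; [case: (h1 p q)|case: (h2 p q)] => _ _ /(_ z zW); rewrite expr0 mulr1.
have half0 : 0 < (2 : R)^-1 by rewrite invr_gt0.
have [d3 d30 [d31 H3]] := small _ half0.
have AZ t z c : nearo o d1 t -> c != 0 -> WL z -> (AB t).1 (c *: z) = (AB t).1 z.
  move=> td c0 zW; have [h _ _] := HAB' t td; apply/matrixP => p q.
  have := (h p q); case=> _ /(_ z c zW c0); rewrite expr0 mul1r mxE [RHS]mxE => /addIr -> //.
have BZ t z c : nearo o d1 t -> c != 0 -> WR z -> (AB t).2 (c *: z) = (AB t).2 z.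
  move=> td c0 zW; have [_ h _] := HAB' t td; apply/matrixP => p q.
  have := (h p q); case=> _ /(_ z c zW c0); rewrite expr0 mul1r mxE [RHS]mxE => /addIr -> //.
have WLZ z c : c != 0 -> WL (c *: z) -> WL z.
  by move=> c0 h; have := @U_cone R _ i _ _ _ c^-1 _ _ h; rewrite scalerA mulVf// scale1r invr_eq0; apply.
(* The definition has to choose a formula for each line; [snL] and [snR] show that either one is
   valid wherever it makes sense. *)
pose sn : frame F := fun p x => if `[< WL (gen x.1) >] then \sum_q (AB x.2).1 (gen x.1) p q *: s1 q x
   else \sum_q invmx ((AB x.2).2 (gen x.1)) p q *: s2 q x.
have genE z : z 0 i != 0 -> exists2 c : C, c != 0 & gen (ln z) = c *: z.
  by move=> zi; have [_ H] := spansP (ln_spans (nzi zi)).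
have snL t z p : nearo o d3 t -> WL z -> sn p (ln z, t) = \sum_q (AB t).1 z p q *: s1 q (ln z, t).
  move=> td zW; have [c c0 gE] := genE z zW.1; rewrite /sn /= gE.
  by case: asboolP => [_|[]]; [rewrite AZ//; exact: nearo_le td|exact: U_cone].
have snR t z p : nearo o d3 t -> WR z -> sn p (ln z, t) = \sum_q invmx ((AB t).2 z) p q *: s2 q (ln z, t).
  move=> td zW; have [zL|nL] := pselect (WL z).
    rewrite snL//; have zO := U_both zL zW.
    have zO' : WO z by apply: U_sub zO; rewrite ler_pdivrMr// ler_peMr ?ler1n// ltW.
    have [_ _ h3] := HAB' t (nearo_le d31 td); have := h3 z zO => AGB.
    have iB : invmx ((AB t).2 z) = (AB t).1 z *m Gm s1 s2 z t.
      have [_ Bu] := mulmx1_unit AGB; by rewrite -[LHS]mul1mx -AGB mulmxK.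
    have [_ [a da ua] _ _] := H1 z t (WOin z zO') (nearo_le d31 td).
    rewrite (eq_bigr (fun q => \sum_j ((AB t).1 z p q * Gm s1 s2 z t q j) *: s2 j (ln z, t))); last first.
      by move=> q _; rewrite (Gm_expand s1 q da ua) scaler_sumr; apply: eq_bigr => j _; rewrite scalerA.
    by rewrite exchange_big; apply: eq_bigr => j _; rewrite iB mxE scaler_suml.
  have [c c0 gE] := genE z zW.1; rewrite /sn /= gE.
  case: asboolP => [h|_]; first by case: nL; exact: WLZ h.
  by rewrite BZ//; exact: nearo_le td.
have mh1 (W : set V) (M : V -> 'M[C]_r) (x' : R) z : msec W x' (fun z => M z - 1%:M) -> W z -> mhd M z.
  move=> h zW p q; have [h' _ _] := h p q; have := hdD (h' z zW) (hd_cst (1%:M p q) z); congr hd.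
  by apply/funext => y; rewrite mxE [X in _ + X + _]mxE subrK.
exists sn, (s0 / 4); first by rewrite divr_gt0.
move=> z0 [zi Hz]; have s4 : s0 / 4 < s0 / 2 by rewrite ltr_pM2l// ltf_pV2 ?posrE// ltr_nat.
have sl : s0 / 2 <= s0 by rewrite ler_pdivrMr// ler_peMr ?ler1n// ltW.
have [hm|hm] := leP (X i (k, b) z0) mid.
  have zL : WL z0.
    split=> // d; have /andP[h1 h2] := Hz d; apply/andP; split.
      by apply: lt_le_trans h1; rewrite ltrD2l ltrN2.
    rewrite /hi' /upd; case: eqP => [->|_]; first by apply: le_lt_trans hm _; rewrite ltrDl divr_gt0.
    by apply: le_lt_trans h2 _; rewrite ltrD2l.
  have g1 : good e s1 z0.
    apply: G1; apply: inbox_sub (inbox_U zL) => d.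
      by rewrite lerD2l lerN2; exact: le_trans sl l1.
    by rewrite lerD2l; exact: le_trans sl l1.
  apply: (@good_mul _ _ _ _ _ _ _ s1 sn z0 WL (fun t z => (AB t).1 z) d3) => //; first exact: (nzi zi).
  - exact: U_open.
  - by move=> t z td zW; have [h _ _] := HAB' t (nearo_le d31 td); exact: mh1 h zW.
  - move=> eps e0'; have [d d0 [_ H]] := small eps e0'; exists d => // t z td zW.
    by case: (H t td) => h _; exact: h.
have zR : WR z0.
  split=> // d; have /andP[h1 h2] := Hz d; apply/andP; split.
    rewrite /lo' /upd; case: eqP => [->|_]; first by apply: lt_trans hm; rewrite gtrBl divr_gt0.
    by apply: lt_le_trans h1; rewrite ltrD2l ltrN2.
  by apply: le_lt_trans h2 _; rewrite ltrD2l.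
have g2 : good e s2 z0.
  apply: G2; apply: inbox_sub (inbox_U zR) => d.
    by rewrite lerD2l lerN2; exact: le_trans sl l2.
  by rewrite lerD2l; exact: le_trans sl l2.
have Bn t z : nearo o d3 t -> WR z -> (AB t).2 z \in unitmx /\
    mn (invmx ((AB t).2 z) - 1%:M) <= 2 * mn (1%:M : 'M[C]_r) * mn ((AB t).2 z - 1%:M).
  move=> td zW; have [_ h] := H3 t td; have := near1_unit (ltW (h z zW)).
  by rewrite addrC subrK.
apply: (@good_mul _ _ _ _ _ _ _ s2 sn z0 WR (fun t z => invmx ((AB t).2 z)) d3) => //; first exact: (nzi zi).
- exact: U_open.
- move=> t z td zW; apply: (@mhd_inv _ _ _ (fun z => (AB t).2 z) z WR) => //; first exact: U_open.
    by move=> z' zW'; case: (Bn t z' td zW').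
  by have [_ h _] := HAB' t (nearo_le d31 td); exact: mh1 h zW.
- move=> eps e0'; have M0 : 0 < 2 * mn (1%:M : 'M[C]_r) + 1 by rewrite ltr_wpDl// mulr_ge0 ?mn_ge0.
  have [d d0 [_ H]] := small _ (divr_gt0 e0' M0); have [q [q0 q1 q2]] := pos_min d0 d30.
  exists q => // t z td zW; have [_ h] := H t (nearo_le q1 td).
  have [_ hB] := Bn t z (nearo_le q2 td) zW; apply: le_lt_trans hB _.
  have := h z zW; rewrite ltr_pdivlMr// mulrC; apply: le_lt_trans; rewrite ler_wpM2r ?mn_ge0// lerDl//.
Qed.

End Glue.
(** In the directions [(i, _)] the coordinate is constant, so one of the halves contains every point
    of the box. *)
Lemma framed_trivial (b : bool) (mid : R) lo hi :
  framed lo (upd hi (i, b) mid) -> framed (upd lo (i, b) mid) hi -> framed lo hi.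
Proof.
move=> [s1 [th1 th10 G1]] [s2 [th2 th20 G2]].
have [h|h] := leP (part b (1 : C)) mid.
  exists s1, th1 => // z [zi H]; apply: G1; split=> // d; have := H d; rewrite /upd; case: eqP => [->|//].
  by rewrite X_self// => /andP[-> _]; apply: le_trans h _; rewrite lerDl ltW.
exists s2, th2 => // z [zi H]; apply: G2; split=> // d; have := H d; rewrite /upd; case: eqP => [->|//].
rewrite X_self// => /andP[_ ->]; rewrite andbT; apply: le_trans (ltW h); by rewrite gerBl ltW.
Qed.

(** Local frames are glued by bisection. The bound 33 exceeds the 32 of [om i], so the closed box
    covers the cone with some margin. *)
Theorem frames : exists s : frame F, forall z, inbox i (fun=> - 33) (fun=> 33) z -> good e s z.
Proof.
suff [s [th th0 H]] : framed (fun=> - 33) (fun=> 33).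
  exists s => z Hz; apply: H; exact: inbox_widen.
suff : (forall d : D, (-33 : R) <= 33 /\ 33 - (-33) <= (66 : R)) -> framed (fun=> - 33) (fun=> 33).
  by apply=> _; split; lra.
apply: (@box_local R _ i (fun lo hi => (forall d, lo d <= hi d /\ hi d - lo d <= 66) -> framed lo hi)).
- by move=> d; lra.
- move=> lo hi [k b] lh0 P1 P2 lh.
  have mE : lo (k, b) <= mid lo hi (k, b) <= hi (k, b).
    by have := lh0 (k, b); rewrite /mid; move: (lo _) (hi _) => u v h; apply/andP; split; lra.
  have F1 : framed lo (upd hi (k, b) (mid lo hi (k, b))).
    apply: P1 => d; have [h1 h2] := lh d; rewrite /upd; case: eqP => [->|//].
    by case/andP: mE => -> h3; split=> //; have [_] := lh (k, b); apply: le_trans; rewrite lerB.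
  have F2 : framed (upd lo (k, b) (mid lo hi (k, b))) hi.
    apply: P2 => d; have [h1 h2] := lh d; rewrite /upd; case: eqP => [->|//].
    by case/andP: mE => h3 ->; split=> //; have [_] := lh (k, b); apply: le_trans; rewrite lerB.
  have [ki|ki] := eqVneq k i; first by rewrite ki in F1 F2; exact: framed_trivial F1 F2.
  have T1 : (1 : R) <= 66 by rewrite ler1n.
  exact: (framed_glue ki T1 lh mE F1 F2).
move=> z0 z01 _; have zi : z0 0 i != 0 by rewrite z01 oner_eq0.
have [s [rho r0 H]] := frame_local fe zi; exists rho => // lo hi th th0 _ Hz _.
by exists s, th => // z zin; have [_ h] := Hz z zin; apply: H => //; case: zin.
Qed.

End Merge.

(** * The explicit transition matrices of [E] and the solver for them *)

Section Solver.
Variables (R : realType) (n r : nat).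
Local Notation C := R[i].
Local Notation I := 'I_n.+1.
Local Notation V := 'rV[C]_n.+1.
Local Notation M := 'M[C]_n.+1.
Implicit Types (z : V) (i j k a b : I) (p q : 'I_r) (Q : M).

Definition sq z : M := z^T *m z.

Lemma sqE z a b : sq z a b = z 0 a * z 0 b.
Proof. by rewrite mxE big_ord1 mxE. Qed.

Definition sym Q := Q^T = Q.

Lemma symE Q : sym Q -> forall a b, Q a b = Q b a.
Proof. by move=> h a b; rewrite -[in LHS]h mxE. Qed.

Lemma sym_sq z : sym (sq z).
Proof. by apply/matrixP => a b; rewrite mxE !sqE mulrC. Qed.

(** The representative of [Q] modulo [z^2] whose [(i, i)] entry vanishes. *)
Definition redm i z Q : M := Q - (Q i i / z 0 i ^+ 2) *: sq z.

Lemma redm_sym i z Q : sym Q -> sym (redm i z Q).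
Proof. by move=> h; apply/matrixP => a b; rewrite !mxE (symE h) !big_ord1 !mxE; ring. Qed.

Lemma redm_ii i z Q : z 0 i != 0 -> redm i z Q i i = 0.
Proof. by move=> zi; rewrite !mxE big_ord1 !mxE; field. Qed.

Definition psit z Q k a b : C := z 0 a * Q k b - z 0 b * Q k a.

Lemma psit_inE z Q : sym Q -> inE z (psit z Q).
Proof.
move=> /symE S; split=> [k a b|k a c b|k a b]; rewrite /wdg /cyc3 /psit; try ring.
by rewrite (S k b) (S a k) (S b a); ring.
Qed.

Lemma psit_sq z k a b : psit z (sq z) k a b = 0.
Proof. by rewrite /psit !sqE; ring. Qed.

Lemma psitD z Q Q' k a b : psit z (Q + Q') k a b = psit z Q k a b + psit z Q' k a b.
Proof. by rewrite /psit !mxE; ring. Qed.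

Lemma psitZ z c Q k a b : psit z (c *: Q) k a b = c * psit z Q k a b.
Proof. by rewrite /psit !mxE; ring. Qed.

Lemma psit_redm i z Q k a b : psit z (redm i z Q) k a b = psit z Q k a b.
Proof. by rewrite /redm -scaleNr psitD psitZ psit_sq mulr0 addr0. Qed.

Lemma psit_sum (J : finType) z (c : J -> C) (Q : J -> M) k a b :
  psit z (\sum_x c x *: Q x) k a b = \sum_x c x * psit z (Q x) k a b.
Proof.
rewrite /psit !summxE !mulr_sumr -sumrB; apply: eq_bigr => x _; rewrite !mxE; ring.
Qed.

(** The equations with an index equal to [i] express all entries through [Q i i]. *)
Lemma psit_ker i z Q : z 0 i != 0 -> sym Q -> (forall k a b, psit z Q k a b = 0) ->
  Q = (Q i i / z 0 i ^+ 2) *: sq z.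
Proof.
move=> zi /symE S H; apply/matrixP => k b; rewrite mxE sqE.
have h1 : Q k b = z 0 b * Q k i / z 0 i.
  have := H k i b; rewrite /psit => /eqP; rewrite subr_eq0 => /eqP h; by rewrite -h mulrC mulKf.
have h2 : Q k i = z 0 k * Q i i / z 0 i.
  have := H i i k; rewrite /psit => /eqP; rewrite subr_eq0 => /eqP h; by rewrite (S k i) -h mulrC mulKf.
by rewrite h1 h2; field.
Qed.

Definition nfm i z (t : I -> I -> I -> C) : M := \matrix_(k, b) nf i z t k b.

Lemma nfm_sym i z t : sym (nfm i z t).
Proof. by apply/matrixP => k b; rewrite !mxE /nf; congr (_ / _ + _ / _); exact: addrC. Qed.

Lemma nfm_ii i z t : skew3 t -> nfm i z t i i = 0.
Proof.
move=> sk; have t0 : t i i i = 0.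
  by have := sk i i i => /eqP; rewrite -subr_eq0 opprK -mulr2n mulrn_eq0 => /eqP.
by rewrite mxE /nf t0 !mulr0 !addr0 !mul0r addr0.
Qed.

Lemma nfm_psit i z Q : z 0 i != 0 -> sym Q -> Q i i = 0 -> nfm i z (psit z Q) = Q.
Proof.
move=> zi /symE S Q0; apply/matrixP => k b; rewrite mxE /nf /psit Q0 (S b k) (S b i) (S i k).
by field.
Qed.

Lemma psit_nfm i z t : z 0 i != 0 -> inE z t -> forall k a b, psit z (nfm i z t) k a b = t k a b.
Proof.
move=> zi [sk w0 c0] k a b; have := projE k a b zi sk; rewrite !w0 !c0 !mul0r !subr0 !mulr0 subrr mulr0 subr0.
by move=> /eqP; rewrite subr_eq0 /psit !mxE => /eqP.
Qed.

Lemma nf_bound i z t (e : R) : om i z -> 0 <= e -> (forall k a b, normc (t k a b) <= e * vn z) ->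
  forall k b, normc (nf i z t k b) <= (32 * n.+1%:R + (32 * n.+1%:R) ^+ 2) * e.
Proof.
move=> zi e0 H k b; have zi0 : z 0 i != 0 by rewrite -normc_gt0; exact: om_gt0.
set W := 32 * n.+1%:R; have W0 : 0 <= W by rewrite /W mulr_ge0.
have -> : nf i z t k b = 2^-1 * (t k i b / z 0 i + t b i k / z 0 i) +
    2^-1 * (z 0 b * t i i k / z 0 i / z 0 i + z 0 k * t i i b / z 0 i / z 0 i).
  by rewrite /nf; field.
have d1 x y u : normc (t x y u / z 0 i) <= e * W * vn z ^+ 0.
  by apply: om_divr => //; rewrite expr1.
have d2 (v : I) x y u : normc (z 0 v * t x y u / z 0 i / z 0 i) <= e * W * W * vn z ^+ 0.
  apply: om_divr => //; first by rewrite mulr_ge0.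
  apply: om_divr => //; rewrite expr2 mulrCA; apply: normcM_le => //; exact: normc_le_vn.
have h2 : normc ((2 : C)^-1) = 2^-1 by rewrite normcV normc_nat.
rewrite mulrDl; apply: normcD_le.
  have -> : W * e = 2^-1 * (e * W * vn z ^+ 0 + e * W * vn z ^+ 0) by rewrite expr0; field.
  by apply: normcM_le; [rewrite h2|apply: normcD_le].
have -> : W ^+ 2 * e = 2^-1 * (e * W * W * vn z ^+ 0 + e * W * W * vn z ^+ 0) by rewrite expr0; field.
by apply: normcM_le; [rewrite h2|apply: normcD_le].
Qed.

Variables (wm : I -> 'I_r -> M) (cfm : I -> {linear M -> 'rV[C]_r}).
Hypotheses (wsym : forall i p, sym (wm i p)) (wii : forall i p, wm i p i i = 0).
Hypothesis cfE : forall i Q, sym Q -> Q i i = 0 -> Q = \sum_p cfm i Q 0 p *: wm i p.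
Hypothesis cfw : forall i p q, cfm i (wm i p) 0 q = (p == q)%:R.

Definition cfk i a b p : C := cfm i (delta_mx a b) 0 p.

Lemma cfmE i Q p : cfm i Q 0 p = \sum_(x : I * I) Q x.1 x.2 * cfk i x.1 x.2 p.
Proof.
rewrite {1}(matrix_sum_delta Q) !linear_sum summxE -(pair_bigA _ (fun a b => Q a b * cfk i a b p)) /=.
apply: eq_bigr => a _; rewrite linear_sum summxE; apply: eq_bigr => b _.
by rewrite linearZ mxE.
Qed.

Definition Kc : R := \sum_(x : I * I * I * 'I_r) normc (cfk x.1.1.1 x.1.1.2 x.1.2 x.2).
Definition Kw : R := \sum_(x : I * 'I_r * I * I) normc (wm x.1.1.1 x.1.1.2 x.1.2 x.2).

Lemma Kc_ge0 : 0 <= Kc. Proof. by apply: sumr_ge0 => x _; exact: normc_ge0. Qed.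
Lemma Kw_ge0 : 0 <= Kw. Proof. by apply: sumr_ge0 => x _; exact: normc_ge0. Qed.

Lemma wm_le i p a b : normc (wm i p a b) <= Kw.
Proof. by rewrite /Kw (bigD1 (i, p, a, b)) //= lerDl; apply: sumr_ge0 => x _; exact: normc_ge0. Qed.

Lemma cfm_le i Q p (e : R) : 0 <= e -> (forall a b, normc (Q a b) <= e) -> normc (cfm i Q 0 p) <= (n.+1 * n.+1)%:R * Kc * e.
Proof.
move=> e0 H; rewrite cfmE; apply: le_trans (normc_sum _ _ _) _.
apply: (@le_trans _ _ (\sum_(x : I * I) e * Kc)).
  apply: ler_sum => x _; apply: normcM_le => //.
  by rewrite /Kc (bigD1 (i, x.1, x.2, p)) //= lerDl; apply: sumr_ge0 => y _; exact: normc_ge0.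
by rewrite sumr_const card_prod !card_ord -[_ *+ _]mulr_natl -mulrA [Kc * e]mulrC.
Qed.

(** Over [z_i != 0] the classes of the basis [wm i] of symmetric matrices with zero [(i, i)] entry
    form a frame of [E], with coordinates [cfm i]. This is the transition matrix from frame [i] to
    frame [j]. *)
Definition G0 i j z : 'M[C]_r := \matrix_(p, q) cfm j (redm j z (wm i p)) 0 q.

Lemma hd_cfm i (Qf : V -> M) z p : (forall a b, hd (fun z => Qf z a b) z) -> hd (fun z => cfm i (Qf z) 0 p) z.
Proof.
move=> H; rewrite (_ : (fun z => _) = fun z => \sum_(x : I * I) Qf z x.1 x.2 * cfk i x.1 x.2 p).
  by apply: hd_sum => x; apply: hdM; [exact: H|exact: hd_cst].
by apply/funext => y; rewrite cfmE.
Qed.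

Lemma redm_hd j z Q a b : z 0 j != 0 -> hd (fun z => redm j z Q a b) z.
Proof.
move=> zj; rewrite (_ : (fun z => _) = fun z => Q a b - Q j j * (z 0 j ^+ 2)^-1 * (z 0 a * z 0 b)).
  apply: hdB; first exact: hd_cst.
  apply: hdM; last by apply: hdM; exact: hd_coord.
  apply: hdZ; apply: hdV; first by apply: hdX; exact: hd_coord.
  exact: expf_neq0.
by apply/funext => y; rewrite mxE [X in _ + X]mxE [X in _ - X]mxE sqE.
Qed.

Lemma redmZ j z Q (c : C) : c != 0 -> redm j (c *: z) Q = redm j z Q.
Proof.
move=> c0; rewrite /redm; congr (_ - _); apply/matrixP => a b; rewrite 2!mxE [RHS]mxE !sqE !mxE.
have [->|zj] := eqVneq (z 0 j) 0; first by rewrite mulr0 expr0n /= invr0 !mulr0 !mul0r.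
by field; rewrite c0 zj.
Qed.

Lemma redm_le j z Q (e : R) : om j z -> 0 <= e -> (forall a b, normc (Q a b) <= e) ->
  forall a b, normc (redm j z Q a b) <= 1025 * e.
Proof.
move=> zj e0 H a b; have zj0 := om_gt0 zj.
have -> : redm j z Q a b = Q a b - Q j j * ((z 0 a / z 0 j) * (z 0 b / z 0 j)).
  by rewrite !mxE big_ord1 !mxE; field; rewrite -normc_gt0.
have -> : 1025 * e = e + e * (32 * 32) by ring.
apply: normcB_le => //; apply: normcM_le => //.
by apply: normcM_le; rewrite normcM normcV ler_pdivrMr// ltW//; exact: zj.
Qed.

Lemma sec_redm i Q (e : R) p : 0 <= e -> (forall a b, normc (Q a b) <= e) ->
  sec (om i) 0 ((n.+1 * n.+1)%:R * Kc * (1025 * e)) (fun z => cfm i (redm i z Q) 0 p).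
Proof.
move=> e0 H; split=> [z zi|z c zi c0|z zi].
- by apply: hd_cfm => a b; apply: redm_hd; rewrite -normc_gt0; exact: om_gt0.
- by rewrite redmZ// expr0 mul1r.
- by rewrite expr0 mulr1; apply: cfm_le; [exact: mulr_ge0 (ler0n _ _) e0|exact: redm_le].
Qed.

Lemma G0_sec i j p q : sec (om j) 0 ((n.+1 * n.+1)%:R * Kc * (1025 * Kw)) (fun z => G0 i j z p q).
Proof.
have := sec_redm j q Kw_ge0 (wm_le i p); congr sec; by apply/funext => z; rewrite mxE.
Qed.

Lemma redm_cfm i z Q : z 0 i != 0 -> sym Q -> redm i z Q = \sum_p cfm i (redm i z Q) 0 p *: wm i p.
Proof. by move=> zi Qs; apply: cfE; [exact: redm_sym|exact: redm_ii]. Qed.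

Lemma redm_redm i j z Q : z 0 i != 0 -> z 0 j != 0 -> redm j z (redm i z Q) = redm j z Q.
Proof.
move=> zi zj; apply/matrixP => a b; rewrite !mxE !big_ord1 !mxE; field.
by rewrite zi zj.
Qed.

Lemma redm_sum i z (c : 'I_r -> C) (Q : 'I_r -> M) : redm i z (\sum_p c p *: Q p) = \sum_p c p *: redm i z (Q p).
Proof.
apply/matrixP => a b; rewrite /redm mxE [X in _ + X]mxE [X in _ - X]mxE !summxE !mulr_suml -sumrB.
apply: eq_bigr => p _; rewrite !mxE; ring.
Qed.

Lemma G0_change i j z Q q : z 0 i != 0 -> z 0 j != 0 -> sym Q ->
  \sum_p cfm i (redm i z Q) 0 p * G0 i j z p q = cfm j (redm j z Q) 0 q.
Proof.
move=> zi zj Qs; rewrite -(redm_redm Q zi zj) {2}(redm_cfm zi Qs) redm_sum linear_sum summxE.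
by apply: eq_bigr => p _; rewrite linearZ !mxE.
Qed.

Lemma psit_wm i j z q k a b : z 0 j != 0 ->
  psit z (wm i q) k a b = \sum_p G0 i j z q p * psit z (wm j p) k a b.
Proof.
move=> zj; rewrite -(psit_redm j) {1}(redm_cfm zj (wsym i q)) psit_sum.
by apply: eq_bigr => p _; rewrite mxE.
Qed.

Hypothesis n0 : (0 < n)%N.

Let W : R := 32 * n.+1%:R + (32 * n.+1%:R) ^+ 2.
Let KT : R := r%:R * (2 * Kw).
Definition KSol : R := (n.+1 * n.+1)%:R * Kc * (W * (KE R n * KT)).

Lemma psit_comb_le z (c : 'I_r -> C) j (e : R) k a b : 0 <= e -> (forall p, normc (c p) <= e) ->
  normc (\sum_p c p * psit z (wm j p) k a b) <= KT * e * vn z.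
Proof.
move=> e0' H; apply: le_trans (normc_sum _ _ _) _.
apply: (@le_trans _ _ (\sum_(p < r) e * (2 * Kw * vn z))).
  apply: ler_sum => p _; apply: normcM_le => //.
  have -> : 2 * Kw * vn z = vn z * Kw + vn z * Kw by ring.
  by apply: normcB_le; apply: normcM_le; rewrite ?normc_le_vn ?wm_le.
by rewrite sumr_const card_ord -[_ *+ _]mulr_natl /KT le_eqVlt; apply/orP; left; apply/eqP; ring.
Qed.

Let KT0 : 0 <= KT. Proof. by apply: mulr_ge0 => //; apply: mulr_ge0 => //; exact: Kw_ge0. Qed.

Lemma sym_comb (c : 'I_r -> C) j : sym (\sum_p c p *: wm j p).
Proof. by rewrite /sym linear_sum; apply: eq_bigr => p _; rewrite linearZ /= wsym. Qed.

Lemma comb_ii (c : 'I_r -> C) j : (\sum_p c p *: wm j p) j j = 0.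
Proof. by rewrite summxE big1// => p _; rewrite mxE wii mulr0. Qed.

Lemma cfm_comb (c : 'I_r -> C) j q : cfm j (\sum_p c p *: wm j p) 0 q = c q.
Proof.
rewrite linear_sum summxE (bigD1 q) //= linearZ mxE cfw eqxx mulr1 big1 ?addr0// => p pq.
by rewrite linearZ mxE cfw (negPf pq) mulr0.
Qed.

Lemma hd_nf i (h : I -> I -> I -> V -> C) z k b : z 0 i != 0 -> (forall k a b, hd (h k a b) z) ->
  hd (fun z => nf i z (at3 h z) k b) z.
Proof.
move=> zi H; have two0 : (2 : C) != 0 by rewrite pnatr_eq0.
apply: hdD; apply: hdM.
- by apply: hdD; exact: H.
- by apply: hdV; [apply: hdZ; exact: hd_coord|rewrite mulf_neq0].
- by apply: hdD; apply: hdM; try exact: H; exact: hd_coord.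
- apply: hdV; first by apply: hdZ; apply: hdX; exact: hd_coord.
  by rewrite mulf_neq0// expf_neq0.
Qed.

(** [psi] turns coordinate vectors into tensors with entries of degree 1, to which [cousinE]
    applies; [nfm] and [cfm] lead back. This is the solver that [neumann] expects for [G0]. *)
Theorem solverE (c : I -> I -> 'I_r -> V -> C) (B eta : R) : 0 <= eta -> eta <= B ->
  (forall i j p, sec (ov i j) 0 B (c i j p)) ->
  (forall i j k p z, om i z -> om j z -> om k z ->
     normc (\sum_q c i j q z * G0 j k z q p + c j k p z - c i k p z) <= eta) ->
  exists b : I -> 'I_r -> V -> C, (forall i p, sec (om i) 0 (KSol * B) (b i p)) /\
    forall i j p z, om i z -> om j z ->
      normc (b j p z - \sum_q b i q z * G0 i j z q p - c i j p z) <= KSol * eta.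
Proof.
move=> e0 eB cs cc; have B0 := le_trans e0 eB.
have nz0 i z : om i z -> z 0 i != 0 by move=> zi; rewrite -normc_gt0; exact: om_gt0.
pose T i j k a b z := \sum_p c i j p z * psit z (wm j p) k a b.
have TE i j z : at3 (T i j) z = psit z (\sum_p c i j p z *: wm j p).
  by apply/funext => k; apply/funext => a; apply/funext => b; rewrite psit_sum.
have cb i j p z : om i z -> om j z -> normc (c i j p z) <= B.
  by move=> zi zj; case: (cs i j p) => _ _ /(_ z (conj zi zj)); rewrite expr0 mulr1.
have Ts i j k a b : sec (om i `&` om j) 1 (KT * B) (T i j k a b).
  split=> [z Hz|z s Hz s0|z [zi zj]].
  - apply: hd_sum => p; apply: hdM; first by case: (cs i j p) => h _ _; exact: h.
    by apply: hdB; apply: hdM; try exact: hd_coord; exact: hd_cst.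
  - rewrite /T mulr_sumr; apply: eq_bigr => p _; case: (cs i j p) => _ h _.
    by rewrite h// expr0 mul1r expr1 /psit !mxE; ring.
  - by rewrite expr1; apply: psit_comb_le => // p; exact: cb.
have TI i j z : om i z -> om j z -> inE z (at3 (T i j) z) by move=> zi zj; rewrite TE; apply: psit_inE; exact: sym_comb.
have Tc i j l k a b z : om i z -> om j z -> om l z ->
    normc (T i j k a b z + T j l k a b z - T i l k a b z) <= KT * eta * vn z.
  move=> zi zj zl; have -> : T i j k a b z + T j l k a b z - T i l k a b z =
    \sum_p (\sum_q c i j q z * G0 j l z q p + c j l p z - c i l p z) * psit z (wm l p) k a b.
    rewrite /T (eq_bigr (fun q => \sum_p c i j q z * G0 j l z q p * psit z (wm l p) k a b)); last first.
      by move=> q _; rewrite (psit_wm j q k a b (nz0 _ _ zl)) mulr_sumr; apply: eq_bigr => p _; rewrite mulrA.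
    rewrite exchange_big -big_split -sumrB; apply: eq_bigr => p _.
    by rewrite mulrBl mulrDl mulr_suml.
  by apply: psit_comb_le => // p; exact: cc.
have e1 : 0 <= KT * eta by exact: mulr_ge0.
have e2 : KT * eta <= KT * B by rewrite ler_wpM2l.
have [h [hs hI hc]] := cousinE n0 e1 e2 Ts TI Tc.
pose b i p z := cfm i (nfm i z (at3 (h i) z)) 0 p.
have hb i z : om i z -> nfm i z (at3 (h i) z) = \sum_p b i p z *: wm i p.
  by move=> zi; apply: cfE; [exact: nfm_sym|apply: nfm_ii; case: (hI i z zi)].
have hE i z k a b' : om i z -> h i k a b' z = \sum_p b i p z * psit z (wm i p) k a b'.
  by move=> zi; rewrite -psit_sum -hb// psit_nfm//; [exact: nz0|exact: hI].
have KE0 := KE_ge0 R n; have KEB : 0 <= KE R n * (KT * B) by rewrite mulr_ge0// mulr_ge0.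
have W0 : 0 <= W by apply: addr_ge0; rewrite ?exprn_ge0// mulr_ge0.
exists b; split=> [i p|i j p z zi zj].
  split=> [z zi|z s zi s0|z zi].
  - apply: hd_cfm => k b'; rewrite (_ : (fun z => _) = fun z => nf i z (at3 (h i) z) k b'); last first.
      by apply/funext => y; rewrite mxE.
    by apply: hd_nf; [exact: nz0|move=> k' a' b''; case: (hs i k' a' b'') => H _ _; exact: H].
  - rewrite expr0 mul1r /b; congr (cfm i _ 0 p); apply/matrixP => k b'; rewrite !mxE /nf.
    have H x y w : at3 (h i) (s *: z) x y w = s * at3 (h i) z x y w.
      by case: (hs i x y w) => _ H _; rewrite /at3 H// expr1.
    rewrite !H !mxE; field.
    by rewrite s0 nz0.
  - rewrite expr0 mulr1 /KSol; have -> : (n.+1 * n.+1)%:R * Kc * (W * (KE R n * KT)) * B =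
      (n.+1 * n.+1)%:R * Kc * (W * (KE R n * (KT * B))) by ring.
    apply: cfm_le => [|k b']; first by rewrite mulr_ge0.
    rewrite mxE; apply: nf_bound => // k' a' b''.
    by case: (hs i k' a' b'') => _ _ /(_ z zi); rewrite expr1.
set rho := fun p => b j p z - \sum_q b i q z * G0 i j z q p - c i j p z.
pose Q := \sum_p rho p *: wm j p.
have -> : b j p z - \sum_q b i q z * G0 i j z q p - c i j p z = cfm j Q 0 p by rewrite cfm_comb.
(* The error is turned into a tensor, bounded there by [hc], and read back through [nfm]. *)
have QE : Q = nfm j z (psit z Q) by rewrite nfm_psit//; [exact: nz0|exact: sym_comb|exact: comb_ii].
have -> : KSol * eta = (n.+1 * n.+1)%:R * Kc * (W * (KE R n * (KT * eta))) by rewrite /KSol; ring.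
apply: cfm_le => [|k b']; first by apply: mulr_ge0 => //; apply: mulr_ge0 => //; exact: mulr_ge0.
rewrite QE mxE; apply: nf_bound => //; first by rewrite mulr_ge0.
move=> k' a' b''; rewrite psit_sum.
have -> : \sum_x rho x * psit z (wm j x) k' a' b'' = h j k' a' b'' z - h i k' a' b'' z - T i j k' a' b'' z.
  rewrite (hE j)// (hE i)// /T.
  rewrite (eq_bigr (fun x => b j x z * psit z (wm j x) k' a' b'' - \sum_q b i q z * G0 i j z q x * psit z (wm j x) k' a' b'' - c i j x z * psit z (wm j x) k' a' b'')); last first.
    by move=> x _; rewrite /rho !mulrBl mulr_suml.
  rewrite !sumrB exchange_big; congr (_ - _ - _); apply: eq_bigr => q _.
  by rewrite (psit_wm i q _ _ _ (nz0 _ _ zj)) mulr_sumr; apply: eq_bigr => x _; rewrite mulrA.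
exact: hc.
Qed.

End Solver.

(** * A quadratic map close to [z^2] comes from an automorphism of [S^2V] *)

Section QuadOp.
Variables (R : realType) (n : nat).
Local Notation C := R[i].
Local Notation I := 'I_n.+1.
Local Notation V := 'rV[C]_n.+1.
Local Notation M := 'M[C]_n.+1.
Local Notation N2 := ((n.+1 * n.+1)%:R : R).
Implicit Types (z : V) (a b : I) (Q P : M).
Variables (f : I -> I -> V -> C) (K D : R).
Hypotheses (fs : forall a b, sec (@nz R n.+1) 2 K (f a b)) (f0 : forall a b, f a b 0 = 0).
Hypotheses (fC : forall a b z, f a b z = f b a z) (D0 : 0 <= D).
Hypothesis fD : forall a b z, normc (f a b z - sq z a b) <= D * vn z ^+ 2.
Hypothesis small : N2 * (N2 * (3 * D)) <= 2^-1.

(** The linear operator on matrices with [Bq (sq z) = f z], obtained by polarizing the quadratic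
    forms [f a b]. *)
Definition Bq Q : M := \matrix_(a, b) (2^-1 * \sum_(u : I * I) Q u.1 u.2 * polar (f a b) (ek R u.1) (ek R u.2)).

Lemma Bq_linear : linear Bq.
Proof.
move=> c Q Q'; apply/matrixP => a b; rewrite !mxE mulrCA -mulrDr; congr (_ * _).
by rewrite mulr_sumr -big_split; apply: eq_bigr => u _; rewrite !mxE /= mulrDl mulrA.
Qed.
HB.instance Definition _ := GRing.isLinear.Build C M M *:%R Bq Bq_linear.

Lemma Bq_sym Q : sym (Bq Q).
Proof.
apply/matrixP => a b; rewrite !mxE; congr (_ * _); apply: eq_bigr => u _; congr (_ * _).
by rewrite /polar !(fC b a).
Qed.

Lemma Bq_sq z : Bq (sq z) = \matrix_(a, b) f a b z.
Proof.
apply/matrixP => a b; rewrite !mxE.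
rewrite (eq_bigr (fun u : I * I => z 0 u.1 * (z 0 u.2 * polar (f a b) (ek R u.1) (ek R u.2)))); last first.
  by move=> u _; rewrite sqE mulrA.
rewrite -(pair_bigA _ (fun x y => z 0 x * (z 0 y * polar (f a b) (ek R x) (ek R y)))) /=.
rewrite (eq_bigr (fun x => z 0 x * polar (f a b) (ek R x) z)); last first.
  move=> x _; rewrite -mulr_sumr; congr (_ * _); rewrite [RHS]polarC -(polar_sum (fs a b) (f0 a b)).
  by apply: eq_bigr => y _; rewrite [in RHS]polarC.
by rewrite (polar_sum (fs a b) (f0 a b)) (polarxx (fs a b) (f0 a b)) mulrA mulVf ?mul1r// pnatr_eq0.
Qed.

Lemma sum_ek Q a b : \sum_(u : I * I) Q u.1 u.2 * (ek R u.1 0 a * ek R u.2 0 b) = Q a b.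
Proof.
rewrite [in RHS](matrix_sum_delta Q) pair_bigA summxE; apply: eq_bigr => u _.
by rewrite !mxE /= -natrM mulnb.
Qed.

(** Polarization of [fD]: each coefficient involves three values of [f - sq], at vectors of norm at
    most 2, 1 and 1, whence [6 * D]. *)
Lemma Bq_close Q : sym Q -> mn (Bq Q - Q) <= 2^-1 * mn Q.
Proof.
move=> Qs; have m0 := mn_ge0 Q.
suff h a b : normc ((Bq Q - Q) a b) <= N2 * (mn Q * (3 * D)).
  apply: le_trans (mn_le h) _.
  have -> : N2 * (N2 * (mn Q * (3 * D))) = N2 * (N2 * (3 * D)) * mn Q by ring.
  exact: ler_wpM2r.
have QE : Q a b = 2^-1 * \sum_(u : I * I) Q u.1 u.2 * polar (fun z => sq z a b) (ek R u.1) (ek R u.2).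
  have two0 : (2 : C) != 0 by rewrite pnatr_eq0.
  rewrite (eq_bigr (fun u : I * I => Q u.1 u.2 * (ek R u.1 0 a * ek R u.2 0 b) + Q u.1 u.2 * (ek R u.1 0 b * ek R u.2 0 a))).
    by rewrite big_split /= !sum_ek (symE Qs b a); field.
  by move=> u _; rewrite -mulrDr; congr (_ * _); rewrite /polar !sqE 4!mxE; ring.
rewrite mxE [X in _ + X]mxE QE mxE -mulrBr -sumrB.
have -> : N2 * (mn Q * (3 * D)) = 2^-1 * (N2 * (mn Q * (6 * D))) by field.
apply: normcM_le; first by rewrite normcV normc_nat.
apply: le_trans (normc_sum _ _ _) _.
apply: (@le_trans _ _ (\sum_(u : I * I) mn Q * (6 * D))).
  apply: ler_sum => u _; rewrite -mulrBr; apply: normcM_le; first exact: normc_le_mn.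
  set x := ek R u.1; set y := ek R u.2.
  have -> : polar (f a b) x y - polar (fun z => sq z a b) x y = (f a b (x + y) - sq (x + y) a b)
    - (f a b x - sq x a b) - (f a b y - sq y a b) by rewrite /polar; ring.
  have -> : 6 * D = D * 2 ^+ 2 + D * 1 ^+ 2 + D * 1 ^+ 2 by ring.
  have vx : vn x = 1 by exact: vn_ek.
  have vy : vn y = 1 by exact: vn_ek.
  apply: normcB_le; [apply: normcB_le|].
  - apply: le_trans (fD _ _ _) _; apply: ler_wpM2l => //; rewrite ler_sqr ?nnegrE ?vn_ge0//.
    by apply: le_trans (vnD _ _) _; rewrite vx vy.
  - by have := fD a b x; rewrite vx.
  - by have := fD a b y; rewrite vy.
by rewrite sumr_const card_prod !card_ord -[_ *+ _]mulr_natl.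
Qed.

Lemma Bq_inj Q : sym Q -> Bq Q = 0 -> Q = 0.
Proof.
move=> Qs BQ; have := Bq_close Qs; rewrite BQ sub0r mnN => h; apply: mn_eq0.
have : mn Q - 2^-1 * mn Q <= 0 by rewrite subr_le0.
have -> : mn Q - 2^-1 * mn Q = 2^-1 * mn Q by field.
by rewrite pmulr_rle0// invr_gt0.
Qed.

(** [Bq] completed by the identity on skew matrices, so that on the whole matrix space injectivity
    yields surjectivity. *)
Definition Tq Q := Bq Q + 2^-1 *: (Q - Q^T).

Lemma Tq_linear : linear Tq.
Proof.
move=> c Q Q'; rewrite /Tq linearP /=; move: (Bq Q) (Bq Q') => B1 B2.
by apply/matrixP => a b; rewrite !mxE; ring.
Qed.
HB.instance Definition _ := GRing.isLinear.Build C M M *:%R Tq Tq_linear.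

Lemma Tq_tr Q : (Tq Q)^T = Bq Q - 2^-1 *: (Q - Q^T).
Proof. by rewrite /Tq linearD linearZ /= linearB /= trmxK Bq_sym -scalerN opprB. Qed.

Lemma Tq_sym Q : sym (Tq Q) -> sym Q /\ Tq Q = Bq Q.
Proof.
rewrite /sym Tq_tr /Tq; move: (Bq Q) => B1 h; have Qs : sym Q.
  apply/matrixP => a b; have := congr1 (fun A : M => A a b) h; rewrite !mxE => /eqP; rewrite -subr_eq0.
  rewrite (_ : _ - _ = Q b a - Q a b); last by field.
  by rewrite subr_eq0 => /eqP.
by split=> //; rewrite Qs subrr scaler0 addr0.
Qed.

Lemma Bq_surj P : sym P -> exists Q, sym Q /\ Bq Q = P.
Proof.
move=> Ps; have L0 : lker (linfun Tq) == 0%VS.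
  apply/lker0P => Q Q'; rewrite !lfunE /= => h; apply/eqP; rewrite -subr_eq0; apply/eqP.
  have h0 : Tq (Q - Q') = 0 by rewrite linearB /= h subrr.
  have [s1 s2] : sym (Q - Q') /\ Tq (Q - Q') = Bq (Q - Q') by apply: Tq_sym; rewrite h0 /sym trmx0.
  by apply: Bq_inj => //; rewrite -s2 h0.
pose Q := ((linfun Tq)^-1)%VF P.
have h : Tq Q = P by have := lker0_lfunVK L0 P; rewrite lfunE.
have [s1 s2] : sym Q /\ Tq Q = Bq Q by apply: Tq_sym; rewrite h.
by exists Q; rewrite -s2.
Qed.

End QuadOp.

(** * Deforming the map from [S^2V] and straightening its kernel *)

Section Deform.
Variables (R : realType) (n r : nat).
Local Notation C := R[i].
Local Notation I := 'I_n.+1.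
Local Notation V := 'rV[C]_n.+1.
Local Notation M := 'M[C]_n.+1.
Implicit Types (z : V) (i j k a b : I) (p q : 'I_r) (Q : M).

Definition symd (u : I * I) : M := 2^-1 *: (delta_mx u.1 u.2 + delta_mx u.2 u.1).

Lemma symd_sym u : sym (symd u).
Proof. by rewrite /sym /symd linearZ linearD /= !trmx_delta addrC. Qed.

Lemma normc_delta2 (b : bool) : normc (b%:R : C) <= 1.
Proof. by case: b; rewrite ?normc1 ?normc0. Qed.

Lemma symd_le u a b : normc (symd u a b) <= 1.
Proof.
rewrite !mxE; have -> : (1 : R) = 2^-1 * (1 + 1) by field.
by apply: normcM_le; [rewrite normcV normc_nat|apply: normcD_le; exact: normc_delta2].
Qed.

Lemma sym_sum Q : sym Q -> Q = \sum_u Q u.1 u.2 *: symd u.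
Proof.
move=> Qs; have h : \sum_u Q u.1 u.2 *: delta_mx u.1 u.2 = Q.
  by rewrite [RHS]matrix_sum_delta pair_bigA.
have h' : \sum_u Q u.1 u.2 *: delta_mx u.2 u.1 = Q.
  rewrite -[RHS]Qs -[in RHS]h linear_sum; apply: eq_bigr => u _.
  by rewrite linearZ /= trmx_delta.
rewrite (eq_bigr (fun u => 2^-1 *: (Q u.1 u.2 *: delta_mx u.1 u.2) + 2^-1 *: (Q u.1 u.2 *: delta_mx u.2 u.1))).
  by rewrite big_split -!scaler_sumr h h' /= -scalerDl -[LHS]scale1r; congr (_ *: _); field.
by move=> u _; rewrite /symd scalerA mulrC -scalerA scalerDr scalerDr.
Qed.

Variables (wm : I -> 'I_r -> M) (cfm : I -> {linear M -> 'rV[C]_r}).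
Hypotheses (wsym : forall i p, sym (wm i p)) (wii : forall i p, wm i p i i = 0).
Hypothesis cfE : forall i Q, sym Q -> Q i i = 0 -> Q = \sum_p cfm i Q 0 p *: wm i p.
Hypothesis cfw : forall i p q, cfm i (wm i p) 0 q = (p == q)%:R.
Hypothesis n0 : (0 < n)%N.

Local Notation N2 := ((n.+1 * n.+1)%:R : R).
Local Notation Kw := (Kw wm).
Local Notation W := (32 * n.+1%:R : R).

Section Sections.
Variable x : I * I -> I -> 'I_r -> V -> C.
Variables (Mx e : R).
Hypotheses (e0 : 0 <= e).
Hypothesis xs : forall u i p, sec (om i) 0 Mx (x u i p).
Hypothesis xc : forall u i p z, om i z -> normc (x u i p z - cfm i (redm i z (symd u)) 0 p) <= e.

(** In frame [i], the map from [S^2V] to the deformed bundle determined by the extended sections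
    [x u] of the tensors [symd u]. *)
Definition Xf i z Q : 'rV[C]_r := \row_p \sum_u Q u.1 u.2 * x u i p z.

Lemma Xf_linear i z : linear (Xf i z).
Proof.
move=> c Q Q'; apply/rowP => p; rewrite !mxE mulr_sumr -big_split; apply: eq_bigr => u _.
by rewrite !mxE /= mulrDl mulrA.
Qed.
HB.instance Definition _ i z := GRing.isLinear.Build C M 'rV[C]_r *:%R (Xf i z) (@Xf_linear i z).

Lemma Xf_close i z Q p (s : R) : om i z -> sym Q -> 0 <= s -> (forall a b, normc (Q a b) <= s) ->
  normc (Xf i z Q 0 p - cfm i (redm i z Q) 0 p) <= N2 * (s * e).
Proof.
move=> zi Qs s0 Q1; rewrite [in X in _ - X](sym_sum Qs).
have -> : redm i z (\sum_u Q u.1 u.2 *: symd u) = \sum_u Q u.1 u.2 *: redm i z (symd u).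
  apply/matrixP => a b; rewrite /redm mxE [X in _ + X]mxE [X in _ - X]mxE !summxE !mulr_suml -sumrB.
  by apply: eq_bigr => u _; rewrite !mxE; ring.
rewrite linear_sum summxE mxE -sumrB; apply: le_trans (normc_sum _ _ _) _.
apply: (@le_trans _ _ (\sum_(u : I * I) s * e)).
  apply: ler_sum => u _; rewrite linearZ mxE -mulrBr; apply: normcM_le => //; exact: xc.
by rewrite sumr_const card_prod !card_ord -[_ *+ _]mulr_natl.
Qed.

Definition Mf i z : 'M[C]_r := \matrix_(p, q) Xf i z (wm i p) 0 q.

Hypothesis small1 : (r * r)%:R * (N2 * (Kw * e)) <= 2^-1.

Lemma redm_id i z Q : Q i i = 0 -> redm i z Q = Q.
Proof. by rewrite /redm => ->; rewrite mul0r scale0r subr0. Qed.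

Lemma Mf_unit i z : om i z -> Mf i z \in unitmx /\ mn (invmx (Mf i z)) <= 2 * mn (1%:M : 'M[C]_r).
Proof.
move=> zi; set D := Mf i z - 1%:M.
have h : mn D <= 2^-1.
  apply: le_trans small1; apply: mn_le => p q; rewrite /D !mxE.
  have := Xf_close q zi (wsym i p) (Kw_ge0 wm) (wm_le wm i p).
  by rewrite redm_id // cfw !mxE.
have -> : Mf i z = 1%:M + D by rewrite addrC subrK.
have [u1 u2] := near1_unit h; split=> //.
have -> : invmx (1%:M + D) = (invmx (1%:M + D) - 1%:M) + 1%:M by rewrite subrK.
apply: le_trans (mnD _ _) _; rewrite mulrDl mul1r lerD2r; apply: le_trans u2 _.
have m1 := mn_ge0 (1%:M : 'M[C]_r).
apply: (@le_trans _ _ (2 * mn (1%:M : 'M[C]_r) * 2^-1)); first by apply: ler_wpM2l => //; apply: mulr_ge0.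
by rewrite mulrAC divff ?mul1r// pnatr_eq0.
Qed.

Definition yf i z : 'rV[C]_r := Xf i z (sq z) *m invmx (Mf i z).
(** Generator of the kernel of [Xf i z], normalized to have the same [(i, i)] entry as [z^2]. *)
Definition kk i z : M := sq z - \sum_p yf i z 0 p *: wm i p.

Lemma Xwm i z (y : 'rV[C]_r) : Xf i z (\sum_p y 0 p *: wm i p) = y *m Mf i z.
Proof.
rewrite linear_sum; apply/rowP => q; rewrite summxE mxE; apply: eq_bigr => p _.
by rewrite linearZ mxE [in RHS]mxE.
Qed.

Lemma Xkk i z : om i z -> Xf i z (kk i z) = 0.
Proof.
by move=> zi; rewrite linearB /= Xwm /yf mulmxKV ?subrr//; case: (Mf_unit zi).
Qed.

Lemma kk_sym i z : sym (kk i z).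
Proof. by rewrite /kk /sym linearB /= (sym_comb wsym) sym_sq. Qed.

Lemma kk_ii i z : kk i z i i = z 0 i ^+ 2.
Proof. by rewrite mxE [X in _ + X]mxE (comb_ii wii) subr0 sqE expr2. Qed.

(** Subtracting a multiple of [kk i z] makes the [(i, i)] entry zero; on such matrices the map is
    given by the invertible [Mf i z]. *)
Lemma ker_kk i z Q : om i z -> sym Q -> Xf i z Q = 0 -> Q = (Q i i / z 0 i ^+ 2) *: kk i z.
Proof.
move=> zi Qs XQ; have zi0 : z 0 i != 0 by rewrite -normc_gt0; exact: om_gt0.
set c := _ / _; pose D := Q - c *: kk i z.
have Ds : sym D by rewrite /sym /D linearB linearZ /= Qs kk_sym.
have D0 : D i i = 0 by rewrite /D mxE [X in _ + X]mxE [X in _ - X]mxE kk_ii divfK ?subrr// expf_neq0.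
have := cfE Ds D0; have XD : Xf i z D = 0 by rewrite linearB linearZ /= XQ Xkk// scaler0 subrr.
move: XD => /[swap] DE; rewrite DE Xwm => /(congr1 (mulmx^~ (invmx (Mf i z)))).
rewrite mulmxK; last by case: (Mf_unit zi).
rewrite mul0mx => cf0; have : D = 0 by rewrite DE cf0 big1// => p _; rewrite mxE scale0r.
by move=> /eqP; rewrite subr_eq0 => /eqP.
Qed.

Lemma kkE i z a b : kk i z a b = sq z a b - \sum_p yf i z 0 p * wm i p a b.
Proof.
by rewrite mxE [X in _ + X]mxE summxE; congr (_ - _); apply: eq_bigr => p _; rewrite mxE.
Qed.

Local Opaque sq kk.

Lemma scalemxE (c : C) Q a b : (c *: Q) a b = c * Q a b.
Proof. exact: mxE. Qed.

Definition C3 : R := r%:R * (r%:R * N2 * (2 * mn (1%:M : 'M[C]_r)) * Kw).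

Lemma C3_ge0 : 0 <= C3.
Proof.
have h1 := Kw_ge0 wm; have h2 := mn_ge0 (1%:M : 'M[C]_r).
by apply: mulr_ge0 => //; apply: mulr_ge0 => //; apply: mulr_ge0; apply: mulr_ge0.
Qed.

Lemma sq_le z a b : normc (sq z a b) <= vn z ^+ 2.
Proof. by rewrite sqE expr2; apply: normcM_le; exact: normc_le_vn. Qed.

Lemma kk_close i z a b : om i z -> normc (kk i z a b - sq z a b) <= C3 * e * vn z ^+ 2.
Proof.
move=> zi; have zi0 : z 0 i != 0 by rewrite -normc_gt0; exact: om_gt0.
have -> : kk i z a b - sq z a b = - \sum_p yf i z 0 p * wm i p a b by rewrite kkE addrAC subrr add0r.
rewrite normcN; apply: le_trans (normc_sum _ _ _) _.
have X1 p : normc (Xf i z (sq z) 0 p) <= N2 * (vn z ^+ 2 * e).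
  have h := Xf_close p zi (sym_sq z) (exprn_ge0 2 (vn_ge0 z)) (sq_le z).
  have r0 : redm i z (sq z) = 0.
    apply/matrixP => u v; rewrite mxE [X in _ + X]mxE [X in _ - X]mxE !sqE mxE; field; exact: zi0.
  have c00 : cfm i (0 : M) 0 p = 0 by rewrite linear0 mxE.
  by rewrite r0 c00 subr0 in h.
have [Mu Mi] := Mf_unit zi.
apply: (@le_trans _ _ (\sum_(p < r) (r%:R * (N2 * (vn z ^+ 2 * e) * (2 * mn (1%:M : 'M[C]_r)))) * Kw)).
  apply: ler_sum => p _; apply: normcM_le; last exact: wm_le.
  rewrite mxE; apply: le_trans (normc_sum _ _ _) _.
  apply: (@le_trans _ _ (\sum_(q < r) N2 * (vn z ^+ 2 * e) * (2 * mn (1%:M : 'M[C]_r)))).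
    by apply: ler_sum => q _; apply: normcM_le => //; apply: le_trans Mi; exact: normc_le_mn.
  by rewrite sumr_const card_ord -[_ *+ _]mulr_natl.
by rewrite sumr_const card_ord -[_ *+ _]mulr_natl /C3 le_eqVlt; apply/orP; left; apply/eqP; ring.
Qed.

Lemma XfZz i z (c : C) Q : om i z -> c != 0 -> Xf i (c *: z) Q = Xf i z Q.
Proof.
move=> zi c0; apply/rowP => p; rewrite !mxE; apply: eq_bigr => u _; congr (_ * _).
by case: (xs u i p) => _ h _; rewrite h// expr0 mul1r.
Qed.

Lemma sq_scale z (c : C) : sq (c *: z) = c ^+ 2 *: sq z.
Proof. by apply/matrixP => a b; rewrite [RHS]mxE !sqE !mxE; ring. Qed.

Lemma hd_Xf i z (Qf : V -> M) p : om i z -> (forall a b, hd (fun z => Qf z a b) z) -> hd (fun z => Xf i z (Qf z) 0 p) z.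
Proof.
move=> zi H; rewrite (_ : (fun z => _) = fun z => \sum_u Qf z u.1 u.2 * x u i p z).
  by apply: hd_sum => u; apply: hdM => //; case: (xs u i p) => h _ _; exact: h.
by apply/funext => y; rewrite mxE.
Qed.

Lemma hd_sq z a b : hd (fun z => sq z a b) z.
Proof.
rewrite (_ : (fun z => _) = fun z => z 0 a * z 0 b); last by apply/funext => y; rewrite sqE.
by apply: hdM; exact: hd_coord.
Qed.

Hypothesis small2 : C3 * e <= 1.

Lemma kk_sec i a b : sec (om i) 2 2 (fun z => kk i z a b).
Proof.
split=> [z zi|z c zi c0|z zi].
- rewrite (_ : (fun z => _) = fun z => sq z a b - \sum_p yf i z 0 p * wm i p a b); last first.
    by apply/funext => y; rewrite kkE.
  apply: hdB; first exact: hd_sq.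
  apply: hd_sum => p; apply: hdM; last exact: hd_cst.
  have : mhd (fun z => Xf i z (sq z) *m invmx (Mf i z)) z; last by move=> /(_ 0 p).
  apply: mhdM.
    by move=> u v; rewrite ord1; apply: hd_Xf => // *; exact: hd_sq.
  apply: (mhd_inv (@om_open R n.+1 i)) => //; first by move=> z' zi'; case: (Mf_unit zi').
  move=> u v; rewrite (_ : (fun z => _) = fun z => Xf i z (wm i u) 0 v); last by apply/funext => y; rewrite mxE.
  by apply: hd_Xf => // *; exact: hd_cst.
- have hM : Mf i (c *: z) = Mf i z by apply/matrixP => p q; rewrite !mxE -!/(Xf _ _ _) ; have := XfZz (wm i p) zi c0 => /rowP/(_ q); rewrite !mxE.
  have hy p : yf i (c *: z) 0 p = c ^+ 2 * yf i z 0 p.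
    by rewrite /yf hM XfZz// sq_scale linearZ /= -scalemxAl mxE.
  apply: (etrans (kkE i (c *: z) a b)); rewrite (kkE i z a b) sq_scale scalemxE mulrBr mulr_sumr.
  by congr (_ - _); apply: eq_bigr => p _; rewrite hy mulrA.
- have -> : kk i z a b = (kk i z a b - sq z a b) + sq z a b by rewrite subrK.
  rewrite mulrDl mul1r; apply: normcD_le; last exact: sq_le.
  apply: le_trans (kk_close a b zi) _; rewrite -[leRHS]mul1r; apply: ler_wpM2r => //.
  by apply: exprn_ge0; exact: vn_ge0.
Qed.

Variables (G : I -> I -> V -> 'M[C]_r).
Hypothesis xG : forall i j u p z, om i z -> om j z -> \sum_q x u i q z * G i j z q p = x u j p z.

Lemma XfG i j z Q : om i z -> om j z -> Xf i z Q *m G i j z = Xf j z Q.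
Proof.
move=> zi zj; apply/rowP => p; rewrite !mxE.
rewrite (eq_bigr (fun q => \sum_u Q u.1 u.2 * (x u i q z * G i j z q p))); last first.
  by move=> q _; rewrite mxE mulr_suml; apply: eq_bigr => u _; rewrite mulrA.
by rewrite exchange_big; apply: eq_bigr => u _; rewrite -mulr_sumr xG.
Qed.

Lemma Xf0 i j z Q : om i z -> om j z -> Xf i z Q = 0 -> Xf j z Q = 0.
Proof. by move=> zi zj h; rewrite -(XfG Q zi zj) h mul0mx. Qed.

(** Transition functions of the kernel line bundle relative to those of [O(-2)], hence of degree 0
    and close to 1. *)
Definition vf i j z : C := kk j z i i / z 0 i ^+ 2.

Lemma kk_vf i j z : om i z -> om j z -> kk j z = vf i j z *: kk i z.
Proof. by move=> zi zj; apply: ker_kk => //; [exact: kk_sym|exact: (Xf0 zj zi (Xkk zj))]. Qed.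

Lemma vf_cocycle i j k z : om i z -> om j z -> om k z -> vf i j z * vf j k z = vf i k z.
Proof.
move=> zi zj zk; have zi0 : z 0 i != 0 by rewrite -normc_gt0; exact: om_gt0.
have := kk_vf zi zk; rewrite (kk_vf zj zk) (kk_vf zi zj) scalerA.
move=> /matrixP/(_ i i); rewrite mxE [in RHS]mxE kk_ii => /mulIf h; rewrite mulrC; apply: h.
exact: expf_neq0.
Qed.

Lemma vf_close i j z : om i z -> om j z -> normc (vf i j z - 1) <= C3 * e * W ^+ 2.
Proof.
move=> zi zj; have zi0 : z 0 i != 0 by rewrite -normc_gt0; exact: om_gt0.
have -> : vf i j z - 1 = (kk j z i i - sq z i i) / z 0 i / z 0 i.
  by rewrite /vf sqE; field.
have h0 : 0 <= C3 * e by apply: mulr_ge0 => //; exact: C3_ge0.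
have := kk_close i i zj => h; rewrite expr2 mulrA -[leRHS]mulr1 -(expr0 (vn z)).
apply: om_divr => //; first by apply: mulr_ge0 => //; apply: mulr_ge0.
exact: om_divr.
Qed.

Let K0 := KH R 0.
Let N := C3 * e * W ^+ 2.
Hypothesis small3 : 4 * ((2 * K0 + 1) * N) <= 2^-1.

Let N0 : 0 <= N. Proof. by apply: mulr_ge0; [apply: mulr_ge0 => //; exact: C3_ge0|exact: sqr_ge0]. Qed.
Let K0p : 0 <= K0. Proof. by apply: ltW; exact: KH_gt0. Qed.

Lemma K0N : 4 * (K0 * N) <= 2^-1.
Proof.
apply: le_trans small3; apply: ler_wpM2l => //; apply: ler_wpM2r => //.
by rewrite mulrDl mul1r -addrA lerDl addr_ge0.
Qed.

(** [H^1(O) = 0] for the kernel: [neumann] in rank one, with [cousin] in degree 0 as solver,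
    perturbs the constant cochain 1 into a nowhere vanishing trivialization. *)
Lemma unif : exists a : I -> V -> C, [/\ forall i, sec (om i) 0 2 (a i),
  forall i z, om i z -> a i z != 0,
  forall i z, om i z -> normc (a i z - 1) <= 4 * (K0 * N) &
  forall i j z, om i z -> om j z -> a i z *: kk i z = a j z *: kk j z].
Proof.
have op : (ord0 : I) != ord_max by rewrite -val_eqE /= eq_sym -lt0n.
(* The indices are exchanged because [a i * kk i = a j * kk j] means [a i * vf j i = a j]. *)
pose Gv i j z : 'M[C]_1 := (vf j i z)%:M; pose G1 i j z : 'M[C]_1 := 1%:M.
have GvE i j z (p q : 'I_1) : Gv i j z p q = vf j i z by rewrite !ord1 mxE eqxx mulr1n.
have G1E i j z (p q : 'I_1) : G1 i j z p q = 1 by rewrite !ord1 mxE eqxx.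
have solver (c : I -> I -> 'I_1 -> V -> C) (K eta : R) : 0 <= eta -> eta <= K ->
    (forall i j (p : 'I_1), sec (ov i j) 0 K (c i j p)) ->
    (forall i j k (p : 'I_1) z, om i z -> om j z -> om k z ->
     normc (\sum_q c i j q z * G1 j k z q p + c j k p z - c i k p z) <= eta) ->
    exists b : I -> 'I_1 -> V -> C, (forall i (p : 'I_1), sec (om i) 0 (K0 * K) (b i p)) /\
    forall i j (p : 'I_1) z, om i z -> om j z ->
      normc (b j p z - \sum_q b i q z * G1 i j z q p - c i j p z) <= K0 * eta.
  move=> eta0 etaK cs cc.
  have cc0 i j k z : om i z -> om j z -> om k z -> normc (c i j 0 z + c j k 0 z - c i k 0 z) <= eta * vn z ^+ 0.
    by move=> zi zj zk; have := cc i j k 0 z zi zj zk; rewrite big_ord1 G1E mulr1 expr0 mulr1.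
  have [h [hs hc]] := cousin op (le_trans eta0 etaK) eta0 (fun i j => cs i j 0) cc0.
  exists (fun i _ => h i); split=> [i p|i j p z zi zj]; first exact: hs.
  by rewrite big_ord1 G1E mulr1 (ord1 p); have := hc i j z zi zj; rewrite expr0 mulr1.
have Gs i j (q p : 'I_1) : sec (ov i j) 0 (1 + N) (fun z => Gv i j z q p).
  have -> : (fun z => Gv i j z q p) = (fun z => vf j i z) by apply/funext => z; rewrite GvE.
  have nz0 z : om j z -> z 0 j != 0 by move=> zj; rewrite -normc_gt0; exact: om_gt0.
  split=> [z [zi zj]|z c [zi zj] c0|z [zi zj]].
  - apply: hdM; first by case: (kk_sec i j j) => h _ _; exact: h.
    by apply: hdV; [apply: hdX; exact: hd_coord|apply: expf_neq0; exact: nz0].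
  - have hc : kk i (c *: z) j j = c ^+ 2 * kk i z j j by case: (kk_sec i j j) => _ h _; exact: h.
    have hz : (c *: z) 0 j = c * z 0 j by rewrite mxE.
    have z0 := nz0 _ zj; rewrite expr0 mul1r /vf hz; apply: (etrans (congr1 (fun x => x / _) hc)).
    by field; rewrite c0 z0.
  - rewrite expr0 mulr1; have -> : vf j i z = 1 + (vf j i z - 1) by ring.
    by apply: normcD_le; [rewrite normc1|exact: vf_close].
have GG i j k z : om i z -> om j z -> om k z -> Gv i j z *m Gv j k z = Gv i k z.
  by move=> zi zj zk; rewrite /Gv -scalar_mxM mulrC vf_cocycle.
have Ge i j (q p : 'I_1) z : om i z -> om j z -> normc (Gv i j z q p - G1 i j z q p) <= N.
  by move=> zi zj; rewrite GvE G1E; exact: vf_close.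
have sm : (2 * K0 + 1) * (1%:R * N) <= 2^-1.
  rewrite mul1r; apply: le_trans small3; rewrite -[leLHS]mul1r; apply: ler_wpM2r; last by rewrite ler1n.
  by apply: mulr_ge0 => //; apply: addr_ge0 => //; apply: mulr_ge0.
have x0s : forall (i : I) (p : 'I_1), sec (om i) 0 1 (fun=> 1 : C).
  by move=> i p; have := @sec_cst R n (om i) 1; rewrite normc1.
have B0 : 0 <= 1 + N by rewrite addr_ge0.
have x0d i j (p : 'I_1) z : om i z -> om j z -> normc (delta Gv (fun _ _ _ => 1) i j p z) <= N.
  by move=> zi zj; rewrite /delta big_ord1 mul1r GvE; exact: vf_close.
have [y [ys yc yE]] := neumann K0p B0 N0 solver Gs GG Ge sm x0s N0 x0d.
have y1 i z : om i z -> normc (y i 0 z - 1) <= 2^-1 by move=> zi; apply: le_trans K0N; exact: yc.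
exists (fun i => y i 0); split=> [i|i z zi|i z zi|i j z zi zj].
- have [M' [h1 h2 _]] := ys i 0; split=> // z zi; rewrite expr0 mulr1.
  have -> : y i 0 z = 1 + (y i 0 z - 1) by ring.
  by rewrite -[2]/(1 + 1); apply: normcD_le; [rewrite normc1|apply: le_trans (y1 _ _ zi) _; rewrite invf_le1 ?ler1n].
- apply/eqP => h; have := y1 i z zi; rewrite h sub0r normcN normc1.
  by rewrite leNgt invf_lt1 ?ltr1n.
- exact: yc.
- by have := yE i j 0 z zi zj; rewrite big_ord1 GvE => <-; rewrite -scalerA -(kk_vf zj zi).
Qed.

Definition Df : R := 8 * (K0 * N) + C3 * e.
Hypothesis small4 : N2 * (N2 * (3 * Df)) <= 2^-1.

(** The functions [a i * kk i] glue to quadratic forms close to [z^2], so they equal [B(z^2)] for an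
    invertible [B]. Composing the deformed map with [B] keeps it onto and makes its kernel exactly
    [C z^2]. *)
Theorem deform_maps : exists Y : I -> I * I -> 'I_r -> V -> C,
  [/\ (forall i u p z, om i z -> hd (Y i u p) z) /\
      (forall i u p z (c : C), om i z -> c != 0 -> Y i u p (c *: z) = Y i u p z),
      forall i j u p z, om i z -> om j z -> \sum_q Y i u q z * G i j z q p = Y j u p z,
      forall i z Q, om i z -> sym Q -> (forall p, \sum_u Q u.1 u.2 * Y i u p z = 0) ->
        exists c, Q = c *: sq z,
      forall i z p, om i z -> \sum_u sq z u.1 u.2 * Y i u p z = 0 &
      forall i z (w : 'rV[C]_r), om i z -> exists Q, sym Q /\ forall p, \sum_u Q u.1 u.2 * Y i u p z = w 0 p].
Proof.
have [a [as_ a0 ac aE]] := unif.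
have op : (ord0 : I) != ord_max by rewrite -val_eqE /= eq_sym -lt0n.
have fex (u : I * I) : exists f, [/\ sec (@nz R n.+1) 2 4 f, f 0 = 0 &
    forall i z, om i z -> f z = a i z * kk i z u.1 u.2].
  have qs i : sec (om i) 2 4 (fun z => a i z * kk i z u.1 u.2).
    by have := secM (as_ i) (kk_sec i u.1 u.2); congr sec; ring.
  have qc i j z : om i z -> om j z -> normc (a j z * kk j z u.1 u.2 - a i z * kk i z u.1 u.2) <= 0 * vn z ^+ 2.
    move=> zi zj; have E : a i z * kk i z u.1 u.2 = a j z * kk j z u.1 u.2 :=
      etrans (esym (scalemxE (a i z) (kk i z) u.1 u.2))
        (etrans (congr1 (fun A : M => A u.1 u.2) (aE i j z zi zj)) (scalemxE (a j z) (kk j z) u.1 u.2)).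
    rewrite E.
    by rewrite subrr normc0 mul0r.
  (* The local functions agree exactly, so [glob] is used with error 0. *)
  have [f [f1 f2 f3]] := glob op (ler0n R 4) (lexx 0) qs qc.
  exists f; split=> [||i z zi] //; first by move: f1; rewrite mulr0 addr0.
  have := f3 i z zi; rewrite mulr0 mul0r => h; apply/eqP; rewrite -subr_eq0 -normc_eq0.
  by rewrite eq_le h normc_ge0.
have [f0 fP] := choice fex; pose f a' b' := f0 (a', b').
have fs a' b' : sec (@nz R n.+1) 2 4 (f a' b') by case: (fP (a', b')).
have f00 a' b' : f a' b' 0 = 0 by case: (fP (a', b')).
have fE i z a' b' : om i z -> f a' b' z = a i z * kk i z a' b' by case: (fP (a', b')) => _ _ h /h.
have fC a' b' z : f a' b' z = f b' a' z.
  have [->|/om_cover[i zi]] := eqVneq z 0; first by rewrite !f00.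
  by rewrite !(fE i)// (symE (kk_sym i z) a' b').
have C30 := C3_ge0.
have D0 : 0 <= Df.
  by apply: addr_ge0; apply: mulr_ge0 => //; apply: mulr_ge0.
have fD a' b' z : normc (f a' b' z - sq z a' b') <= Df * vn z ^+ 2.
  have [->|/om_cover[i zi]] := eqVneq z 0.
    by rewrite f00 sqE mxE mul0r subrr normc0 mulr_ge0// sqr_ge0.
  rewrite (fE i)//; have -> : a i z * kk i z a' b' - sq z a' b' =
    (a i z - 1) * kk i z a' b' + (kk i z a' b' - sq z a' b') by ring.
  have -> : Df * vn z ^+ 2 = 4 * (K0 * N) * (2 * vn z ^+ 2) + C3 * e * vn z ^+ 2 by rewrite /Df; ring.
  apply: normcD_le; last exact: kk_close.
  by apply: normcM_le; [exact: ac|case: (kk_sec i a' b') => _ _; exact].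
pose B := Bq f.
have Bsq i z : om i z -> B (sq z) = a i z *: kk i z.
  by move=> zi; rewrite /B (Bq_sq fs f00); apply/matrixP => a' b'; rewrite scalemxE -(fE i)//; exact: mxE.
pose Y i u p z := Xf i z (B (delta_mx u.1 u.2)) 0 p.
have YE i z Q p : \sum_u Q u.1 u.2 * Y i u p z = Xf i z (B Q) 0 p.
  have -> : B Q = \sum_u Q u.1 u.2 *: B (delta_mx u.1 u.2).
    rewrite /B {1}(matrix_sum_delta Q) pair_bigA linear_sum; apply: eq_bigr => u _.
    by rewrite linearZ.
  by rewrite linear_sum summxE; apply: eq_bigr => u _; rewrite linearZ mxE.
exists Y; split.
- split=> [i u p z zi|i u p z c zi c0]; last by rewrite /Y XfZz.
  by apply: hd_Xf => // *; exact: hd_cst.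
- by move=> i j u p z zi zj; rewrite /Y -(XfG _ zi zj) [RHS]mxE.
- move=> i z Q zi Qs H; have X0 : Xf i z (B Q) = 0 by apply/rowP => p; rewrite -YE H mxE.
  have := ker_kk zi (Bq_sym fC Q) X0; set c := _ / _ => BQ.
  exists (c / a i z); apply/eqP; rewrite -subr_eq0; apply/eqP.
  apply: (Bq_inj D0 fD small4); first by rewrite /sym linearB linearZ /= Qs sym_sq.
  have BS : Bq f (sq z) = a i z *: kk i z := Bsq i z zi.
  by rewrite linearB linearZ /= BS BQ scalerA divfK ?subrr// a0.
- by move=> i z p zi; rewrite YE (Bsq i)// linearZ /= Xkk// scaler0 mxE.
- move=> i z w zi; have [Mu _] := Mf_unit zi.
  pose y := w *m invmx (Mf i z).
  have [Q [Qs BQ]] := Bq_surj fC D0 fD small4 (sym_comb wsym (fun p => y 0 p) i).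
  by exists Q; split=> // p; rewrite YE /B BQ Xwm /y mulmxKV.
Qed.

End Sections.

Lemma scaled_le (a b e : R) : 0 <= e -> a <= b -> b * e <= 2^-1 -> a * e <= 2^-1.
Proof. by move=> e0 ab; apply: le_trans; apply: ler_wpM2r. Qed.

(** [neumann] with the solver of [E] extends the sections given by each [symd u]; [deform_maps] does
    the rest. The bound [eps] depends only on the frames of [E]. *)
Theorem deform : exists2 eps : R, 0 < eps & forall (G : I -> I -> V -> 'M[C]_r) (B : R), 0 <= B ->
  (forall i j q p, sec (ov i j) 0 B (fun z => G i j z q p)) ->
  (forall i j k z, om i z -> om j z -> om k z -> G i j z *m G j k z = G i k z) ->
  (forall i j q p z, om i z -> om j z -> normc (G i j z q p - G0 wm cfm i j z q p) <= eps) ->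
  exists Y : I -> I * I -> 'I_r -> V -> C,
  [/\ (forall i u p z, om i z -> hd (Y i u p) z) /\
      (forall i u p z (c : C), om i z -> c != 0 -> Y i u p (c *: z) = Y i u p z),
      forall i j u p z, om i z -> om j z -> \sum_q Y i u q z * G i j z q p = Y j u p z,
      forall i z Q, om i z -> sym Q -> (forall p, \sum_u Q u.1 u.2 * Y i u p z = 0) ->
        exists c, Q = c *: sq z,
      forall i z p, om i z -> \sum_u sq z u.1 u.2 * Y i u p z = 0 &
      forall i z (w : 'rV[C]_r), om i z -> exists Q, sym Q /\ forall p, \sum_u Q u.1 u.2 * Y i u p z = w 0 p].
Proof.
set KS := KSol wm cfm; set Kx := N2 * Kc cfm * (1025 * 1).
have Kw0 := Kw_ge0 wm; have Kc0 := Kc_ge0 cfm; have C30 := C3_ge0.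
have K0p : 0 <= KH R 0 by apply: ltW; exact: KH_gt0.
have KS0 : 0 <= KS.
  rewrite /KS /KSol; have h := KE_ge0 R n.
  apply: mulr_ge0; first by apply: mulr_ge0.
  apply: mulr_ge0; first by apply: addr_ge0; [apply: mulr_ge0|apply: sqr_ge0].
  by apply: mulr_ge0 => //; apply: mulr_ge0 => //; apply: mulr_ge0.
have Kx0 : 0 <= Kx by exact: mulr_ge0 (mulr_ge0 (ler0n _ _) Kc0) (mulr_ge0 (ler0n _ _) ler01).
pose s1 : R := (r * r)%:R * N2 * Kw.
pose s3 : R := 4 * (2 * KH R 0 + 1) * C3 * W ^+ 2.
pose s4 : R := N2 * N2 * 3 * (8 * KH R 0 * C3 * W ^+ 2 + C3).
have s10 : 0 <= s1 by apply: mulr_ge0 => //; apply: mulr_ge0.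
have W0 : 0 <= W ^+ 2 by exact: sqr_ge0.
have s30 : 0 <= s3.
  by apply: mulr_ge0 => //; apply: mulr_ge0 => //; apply: mulr_ge0 => //; apply: addr_ge0 => //; apply: mulr_ge0.
have s40 : 0 <= s4.
  apply: mulr_ge0; first by apply: mulr_ge0 => //; apply: mulr_ge0.
  by apply: addr_ge0 => //; apply: mulr_ge0 => //; apply: mulr_ge0 => //; apply: mulr_ge0.
(* The sections move by at most [A * eps]; [S] collects the conditions linear in that displacement
   and [A2] the one of [neumann]. *)
pose S : R := s1 + C3 + s3 + s4; pose A : R := 4 * (KS * (r%:R * Kx)); pose A2 : R := (2 * KS + 1) * r%:R.
have S0 : 0 <= S by do 3?apply: addr_ge0.
have A0 : 0 <= A by apply: mulr_ge0 => //; apply: mulr_ge0 => //; apply: mulr_ge0.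
have A20 : 0 <= A2 by apply: mulr_ge0 => //; apply: addr_ge0 => //; apply: mulr_ge0.
have SA0 : 0 <= S * A by apply: mulr_ge0.
pose T : R := S * A + A2 + 1.
have T0 : 0 < T by apply: ltr_wpDl => //; apply: addr_ge0.
pose eps : R := (2 * T)^-1.
have ep0 : 0 < eps by rewrite invr_gt0 mulr_gt0.
have Teps : T * eps <= 2^-1 by rewrite /eps invfM mulrCA divff ?mulr1// gt_eqF.
exists eps => // G B B0 Gs GG Ge.
pose e := A * eps; have e0 : 0 <= e by apply: mulr_ge0 => //; exact: ltW.
have Se : S * e <= 2^-1.
  rewrite /e mulrA; apply: scaled_le Teps; first exact: ltW.
  by rewrite /T -addrA lerDl addr_ge0.
have sm : (2 * KS + 1) * (r%:R * eps) <= 2^-1.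
  rewrite mulrA; apply: scaled_le Teps; first exact: ltW.
  by rewrite /T -/A2 addrAC lerDr addr_ge0.
pose x0 u i p z := cfm i (redm i z (symd u)) 0 p.
have x0s u i p : sec (om i) 0 Kx (x0 u i p) by exact: sec_redm ler01 (symd_le u).
have nz0 i z : om i z -> z 0 i != 0 by move=> zi; rewrite -normc_gt0; exact: om_gt0.
have x0d u i j p z : om i z -> om j z -> normc (delta G (x0 u) i j p z) <= r%:R * eps * Kx.
  move=> zi zj; have -> : delta G (x0 u) i j p z = - \sum_q x0 u i q z * (G0 wm cfm i j z q p - G i j z q p).
    have E : x0 u j p z = \sum_q x0 u i q z * G0 wm cfm i j z q p := esym (G0_change cfE p (nz0 _ _ zi) (nz0 _ _ zj) (symd_sym u)).
    rewrite /delta E.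
    by rewrite -sumrB -sumrN; apply: eq_bigr => q _; rewrite mulrBr opprB.
  rewrite normcN; apply: le_trans (normc_sum _ _ _) _.
  apply: (@le_trans _ _ (\sum_(q < r) Kx * eps)).
    apply: ler_sum => q _; apply: normcM_le; last by rewrite normcB; exact: Ge.
    by case: (x0s u i q) => _ _ /(_ z zi); rewrite expr0 mulr1.
  by rewrite sumr_const card_ord -[_ *+ _]mulr_natl [Kx * _]mulrC mulrA.
have N0 : 0 <= r%:R * eps * Kx by apply: mulr_ge0 => //; apply: mulr_ge0 => //; exact: ltW.
have xex u : exists x : I -> 'I_r -> V -> C, [/\ forall i p, exists M', sec (om i) 0 M' (x i p),
    forall i p z, om i z -> normc (x i p z - x0 u i p z) <= e &
    forall i j p z, om i z -> om j z -> \sum_q x i q z * G i j z q p = x j p z].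
  have [x [h1 h2 h3]] := neumann KS0 B0 (ltW ep0) (solverE wsym wii cfE cfw n0) Gs GG Ge sm (x0s u) N0 (x0d u).
  exists x; split=> // i p z zi; have -> : e = 4 * (KS * (r%:R * eps * Kx)) by rewrite /e /A; ring.
  exact: h2.
have [x xP] := choice xex.
have xc u i p z : om i z -> normc (x u i p z - cfm i (redm i z (symd u)) 0 p) <= e.
  by move=> zi; case: (xP u) => _ h _; exact: h.
have xs u i p : sec (om i) 0 (Kx + e) (x u i p).
  case: (xP u) => /(_ i p)[M' [h1 h2 _]] h _; split=> // z zi.
  have -> : x u i p z = x0 u i p z + (x u i p z - x0 u i p z) by ring.
  rewrite expr0 mulr1; apply: normcD_le; last exact: h.
  by case: (x0s u i p) => _ _ /(_ z zi); rewrite expr0 mulr1.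
have xG i j u p z : om i z -> om j z -> \sum_q x u i q z * G i j z q p = x u j p z.
  by move=> zi zj; case: (xP u) => _ _ h; exact: h.
have sm1 : (r * r)%:R * (N2 * (Kw * e)) <= 2^-1.
  have -> : (r * r)%:R * (N2 * (Kw * e)) = s1 * e by rewrite /s1; ring.
  apply: scaled_le Se => //; rewrite /S -!addrA lerDl.
  by do 2?apply: addr_ge0.
have h12 : C3 * e <= 2^-1.
  by apply: scaled_le Se => //; rewrite /S addrAC [s1 + _]addrC -!addrA lerDl; do 2?apply: addr_ge0.
have sm2 : C3 * e <= 1 by apply: le_trans h12 _; rewrite invf_le1 ?ler1n.
have sm3 : 4 * ((2 * KH R 0 + 1) * (C3 * e * W ^+ 2)) <= 2^-1.
  have -> : 4 * ((2 * KH R 0 + 1) * (C3 * e * W ^+ 2)) = s3 * e by rewrite /s3; ring.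
  by apply: scaled_le Se => //; rewrite /S addrAC lerDr; do 2?apply: addr_ge0.
have sm4 : N2 * (N2 * (3 * (8 * (KH R 0 * (C3 * e * W ^+ 2)) + C3 * e))) <= 2^-1.
  have -> : N2 * (N2 * (3 * (8 * (KH R 0 * (C3 * e * W ^+ 2)) + C3 * e))) = s4 * e by rewrite /s4; ring.
  by apply: scaled_le Se => //; rewrite /S lerDr; do 2?apply: addr_ge0.
exact: (deform_maps e0 xs xc sm1 sm2 xG sm3 sm4).
Qed.

End Deform.

(** * Bundle morphisms from fibrewise linear maps *)

Section BundleMaps.
Variables (R : realType) (n : nat).
Local Notation C := R[i].
Local Notation V := 'rV[C]_n.+1.
Implicit Types (z : V) (l : line R n) (A B : vbundle (PV R n)).

Definition FY B k (u : 'I_k -> forall l, fib B l) (b : chart B) z : 'M[C]_(k, rk B) :=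
  \matrix_(p, q) triv b (ln z) (u p (ln z)) 0 q.

Definition lfr B k (u : 'I_k -> forall l, fib B l) z := forall b : chart B, dom b (ln z) -> mhd (FY u b) z.

Lemma FY_row B k (u : 'I_k -> forall l, fib B l) (b : chart B) z p : row p (FY u b z) = triv b (ln z) (u p (ln z)).
Proof. by apply/rowP => q; rewrite !mxE. Qed.

Lemma PV_openI (U W : set (PV R n)) : isopen U -> isopen W -> isopen (U `&` W).
Proof.
move=> h1 h2 z x zx [xa xb]; apply: filterS2 (h1 z x zx xa) (h2 z x zx xb) => z' H1 H2 x' zx'.
by split; [exact: H1|exact: H2].
Qed.

Lemma PV_open_elim (U : set (PV R n)) z0 : isopen U -> z0 != 0 -> U (ln z0) ->
  exists2 d : R, 0 < d & forall z, vn (z - z0) < d -> z != 0 /\ U (ln z).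
Proof.
move=> oU z00 Uz; have h : holo U (fun=> 0) by exact: holo_cst.
have [d d0 H] := holo_elim oU h z00 Uz; exists d => // z zd; by have [h1 h2 _] := H z zd.
Qed.

Lemma PV_opn (U : set (PV R n)) : isopen U -> opn [set z | z != 0 /\ U (ln z)].
Proof. by move=> oU z [z0 Uz]; exact: PV_open_elim. Qed.

Lemma holo_hd (U : set (PV R n)) (f : PV R n -> C) z : isopen U -> holo U f -> z != 0 -> U (ln z) ->
  hd (fun z => f (ln z)) z.
Proof.
move=> oU fU z0 Uz; have [d d0 H] := holo_elim oU fU z0 Uz.
by have [|_ _ h] := H z; rewrite ?subrr ?vn0.
Qed.

Lemma mhd_near k r (M N : V -> 'M[C]_(k, r)) (U : set V) z : opn U -> U z -> (forall y, U y -> M y = N y) ->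
  mhd N z -> mhd M z.
Proof.
move=> oU Uz MN hN p q; apply: (@hd_nearU _ _ _ (fun z => N z p q) _ _ oU Uz) => // y Uy.
by rewrite MN.
Qed.

Lemma hom_lfr A B (f : bundle_hom A B) k (u : 'I_k -> forall l, fib A l) z : z != 0 ->
  lfr u z -> lfr (fun p l => f l (u p l)) z.
Proof.
move=> z0 uz b db; have [a da] := dom_cover A (ln z).
have [g [gh gE]] := hmap_holo f a b.
have oU := PV_openI (dom_open a) (dom_open b).
apply: (@mhd_near _ _ _ (fun z => FY u a z *m g (ln z)) [set z | z != 0 /\ (dom a `&` dom b) (ln z)] z (PV_opn oU)) => //.
  move=> y [_ [da' db']]; apply/row_matrixP => p; by rewrite row_mul !FY_row gE.
apply: mhdM; first exact: uz.
by move=> p q; apply: (holo_hd oU (gh p q)).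
Qed.

Lemma lfr_chart B k (u : 'I_k -> forall l, fib B l) z (a : chart B) : z != 0 -> dom a (ln z) -> mhd (FY u a) z -> lfr u z.
Proof.
move=> z0 da ua b db; have [g [gh gE]] := triv_holo a b.
have oU := PV_openI (dom_open a) (dom_open b).
apply: (@mhd_near _ _ _ (fun z => FY u a z *m g (ln z)) [set z | z != 0 /\ (dom a `&` dom b) (ln z)] z (PV_opn oU)) => //.
  by move=> y [_ [da' db']]; apply/row_matrixP => p; rewrite row_mul !FY_row gE.
by apply: mhdM => // p q; apply: (holo_hd oU (gh p q)).
Qed.

(** Inverse of the trivialization by choice, with value 0 when there is no preimage. *)
Definition trinv B (b : chart B) (l : PV R n) (w : 'rV[C]_(rk B)) : fib B l := xget 0 [set v | triv b l v = w].

Lemma trinvK B (b : chart B) (l : PV R n) w : dom b l -> triv b l (trinv b l w) = w.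
Proof.
move=> db; have [f fK Kf] := triv_bij db.
by apply: (@xgetPex _ 0 [set v | triv b l v = w]); exists (f w); exact: Kf.
Qed.

Definition chfr B (b : chart B) (p : 'I_(rk B)) l : fib B l := trinv b l (delta_mx 0 p).

Lemma chfr_sum B (b : chart B) (l : PV R n) v : dom b l -> v = \sum_p triv b l v 0 p *: chfr b p l.
Proof.
move=> db; apply: (bij_inj (triv_bij db)); rewrite linear_sum [LHS]row_sum_delta.
by apply: eq_bigr => p _; rewrite linearZ trinvK.
Qed.

Lemma chfr_FY B (b : chart B) z : dom b (ln z) -> FY (@chfr B b) b z = 1%:M.
Proof. by move=> db; apply/row_matrixP => p; rewrite FY_row trinvK// row1. Qed.

Lemma chfr_lfr B (b : chart B) z : z != 0 -> dom b (ln z) -> lfr (@chfr B b) z.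
Proof.
move=> z0 db; apply: (lfr_chart z0 db).
apply: (@mhd_near _ _ _ (fun=> 1%:M) [set z | z != 0 /\ dom b (ln z)] z (PV_opn (dom_open b))) => //.
  by move=> y [_ db']; exact: chfr_FY.
by move=> p q; exact: hd_cst.
Qed.

Lemma map_FY A B (f : forall l, {linear fib A l -> fib B l}) (u : 'I_(rk A) -> forall l, fib A l) (a : chart A) (b : chart B) z :
  dom a (ln z) -> FY (fun p l => f l (u p l)) b z = FY u a z *m FY (fun p l => f l (@chfr A a p l)) b z.
Proof.
move=> da; apply/row_matrixP => p; rewrite row_mul !FY_row {1}(chfr_sum (u p (ln z)) da) linear_sum.
rewrite linear_sum mulmx_sum_row; apply: eq_bigr => q _.
by rewrite !linearZ FY_row.
Qed.

(** A family of linear maps is holomorphic as soon as it sends some local holomorphic frame to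
    holomorphic sections: its matrix is that of the images times the inverse of that of the
    frame. *)
Lemma hom_of_frames A B (f : forall l, {linear fib A l -> fib B l}) :
  (forall z0, z0 != 0 -> exists (u : 'I_(rk A) -> forall l, fib A l) (W : set V),
    [/\ opn W, W z0 & forall z, W z -> [/\ z != 0, lfr u z, forall a : chart A, dom a (ln z) -> FY u a z \in unitmx &
        lfr (fun p l => f l (u p l)) z]]) ->
  exists F : bundle_hom A B, forall l v, F l v = f l v.
Proof.
move=> H.
have fh (a : chart A) (b : chart B) : exists g : PV R n -> 'M[C]_(rk A, rk B),
    (forall i j, holo (dom a `&` dom b) (fun x => g x i j)) /\
    (forall x, dom a x -> dom b x -> forall u, triv b x (f x u) = triv a x u *m g x).
  pose g (l : PV R n) : 'M[C]_(rk A, rk B) := \matrix_(p, q) triv b l (f l (@chfr A a p l)) 0 q.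
  exists g; split; last first.
    move=> l da db v; rewrite {1}(chfr_sum v da) linear_sum linear_sum mulmx_sum_row.
    apply: eq_bigr => p _; rewrite !linearZ; congr (_ *: _); by apply/rowP => q; rewrite !mxE.
  move=> i j; apply: holo_intro => z0 z00 [da db].
  have [u [W [oW Wz HW]]] := H z0 z00.
  pose U : set V := [set z | z != 0 /\ (dom a `&` dom b) (ln z)].
  have oU : opn U by apply: PV_opn; apply: PV_openI; exact: dom_open.
  have [d1 d10 H1] := oU z0 (conj z00 (conj da db)); have [d2 d20 H2] := oW z0 Wz.
  have [d [d0 dd1 dd2]] := pos_min d10 d20.
  have near z : vn (z - z0) < d -> U z /\ W z.
    by move=> zd; split; [apply: H1; exact: lt_le_trans zd dd1|apply: H2; exact: lt_le_trans zd dd2].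
  exists d => // z zd; suff : mhd (fun z => g (ln z)) z by apply.
  have oB := opn_ball (z0 := z0) (d := d).
  apply: (@mhd_near _ _ _ (fun z => invmx (FY u a z) *m FY (fun p l => f l (u p l)) b z) _ z oB zd).
    move=> y yd; have [[_ [da' _]] Wy] := near y yd; have [_ _ uu _] := HW y Wy.
    by rewrite (map_FY f u b da') mulKmx ?uu.
  have [[_ [da' db']] Wy] := near z zd; have [_ u1 uu u2] := HW z Wy.
  apply: mhdM; last exact: u2.
  apply: (mhd_inv oB zd); last exact: u1.
  by move=> y yd; have [[_ [da2 _]] Wy2] := near y yd; have [_ _ uu2 _] := HW y Wy2; exact: uu2.
by exists (BundleHom fh).
Qed.

Lemma comp_hom A B D (f : bundle_hom A B) (g : bundle_hom B D) :
  exists h : bundle_hom A D, forall l v, h l v = g l (f l v).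
Proof.
pose h l : {linear fib A l -> fib D l} := g l \o f l.
have [F FE] : exists F : bundle_hom A D, forall l v, F l v = h l v; last by exists F.
apply: hom_of_frames => z0 z00; have [a da] := dom_cover A (ln z0).
exists (@chfr A a), [set z | z != 0 /\ dom a (ln z)]; split=> //; first exact: (PV_opn (dom_open a)).
move=> z [zn da']; have ul := chfr_lfr zn da'; split=> //; last first.
  exact: (hom_lfr g zn (hom_lfr f zn ul)).
move=> b db; have [g1 [_ gE]] := triv_holo a b; have [g2 [_ gE2]] := triv_holo b a.
suff /mulmx1_unit[] : FY (@chfr A a) b z *m g2 (ln z) = 1%:M by [].
by apply/row_matrixP => p; rewrite row_mul FY_row -gE2// trinvK// row1.
Qed.

Lemma iso_trans A B D : bundle_iso A B -> bundle_iso B D -> bundle_iso A D.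
Proof.
move=> [f [g fg]] [f' [g' fg']]; have [h hE] := comp_hom f f'; have [k kE] := comp_hom g' g.
exists h, k => l; have [c1 c2] := fg l; have [c3 c4] := fg' l.
by split=> v; rewrite hE kE ?c3 ?c2 // ?c1 ?c4.
Qed.

End BundleMaps.

(** * From the family to the isomorphisms *)

Section Main.
Variables (R : realType) (n : nat).
Local Notation C := R[i].
Local Notation I := 'I_n.+1.
Local Notation V := 'rV[C]_n.+1.
Local Notation M := 'M[C]_n.+1.
Local Notation pm := (vsproj (Sym2 R n)).
Local Notation S2 := (trivial_bundle n (subvs_of (Sym2 R n))).
Implicit Types (z : V) (i j k a b : I) (Q : M).

Lemma pmK Q : sym Q -> vsval (pm Q) = Q.
Proof. by move=> Qs; rewrite vsprojK// mem_Sym2; apply/eqP. Qed.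

Lemma psi_fibE (l : line R n) u (w : subvs_of (val l)) : vsval (psi_fib l u w) = psi_tensor (vsval w) (vsval u).
Proof. by rewrite /psi_fib lfunE /= /psi_eval /psi_hom lfunE; exact: psi_subE. Qed.

(** As [j] is injective, the kernel of [q] is that of [psi], which is [C z^2] by [psit_ker]. *)
Lemma im_ker (E : vbundle (PV R n)) (q : bundle_hom S2 E) (j : forall l : line R n, fib E l -> 'Hom(subvs_of (val l), subvs_of (S21 R n))) z Q :
  (forall l u, psi_fib l u = j l (q l u)) -> (forall l, injective (j l)) -> z != 0 -> sym Q ->
  q (ln z) (pm Q) = 0 <-> exists c, Q = c *: sq z.
Proof.
move=> fac inj z0 Qs; have [lE _] := spansP (ln_spans z0).
have q00 : q (ln z) 0 = 0 by exact: linear0.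
have p00 : psi_fib (ln z) (0 : subvs_of (Sym2 R n)) = 0 by exact: linear0.
have j0 : j (ln z) 0 = 0 := etrans (congr1 (j (ln z)) (esym q00)) (etrans (esym (fac (ln z) 0)) p00).
split=> [q0|[c QE]]; last first.
  apply: (inj (ln z)); apply: (etrans (esym (fac (ln z) (pm Q)))); rewrite j0; apply/lfunP => w.
  apply: val_inj; apply: (etrans (psi_fibE _ _)); rewrite pmK// zero_lfunE.
  have : vsval w \in <[z]>%VS by rewrite -lE subvsP.
  move=> /vlineP[d ->]; apply/ffunP => k; apply/matrixP => a b.
  by rewrite psi_tensorE QE ffunE !mxE !big_ord1 !mxE; ring.
have zl : z \in val (ln z) by rewrite lE memv_line.
have p0 : psi_fib (ln z) (pm Q) = 0 := etrans (fac (ln z) (pm Q)) (etrans (congr1 (j (ln z)) q0) j0).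
have T0 : psi_tensor z Q = 0.
  by rewrite -[in LHS](pmK Qs) -[in LHS](vsprojK zl) -psi_fibE p0 zero_lfunE.
have /rV0Pn[i zi] := z0; exists (Q i i / z 0 i ^+ 2); apply: (psit_ker zi Qs) => k a b.
have := congr1 (fun f : tensor3 R n => f k a b) T0; rewrite psi_tensorE ffunE mxE => <-.
by rewrite /psit; ring.
Qed.

Variables (m : nat) (T : set 'rV[C]_m) (F : vbundle (PVxT n T)) (o : set_type T).
Local Notation r := (rk F).
Local Notation Fo := (member F o).
Implicit Type t : set_type T.
Variable h : bundle_hom S2 Fo.
Hypothesis hker : forall z Q, z != 0 -> sym Q -> h (ln z) (pm Q) = 0 <-> exists c, Q = c *: sq z.
Hypothesis hsur : forall (l : PV R n) (v : fib Fo l), exists Q, sym Q /\ h l (pm Q) = v.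

Definition hl (l : PV R n) : {linear M -> fib Fo l} := h l \o pm.

Lemma linear_subZ (W : lmodType C) (f : {linear M -> W}) (c : C) (Q Q' : M) : f (Q - c *: Q') = f Q - c *: f Q'.
Proof. by rewrite linearB linearZ. Qed.

(** The induced map on the target of [f], evaluated on chosen symmetric preimages; the choice is
    irrelevant by the inclusion of kernels. *)
Lemma factor1 (A B : lmodType C) (f : {linear M -> A}) (g : {linear M -> B}) :
  (forall v, exists Q, sym Q /\ f Q = v) -> (forall Q, sym Q -> f Q = 0 -> g Q = 0) ->
  exists phi : {linear A -> B}, forall Q, sym Q -> phi (f Q) = g Q.
Proof.
move=> fsur fg; have [c Hc] := choice fsur; pose p v := g (c v).
have pE Q : sym Q -> p (f Q) = g Q.
  move=> Qs; apply/eqP; rewrite -subr_eq0 /p -linearB; apply/eqP; have [cs cE] := Hc (f Q).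
  by apply: fg; [rewrite /sym linearB /= cs Qs|rewrite linearB /= cE subrr].
have pl : linear p.
  move=> a v w; have [vs vE] := Hc v; have [ws wE] := Hc w.
  have {1}-> : a *: v + w = f (a *: c v + c w) by rewrite linearP vE wE.
  by rewrite pE ?linearP// /sym linearP /= vs ws.
pose pL := GRing.isLinear.Build _ _ _ _ p pl.
by exists (HB.pack p pL : {linear A -> B}).
Qed.

Lemma factor (A B : lmodType C) (f : {linear M -> A}) (g : {linear M -> B}) :
  (forall v, exists Q, sym Q /\ f Q = v) -> (forall v, exists Q, sym Q /\ g Q = v) ->
  (forall Q, sym Q -> f Q = 0 <-> g Q = 0) ->
  exists (phi : {linear A -> B}) (phi' : {linear B -> A}),
    [/\ cancel phi phi', cancel phi' phi & forall Q, sym Q -> phi (f Q) = g Q].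
Proof.
move=> fs gs fg; have [phi pE] := factor1 fs (fun Q Qs => (fg Q Qs).1).
have [phi' pE'] := factor1 gs (fun Q Qs => (fg Q Qs).2); exists phi, phi'; split=> // v.
  by have [Q [Qs <-]] := fs v; rewrite pE// pE'.
by have [Q [Qs <-]] := gs v; rewrite pE'// pE.
Qed.

Lemma ek_i i : ek R i 0 i = 1. Proof. by rewrite mxE !eqxx. Qed.

Lemma basis i : exists (w : 'I_r -> M) (L : {linear M -> 'rV[C]_r}), [/\ forall p, sym (w p),
  forall p, w p i i = 0, forall Q, sym Q -> Q i i = 0 -> Q = \sum_p L Q 0 p *: w p &
  forall p q, L (w p) 0 q = (p == q)%:R].
Proof.
pose z0 : V := ek R i; have z0i : z0 0 i != 0 by rewrite ek_i oner_eq0.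
have z00 : z0 != 0 := nzi z0i.
have [a da] := dom_cover Fo (ln z0); have [f fK Kf] := triv_bij da.
pose L : {linear M -> 'rV[C]_r} := triv a (ln z0) \o hl (ln z0).
have Lsur v : exists Q, sym Q /\ L Q = v.
  have [Q [Qs hQ]] := hsur (f v); exists Q; split=> //.
  by rewrite /L /= hQ Kf.
have Lker Q : sym Q -> L Q = 0 -> exists c, Q = c *: sq z0.
  move=> Qs LQ; apply/(hker z00 Qs); apply: (bij_inj (triv_bij da)); rewrite [RHS]linear0.
  exact: LQ.
have Lsq : L (sq z0) = 0.
  rewrite /L /=; have -> : h (ln z0) (pm (sq z0)) = 0 by apply/(hker z00 (sym_sq z0)); exists 1; rewrite scale1r.
  exact: linear0.
have [w0 Hw0] := choice (fun p => Lsur (delta_mx 0 p)).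
pose w p : M := w0 p - w0 p i i *: sq z0.
have sq1 : sq z0 i i = 1 by rewrite sqE ek_i mulr1.
have ws p : sym (w p) by rewrite /sym /w linearB linearZ /= sym_sq; case: (Hw0 p) => -> _.
have wi p : w p i i = 0 by rewrite /w mxE [X in _ + X]mxE [X in _ - X]mxE sq1 mulr1 subrr.
have Lw p : L (w p) = delta_mx 0 p.
  by rewrite /w linear_subZ Lsq scaler0 subr0; case: (Hw0 p).
exists w, L; split=> // [Q Qs Qi|p q]; last by rewrite Lw mxE eqxx eq_sym.
pose D := Q - \sum_p L Q 0 p *: w p.
have Ds : sym D.
  by rewrite /sym /D linearB linear_sum /= Qs; congr (_ - _); apply: eq_bigr => p _; rewrite linearZ /= ws.
have LD : L D = 0.
  rewrite /D linearB linear_sum; apply/eqP; rewrite subr_eq0; apply/eqP.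
  by rewrite [LHS]row_sum_delta; apply: eq_bigr => p _; rewrite linearZ Lw.
have [c DE] := Lker D Ds LD; have : D i i = 0.
  rewrite /D mxE [X in _ + X]mxE Qi summxE big1 ?subr0// => p _; by rewrite mxE wi mulr0.
rewrite DE mxE sq1 mulr1 => c0; move: DE; rewrite c0 scale0r /D => /eqP; rewrite subr_eq0 => /eqP.
exact.
Qed.

Section Family.
Variables (wm : I -> 'I_r -> M) (cfm : I -> {linear M -> 'rV[C]_r}).
Hypotheses (wsym : forall i p, sym (wm i p)) (wii : forall i p, wm i p i i = 0).
Hypothesis cfE : forall i Q, sym Q -> Q i i = 0 -> Q = \sum_p cfm i Q 0 p *: wm i p.
Hypothesis cfw : forall i p q, cfm i (wm i p) 0 q = (p == q)%:R.

(** The frame of the central member over [z_i != 0] given by the images of the constant tensors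
    [wm i p]. *)
Definition fr i : rframe F o := fun p l => hl l (wm i p).

Lemma fr_lfr i z : z != 0 -> lfr (B := Fo) (fr i) z.
Proof.
move=> z0; pose u (p : 'I_r) (l : line R n) : fib S2 l := pm (wm i p).
have ul : lfr u z.
  move=> b _ p q; rewrite (_ : (fun z => _) = fun=> passmx.rVof (vbasis {:subvs_of (Sym2 R n)}) (pm (wm i p)) 0 q).
    exact: hd_cst.
  by apply/funext => y; rewrite mxE.
exact: (hom_lfr h z0 ul).
Qed.

Lemma hl0 z Q : z != 0 -> sym Q -> hl (ln z) Q = 0 -> exists c, Q = c *: sq z.
Proof. by move=> z0 Qs H; apply/(hker z0 Qs). Qed.

Lemma hl_sq z : z != 0 -> hl (ln z) (sq z) = 0.
Proof. by move=> z0; apply/(hker z0 (sym_sq z)); exists 1; rewrite scale1r. Qed.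

Lemma hl_redm z i Q : z != 0 -> hl (ln z) (redm i z Q) = hl (ln z) Q.
Proof. by move=> z0; rewrite /redm linear_subZ (hl_sq z0) scaler0 subr0. Qed.

Lemma fr_unit i z (a : chart F) : z 0 i != 0 -> dom a (ln z, o) -> RY a (fr i) z \in unitmx.
Proof.
move=> zi da; have z0 := nzi zi; rewrite -row_free_unit; apply: inj_row_free => v vA.
pose Q := \sum_p v 0 p *: wm i p.
have LQ : triv a (ln z, o) (hl (ln z) Q) = 0.
  rewrite -vA mulmx_sum_row /Q !linear_sum; apply: eq_bigr => p _; rewrite !linearZ; congr (_ *: _).
  by apply/rowP => q; rewrite !mxE.
have hQ : hl (ln z) Q = 0 by apply: (bij_inj (triv_bij da)); rewrite [RHS]linear0.
have [c QE] := hl0 z0 (sym_comb wsym (fun p => v 0 p) i) hQ.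
have := comb_ii wii (fun p => v 0 p) i; rewrite QE mxE sqE => /eqP; rewrite !mulf_eq0 !(negPf zi) !orbF => /eqP c0.
by apply/rowP => q; have := cfm_comb cfw (fun p => v 0 p) i q; rewrite QE c0 scale0r linear0 !mxE => <-.
Qed.

Lemma fr_isframe i : isframe i (fr i).
Proof.
move=> z0 zi a da; split; first exact: fr_unit.
have [d d0 H] := PV_open_elim (dom_open (v := Fo) a) (nzi zi) da.
by exists d => // z zd; have [zn dz] := H z zd; exact: (fr_lfr i zn dz).
Qed.

(** [h] kills [z^2], so [wm i p] may be replaced by its reduction for the index [j]. *)
Lemma RG_fr i j z : z 0 i != 0 -> z 0 j != 0 -> RG (fr i) (fr j) z = G0 wm cfm i j z.
Proof.
move=> zi zj; have z0 := nzi zi; set a := chx F (ln z, o); have da : dom a (ln z, o) := chx_dom _ _.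
have E : RY a (fr i) z = G0 wm cfm i j z *m RY a (fr j) z.
  apply/row_matrixP => p; rewrite row_mul mulmx_sum_row.
  have -> : row p (RY a (fr i) z) = triv a (ln z, o) (hl (ln z) (redm j z (wm i p))).
    by rewrite (hl_redm j _ z0); apply/rowP => q; rewrite !mxE.
  rewrite {1}(redm_cfm cfE zj (wsym i p)) !linear_sum; apply: eq_bigr => q _.
  rewrite !linearZ !mxE; congr (_ *: _); by apply/rowP => s; rewrite !mxE.
by rewrite /RG -/a E mulmxK// fr_unit.
Qed.

Hypothesis n0 : (0 < n)%N.

Lemma om_inbox i z : om i z -> inbox i (fun=> - 33) (fun=> 33) z.
Proof.
move=> zi; have zi0 : z 0 i != 0 by rewrite -normc_gt0; exact: om_gt0.
split=> // d; have hb : normc (z 0 d.1 / z 0 i) <= 33.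
  rewrite normcM normcV ler_pdivrMr ?normc_gt0//; apply: le_trans (ltW (zi d.1)) _.
  by apply: ler_wpM2r; [exact: normc_ge0|rewrite ler_nat].
have := part_lip d.2 (z 0 d.1 / z 0 i) 0; rewrite subr0 => /le_trans/(_ hb).
have -> : part d.2 (0 : C) = 0 by rewrite /part; case: d.2.
by rewrite subr0 ler_norml.
Qed.

Lemma G0Z i j (c : C) z : c != 0 -> G0 wm cfm i j (c *: z) = G0 wm cfm i j z.
Proof. by move=> c0; apply: eq_mx => p q; congr (cfm j _ 0 q); exact: redmZ. Qed.

Lemma G0_mhd i j z : z 0 j != 0 -> mhd (G0 wm cfm i j) z.
Proof.
move=> zj p q; rewrite (_ : (fun z => _) = fun z => cfm j (redm j z (wm i p)) 0 q); last first.
  by apply/funext => y; rewrite mxE.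
by apply: hd_cfm => a b; exact: redm_hd.
Qed.

Lemma mhd_cont (p q : nat) (A : V -> 'M[C]_(p, q)) z0 : mhd A z0 -> forall e : R, 0 < e -> exists2 d : R, 0 < d &
  forall z, vn (z - z0) < d -> mn (A z - A z0) < e.
Proof.
move=> Ah e e0; have e5 : 0 < e / ((p * q)%:R + 1) by rewrite divr_gt0// ltr_wpDl.
have H (x : 'I_p * 'I_q) : exists d, 0 < d /\ forall z, vn (z - z0) < d ->
    normc (A z x.1 x.2 - A z0 x.1 x.2) < e / ((p * q)%:R + 1).
  have [d d0 Hd] := hd_cont (Ah x.1 x.2) e5; exists d; split=> // z zd.
  by have := Hd _ zd; rewrite [z0 + _]addrC subrK.
have [f Hf] := choice H; have [d d0 Hd] := fin_min (fun x => (Hf x).1).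
exists d => // z zd; apply: mn_lt => // a b; rewrite [X in normc X]mxE [X in _ + X]mxE.
by apply: ((Hf (a, b)).2 z); exact: lt_le_trans zd (Hd _).
Qed.

Section Chosen.
Variable s : I -> frame F.
Hypothesis sg : forall i z, inbox i (fun=> - 33) (fun=> 33) z -> good (fr i) (s i) z.

(** [trans_good] made uniform over the overlap by [compact_uniform] on the closed box of chart [i].
    Membership in [om j] is put into the property, because the overlap is not itself a box. *)
Lemma close_near i j (eps : R) : 0 < eps -> exists2 d : R, 0 < d & forall z t, om i z -> om j z -> nearo o d t ->
  goodQ (fr i) (fr j) (s i) (s j) (G0 wm cfm i j) eps z t.
Proof.
move=> e0; pose Qp z t := om j z -> goodQ (fr i) (fr j) (s i) (s j) (G0 wm cfm i j) eps z t.
have lh (d : I * bool) : (fun=> - 33) d <= (fun=> 33) d :> R by lra.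
have [||z0 [zi zb]|d d0 H] := @compact_uniform R _ i _ (nearo o) Qp (fun=> - 33) (fun=> 33) lh.
- by move=> d d' t; exact: nearo_le.
- move=> z c t c0 Hq czj.
  have zj : om j z by have := omZ (invr_neq0 c0) czj; rewrite scalerA mulVf// scale1r.
  exact: (goodQ_scale (fun c' z' => @G0Z i j c' z') c0 (Hq zj)).
- have z00 := nzi zi.
  (* If some coordinate of [z0] exceeds 33 times the [j]-th one, no nearby point lies in [om j].
     Otherwise [z0] is in the closed box of chart [j], where the second frame is good. *)
  have [[l hl']|no] := pselect (exists l, 33 * normc (z0 0 j) < 1 * normc (z0 0 l)).
    have [d d0 Hd] := @opn_lt R n.+1 33 1 l j (ler0n _ _) ler01 z0 hl'.
    exists d => // z t zd _ zj; have := Hd z zd; rewrite /= mul1r => h1; have := lt_trans h1 (zj l).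
    by rewrite ltr_pM2r ?(om_gt0 zj)// ltr_nat.
  have le33 l : normc (z0 0 l) <= 33 * normc (z0 0 j).
    by rewrite leNgt; apply/negP => hlt; apply: no; exists l; rewrite mul1r.
  have zj : z0 0 j != 0.
    rewrite -normc_gt0; have := le33 i; have := normc_gt0 (z0 0 i); rewrite zi => /[swap] hh.
    by move=> /lt_le_trans/(_ hh); rewrite pmulr_rgt0.
  have zjb : inbox j (fun=> - 33) (fun=> 33) z0.
    split=> // d; have h33 : normc (z0 0 d.1 / z0 0 j) <= 33.
      by rewrite normcM normcV ler_pdivrMr ?normc_gt0.
    have := part_lip d.2 (z0 0 d.1 / z0 0 j) 0; rewrite subr0 => /le_trans/(_ h33).
    have -> : part d.2 (0 : C) = 0 by rewrite /part; case: d.2.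
    by rewrite subr0 ler_norml.
  have e2 : 0 < eps / 2 by rewrite divr_gt0.
  have [d1 d10 H1] := trans_good zj (@fr_isframe j) (sg (conj zi zb)) (sg zjb) e2.
  have [d2 d20 H2] := mhd_cont (G0_mhd i zj) e2.
  have [d [d0 dd1 dd2]] := pos_min d10 d20; exists d => // z t zd td _.
  have [h1 h2 h3 h4] := H1 z t (lt_le_trans zd dd1) (lt_le_trans td dd1); split=> //.
  have -> : Gm (s i) (s j) z t - G0 wm cfm i j z = (Gm (s i) (s j) z t - RG (fr i) (fr j) z0) -
      (G0 wm cfm i j z - G0 wm cfm i j z0).
    by rewrite (RG_fr zi zj) opprB addrA subrK.
  apply: le_trans (mnD _ _) _; rewrite mnN [eps]splitr; apply: lerD; apply: ltW => //.
  by apply: H2; exact: lt_le_trans zd dd2.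
by exists d => // z t zi zj td; apply: H => //; exact: om_inbox.
Qed.

Lemma hol_near i : exists2 d : R, 0 < d & forall z t, om i z -> nearo o d t ->
  exists2 a : chart F, dom a (ln z, t) & mhd (fun z => Y a (s i) z t) z.
Proof.
pose Qp z t := z != 0 /\ exists2 a : chart F, dom a (ln z, t) & mhd (fun z => Y a (s i) z t) z.
have lh (d : I * bool) : (fun=> - 33) d <= (fun=> 33) d :> R by lra.
have [||z0 zb|d d0 H] := @compact_uniform R _ i _ (nearo o) Qp (fun=> - 33) (fun=> 33) lh.
- by move=> d d' t; exact: nearo_le.
- move=> z c t c0 [z0 [a da ah]]; split; first by rewrite scaler_eq0 negb_or c0.
  exists a; first by rewrite ln_scale.
  by move=> p q; apply: hd_scale => // w w0; rewrite Y_scale// invr_eq0.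
- have [zi _] := zb; have [a [da ga]] := sg zb; have [d1 d10 H1] := ga 1 ltr01.
  have [d2 d20 H2] := nz_near (nzi zi); have [d [d0 dd1 dd2]] := pos_min d10 d20.
  exists d => // z t zd td; split; first by apply: H2; exact: lt_le_trans zd dd2.
  by have [h1 h2 _] := H1 z t (lt_le_trans zd dd1) (lt_le_trans td dd1); exists a.
by exists d => // z t zi td; have [] := H z t (om_inbox zi) td.
Qed.

Lemma unit_any (s' : frame F) z t (a b : chart F) : dom a (ln z, t) -> dom b (ln z, t) ->
  Y a s' z t \in unitmx -> Y b s' z t \in unitmx.
Proof.
move=> da db u; have [g [_ gE]] := triv_holo a b.
by rewrite (Y_chart gE)// unitmx_mul u (chart_unit gE da db).
Qed.

Section Fibre.
Variables (t : set_type T) (eps : R).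
Hypothesis gq : forall i j z, om i z -> om j z -> goodQ (fr i) (fr j) (s i) (s j) (G0 wm cfm i j) eps z t.
Hypothesis gh : forall i z, om i z -> exists2 a : chart F, dom a (ln z, t) & mhd (fun z => Y a (s i) z t) z.
Local Notation Ft := (member F t).
Local Notation G i j z := (Gm (s i) (s j) z t).

Lemma gunit i z (a : chart F) : om i z -> dom a (ln z, t) -> Y a (s i) z t \in unitmx.
Proof. by move=> zi da; have [_ [b db ub] _ _] := gq zi zi; exact: unit_any ub. Qed.

Lemma G_cocycle i j k z : om i z -> om j z -> om k z -> G i j z *m G j k z = G i k z.
Proof.
move=> zi zj zk; have [a da] := dom_cover F (ln z, t).
rewrite !(@Gm_chart R n m T F a)//; try exact: gunit.
by rewrite mulmxA mulmxKV//; exact: gunit.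
Qed.

Lemma G_sec : 0 <= eps -> exists2 B : R, 0 <= B & forall i j q p, sec (ov i j) 0 B (fun z => G i j z q p).
Proof.
move=> e0; exists ((n.+1 * n.+1)%:R * Kc cfm * (1025 * Kw wm) + eps).
  exact: addr_ge0 (mulr_ge0 (mulr_ge0 (ler0n _ _) (Kc_ge0 cfm)) (mulr_ge0 (ler0n _ _) (Kw_ge0 wm))) e0.
move=> i j q p; split=> [z [zi zj]|z c [zi zj] c0|z [zi zj]].
- by have [_ _ H _] := gq zi zj; exact: H.
- by rewrite expr0 mul1r Gm_scale.
- have -> : G i j z q p = G0 wm cfm i j z q p + (G i j z - G0 wm cfm i j z) q p.
    by rewrite [X in _ + X]mxE [X in _ + (_ + X)]mxE addrC subrK.
  rewrite expr0 mulr1; apply: normcD_le.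
    by have [_ _ /(_ z zj)] := G0_sec wm cfm i j q p; rewrite expr0 mulr1.
  by have [_ _ _ H] := gq zi zj; apply: le_trans H; exact: normc_le_mn.
Qed.

Variable Yd : I -> I * I -> 'I_r -> V -> C.
Hypothesis Yh : forall i u p z, om i z -> hd (Yd i u p) z.
Hypothesis YZ : forall i u p z (c : C), om i z -> c != 0 -> Yd i u p (c *: z) = Yd i u p z.
Hypothesis YG : forall i j u p z, om i z -> om j z -> \sum_q Yd i u q z * G i j z q p = Yd j u p z.
Hypothesis Yker : forall i z Q, om i z -> sym Q -> (forall p, \sum_u Q u.1 u.2 * Yd i u p z = 0) -> exists c, Q = c *: sq z.
Hypothesis Ysq : forall i z p, om i z -> \sum_u sq z u.1 u.2 * Yd i u p z = 0.
Hypothesis Ysur : forall i z (w : 'rV[C]_r), om i z -> exists Q, sym Q /\ forall p, \sum_u Q u.1 u.2 * Yd i u p z = w 0 p.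

Lemma gen_om (l : PV R n) : exists i, om i (gen l).
Proof. by apply: om_cover; have /andP[] := spans_gen l. Qed.
Definition gi l : I := sval (cid (gen_om l)).
Lemma gi_om l : om (gi l) (gen l). Proof. exact: svalP (cid (gen_om l)). Qed.

Definition XQ i z Q p := \sum_u Q u.1 u.2 * Yd i u p z.

Lemma XQ_lin i z (c : C) Q Q' p : XQ i z (c *: Q + Q') p = c * XQ i z Q p + XQ i z Q' p.
Proof.
rewrite /XQ mulr_sumr -big_split; apply: eq_bigr => u _.
by rewrite !mxE /= mulrDl mulrA.
Qed.

Lemma XQG i j z Q p : om i z -> om j z -> \sum_q XQ i z Q q * G i j z q p = XQ j z Q p.
Proof.
move=> zi zj; rewrite (eq_bigr (fun q => \sum_u Q u.1 u.2 * (Yd i u q z * G i j z q p))).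
  by rewrite exchange_big; apply: eq_bigr => u _; rewrite -mulr_sumr YG.
by move=> q _; rewrite mulr_suml; apply: eq_bigr => u _; rewrite mulrA.
Qed.

(** The deformed map from [S^2V] to the member at [t], written in one chosen cone containing the
    generator of the line. *)
Definition Psi (l : PV R n) Q : fib Ft l := \sum_p XQ (gi l) (gen l) Q p *: s (gi l) p (l, t).

Lemma Psi_linear l : linear (Psi l).
Proof.
move=> c Q Q'; rewrite /Psi scaler_sumr -big_split; apply: eq_bigr => p _.
by rewrite XQ_lin scalerDl scalerA.
Qed.
HB.instance Definition _ l := GRing.isLinear.Build C M (fib Ft l) *:%R (Psi l) (@Psi_linear l).

(** Independence of the chosen cone and generator, from [YG] and the homogeneity [YZ]. *)
Lemma PsiE i z Q : om i z -> Psi (ln z) Q = \sum_p XQ i z Q p *: s i p (ln z, t).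
Proof.
move=> zi; have z0 := om_nz zi; have [_ [c c0 gE]] := spansP (ln_spans z0).
have := gi_om (ln z); rewrite /Psi gE; move: (gi _) => j zj.
have zj' : om j z by have := omZ (invr_neq0 c0) zj; rewrite scalerA mulVf// scale1r.
have [_ [a da ua] _ _] := gq zj' zi.
rewrite (eq_bigr (fun p => \sum_q (XQ j z Q p * G j i z p q) *: s i q (ln z, t))).
  by rewrite exchange_big; apply: eq_bigr => q _; rewrite -scaler_suml XQG.
move=> p _; rewrite (Gm_expand (s j) p da ua) scaler_sumr; apply: eq_bigr => q _.
rewrite scalerA; congr (_ * _ *: _); apply: eq_bigr => u _; by rewrite YZ.
Qed.

Lemma comb_inj i z (x : 'rV[C]_r) : om i z -> \sum_p x 0 p *: s i p (ln z, t) = 0 -> x = 0.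
Proof.
move=> zi xs; have [a da] := dom_cover F (ln z, t); have u := gunit zi da.
have := congr1 (triv a (ln z, t)) xs; rewrite linear_sum linear0 => x0.
have xY : x *m Y a (s i) z t = 0.
  apply: etrans _ x0; rewrite mulmx_sum_row; apply: eq_bigr => p _; rewrite linearZ; congr (_ *: _).
  by apply/rowP => q; rewrite !mxE.
by rewrite -(mulmxK u x) xY mul0mx.
Qed.

Lemma Psi_ker z Q : z != 0 -> sym Q -> Psi (ln z) Q = 0 <-> exists c, Q = c *: sq z.
Proof.
move=> z0 Qs; have [i zi] := om_cover z0; rewrite (PsiE _ zi); split=> [H|[c ->]].
  apply: (Yker zi Qs) => p; have /rowP/(_ p) : \row_p XQ i z Q p = 0; last by rewrite !mxE.
  by apply: (comb_inj zi); rewrite -[RHS]H; apply: eq_bigr => q _; rewrite mxE.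
apply: big1 => p _; have -> : XQ i z (c *: sq z) p = 0; last by rewrite scale0r.
by have := XQ_lin i z c (sq z) 0 p; rewrite addr0 => ->; rewrite {1}/XQ Ysq// mulr0 add0r /XQ big1// => u _; rewrite mxE mul0r.
Qed.

Lemma Psi_sur z (v : fib Ft (ln z)) : z != 0 -> exists Q, sym Q /\ Psi (ln z) Q = v.
Proof.
move=> z0; have [i zi] := om_cover z0; have [a da] := dom_cover F (ln z, t); have u := gunit zi da.
pose x := triv a (ln z, t) v *m invmx (Y a (s i) z t).
have [Q [Qs QE]] := Ysur x zi; exists Q; split=> //; rewrite (PsiE _ zi).
apply: (bij_inj (triv_bij da)); rewrite linear_sum -[RHS](mulmxKV u) -/x mulmx_sum_row.
apply: eq_bigr => p _; rewrite linearZ; congr (_ *: _); first exact: QE.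
by apply/rowP => q; rewrite !mxE.
Qed.

(** The central map [hl] and the deformed map [Psi] are onto with the same kernel [C z^2], so
    [factor] gives fibrewise isomorphisms. They are holomorphic in both directions by
    [hom_of_frames]. *)
Lemma fibre_iso : bundle_iso Ft Fo.
Proof.
have ex (l : PV R n) : exists (phi : {linear fib Fo l -> fib Ft l}) (phi' : {linear fib Ft l -> fib Fo l}),
    [/\ cancel phi phi', cancel phi' phi & forall Q, sym Q -> phi (hl l Q) = Psi l Q].
  have gl0 : gen l != 0 by have /andP[] := spans_gen l.
  have lE := spans_ln (spans_gen l); move: gl0 lE; move: (gen l) => z z0 ->.
  apply: (factor (f := hl (ln z)) (g := Psi (ln z))).
  - exact: hsur.
  - by move=> v; exact: Psi_sur.
  - by move=> Q Qs; split=> H; [apply/(Psi_ker z0 Qs)/(hker z0 Qs)|apply/(hker z0 Qs)/(Psi_ker z0 Qs)].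
pose phi l := sval (cid (ex l)); pose phi' l := sval (cid (svalP (cid (ex l)))).
have phiP l : [/\ cancel (phi l) (phi' l), cancel (phi' l) (phi l) & forall Q, sym Q -> phi l (hl l Q) = Psi l Q].
  exact: svalP (cid (svalP (cid (ex l)))).
(* The image of [fr i] is [Psi] of constant tensors, a combination of the frame [s i] with
   holomorphic coefficients. *)
have ph i z : om i z -> lfr (B := Ft) (fun p l => phi l (fr i p l)) z.
  move=> zi; have z0 := om_nz zi; have [a da ah] := gh zi; apply: (@lfr_chart R n Ft r (fun p l => phi l (fr i p l)) z a z0 da).
  pose U := om i `&` [set z | z != 0 /\ dom (v := Ft) a (ln z)].
  have oU : opn U by apply: opnI; [exact: om_open|exact: (PV_opn (dom_open (v := Ft) a))].
  apply: (@mhd_near _ _ _ _ _ (fun z => (\matrix_(p, q) XQ i z (wm i p) q) *m Y a (s i) z t) U z oU) => //.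
    move=> y [yi [y0 dy]]; apply/row_matrixP => p; apply: (etrans (FY_row (B := Ft) (fun p l => phi l (fr i p l)) a y p)).
    have [_ _ ->] := phiP (ln y); last exact: wsym.
    rewrite row_mul.
    rewrite (PsiE _ yi) linear_sum mulmx_sum_row; apply: eq_bigr => q _.
    rewrite linearZ !mxE; congr (_ *: _); by apply/rowP => k; rewrite !mxE.
  apply: mhdM => // p q; rewrite (_ : (fun z => _) = fun z => XQ i z (wm i p) q); last first.
    by apply/funext => y; rewrite mxE.
  by apply: hd_sum => u; apply: hdM; [exact: hd_cst|exact: Yh].
have nz0 i z : om i z -> z 0 i != 0 by move=> zi; rewrite -normc_gt0; exact: om_gt0.
have [f fE] : exists f : bundle_hom Fo Ft, forall l v, f l v = phi l v.
  apply: hom_of_frames => z0 /om_cover[i zi]; exists (fr i), (om i); split=> //; first exact: om_open.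
  move=> z zi'; split; [exact: om_nz zi'|exact: (fr_lfr i (om_nz zi'))| |exact: ph].
  by move=> a da; exact: (fr_unit (nz0 _ _ zi') da).
have [g gE] : exists g : bundle_hom Ft Fo, forall l v, g l v = phi' l v.
  apply: hom_of_frames => z0 /om_cover[i zi]; exists (fun p l => phi l (fr i p l)), (om i).
  split=> //; first exact: om_open.
  have pp : (fun (p : 'I_r) (l : line R n) => phi' l (phi l (fr i p l))) = fr i.
    by apply/funext => p; apply: functional_extensionality_dep => l; case: (phiP l) => ->.
  move=> z zi'; split; [exact: om_nz zi'|exact: ph| |exact: (eq_ind_r (fun u => lfr (B := Fo) u z) (fr_lfr i (om_nz zi')) pp)].
  move=> a da; have [b db] := dom_cover Fo (ln z).
  (* The frame [phi (fr i)] has an invertible matrix because [phi'] maps it back to the frame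
     [fr i]. *)
  have := map_FY (A := Ft) (B := Fo) phi' (fun p l => phi l (fr i p l)) b da; rewrite pp => E.
  have := fr_unit (nz0 _ _ zi') db; rewrite [RY _ _ _]E unitmx_mul => /andP[].
  by [].
exists g, f => l; have [c1 c2 _] := phiP l.
by split=> v; rewrite fE gE.
Qed.

End Fibre.
End Chosen.

(** The [eps] of [deform] is fixed first; then [t] is taken so close to [o] that on every pair of
    cones the transition matrices are within [eps] of [G0]. *)
Lemma near_iso : exists2 d : R, 0 < d & forall t, nearo o d t -> bundle_iso (member F t) Fo.
Proof.
have [eps e0 D] := deform wsym wii cfE cfw n0.
have [s sg] := choice (fun i => frames (@fr_isframe i)).
have [d1 Hd1] := choice (fun u : I * I => let: ex_intro2 d d0 H := close_near sg u.1 u.2 e0 in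
  ex_intro (fun d => 0 < d /\ forall z t, om u.1 z -> om u.2 z -> nearo o d t ->
    goodQ (fr u.1) (fr u.2) (s u.1) (s u.2) (G0 wm cfm u.1 u.2) eps z t) d (conj d0 H)).
have [d2 Hd2] := choice (fun i => let: ex_intro2 d d0 H := hol_near sg i in
  ex_intro (fun d => 0 < d /\ forall z t, om i z -> nearo o d t ->
    exists2 a : chart F, dom a (ln z, t) & mhd (fun z => Y a (s i) z t) z) d (conj d0 H)).
have [d3 d30 H3] := fin_min (fun u => (Hd1 u).1); have [d4 d40 H4] := fin_min (fun i => (Hd2 i).1).
have [d [d0 dd3 dd4]] := pos_min d30 d40; exists d => // t td.
have gq i j z : om i z -> om j z -> goodQ (fr i) (fr j) (s i) (s j) (G0 wm cfm i j) eps z t.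
  by move=> zi zj; apply: ((Hd1 (i, j)).2 z t zi zj); apply: nearo_le td; exact: le_trans dd3 (H3 _).
have gh i z : om i z -> exists2 a : chart F, dom a (ln z, t) & mhd (fun z => Y a (s i) z t) z.
  by move=> zi; apply: ((Hd2 i).2 z t zi); apply: nearo_le td; exact: le_trans dd4 (H4 _).
have [B B0 Gs] := G_sec gq (ltW e0).
have Ge i j q p z : om i z -> om j z -> normc (Gm (s i) (s j) z t q p - G0 wm cfm i j z q p) <= eps.
  move=> zi zj; have [_ _ _ H] := gq i j z zi zj; apply: le_trans H.
  have := normc_le_mn (Gm (s i) (s j) z t - G0 wm cfm i j z) q p.
  by rewrite [X in normc X <= _ -> _]mxE [X in normc (_ + X) <= _ -> _]mxE.
have [Yd [[Y1 Y2] Y3 Y4 Y5 Y6]] := D _ B B0 Gs (G_cocycle gq) Ge.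
by have := @fibre_iso s t eps gq gh Yd Y1 Y2 Y3 Y4 Y5 Y6.
Qed.

End Family.
End Main.

Theorem proposition9 (R : realType) (n : nat) (n_ge1 : (1 <= n)%N)
    (E : vbundle (PV R n)) (E_image : is_image (psi R n) E) :
  rigid E.
Proof.
move=> m T _ F o iso; have [f [g fg]] := iso.
(* The quotient map onto [E] is composed with the given isomorphism from [E] to the central member;
   its kernels and its surjectivity carry over to [h]. *)
have [q [j [fac qsur inj]]] := E_image; have [h hE] := comp_hom q g.
have hker (z : 'rV_n.+1) Q : z != 0 -> sym Q -> h (ln z) (vsproj (Sym2 R n) Q) = 0 <-> exists c, Q = c *: sq z.
  move=> z0 Qs; rewrite -(im_ker (q := q) (j := fun l x => j l x) fac inj z0 Qs) hE.
  have [c1 c2] := fg (ln z); split=> [H|->]; last exact: linear0.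
  by rewrite -[LHS]c2 H; exact: linear0.
have hsur (l : PV R n) (v : fib (member F o) l) : exists Q, sym Q /\ h l (vsproj (Sym2 R n) Q) = v.
  have [c1 c2] := fg l; have [u uE] := qsur l (f l v); exists (vsval u); split.
    by apply/eqP; rewrite -mem_Sym2 subvsP.
  by rewrite vsvalK hE uE c1.
have [wm bw] := choice (basis hker hsur); have [cfm bc] := choice bw.
have b1 i p : sym (wm i p) by case: (bc i).
have b2 i p : wm i p i i = 0 by case: (bc i).
have b3 i Q : sym Q -> Q i i = 0 -> Q = \sum_p cfm i Q 0 p *: wm i p by case: (bc i) => _ _ H _; exact: H.
have b4 i p q' : cfm i (wm i p) 0 q' = (p == q')%:R by case: (bc i).
have [d d0 H] := near_iso hker hsur b1 b2 b3 b4 n_ge1.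
apply/nbhs_vn; exists d => // z zd t tz; apply: (iso_trans (H t _) iso).
by rewrite /nearo tz.
Qed.
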